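(* Let $H$ be an entire harmonic function on $\mathbb{R}^2$, let $0<k_i,k_e\neq1<\infty$, and let $u$ be the solution of $$\nabla\cdot\sigma\nabla u=0\ \text{ in }\mathbb{R}^2,\qquad u(\mathbf{x})-H(\mathbf{x})=O(|\mathbf{x}|^{-1})\ \text{ as }|\mathbf{x}|\to\infty,$$ with $\sigma=k_i\chi(B_i)+k_e\chi(B_e\setminus B_i)+\chi(\mathbb{R}^2\setminus B_e)$. Then the following hold. (a) (Assuming $\tau>0$.) The solution $u$ admits $$u(\mathbf{x})=H(\mathbf{x})+C_xr_*^2\,\Re\{q(\mathbf{x};\beta,\tau_i,\tau_e)\}+C_yr_*^2\,\Im\{q(\mathbf{x};\beta,\tau_i,\tau_e)\}+r(\mathbf{x}),\qquad\mathbf{x}\in\mathbb{R}^2,$$ where the singular function $q$ is $$q(\mathbf{x};\beta,\tau_i,\tau_e)=\frac12\begin{cases}-(\tau+\tau_i)L(e^{\xi-\mathrm{i}\theta-2\xi_i};\beta)+(\tau+\tau_e)L(e^{\xi-\mathrm{i}\theta-2\xi_e};\beta)&\text{in }\mathbb{R}^2\setminus B_e,\\-(\tau+\tau_i)L(e^{\xi-\mathrm{i}\theta-2\xi_i};\beta)+(\tau+\tau_e)L(e^{-\xi-\mathrm{i}\theta};\beta)&\text{in }B_e\setminus B_i,\\-(\tau+\tau_i)L(e^{-\xi-\mathrm{i}\theta};\beta)+(\tau+\tau_e)L(e^{-\xi-\mathrm{i}\theta};\beta)&\text{in }B_i,\end{cases}$$ and $\|\nabla r\|_{L^\infty(\mathbb{R}^2)}<C$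 for some constant $C$ independent of $\epsilon$. (b) For any $k_i,k_e$, we have $\|\nabla(u-H)\|_{L^\infty(\mathbb{R}^2\setminus\overline{(B_e\setminus B_i)})}\le C$ for some constant $C$ independent of $\epsilon$. The gradient blow-up (as $\epsilon\to0$) occurs only when $\tau_i,\tau_e$ are similar to $1$ (equivalently, $0<k_e\ll1,k_i$, that is, $k_e\ll1$ and $k_e\ll k_i$). For such a case, we have in $B_e\setminus B_i$ $$\begin{aligned}\nabla(u-H)(\mathbf{x})=\ &\frac{C_xr_*(\tau_i+\tau_e+2\tau)}{2\sqrt\epsilon}(\cosh\xi+\cos\theta)\,\Re\{P(e^{-\xi-\mathrm{i}\theta};\beta)\}\,\hat{\mathbf{e}}_\xi\\&+\frac{C_yr_*(\tau_i+\tau_e+2\tau)}{2\sqrt\epsilon}(\cosh\xi+\cos\theta)\,\Im\{P(e^{-\xi-\mathrm{i}\theta};\beta)\}\,\hat{\mathbf{e}}_\xi+O(1),\end{aligned}$$ where $O(1)$ is uniformly bounded independently of $\epsilon$ and $\mathbf{x}$.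
   Context: Geometry. Let $r_e>r_i>0$. For small $\epsilon>0$ let $B_i,B_e$ be the disks with radii $r_i,r_e$ and centers $(c_i,0),(c_e,0)$, where $c_i=\frac{r_e^2-r_i^2-(r_e-r_i-\epsilon)^2}{2(r_e-r_i-\epsilon)}$ and $c_e=c_i+r_e-r_i-\epsilon$. Then $B_i\subset B_e$ and $\mathrm{dist}(\partial B_i,\partial B_e)=\epsilon$. Set $$\alpha=\frac{\sqrt{\epsilon(2r_i+\epsilon)(2r_e-\epsilon)(2r_e-2r_i-\epsilon)}}{2(r_e-r_i-\epsilon)},\quad r_*=\sqrt{\frac{2r_ir_e}{r_e-r_i}},\quad \xi_i=\ln|c_i+\alpha|-\ln r_i,\quad \xi_e=\ln|c_e+\alpha|-\ln r_e .$$ Bipolar coordinates $(\xi,\theta)\in\mathbb{R}\times(-\pi,\pi]$ are defined for $\mathbf{x}=(x,y)$, $z=x+\mathrm{i}y$, by $e^{\xi+\mathrm{i}\theta}=\frac{\alpha+z}{\alpha-z}$; then $\partial B_i=\{\xi=\xi_i\}$, $\partial B_e=\{\xi=\xi_e\}$, $\xi_i>\xi_e>0$, and $\hat{\mathbf{e}}_\xi=\frac{\partial\mathbf{x}/\partial\xi}{|\partial\mathbf{x}/\partial\xi|}$. Parameters: $\tau_i=\frac{k_i-k_e}{k_i+k_e}$, $\tau_e=\frac{1-k_e}{1+k_e}$, $\tau=\tau_i\tau_e$, $\beta=\frac{r_*(-\ln\tau)}{4\sqrt\epsilon}$ (for $\tau>0$, so that $\beta>0$). Also $C_x=\nabla H(\mathbf{0})\cdot(1,0)$,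 $C_y=\nabla H(\mathbf{0})\cdot(0,1)$. Special functions: for $z\in\mathbb{C}$, $|z|<1$, $$L(z;\beta)=-\int_0^\infty\frac{ze^{-(\beta+1)t}}{1+ze^{-t}}\,dt,\qquad P(z;\beta)=(-z)\frac{\partial}{\partial z}L(z;\beta)=\int_0^\infty\frac{ze^{-(\beta+1)t}}{(1+ze^{-t})^2}\,dt .$$ Conventions. $\chi$ denotes a characteristic function. The solution $u$ is continuous across $\partial B_i,\partial B_e$ and satisfies $\partial_\nu u|^+=k_e\,\partial_\nu u|^-$ on $\partial B_e$ and $k_e\,\partial_\nu u|^+=k_i\,\partial_\nu u|^-$ on $\partial B_i$ ($\nu$ outward unit normal; $+$/$-$ are limits from outside/inside). *)

(* Defs.v *)
From mathcomp Require Import all_boot all_order all_algebra.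
From mathcomp Require Import all_classical all_reals all_analysis.
From mathcomp Require Import complex ring.

Set Implicit Arguments.
Unset Strict Implicit.
Unset Printing Implicit Defensive.
Import Order.TTheory GRing.Theory Num.Theory.
Import numFieldNormedType.Exports.

Local Open Scope classical_set_scope.
Local Open Scope ring_scope.
Local Open Scope complex_scope.

(* The plane is R * R.  The library norm on the product is the max norm, hence
   a separate Euclidean norm; the topologies agree. *)
Section Plane.
Variable R : realType.
Implicit Types (f : R * R -> R) (p v c : R * R) (U : set (R * R)).

Definition dot p v : R := p.1 * v.1 + p.2 * v.2.

Definition enorm p : R := Num.sqrt (p.1 ^+ 2 + p.2 ^+ 2).

Definition dx f p : R := 'D_((1, 0) : R * R) f p.
Definition dy f p : R := 'D_((0, 1) : R * R) f p.

Definition grad f p : R * R := (dx f p, dy f p).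

Definition C1_on U f :=
  forall p, U p ->
    [/\ derivable f p ((1, 0) : R * R), derivable f p ((0, 1) : R * R),
        {for p, continuous (dx f)} & {for p, continuous (dy f)}].

Definition C2_on U f := [/\ C1_on U f, C1_on U (dx f) & C1_on U (dy f)].

Definition entire_harmonic f :=
  C2_on setT f /\ forall p, dx (dx f) p + dy (dy f) p = 0.

Definition disk c (r : R) : set (R * R) := [set p | enorm (p - c) < r].
Definition circle c (r : R) : set (R * R) := [set p | enorm (p - c) = r].

(* The one-sided normal derivative: grad f (p + side t nu) . nu tends to l as
   t -> 0+, for p on circle c r and nu its outward unit normal; side = 1 is the
   limit from outside, side = -1 the limit from inside. *)
Definition normal_deriv_cvg (side : R) f c (r : R) p (l : R) :=
  let nu : R * R := ((p.1 - c.1) / r, (p.2 - c.2) / r) in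
  (fun t : R =>
     dot (grad f (p.1 + side * t * nu.1, p.2 + side * t * nu.2)) nu)
    @ 0^'+ --> l.

(* || grad f ||_{L^oo(U)} for the classical gradient.  For f continuous and
   differentiable off finitely many circles this is the L^oo norm of the
   distributional gradient. *)
Definition gradLoo U f : \bar R :=
  ('N[ (@lebesgue_measure R \x @lebesgue_measure R)%E ]_+oo
     [ EFin \o ((fun p => enorm (grad f p)) \_ U) ])%E.

End Plane.

Section Geometry.
Variables (R : realType) (ri re eps : R).

Definition center_i : R :=
  (re ^+ 2 - ri ^+ 2 - (re - ri - eps) ^+ 2) / (2 * (re - ri - eps)).
Definition center_e : R := center_i + re - ri - eps.

Definition B_i : set (R * R) := disk (center_i, 0) ri.
Definition B_e : set (R * R) := disk (center_e, 0) re.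
Definition bd_i : set (R * R) := circle (center_i, 0) ri.
Definition bd_e : set (R * R) := circle (center_e, 0) re.

Definition alpha : R :=
  Num.sqrt (eps * (2 * ri + eps) * (2 * re - eps) * (2 * re - 2 * ri - eps))
  / (2 * (re - ri - eps)).

Definition r_star : R := Num.sqrt (2 * ri * re / (re - ri)).

Definition xi_i : R := ln `|center_i + alpha| - ln ri.
Definition xi_e : R := ln `|center_e + alpha| - ln re.

End Geometry.

Section Bipolar.
Variable R : realType.
Implicit Types (a s t : R) (p : R * R) (w : R[i]).

Definition expc s t : R[i] := (expR s * cos t) +i* (expR s * sin t).

Definition modc w : R := enorm (complex.Re w, complex.Im w).

(* principal argument, in ]-pi, pi] *)
Definition argc w : R :=
  let t := acos (complex.Re w / modc w) in
  if 0 <= complex.Im w then t else - t.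

(* This is e^(xi + i theta), see expc_bip below; bip_point is the inverse map
   (xi, theta) |-> x.  At the two poles (+-a, 0), where xi = +-oo, bip_xi has a
   junk value. *)
Definition bipolar_ratio a p : R[i] :=
  (a%:C + (p.1 +i* p.2)) / (a%:C - (p.1 +i* p.2)).

Definition is_pole a p := (p == (a, 0)) || (p == (- a, 0)).

Definition bip_xi a p : R := ln (modc (bipolar_ratio a p)).
Definition bip_theta a p : R := argc (bipolar_ratio a p).

Definition bip_point a s t : R * R :=
  let z := a%:C * (expc s t - 1) / (expc s t + 1) in
  (complex.Re z, complex.Im z).

Definition e_xi a s t : R * R :=
  let v : R * R := (derive1 (fun s' => (bip_point a s' t).1) s,
                    derive1 (fun s' => (bip_point a s' t).2) s) in
  (v.1 / enorm v, v.2 / enorm v).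

Definition coshR s : R := (expR s + expR (- s)) / 2.

Lemma expc_bip a p : a != 0 -> ~~ is_pole a p ->
  expc (bip_xi a p) (bip_theta a p) = bipolar_ratio a p.
Proof.
move=> a0; rewrite negb_or => /andP[ap anp].
have nz (b c : R) : (b != 0) || (c != 0) -> (b +i* c : R[i]) != 0.
  by rewrite eq_complex /= negb_and.
have pole (e : R) : p != (e, 0) -> (p.1 != e) || (p.2 != 0).
  by case: p {ap anp} => x y; rewrite xpair_eqE negb_and.
have w0 : bipolar_ratio a p != 0.
  rewrite /bipolar_ratio mulf_neq0 ?invr_eq0//; simpc; apply: nz => /=.
    by case/orP: (pole _ anp) => h; apply/orP; [left|right];
      rewrite 1?addrC ?addr_eq0.
  by case/orP: (pole _ ap) => h; apply/orP; [left|right];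
    rewrite ?oppr_eq0 // subr_eq0 eq_sym.
rewrite /expc /bip_xi /bip_theta; move: (bipolar_ratio a p) w0 => {pole nz}.
case=> x y; rewrite eq_complex /= negb_and => xy0.
have s0 : 0 < x ^+ 2 + y ^+ 2.
  by rewrite lt_neqAle addr_ge0 ?sqr_ge0// andbT eq_sym paddr_eq0 ?sqr_ge0//
    !sqrf_eq0 negb_and.
rewrite /argc /modc /enorm /=; set m := Num.sqrt _.
have m0 : 0 < m by rewrite sqrtr_gt0.
have m2 : m ^+ 2 = x ^+ 2 + y ^+ 2 by rewrite sqr_sqrtr// ltW.
have xm : x / m \in `[-1, 1].
  rewrite in_itv/= ler_pdivlMr// ler_pdivrMr// mul1r mulN1r -ler_norml.
  by rewrite -sqrtr_sqr ler_wsqrtr// lerDl sqr_ge0.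
have sm : Num.sqrt (1 - (x / m) ^+ 2) = `|y| / m.
  rewrite -[RHS]ger0_norm ?divr_ge0// ?ltW// -sqrtr_sqr; congr Num.sqrt.
  rewrite !expr_div_n real_normK ?num_real// m2.
  by rewrite -[1](@divff _ (x ^+ 2 + y ^+ 2)) ?gt_eqF// -mulrBl addrAC subrr add0r.
rewrite lnK ?posrE//; congr Complex.
  by case: ifP => _; rewrite ?cosN acosK// mulrC divfK// gt_eqF.
case: ifP => [y0|/negbT]; last rewrite -ltNge => y0.
  by rewrite sin_acos ?ger0_norm// sm ger0_norm// mulrC divfK// gt_eqF.
by rewrite sinN sin_acos// sm ltr0_norm// mulNr opprK mulrC divfK// gt_eqF.
Qed.

Lemma bip_pointK a p : a != 0 -> ~~ is_pole a p ->
  bip_point a (bip_xi a p) (bip_theta a p) = p.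
Proof.
move=> a0 pp; rewrite /bip_point expc_bip// /bipolar_ratio.
have {pp} d0 : a%:C - (p.1 +i* p.2) != 0 :> R[i].
  apply: contra pp; rewrite subr_eq0 eq_complex /= => /andP[/eqP-> /eqP p2].
  by rewrite /is_pole {1}[p]surjective_pairing -p2 eqxx.
have aC0 : a%:C != 0 :> R[i] by rewrite eq_complex /= negb_and a0.
set d := _ - _ in d0 *; set z := p.1 +i* p.2.
have -> : (a%:C + z) / d - 1 = 2 * z / d.
  by rewrite -[X in _ - X](divff d0) -mulrBl /d -/z; congr (_ / _); ring.
have -> : (a%:C + z) / d + 1 = 2 * a%:C / d.
  by rewrite -[X in _ + X](divff d0) -mulrDl /d -/z; congr (_ / _); ring.
have -> : a%:C * (2 * z / d) / (2 * a%:C / d) = z.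
  by field; rewrite d0 aC0.
by rewrite /z /=; case: p {d0 z d}.
Qed.

End Bipolar.

Section Singular.
Variable R : realType.
Implicit Types (beta : R) (z : R[i]).

Definition Cint (g : R -> R[i]) : R[i] :=
  (\int[lebesgue_measure]_(t in `[0, +oo[) complex.Re (g t))
  +i* (\int[lebesgue_measure]_(t in `[0, +oo[) complex.Im (g t)).

Definition L_fun z beta : R[i] :=
  - Cint (fun t => z * (expR (- ((beta + 1) * t)))%:C
                   / (1 + z * (expR (- t))%:C)).

Definition P_fun z beta : R[i] :=
  Cint (fun t => z * (expR (- ((beta + 1) * t)))%:C
                 / (1 + z * (expR (- t))%:C) ^+ 2).

End Singular.

Section Problem.
Variables (R : realType) (ri re eps ki ke : R).
Implicit Types (u H : R * R -> R) (p : R * R).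

Definition tau_i : R := (ki - ke) / (ki + ke).
Definition tau_e : R := (1 - ke) / (1 + ke).
Definition tau : R := tau_i * tau_e.
Definition beta : R := r_star ri re * (- ln tau) / (4 * Num.sqrt eps).

Definition admissible := [/\ 0 < ki, 0 < ke, ki != 1 & ke != 1].

Definition sigma p : R :=
  ki * \1_(B_i ri re eps) p
  + ke * \1_(B_e ri re eps `\` B_i ri re eps) p
  + \1_(~` B_e ri re eps) p.

Definition off_interfaces : set (R * R) :=
  ~` (bd_i ri re eps `|` bd_e ri re eps).

(* div (sigma grad u) = 0 in R^2, in classical form: the equation where sigma is locally constant
   and the transmission conditions across the two circles. *)
Definition is_solution H u :=
  [/\ continuous u,
      C2_on off_interfaces u /\
      (forall p, off_interfaces p ->
         dx (fun p' => sigma p' * dx u p') p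
         + dy (fun p' => sigma p' * dy u p') p = 0),
      (forall p, bd_e ri re eps p -> exists gp gm : R,
         [/\ normal_deriv_cvg 1 u (center_e ri re eps, 0) re p gp,
             normal_deriv_cvg (-1) u (center_e ri re eps, 0) re p gm &
             gp = ke * gm]),
      (forall p, bd_i ri re eps p -> exists gp gm : R,
         [/\ normal_deriv_cvg 1 u (center_i ri re eps, 0) ri p gp,
             normal_deriv_cvg (-1) u (center_i ri re eps, 0) ri p gm &
             ke * gp = ki * gm]) &
      (exists M rho : R, 0 < rho /\
         forall p, rho <= enorm p -> `|u p - H p| <= M * (enorm p)^-1)].

(* At the poles +-alpha, xi is +-oo and both arguments of L are 0 in the
   relevant region, so that q vanishes there since L(0) = 0. *)
Definition q_fun p : R[i] :=
  let a := alpha ri re eps in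
  let xi := bip_xi a p in
  let theta := bip_theta a p in
  let xii := xi_i ri re eps in
  let xie := xi_e ri re eps in
  let Lb z := L_fun z beta in
  let ti := (tau + tau_i)%:C in
  let te := (tau + tau_e)%:C in
  if is_pole a p then 0
  else if p \notin B_e ri re eps then
    2^-1 * (- ti * Lb (expc (xi - 2 * xii) (- theta))
            + te * Lb (expc (xi - 2 * xie) (- theta)))
  else if p \notin B_i ri re eps then
    2^-1 * (- ti * Lb (expc (xi - 2 * xii) (- theta))
            + te * Lb (expc (- xi) (- theta)))
  else
    2^-1 * (- ti * Lb (expc (- xi) (- theta))
            + te * Lb (expc (- xi) (- theta))).

(* Quantitative forms of `tau_i, tau_e are similar to 1' and of
   `ke << 1 and ke << ki'. *)
Definition tau_near_one (delta : R) :=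
  `|tau_i - 1| < delta /\ `|tau_e - 1| < delta.

Definition ke_small (eta : R) := ke < eta /\ ke < eta * ki.

End Problem.

Section LeadingTerm.
Variables (R : realType) (ri re eps ki ke : R).

Definition shell_gradient (H : R * R -> R) (p : R * R) : R * R :=
  let a := alpha ri re eps in
  let xi := bip_xi a p in
  let theta := bip_theta a p in
  let C_x := dot (grad H (0, 0)) (1, 0) in
  let C_y := dot (grad H (0, 0)) (0, 1) in
  let K := r_star ri re * (tau_i ki ke + tau_e ke + 2 * tau ki ke)
           / (2 * Num.sqrt eps) in
  let P := P_fun (expc (- xi) (- theta)) (beta ri re eps ki ke) in
  let m := C_x * K * (coshR xi + cos theta) * complex.Re P
           + C_y * K * (coshR xi + cos theta) * complex.Im P in
  (m * (e_xi a xi theta).1, m * (e_xi a xi theta).2).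

End LeadingTerm.

(* Main.v *)
(* The coordinate w = (alpha - z) / (alpha + z) = e^(- xi - i theta) turns the two
   circles into concentric circles |w| = const.  Composing H with the Moebius maps
   w -> rho^m w (rho = e^(-2 (xi_i - xi_e))) and with the inversions in the two
   circles, with weights tau^m, gives the image series of the problem.  Its partial
   sums u_N are continuous, harmonic off the circles, and have a flux defect
   O(tau^N) on them, so a maximum principle gives u_N -> u pointwise; uniform
   bounds on the gradients of u_N then pass to u.

   Up to O(1), the gradient of the N-th image sum is the gradient of H at the
   origin times
     sum_(m < N) tau^m G(rho^m),   G(r) = r (1 + w)^2 / (1 + w r)^2,
   and G has bounded variation on [0, 1] uniformly in w.  Hence the sum is
   O(1 / (1 - |tau|)), is bounded for tau <= 0 by Abel summation, and for
   tau = e^(- beta c), c = 4 sqrt eps / r_*, is within O(1) of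
     c^-1 int_0^oo e^(- beta t) G(e^-t) dt,
   which is the gradient of the part of q built from L.  In the exterior and in the
   core the sums come with a factor O(1 - |tau|), or combine to one by the reflection
   identity F o R_e - tau F o R_i = H o R_e - tau^N H o T^N o R_e. *)
Require Import Defs.
From mathcomp Require Import all_boot all_order all_algebra.
From mathcomp Require Import all_classical all_reals all_analysis.
From mathcomp Require Import measurable_realfun ess_sup_inf complex ring lra.
From HB Require Import structures.

Set Implicit Arguments.
Unset Strict Implicit.
Unset Printing Implicit Defensive.
Import Order.TTheory GRing.Theory Num.Theory.
Import numFieldNormedType.Exports.

Local Open Scope classical_set_scope.
Local Open Scope ring_scope.
Local Open Scope complex_scope.

(** * Complex gradients and complex derivatives *)

Section ComplexModulus.
Variable R : realType.
Implicit Types (x y z w : R[i]) (a b : R) (p q : R * R).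

(** The difficulty is uniformity: eps, ki and ke vary independently and tau may tend to 1 at any
    rate relative to sqrt eps, so a factor 1 / (1 - tau) or 1 / sqrt eps is never lost without
    compensation. The constants K (from the radii) and B (from H on a fixed box) are chosen before
    eps, ki and ke. Only the speed of convergence of u_N may depend on everything.

    The integral L has the step c built in through beta, whereas the images contract by e^-d with d
    = 2 (xi_i - xi_e). Since c - d = O(eps), and since the sum has O(1 / sqrt eps) significant
    terms, each moving by O(|c - d| / sqrt eps), the exchange of d for c costs O(1).

    A truncated image sum cannot meet all transmission conditions. The tail tau^N H o T^N is
    therefore added inside B_e: it keeps u_N continuous and puts the whole truncation error into the
    fluxes, where a barrier can absorb it.

    For tau close to 1 the three regions differ by their coefficients: in the core they are O(1 -
    tau), in the exterior they become so after use of the reflection identity, and in the shell 1 +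
    tau_e stays of order 1 when tau_e is near 1. *)

Definition toC p : R[i] := p.1 +i* p.2.

Lemma toCD p q : toC (p + q) = toC p + toC q.
Proof. by []. Qed.

Lemma toCB p q : toC (p - q) = toC p - toC q.
Proof. by []. Qed.

Lemma modcE w : modc w = Normc.normc w.
Proof. by case: w. Qed.

Lemma modcM x y : modc (x * y) = modc x * modc y.
Proof. by rewrite !modcE Normc.normcM. Qed.

Lemma modcV x : modc x^-1 = (modc x)^-1.
Proof. by rewrite !modcE Normc.normcV. Qed.

Lemma modcD x y : modc (x + y) <= modc x + modc y.
Proof. by rewrite !modcE le_normcD. Qed.

Lemma modcN x : modc (- x) = modc x.
Proof. by rewrite !modcE normcN. Qed.

Lemma modcB x y : modc (x - y) <= modc x + modc y.
Proof. by rewrite -(modcN y) modcD. Qed.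

Lemma modcBC x y : modc (x - y) = modc (y - x).
Proof. by rewrite -modcN opprB. Qed.

Lemma modc_ge0 x : 0 <= modc x.
Proof. exact: sqrtr_ge0. Qed.

Lemma modc0 : modc 0 = 0 :> R.
Proof. by rewrite modcE Normc.normc0. Qed.

Lemma modc1 : modc 1 = 1 :> R.
Proof. by rewrite modcE Normc.normc1. Qed.

Lemma modc_eq0 x : (modc x == 0) = (x == 0).
Proof.
apply/eqP/eqP => [|->]; last exact: modc0.
by rewrite modcE => /Normc.eq0_normc.
Qed.

Lemma modc_gt0 x : (0 < modc x) = (x != 0).
Proof. by rewrite lt_neqAle modc_ge0 andbT eq_sym modc_eq0. Qed.

Lemma modcX x n : modc (x ^+ n) = modc x ^+ n.
Proof. by elim: n => [|n IH]; rewrite ?expr0 ?modc1// !exprS modcM IH. Qed.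

Lemma modcR a : modc a%:C = `|a|.
Proof. by rewrite /modc /enorm /= expr0n addr0 sqrtr_sqr. Qed.

Lemma modcJ x : modc (conjc x) = modc x.
Proof. by case: x => a b; rewrite /modc /enorm /= sqrrN. Qed.

Lemma sqr_modc x : modc x ^+ 2 = complex.Re x ^+ 2 + complex.Im x ^+ 2.
Proof. by rewrite sqr_sqrtr// addr_ge0// sqr_ge0. Qed.

Lemma modc2J x : (modc x ^+ 2)%:C = x * conjc x.
Proof. by rewrite sqr_modc; case: x => a b; simpc; congr Complex; ring. Qed.

Lemma Re_le_modc x : `|complex.Re x| <= modc x.
Proof. by rewrite -sqrtr_sqr ler_wsqrtr// lerDl sqr_ge0. Qed.

Lemma Im_le_modc x : `|complex.Im x| <= modc x.
Proof. by rewrite -sqrtr_sqr ler_wsqrtr// lerDr sqr_ge0. Qed.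

Lemma modc_le_ReIm x : modc x <= `|complex.Re x| + `|complex.Im x|.
Proof.
have h : x = (complex.Re x)%:C + 'i * (complex.Im x)%:C by case: x => a b; simpc.
rewrite {1}h (le_trans (modcD _ _))// modcM !modcR.
by rewrite /modc /enorm /= expr0n expr1n add0r sqrtr1 mul1r.
Qed.

Lemma modc_sum n (F : 'I_n -> R[i]) : modc (\sum_(i < n) F i) <= \sum_(i < n) modc (F i).
Proof.
elim/big_ind2 : _ => [|x1 x2 y1 y2 h1 h2|//]; first by rewrite modc0.
exact: le_trans (modcD _ _) (lerD _ _).
Qed.

Lemma ReD x y : complex.Re (x + y) = complex.Re x + complex.Re y.
Proof. by case: x; case: y. Qed.
Lemma ImD x y : complex.Im (x + y) = complex.Im x + complex.Im y.
Proof. by case: x; case: y. Qed.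
Lemma ReN x : complex.Re (- x) = - complex.Re x.
Proof. by case: x. Qed.
Lemma ImN x : complex.Im (- x) = - complex.Im x.
Proof. by case: x. Qed.
Lemma ReB x y : complex.Re (x - y) = complex.Re x - complex.Re y.
Proof. by case: x; case: y. Qed.
Lemma ImB x y : complex.Im (x - y) = complex.Im x - complex.Im y.
Proof. by case: x; case: y. Qed.
Lemma ReM x y : complex.Re (x * y) =
  complex.Re x * complex.Re y - complex.Im x * complex.Im y.
Proof. by case: x; case: y. Qed.
Lemma ImM x y : complex.Im (x * y) =
  complex.Re x * complex.Im y + complex.Im x * complex.Re y.
Proof. by case: x => a b; case: y => c d /=; ring. Qed.
Lemma ReRM a y : complex.Re (a%:C * y) = a * complex.Re y.
Proof. by rewrite ReM /= mul0r subr0. Qed.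
Lemma ImRM a y : complex.Im (a%:C * y) = a * complex.Im y.
Proof. by rewrite ImM /= mul0r addr0. Qed.

Lemma Re_inv x : complex.Re x^-1 = complex.Re x / modc x ^+ 2.
Proof. by rewrite sqr_modc; case: x. Qed.
Lemma Im_inv x : complex.Im x^-1 = - complex.Im x / modc x ^+ 2.
Proof. by rewrite sqr_modc; case: x => a b; rewrite /= mulNr. Qed.

Lemma modc_norm p : modc (toC p) <= 2 * `|p|.
Proof.
apply: le_trans (modc_le_ReIm _) _ => /=.
have : `|p.1| <= `|p| by rewrite prod_normE le_max lexx.
have : `|p.2| <= `|p| by rewrite prod_normE le_max lexx orbT.
by lra.
Qed.

Lemma norm_modc p : `|p| <= modc (toC p).
Proof.
rewrite prod_normE ge_max.
by rewrite (Re_le_modc (toC p)) (Im_le_modc (toC p)).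
Qed.

Lemma enormE p : enorm p = modc (toC p).
Proof. by []. Qed.

End ComplexModulus.

Section Gradient.
Variable R : realType.
Implicit Types (f g : R * R -> R) (p q h : R * R) (c : R[i]).

Definition cgrad f p : R[i] := (dx f p) -i* (dy f p).

(* [cgrad = dx - i dy], so that Re (F z) has complex gradient F' z. *)
Definition is_cgrad f p c := differentiable f p /\ cgrad f p = c.

Lemma enorm_grad f p : enorm (grad f p) = modc (cgrad f p).
Proof. by rewrite /modc /enorm /= sqrrN. Qed.

Lemma cgrad_diff f p h : differentiable f p ->
  'd f p h = complex.Re (cgrad f p * toC h).
Proof.
move=> df; rewrite ReM /= mulNr opprK /dx /dy !deriveE//.
have -> : h = h.1 *: ((1, 0) : R * R) + h.2 *: ((0, 1) : R * R).
  case: h => a b; apply/pair_equal_spec => /=.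
  by rewrite !scaler0 addr0 add0r !/(_ *: _) /= !mulr1.
rewrite linearD !linearZ /=.
by rewrite !/(_ *: _) /= !mulr1 !mulr0 addr0 add0r; ring.
Qed.

(** The real-linear form h -> Re (c h) is packaged as a continuous linear map, and [diff_unique]
    identifies it with the differential. Together with [is_cgradE] this allows the chain rules to be
    proved in epsilon form. *)
Lemma is_cgradP f p c :
  (forall e, 0 < e -> \forall h \near (0 : R * R),
     `|f (p + h) - f p - complex.Re (c * toC h)| <= e * `|h|) ->
  is_cgrad f p c.
Proof.
move=> H.
pose L0 (h : R * R) : R := complex.Re (c * toC h).
have L0l : linear L0.
  move=> k x y; rewrite /L0 toCD mulrDr ReD; congr (_ + _).
  by rewrite !ReM /= !/(_ *: _) /= /GRing.scale /=; ring.
pose L1 := GRing.isLinear.Build R (R * R)%type R _ L0 L0l.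
pose L : {linear (R * R)%type -> R} := HB.pack L0 L1.
have Lc : continuous L.
  have LE : (L : R * R -> R) = (fun h => complex.Re c * h.1 - complex.Im c * h.2).
    by apply/funext => h; rewrite /= /L0 ReM.
  rewrite LE => x; apply: cvgB; apply: cvgM; [exact: cvg_cst|exact: cvg_fst|
    exact: cvg_cst|exact: cvg_snd].
have fE : f \o shift p = cst (f p) + L +o_ (0 : R * R) id.
  apply/eqaddoP => e e0; have := H e e0; apply: filterS => h /=.
  rewrite !fctE /= [h + p]addrC opprD addrA.
  by [].
have dE := diff_unique Lc fE.
have df : differentiable f p by apply/diff_locallyP; rewrite dE.
split => //; apply/eqP; rewrite eq_complex /=; apply/andP; split; apply/eqP.
  by rewrite /dx deriveE// dE /= /L0 ReM /=; ring.
by rewrite /dy deriveE// dE /= /L0 ReM /=; ring.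
Qed.

Lemma is_cgradE f p c : is_cgrad f p c ->
  forall e, 0 < e -> \forall h \near (0 : R * R),
     `|f (p + h) - f p - complex.Re (c * toC h)| <= e * `|h|.
Proof.
move=> [df <-] e e0.
have /eqaddoP/(_ _ e0) := diff_locally df; apply: filterS => h /=.
by rewrite !fctE /= [h + p]addrC opprD addrA cgrad_diff.
Qed.
End Gradient.

Section GradientRules.
Variable R : realType.
Implicit Types (f g : R * R -> R) (p q h : R * R) (c : R[i]).

Lemma is_cgrad_near f g p c : (\forall q \near p, f q = g q) ->
  is_cgrad f p c -> is_cgrad g p c.
Proof.
move=> fg fc; apply: is_cgradP => e e0.
have := is_cgradE fc e0; have fgp := nbhs_singleton fg.
have : \forall h \near (0 : R * R), f (p + h) = g (p + h).
  by move: fg; rewrite (near_shift 0)/=; apply: filterS => h; rewrite subr0 addrC.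
by apply: filterS2 => h <-; rewrite -fgp.
Qed.

Lemma is_cgrad_eq f p c c' : is_cgrad f p c -> c = c' -> is_cgrad f p c'.
Proof. by move=> ? <-. Qed.

Lemma is_cgrad_cst (k : R) p : is_cgrad (fun _ => k) p 0.
Proof.
split; first exact: differentiable_cst.
by rewrite /cgrad /dx /dy !derive_cst oppr0.
Qed.

Lemma is_cgradD f g p c c' : is_cgrad f p c -> is_cgrad g p c' ->
  is_cgrad (fun q => f q + g q) p (c + c').
Proof.
move=> [df <-] [dg <-]; split; first exact: differentiableD.
rewrite /cgrad /dx /dy !(@deriveD _ _ _ f g) ?opprD//; exact: diff_derivable.
Qed.

Lemma is_cgradZ (k : R) f p c : is_cgrad f p c ->
  is_cgrad (fun q => k * f q) p (k%:C * c).
Proof.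
move=> [df <-]; split; first exact: differentiableZ.
rewrite /cgrad /dx /dy !(@deriveZ _ _ _ f)//; [|exact: diff_derivable..].
by apply/eqP; rewrite eq_complex /= /GRing.scale /=; apply/andP; split; apply/eqP; ring.
Qed.

Lemma is_cgradN f p c : is_cgrad f p c -> is_cgrad (fun q => - f q) p (- c).
Proof.
move=> /(is_cgradZ (-1)); rewrite rmorphN1 mulN1r.
by under eq_fun do rewrite mulN1r.
Qed.

Lemma is_cgradB f g p c c' : is_cgrad f p c -> is_cgrad g p c' ->
  is_cgrad (fun q => f q - g q) p (c - c').
Proof. by move=> fc /is_cgradN; exact: is_cgradD. Qed.

Lemma is_cgrad_sum n (F : 'I_n -> R * R -> R) p (C : 'I_n -> R[i]) :
  (forall i, is_cgrad (F i) p (C i)) ->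
  is_cgrad (fun q => \sum_(i < n) F i q) p (\sum_(i < n) C i).
Proof.
elim: n F C => [|n IH] F C FC.
  under eq_fun do rewrite big_ord0; rewrite big_ord0; exact: is_cgrad_cst.
under eq_fun do rewrite big_ord_recl; rewrite big_ord_recl.
by apply: is_cgradD => //; apply: IH.
Qed.

Lemma is_cgradM f g p c c' : is_cgrad f p c -> is_cgrad g p c' ->
  is_cgrad (fun q => f q * g q) p ((g p)%:C * c + (f p)%:C * c').
Proof.
move=> [df <-] [dg <-]; split; first exact: differentiableM.
rewrite /cgrad /dx /dy !(@deriveM _ _ f g)//; [|exact: diff_derivable..].
move: ('D__ f p) ('D__ f p) ('D__ g p) ('D__ g p) (f p) (g p) => a b a' b' x y.
by apply/eqP; rewrite eq_complex /= /GRing.scale /=; apply/andP; split; apply/eqP; ring.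
Qed.

Lemma is_cgrad_uniq f p c c' : is_cgrad f p c -> is_cgrad f p c' -> c = c'.
Proof. by move=> [_ <-] [_ <-]. Qed.

Lemma is_cgrad_linear c p : is_cgrad (fun q => complex.Re (c * toC q)) p c.
Proof.
apply: is_cgradP => e e0; near=> h.
rewrite toCD mulrDr ReD [_ + complex.Re (c * toC h)]addrC addrK subrr normr0.
by rewrite mulr_ge0// ltW.
Unshelve. all: by end_near. Qed.

Lemma is_cgrad_cont f p c : is_cgrad f p c -> {for p, continuous f}.
Proof. by move=> [df _]; exact: differentiable_continuous. Qed.

End GradientRules.

Section ComplexDerivative.
Variable R : realType.
Implicit Types (M N : R[i] -> R[i]) (z l h : R[i]) (p q : R * R).

Definition toP z : R * R := (complex.Re z, complex.Im z).

Lemma toPK z : toC (toP z) = z. Proof. by case: z. Qed.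
Lemma toCK p : toP (toC p) = p. Proof. by case: p. Qed.
Lemma toPD z h : toP (z + h) = toP z + toP h.
Proof. by rewrite -[LHS]toCK -[RHS]toCK; congr toP; rewrite toCD !toPK. Qed.
(** The quadratic remainder is stronger than complex differentiability, but Moebius maps, their
    derivatives and [L_fun] all have it, and it is preserved by the algebraic operations with
    explicit constants. The condition d <= 1 lets |h|^2 be absorbed in |h| ([cder_incr]). *)
Definition cder M z l := exists K d, [/\ 0 <= K, 0 < d <= 1 &
  forall h, modc h < d -> modc (M (z + h) - M z - l * h) <= K * modc h ^+ 2].

Lemma cderI M z l K d : 0 < d ->
  (forall h, modc h < d -> modc (M (z + h) - M z - l * h) <= K * modc h ^+ 2) ->
  cder M z l.
Proof.
move=> d0 H; exists `|K|, (Num.min d 1); split=> //.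
  by rewrite lt_min d0 ltr01 ge_min lexx orbT.
move=> h; rewrite lt_min => /andP[hd _]; apply: le_trans (H h hd) _.
by rewrite ler_wpM2r ?sqr_ge0// ler_norm.
Qed.

Lemma cder_incr M z l : cder M z l -> exists K d, [/\ 0 <= K, 0 < d <= 1,
  forall h, modc h < d -> modc (M (z + h) - M z - l * h) <= K * modc h ^+ 2 &
  forall h, modc h < d -> modc (M (z + h) - M z) <= (modc l + K) * modc h].
Proof.
move=> [K [d [K0 /andP[d0 d1] H]]]; exists K, d; split; rewrite ?d0//.
move=> h hd; rewrite -[M _ - _](subrK (l * h)); apply: le_trans (modcD _ _) _.
rewrite modcM mulrDl addrC lerD2l; apply: le_trans (H h hd) _.
rewrite ler_wpM2l// expr2 ler_piMl ?modc_ge0//.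
by rewrite (le_trans (ltW hd)).
Qed.

Lemma cder_cst (k z : R[i]) : cder (fun _ => k) z 0.
Proof.
apply: (@cderI _ _ _ 0 1) => // h _.
by rewrite subrr mul0r subr0 modc0 mul0r.
Qed.

Lemma cder_id z : cder id z 1.
Proof.
apply: (@cderI _ _ _ 0 1) => // h _.
by rewrite mul1r [z + h]addrC addrK subrr modc0 mul0r.
Qed.

Lemma cderD M N z l n : cder M z l -> cder N z n ->
  cder (fun w => M w + N w) z (l + n).
Proof.
move=> [K [d [K0 /andP[d0 d1] H]]] [K' [d' [K'0 /andP[d'0 d'1] H']]].
apply: (@cderI _ _ _ (K + K') (Num.min d d')).
  by rewrite lt_min d0 d'0.
move=> h; rewrite lt_min => /andP[/H hd /H' hd'].
rewrite [X in modc X](_ : _ = (M (z + h) - M z - l * h) + (N (z + h) - N z - n * h)); last by ring.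
by rewrite (le_trans (modcD _ _))// mulrDl lerD.
Qed.

Lemma cderM M N z l n : cder M z l -> cder N z n ->
  cder (fun w => M w * N w) z (l * N z + M z * n).
Proof.
move=> /cder_incr[K [d [K0 /andP[d0 d1] H I]]].
move=> /cder_incr[K' [d' [K'0 /andP[d'0 d'1] H' I']]].
apply: (@cderI _ _ _ (K * (modc (N z) + modc n + K') + modc (M z) * K'
  + modc l * (modc n + K')) (Num.min d d')).
  by rewrite lt_min d0 d'0.
move=> h; rewrite lt_min => /andP[hd hd'].
have h1 : modc h <= 1 by rewrite (le_trans (ltW hd)).
have hh : 0 <= modc h ^+ 2 by exact: sqr_ge0.
rewrite [X in modc X](_ : _ = (M (z + h) - M z - l * h) * N (z + h) +
  M z * (N (z + h) - N z - n * h) + l * h * (N (z + h) - N z)); last by ring.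
rewrite (le_trans (modcD _ _))// [leRHS]mulrDl lerD//.
  rewrite (le_trans (modcD _ _))// [leRHS]mulrDl lerD// modcM.
    rewrite mulrAC ler_pM ?modc_ge0//; first exact: H.
    rewrite -[N (z + h)](subrK (N z)) addrC (le_trans (modcD _ _))//.
    rewrite -addrA lerD2l (le_trans (I' _ hd'))// ler_piMr//.
    by rewrite addr_ge0// modc_ge0.
  by rewrite -mulrA ler_wpM2l ?modc_ge0//; exact: H'.
rewrite !modcM -!mulrA ler_wpM2l ?modc_ge0// mulrC expr2 mulrA ler_wpM2r ?modc_ge0//.
exact: I'.
Qed.

Lemma cderV M z l : M z != 0 -> cder M z l ->
  cder (fun w => (M w)^-1) z (- l / M z ^+ 2).
Proof.
move=> Mz0 /cder_incr[K [d [K0 /andP[d0 d1] H I]]].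
have m0 : 0 < modc (M z) by rewrite modc_gt0.
pose B := modc l + K; have B0 : 0 <= B by rewrite addr_ge0 ?modc_ge0.
have B1 : 0 < B + 1 by rewrite ltr_wpDl.
(* The radius keeps |M (z + h)| >= |M z| / 2, hence the denominator away from 0. *)
apply: (@cderI _ _ _ ((K * modc (M z) + modc l * B) / (modc (M z) ^+ 3 / 2))
  (Num.min d (modc (M z) / 2 / (B + 1)))).
  by rewrite lt_min d0 !divr_gt0.
move=> h; rewrite lt_min => /andP[hd]; rewrite ltr_pdivlMr// => hd'.
have D2 : modc (M (z + h) - M z) <= modc (M z) / 2.
  rewrite (le_trans (I _ hd))//; apply: le_trans (ltW hd').
  by rewrite mulrC ler_wpM2l ?modc_ge0// lerDl.
have Mh : modc (M z) / 2 <= modc (M (z + h)).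
  have := modcD (M (z + h)) (M z - M (z + h)).
  rewrite [M (z + h) + _]addrC subrK modcBC; lra.
have Mh0 : M (z + h) != 0 by rewrite -modc_gt0 (lt_le_trans _ Mh)// divr_gt0.
rewrite [X in modc X](_ : _ = (- (M (z + h) - M z - l * h) * M z +
  l * h * (M (z + h) - M z)) / (M z ^+ 2 * M (z + h))); last by field; rewrite ?Mz0 ?Mh0.
rewrite modcM modcV [leRHS]mulrAC ler_pM ?modc_ge0 ?invr_ge0 ?modc_ge0//.
  rewrite (le_trans (modcD _ _))// mulrDl lerD// !modcM ?modcN.
    by rewrite mulrAC ler_wpM2r ?modc_ge0// H.
  rewrite -!mulrA ler_wpM2l ?modc_ge0// mulrC expr2 mulrA ler_wpM2r ?modc_ge0//.
  exact: I.
rewrite lef_pV2 ?posrE ?divr_gt0 ?exprn_gt0// ?modc_gt0 ?mulf_neq0 ?expf_neq0//.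
by rewrite modcM modcX exprSr -mulrA ler_wpM2l ?exprn_ge0// modc_ge0.
Qed.

Lemma cder_comp M N z l n : cder M z l -> cder N (M z) n ->
  cder (fun w => N (M w)) z (n * l).
Proof.
move=> /cder_incr[K [d [K0 /andP[d0 d1] H I]]] [K' [d' [K'0 /andP[d'0 d'1] H']]].
pose B := modc l + K; have B0 : 0 <= B by rewrite addr_ge0 ?modc_ge0.
have B1 : 0 < B + 1 by rewrite ltr_wpDl.
apply: (@cderI _ _ _ (K' * B ^+ 2 + modc n * K) (Num.min d (d' / (B + 1)))).
  by rewrite lt_min d0 divr_gt0.
move=> h; rewrite lt_min => /andP[hd]; rewrite ltr_pdivlMr// => hd'.
set D := M (z + h) - M z.
have DE : M (z + h) = M z + D by rewrite /D [RHS]addrC subrK.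
have DB : modc D <= B * modc h by exact: I.
have Dd : modc D < d'.
  apply: le_lt_trans hd'; rewrite (le_trans DB)// mulrC ler_wpM2l ?modc_ge0//.
  by rewrite lerDl.
rewrite DE [X in modc X](_ : _ = (N (M z + D) - N (M z) - n * D) + n * (D - l * h));
  last by ring.
rewrite (le_trans (modcD _ _))// mulrDl lerD//.
  rewrite (le_trans (H' _ Dd))// -mulrA ler_wpM2l// -exprMn lerXn2r// ?nnegrE ?modc_ge0//.
  by rewrite mulr_ge0 ?modc_ge0.
by rewrite modcM -mulrA ler_wpM2l ?modc_ge0// H.
Qed.

Lemma cder_eq M z l l' : cder M z l -> l = l' -> cder M z l'.
Proof. by move=> ? <-. Qed.

Lemma cder_ext M N z l : M =1 N -> cder M z l -> cder N z l.
Proof. by move=> /funext->. Qed.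

Lemma near_modc p (P : R[i] -> Prop) (d : R) : 0 < d ->
  (forall h, modc h < d -> P (toC p + h)) -> \forall q \near p, P (toC q).
Proof.
move=> d0 H; apply/nbhs_ballP; exists (d / 2); first by rewrite /= divr_gt0.
move=> q; rewrite -ball_normE /= => pq.
have -> : toC q = toC p + toC (q - p) by rewrite toCB addrC subrK.
apply: H; apply: le_lt_trans (modc_norm _) _; rewrite distrC; lra.
Qed.

Lemma near0_modc (P : R * R -> Prop) (d : R) : 0 < d ->
  (forall h : R * R, modc (toC h) < d -> P h) -> \forall h \near (0 : R * R), P h.
Proof.
move=> d0 H; have H1 : \forall q \near (0 : R * R), P (toP (toC q)).
  apply: (@near_modc 0 (fun z => P (toP z)) d d0) => h hd.
  by apply: H; rewrite toPK [toC 0](_ : _ = 0)// add0r.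
by apply: filterS H1 => q; rewrite toCK.
Qed.

(** In the convention dx - i dy a holomorphic inner map acts on gradients by multiplication by its
    derivative. The error is the remainder of f at M (z + h) - M z plus c times the quadratic
    remainder of M; each receives half of e. *)
Lemma is_cgrad_comp f M p l c : cder M (toC p) l -> is_cgrad f (toP (M (toC p))) c ->
  is_cgrad (fun q => f (toP (M (toC q)))) p (c * l).
Proof.
move=> /cder_incr[K [d [K0 /andP[d0 d1] H I]]] fc.
apply: is_cgradP => e e0.
pose B := modc l + K; have B0 : 0 <= B by rewrite addr_ge0 ?modc_ge0.
have B1 : 0 < 4 * (B + 1) by rewrite mulr_gt0// ltr_wpDl.
have C1 : 0 < 8 * (modc c * K + 1) by rewrite mulr_gt0// ltr_wpDl// mulr_ge0// modc_ge0.
have e1 : 0 < e / (4 * (B + 1)) by rewrite divr_gt0.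
have /nbhs_ballP[d' /= d'0 H'] := is_cgradE fc e1.
have d''0 : 0 < Num.min (Num.min d (e / (8 * (modc c * K + 1)))) (d' / (4 * (B + 1))).
  by rewrite !lt_min d0 !divr_gt0.
apply: near0_modc d''0 _ => h; rewrite !lt_min -andbA => /and3P[hd he hd'].
set z := toC p in H I fc H' *; rewrite toCD -/z.
set D := M (z + toC h) - M z.
have DB : modc D <= B * modc (toC h) by exact: I.
have MD : toP (M (z + toC h)) = toP (M z) + toP D.
  by rewrite -toPD; congr toP; rewrite /D [RHS]addrC subrK.
have Dd : `|toP D| < d'.
  apply: le_lt_trans (norm_modc _) _; rewrite toPK; apply: le_lt_trans DB _.
  move: hd'; rewrite ltr_pdivlMr// => /(le_lt_trans _); apply.
  rewrite mulrC ler_wpM2l ?modc_ge0//; lra.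
have /= := H' (toP D); rewrite -ball_normE /= sub0r normrN => /(_ Dd).
rewrite toPK MD => HD.
have hn := modc_norm h.
have -> : f (toP (M z) + toP D) - f (toP (M z)) - complex.Re (c * l * toC h) =
  (f (toP (M z) + toP D) - f (toP (M z)) - complex.Re (c * D)) + complex.Re (c * (D - l * toC h)).
  by rewrite (_ : c * (D - l * toC h) = c * D - c * l * toC h) ?ReB; ring.
rewrite (le_trans (ler_normD _ _))// [X in _ <= X * _](_ : _ = e / 2 + e / 2); last by lra.
rewrite mulrDl lerD//.
  apply: le_trans HD _.
  have : `|toP D| <= (4 * (B + 1)) * (`|h| / 2).
    rewrite (le_trans (norm_modc _))// toPK (le_trans DB)//.
    have : B * modc (toC h) <= B * (2 * `|h|) by rewrite ler_wpM2l.
    have := normr_ge0 h; lra.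
  move=> /(ler_wpM2l (ltW e1)) /le_trans; apply.
  rewrite mulrA divfK ?gt_eqF//; lra.
apply: le_trans (Re_le_modc _) _; rewrite modcM.
apply: le_trans (ler_wpM2l (modc_ge0 _) (H _ hd)) _.
rewrite mulrA expr2 mulrA.
move: he; rewrite ltr_pdivlMr// => he.
have h0 := modc_ge0 (toC h).
have : modc c * K * modc (toC h) <= e / 8.
  by move: he; rewrite mulrC; lra.
move=> /(ler_wpM2r h0) /le_trans; apply.
have : e / 8 * modc (toC h) <= e / 8 * (2 * `|h|) by rewrite ler_wpM2l// divr_ge0// ltW.
have : 0 <= e * `|h| by rewrite mulr_ge0// ltW.
lra.
Qed.

Lemma is_cgrad_Re M p l : cder M (toC p) l ->
  is_cgrad (fun q => complex.Re (M (toC q))) p l.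
Proof.
move=> Ml; have := is_cgrad_comp Ml (is_cgrad_linear 1 _).
by under eq_fun do rewrite mul1r toPK; rewrite mul1r.
Qed.

Lemma is_cgrad_Im M p l : cder M (toC p) l ->
  is_cgrad (fun q => complex.Im (M (toC q))) p (- 'i * l).
Proof.
move=> Ml; have := is_cgrad_comp Ml (is_cgrad_linear (- 'i) _).
under eq_fun => q.
  rewrite (_ : complex.Re _ = complex.Im (M (toC q))); last first.
    by rewrite toPK ReM /=; ring.
  over.
by [].
Qed.

End ComplexDerivative.

(** * Mean values and one-sided slopes *)

Section Lines.
Variable R : realType.
Implicit Types (f g : R * R -> R) (p q v : R * R) (c r s : R[i]).

Lemma is_derive_line f (p v : R * R) (t l : R) :
  is_derive (p + t *: v) v f l -> is_derive t 1 (fun x => f (p + x *: v)) l.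
Proof.
have E : (fun h : R => h^-1 *: (((fun x => f (p + x *: v)) \o shift t) (h *: (1 : R)) - f (p + t *: v))) =
  (fun h : R => h^-1 *: ((f \o shift (p + t *: v)) (h *: v) - f (p + t *: v))).
  apply/funext => h /=; congr (_ *: (f _ - _)).
  by rewrite [h%:A]mulr1 scalerDl addrCA.
by move=> [df <-]; split; rewrite /derivable /derive /= ?E.
Qed.

Lemma is_derive_cgrad f p v (t : R) c : is_cgrad f (p + t *: v) c ->
  is_derive t 1 (fun x => f (p + x *: v)) (complex.Re (c * toC v)).
Proof.
move=> [df <-]; apply: is_derive_line; split; first exact: diff_derivable.
by rewrite deriveE// cgrad_diff.
Qed.

Lemma MVT0 (g g' : R -> R) (a : R) :
  (forall t : R, `|t| <= `|a| -> is_derive t 1 g (g' t)) ->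
  exists2 t, `|t| <= `|a| & g a - g 0 = g' t * a.
Proof.
move=> H.
have C x y : (forall t, t \in `[x, y] -> `|t| <= `|a|) -> {within `[x, y], continuous g}.
  move=> xy; apply: continuous_in_subspaceT => t; rewrite inE /= => txy.
  apply: differentiable_continuous; apply/derivable1_diffP.
  by have [] := H t (xy _ txy).
have [a0|a0|a0] := ltgtP 0 a.
- have D t : t \in `]0, a[ -> is_derive t 1 g (g' t).
    by rewrite in_itv/= => /andP[t0 ta]; apply: H; rewrite !ger0_norm ?ltW.
  have [|t ta ->] := MVT a0 D.
    by apply: C => t; rewrite in_itv/= => /andP[t0 ta]; rewrite !ger0_norm// ltW.
  exists t; rewrite ?subr0//; move: ta; rewrite in_itv/= => /andP[t0 ta].
  by rewrite !ger0_norm ?ltW.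
- have D t : t \in `]a, 0[ -> is_derive t 1 g (g' t).
    by rewrite in_itv/= => /andP[t0 ta]; apply: H; rewrite !ler0_norm ?ltW// ltrN2.
  have [|t ta E] := MVT a0 D.
    by apply: C => t; rewrite in_itv/= => /andP[t0 ta]; rewrite !ler0_norm ?lerN2// ltW.
  exists t; last by rewrite -opprB E sub0r mulrN opprK.
  move: ta; rewrite in_itv/= => /andP[t0 ta].
  by rewrite !ler0_norm ?lerN2 ?ltW.
- exists 0; first by rewrite normr0 normr_ge0.
  by rewrite -a0 subrr mulr0.
Qed.

(** The increment is split along p, p + (0, h.2), p + h, and the mean value theorem is applied to
    each leg; continuity of the partial derivatives at p bounds the error. *)
Lemma C1_is_cgrad (U : set (R * R)) f p : open U -> C1_on U f -> U p ->
  is_cgrad f p (cgrad f p).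
Proof.
move=> oU fU Up; apply: is_cgradP => e e0.
have e4 : 0 < e / 2 by rewrite divr_gt0.
have [_ _ /cvgrPdist_le/(_ _ e4) Cx /cvgrPdist_le/(_ _ e4) Cy] := fU _ Up.
have nU : nbhs p U by exact: open_nbhs_nbhs.
have /nbhs_ballP[d /= d0 H] : nbhs p (U `&` [set q | `|dx f p - dx f q| <= e / 2] `&`
  [set q | `|dy f p - dy f q| <= e / 2]).
  exact: filterI (filterI nU Cx) Cy.
apply/nbhs_ballP; exists d; first exact: d0.
move=> h; rewrite -ball_normE /= sub0r normrN => hd.
have h1 : `|h.1| <= `|h| by rewrite prod_normE le_max lexx.
have h2 : `|h.2| <= `|h| by rewrite prod_normE le_max lexx orbT.
have B a b : `|a| <= `|h| -> `|b| <= `|h| -> ball p d (p + (a, b)).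
  move=> ah bh; rewrite -ball_normE /= opprD addrA subrr sub0r normrN.
  by rewrite prod_normE /= gt_max (le_lt_trans ah)// (le_lt_trans bh).
have E1 (a b : R) : p + (a, b) = (p + (0, b)) + a *: (1, 0).
  by apply/pair_equal_spec; split; rewrite /= /GRing.scale /= ?mulr1 ?mulr0 ?addr0.
have E2 (b : R) : p + (0, b) = p + b *: (0, 1).
  by apply/pair_equal_spec; split; rewrite /= /GRing.scale /= ?mulr1 ?mulr0 ?addr0.
have [s sh Es] : exists2 t, `|t| <= `|h.1| & f (p + (0, h.2) + h.1 *: (1, 0)) -
    f (p + (0, h.2) + 0 *: (1, 0)) = dx f (p + (0, h.2) + t *: (1, 0)) * h.1.
  apply: (MVT0 (g := fun t => f (p + (0, h.2) + t *: (1, 0)))) => t th.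
  apply: is_derive_line; split; last reflexivity.
  rewrite -E1; have [[/fU [dfx _ _ _] _] _] := H _ (B t h.2 (le_trans th h1) h2).
  exact: dfx.
have [t th Et] : exists2 t, `|t| <= `|h.2| & f (p + h.2 *: (0, 1)) -
    f (p + 0 *: (0, 1)) = dy f (p + t *: (0, 1)) * h.2.
  apply: (MVT0 (g := fun t => f (p + t *: (0, 1)))) => t th.
  apply: is_derive_line; split; last reflexivity.
  rewrite -E2; have n0 : `|0 : R| <= `|h| by rewrite normr0.
  have [[/fU [_ dfy _ _] _] _] := H _ (B 0 t n0 (le_trans th h2)).
  exact: dfy.
have -> : f (p + h) - f p = dx f (p + (0, h.2) + s *: (1, 0)) * h.1 + dy f (p + t *: (0, 1)) * h.2.
  by rewrite -Es -Et !scale0r !addr0 -E2 -E1 -surjective_pairing; ring.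
rewrite (_ : _ - _ = (dx f (p + (0, h.2) + s *: (1, 0)) - dx f p) * h.1 +
   (dy f (p + t *: (0, 1)) - dy f p) * h.2); last by ring.
rewrite (le_trans (ler_normD _ _))// !normrM (splitr e) mulrDl lerD//.
  apply: ler_pM => //; rewrite distrC.
  by rewrite -E1; have [[_ hx] _] := H _ (B s h.2 (le_trans sh h1) h2); exact: hx.
apply: ler_pM => //; rewrite distrC.
by rewrite -E2; have n0 : `|0 : R| <= `|h| by [rewrite normr0];
  have [_ hy] := H _ (B 0 t n0 (le_trans th h2)); exact: hy.
Qed.

Lemma near_add p (P : R * R -> Prop) : (\forall q \near p, P q) ->
  \forall h \near (0 : R * R), P (p + h).
Proof. by rewrite (near_shift 0)/=; apply: filterS => h; rewrite subr0 addrC. Qed.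

Lemma max_is_cgrad f p c : is_cgrad f p c -> (\forall q \near p, f q <= f p) -> c = 0.
Proof.
move=> fc /near_add fp; apply/eqP; rewrite -modc_eq0 -[_ == _]negbK.
apply/negP => c0; have {}c0 : 0 < modc c by rewrite lt_neqAle eq_sym c0 modc_ge0.
have e0 : 0 < modc c / 2 by rewrite divr_gt0.
have /nbhs_ballP[d /= d0 H] : nbhs (0 : R * R) ([set h | f (p + h) <= f p] `&`
   [set h | `|f (p + h) - f p - complex.Re (c * toC h)| <= modc c / 2 * `|h|]).
  by apply: filterI => //; exact: is_cgradE.
pose t := d / 2 / modc c; have t0 : 0 < t by rewrite !divr_gt0.
pose h := toP (t%:C * conjc c).
have hm : modc (toC h) = d / 2.
  by rewrite toPK modcM modcJ modcR gtr0_norm// /t divfK// gt_eqF.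
have hd := norm_modc h; rewrite hm in hd.
have cE : complex.Re (c * toC h) = modc c * (d / 2).
  rewrite toPK mulrCA -modc2J ReRM /= expr2 /t; field; exact: lt0r_neq0.
have [|/= H1] := H h.
  by rewrite -ball_normE /= sub0r normrN; lra.
rewrite cE ler_norml => /andP[H2 _].
have : modc c / 2 * `|h| <= modc c / 2 * (d / 2) by rewrite ler_wpM2l// ltW.
have : 0 < modc c * (d / 2) by rewrite mulr_gt0// divr_gt0.
lra.
Qed.

Lemma within_continuous_line f p v (a b : R) :
  (forall t, t \in `[a, b] -> {for p + t *: v, continuous f}) ->
  {within `[a, b], continuous (fun t : R => f (p + t *: v))}.
Proof.
move=> H; apply: continuous_in_subspaceT => t; rewrite inE /= => /H ft.
apply: (@continuous_comp _ _ _ (fun t : R => p + t *: v) f) => //.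
apply: cvgD; first exact: cvg_cst.
by apply: cvgZr_tmp; exact: cvg_id.
Qed.

(** The first derivative along v vanishes at p. If Re (m v) were positive it would be at least t Re
    (m v) / 2 at p + t v for small t, and the mean value theorem would give f a value above f p. *)
Lemma max_second_derivative f p v (c : R * R -> R[i]) m :
  (\forall q \near p, is_cgrad f q (c q)) ->
  is_cgrad (fun q => complex.Re (c q * toC v)) p m ->
  (\forall q \near p, f q <= f p) -> complex.Re (m * toC v) <= 0.
Proof.
move=> fc cm fp; rewrite leNgt; apply/negP => m0.
have cp : c p = 0 by apply: max_is_cgrad (nbhs_singleton fc) fp.
have v0 : 0 < `|v|.
  rewrite normr_gt0; apply: contraTneq m0 => ->.
  by rewrite [toC 0](_ : _ = 0)// mulr0 ltxx.
have e0 : 0 < complex.Re (m * toC v) / 2 / `|v| by rewrite !divr_gt0.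
have /nbhs_ballP[d /= d0 H] : nbhs (0 : R * R) ([set h | f (p + h) <= f p] `&`
   [set h | is_cgrad f (p + h) (c (p + h))] `&`
   [set h | `|complex.Re (c (p + h) * toC v) - complex.Re (c p * toC v) -
      complex.Re (m * toC h)| <= complex.Re (m * toC v) / 2 / `|v| * `|h|]).
  by apply: filterI; [apply: filterI; [exact: (near_add fp)|exact: (near_add fc)]|exact: (is_cgradE cm e0)].
pose a := d / 2 / `|v|; have a0 : 0 < a by rewrite !divr_gt0.
have K (t : R) : 0 <= t <= a -> [/\ f (p + t *: v) <= f p,
    is_cgrad f (p + t *: v) (c (p + t *: v)) &
    t * (complex.Re (m * toC v) / 2) <= complex.Re (c (p + t *: v) * toC v)].
  move=> /andP[t0 ta]; have [|[/= H1 H2]] := H (t *: v).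
    rewrite -ball_normE /= sub0r normrN normrZ ger0_norm//.
    apply: (@le_lt_trans _ _ (a * `|v|)); first by rewrite ler_wpM2r.
    by rewrite /a divfK ?gt_eqF//; lra.
  rewrite cp mul0r /= subr0 => H3; split => //.
  have E : complex.Re (m * toC (t *: v)) = t * complex.Re (m * toC v).
    by rewrite !ReM /= /GRing.scale /=; ring.
  move: H3; rewrite E normrZ ger0_norm// ler_norml => /andP[H3 _].
  have : complex.Re (m * toC v) / 2 / `|v| * (t * `|v|) = complex.Re (m * toC v) / 2 * t.
    by field; exact: lt0r_neq0.
  by lra.
have D t : t \in `]0, a[ -> is_derive t 1 (fun t : R => f (p + t *: v))
    (complex.Re (c (p + t *: v) * toC v)).
  rewrite in_itv/= => /andP[t0 ta]; apply: is_derive_cgrad.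
  by have [|_ h _] := K t; [rewrite !ltW|exact: h].
have [|t] := MVT a0 D.
  apply: within_continuous_line => t; rewrite in_itv /= => ta.
  by have [_ h _] := K t ta; exact: is_cgrad_cont h.
rewrite in_itv/= => /andP[t0 ta]; rewrite scale0r addr0 => E.
have [|H1 _ _] := K a; first by rewrite lexx ltW.
have [|_ _ H2] := K t; first by rewrite !ltW.
have : 0 < t * (complex.Re (m * toC v) / 2) * a by rewrite !mulr_gt0// invr_gt0.
have : t * (complex.Re (m * toC v) / 2) * a <= complex.Re (c (p + t *: v) * toC v) * a.
  by rewrite ler_wpM2r// ltW.
rewrite subr0 in E; rewrite -E; lra.
Qed.

Lemma max_slope (g : R -> R) (l : R) :
  (\forall t \near (0 : R)^'+, g t <= g 0) ->
  (fun t => (g t - g 0) / t) @ (0 : R)^'+ --> l -> l <= 0.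
Proof.
move=> gm gl; rewrite leNgt; apply/negP => l0.
have /cvgrPdist_lt/(_ _ l0) H := gl.
near (0 : R)^'+ => t.
have t0 : 0 < t by near: t; exact: nbhs_right_gt.
have gt : g t <= g 0 by near: t.
have : `|l - (g t - g 0) / t| < l by near: t.
rewrite ltr_norml => /andP[_].
have : (g t - g 0) / t <= 0 by rewrite ler_pdivrMr// mul0r subr_le0.
lra.
Unshelve. all: by end_near. Qed.

(** [normal_deriv_cvg] speaks of gradients at points off the circle, the maximum principle of
    difference quotients from the circle. The mean value theorem on ]0, t[ and continuity at p turn
    the first into the second. *)
Lemma slope_of_gradient f p v (c : R * R -> R[i]) (l : R) :
  {for p, continuous f} ->
  (\forall t \near (0 : R)^'+, is_cgrad f (p + t *: v) (c (p + t *: v))) ->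
  (fun t : R => complex.Re (c (p + t *: v) * toC v)) @ (0 : R)^'+ --> l ->
  (fun t : R => (f (p + t *: v) - f p) / t) @ (0 : R)^'+ --> l.
Proof.
move=> fcont fc cl; apply/cvgrPdist_lt => e e0.
have /cvgrPdist_lt/(_ _ e0) H := cl.
have [d /= d0 H1] : nbhs (0 : R)^'+ ([set t : R | is_cgrad f (p + t *: v) (c (p + t *: v))]
   `&` [set t : R | `|l - complex.Re (c (p + t *: v) * toC v)| < e]).
  exact: filterI.
have K t : 0 < t < d -> is_cgrad f (p + t *: v) (c (p + t *: v)) /\
    `|l - complex.Re (c (p + t *: v) * toC v)| < e.
  move=> /andP[t0 td]; apply: H1 => //=.
  by rewrite sub0r normrN gtr0_norm.
near=> t.
have t0 : 0 < t by near: t; exact: nbhs_right_gt.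
have td : t < d by near: t; exact: nbhs_right_lt.
have D x : x \in `]0, t[ -> is_derive x 1 (fun t : R => f (p + t *: v))
    (complex.Re (c (p + x *: v) * toC v)).
  rewrite in_itv/= => /andP[x0 xt]; apply: is_derive_cgrad.
  by have [] := K x; rewrite ?x0 ?(lt_trans xt).
have [|x] := MVT t0 D.
  apply: within_continuous_line => x; rewrite in_itv /= => /andP[].
  rewrite le_eqVlt => /predU1P[<- _|x0 xt]; first by rewrite scale0r addr0.
  have xd : 0 < x < d by rewrite x0 (le_lt_trans xt).
  by have [h _] := K x xd; exact: is_cgrad_cont h.
rewrite in_itv/= => /andP[x0 xt]; rewrite scale0r addr0 subr0 => ->.
by rewrite mulfK ?gt_eqF//; have [] := K x; rewrite ?x0 ?(lt_trans xt).
Unshelve. all: by end_near. Qed.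

Lemma slope_is_cgrad f p v c : is_cgrad f p c ->
  (fun t : R => (f (p + t *: v) - f p) / t) @ (0 : R)^'+ --> complex.Re (c * toC v).
Proof.
move=> fc; apply/cvgrPdist_lt => e e0.
have v1 : 0 < `|v| + 1 by rewrite ltr_wpDl.
have e1 : 0 < e / (`|v| + 1) by rewrite divr_gt0.
have /nbhs_ballP[d /= d0 H] := is_cgradE fc e1.
have d1 : 0 < d / (`|v| + 1) by rewrite divr_gt0.
near=> t.
have t0 : 0 < t by near: t; exact: nbhs_right_gt.
have td : t < d / (`|v| + 1) by near: t; exact: nbhs_right_lt.
have tv : `|t *: v| < t * (`|v| + 1).
  by rewrite normrZ gtr0_norm// ltr_pM2l// ltrDl.
have := H (t *: v); rewrite -ball_normE /= sub0r normrN.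
move=> /(_ (lt_trans tv _)); rewrite -ltr_pdivlMr// => /(_ td).
have -> : complex.Re (c * toC (t *: v)) = t * complex.Re (c * toC v).
  by rewrite !ReM /= /GRing.scale /=; ring.
move=> H1; rewrite distrC -(ltr_pM2r t0) -[X in _ * X < _](gtr0_norm t0) -normrM mulrBl divfK ?gt_eqF//.
rewrite [_ * t]mulrC; apply: le_lt_trans H1 _.
by move: tv; rewrite -(ltr_pM2l e1) [X in _ < X]mulrCA divfK ?gt_eqF// [X in _ < X]mulrC.
Unshelve. all: by end_near. Qed.

(* The approximants are equi-Lipschitz near [p]. *)
Lemma limit_cgrad_bound (F : nat -> R * R -> R) f p c (B d : R) : 0 < d -> 0 <= B ->
  is_cgrad f p c ->
  (forall q, ball p d q -> (fun n => F n q) @ \oo --> f q) ->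
  (\forall n \near \oo, forall q, ball p d q ->
     exists2 c', is_cgrad (F n) q c' & modc c' <= B) ->
  modc c <= B.
Proof.
move=> d0 B0 fc Ff FB.
have [->|c0] := eqVneq c 0; first by rewrite modc0.
have mc0 : 0 < modc c by rewrite modc_gt0.
pose v := toP (conjc c).
have cv : complex.Re (c * toC v) = modc c ^+ 2 by rewrite toPK -modc2J.
have vm : modc (toC v) = modc c by rewrite toPK modcJ.
have v0 : `|v| <= modc c by rewrite -vm norm_modc.
rewrite -(ler_pM2r mc0) -expr2 -cv.
have H := slope_is_cgrad (v := v) fc.
have K t : 0 < t -> t < d / modc c -> `|f (p + t *: v) - f p| <= B * modc c * t.
  move=> t0 td; have tB x : `|x| <= t -> ball p d (p + x *: v).
    move=> xt; rewrite -ball_normE /= opprD addrA subrr sub0r normrN normrZ.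
    apply: (@le_lt_trans _ _ (t * modc c)); first by rewrite ler_pM.
    by rewrite -ltr_pdivlMr.
  apply/ler_addgt0Pr => e e0; have e2 : 0 < e / 2 by rewrite divr_gt0.
  have t1 : ball p d (p + t *: v) by apply: tB; rewrite gtr0_norm.
  have t2 : ball p d p by have := tB 0; rewrite scale0r addr0 normr0; apply; exact: ltW.
  near \oo => n.
  have n1 : `|f (p + t *: v) - F n (p + t *: v)| <= e / 2.
    by near: n; move/cvgrPdist_le : (Ff _ t1); exact.
  have n2 : `|f p - F n p| <= e / 2.
    by near: n; move/cvgrPdist_le : (Ff _ t2); exact.
  have n3 : forall q, ball p d q -> exists2 c', is_cgrad (F n) q c' & modc c' <= B.
    by near: n.
  (* [MVT0] expects a derivative function, so gradients are chosen along the segment, with default 0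
     off it. *)
  have [c' c'P] := choice (fun x : R => match pselect (`|x| <= t) with
    | left h => let: ex_intro2 c' h1 h2 := n3 _ (tB x h) in
        ex_intro (fun c' => `|x| <= t -> is_cgrad (F n) (p + x *: v) c' /\ modc c' <= B) c' (fun _ => conj h1 h2)
    | right h => ex_intro (fun c' => `|x| <= t -> is_cgrad (F n) (p + x *: v) c' /\ modc c' <= B) 0 (fun h' => False_ind _ (h h')) end).
  have [x xt E] : exists2 x, `|x| <= `|t| & F n (p + t *: v) - F n (p + 0 *: v) =
      complex.Re (c' x * toC v) * t.
    apply: (MVT0 (g := fun x => F n (p + x *: v))) => x; rewrite (gtr0_norm t0) => xt.
    by apply: is_derive_cgrad; have [] := c'P x xt.
  rewrite (gtr0_norm t0) in xt; have [_ c'B] := c'P x xt.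
  have : `|F n (p + t *: v) - F n p| <= B * modc c * t.
    rewrite scale0r addr0 in E; rewrite E normrM (gtr0_norm t0) ler_wpM2r ?(ltW t0)//.
    rewrite (le_trans (Re_le_modc _))// modcM vm ler_wpM2r// ltW//.
  have -> : f (p + t *: v) - f p = (f (p + t *: v) - F n (p + t *: v)) +
     ((F n (p + t *: v) - F n p) - (f p - F n p)) by ring.
  move=> n4; rewrite (le_trans (ler_normD _ _))//.
  have := ler_normB (F n (p + t *: v) - F n p) (f p - F n p); lra.
rewrite -(cvg_lim _ H)//; apply: limr_le; first by apply/cvg_ex; eexists; exact: H.
near=> t.
have t0 : 0 < t by near: t; exact: nbhs_right_gt.
rewrite ler_pdivrMr//; apply: le_trans (ler_norm _) (K _ t0 _).
by near: t; apply: nbhs_right_lt; rewrite divr_gt0.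
Unshelve. all: by end_near. Qed.

End Lines.

(** * The Laplacian and the maximum principle *)

Section Laplacian.
Variable R : realType.
Implicit Types (f g : R * R -> R) (p q v : R * R).

(** Here c = f_x - i f_y, so r is the gradient of f_x and s that of - f_y; hence Re r = f_xx and Im
    s = f_yy. The relational form carries the differentiability that the maximum principle
    consumes. *)
Definition laplacian f p (L : R) := exists (c : R * R -> R[i]) (r s : R[i]),
  [/\ \forall q \near p, is_cgrad f q (c q),
      is_cgrad (fun q => complex.Re (c q)) p r,
      is_cgrad (fun q => complex.Im (c q)) p s &
      complex.Re r + complex.Im s = L].

Lemma laplacian_near f g p L : (\forall q \near p, f q = g q) ->
  laplacian f p L -> laplacian g p L.
Proof.
move=> fg [c [r [s [fc cr cs rs]]]]; exists c, r, s; split => //.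
move: fc (near_join fg); apply: filterS2 => q fc fgq.
exact: is_cgrad_near fgq fc.
Qed.

Lemma laplacian_eq f p L L' : laplacian f p L -> L = L' -> laplacian f p L'.
Proof. by move=> ? <-. Qed.

Lemma laplacian_cst k p : laplacian (fun _ => k) p 0.
Proof.
exists (fun _ => 0), 0, 0; split; [|exact: is_cgrad_cst..|by rewrite addr0].
by near=> q; exact: is_cgrad_cst.
Unshelve. all: by end_near. Qed.

Lemma laplacianD f g p L L' : laplacian f p L -> laplacian g p L' ->
  laplacian (fun q => f q + g q) p (L + L').
Proof.
move=> [c [r [s [fc cr cs <-]]]] [c' [r' [s' [fc' cr' cs' <-]]]].
exists (fun q => c q + c' q), (r + r'), (s + s'); split.
- by move: fc fc'; apply: filterS2 => q; exact: is_cgradD.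
- by under eq_fun do rewrite ReD; exact: is_cgradD.
- by under eq_fun do rewrite ImD; exact: is_cgradD.
- by rewrite ReD ImD; ring.
Qed.

Lemma laplacianZ k f p L : laplacian f p L -> laplacian (fun q => k * f q) p (k * L).
Proof.
move=> [c [r [s [fc cr cs <-]]]].
exists (fun q => k%:C * c q), (k%:C * r), (k%:C * s); split.
- by move: fc; apply: filterS => q; exact: is_cgradZ.
- by under eq_fun do rewrite ReRM; exact: is_cgradZ.
- by under eq_fun do rewrite ImRM; exact: is_cgradZ.
- by rewrite ReRM ImRM mulrDr.
Qed.

Lemma laplacianN f p L : laplacian f p L -> laplacian (fun q => - f q) p (- L).
Proof.
move=> /(laplacianZ (-1)); rewrite mulN1r.
by under eq_fun do rewrite mulN1r.
Qed.

Lemma laplacianB f g p L L' : laplacian f p L -> laplacian g p L' ->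
  laplacian (fun q => f q - g q) p (L - L').
Proof. by move=> fL /laplacianN; exact: laplacianD. Qed.

Lemma laplacian_sum n (F : 'I_n -> R * R -> R) p :
  (forall i, laplacian (F i) p 0) -> laplacian (fun q => \sum_(i < n) F i q) p 0.
Proof.
elim: n F => [|n IH] F FC.
  under eq_fun do rewrite big_ord0; exact: laplacian_cst.
under eq_fun do rewrite big_ord_recl.
apply: laplacian_eq (laplacianD (FC ord0) (IH _ _)) (addr0 0) => i; exact: FC.
Qed.

Lemma max_laplacian f p L : laplacian f p L -> (\forall q \near p, f q <= f p) -> L <= 0.
Proof.
move=> [c [r [s [fc cr cs <-]]]] fp.
have h1 : complex.Re (r * toC (1, 0)) <= 0.
  apply: (max_second_derivative fc _ fp).
  by under eq_fun do rewrite [toC _](_ : _ = 1)// mulr1.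
have h2 : complex.Re (- s * toC (0, 1)) <= 0.
  apply: (max_second_derivative fc _ fp).
  under eq_fun => q.
    rewrite (_ : complex.Re _ = - complex.Im (c q)); last by rewrite ReM /=; ring.
    over.
  exact: is_cgradN.
rewrite ReM /= in h1; rewrite ReM /= ImN in h2; lra.
Qed.

(** Conformal invariance: the Laplacian of f o M is |M'|^2 times that of f at M. The terms with the
    second derivative l' cancel by the Cauchy-Riemann equations for l. *)
Lemma harmonic_comp f (M l : R[i] -> R[i]) p l' :
  (\forall q \near p, cder M (toC q) (l (toC q))) -> cder l (toC p) l' ->
  laplacian f (toP (M (toC p))) 0 ->
  laplacian (fun q => f (toP (M (toC q)))) p 0.
Proof.
move=> Ml ll [c [r [s [fc cr cs rs]]]].
pose m := l (toC p).
have Mlp : cder M (toC p) m := nbhs_singleton Ml.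
have Mc : (fun q => toP (M (toC q))) q @[q --> p] --> toP (M (toC p)).
  exact: cvg_pair (is_cgrad_cont (is_cgrad_Re Mlp)) (is_cgrad_cont (is_cgrad_Im Mlp)).
have gr := is_cgrad_comp Mlp cr; have gs := is_cgrad_comp Mlp cs.
have lr := is_cgrad_Re ll; have li := is_cgrad_Im ll.
exists (fun q => c (toP (M (toC q))) * l (toC q)); eexists; eexists; split.
- have fc' : \forall q \near p, is_cgrad f (toP (M (toC q))) (c (toP (M (toC q)))).
    exact: (Mc _ fc).
  by move: Ml fc'; apply: filterS2 => q Mq fq; exact: (is_cgrad_comp Mq fq).
- under eq_fun do rewrite ReM.
  by apply: is_cgradB; apply: is_cgradM; [exact: gr|exact: lr|exact: gs|exact: li].
- under eq_fun do rewrite ImM.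
  by apply: is_cgradD; apply: is_cgradM; [exact: gr|exact: li|exact: gs|exact: lr].
- rewrite /m !(ReM, ImM, ReD, ImD, ReN, ImN) /=.
  transitivity ((complex.Re (l (toC p)) ^+ 2 + complex.Im (l (toC p)) ^+ 2) *
    (complex.Re r + complex.Im s)); first by ring.
  by rewrite rs mulr0.
Qed.

(** Inversions are antiholomorphic; they are written as this reflection z -> - conj z followed by a
    Moebius map. In the coordinate w it becomes w -> 1 / conj w. *)
Definition flipx p : R * R := (- p.1, p.2).

Lemma toC_flipx p : toC (flipx p) = - conjc (toC p).
Proof. by case: p => x y; simpc. Qed.

Lemma is_cgrad_flipx f p c : is_cgrad f (flipx p) c ->
  is_cgrad (fun q => f (flipx q)) p (- conjc c).
Proof.
move=> fc; apply: is_cgradP => e e0.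
have /nbhs_ballP[d /= d0 H] := is_cgradE fc e0.
apply/nbhs_ballP; exists d => //= h; rewrite -ball_normE /= sub0r normrN => hd.
have hn : `|flipx h| = `|h| by rewrite !prod_normE /= normrN.
have := H (flipx h); rewrite -ball_normE /= sub0r normrN hn => /(_ hd).
have -> : flipx p + flipx h = flipx (p + h).
  by apply/pair_equal_spec; split => //=; rewrite opprD.
have -> // : complex.Re (c * toC (flipx h)) = complex.Re (- conjc c * toC h).
by case: c {fc H} => a b; case: h {hd hn} => x y /=; ring.
Qed.

Lemma continuous_flipx : continuous flipx.
Proof.
move=> p; have h1 : (fun q : R * R => - q.1) q @[q --> p] --> - p.1.
  by apply: cvgN; exact: cvg_fst.
have h2 : (fun q : R * R => q.2) q @[q --> p] --> p.2 by exact: cvg_snd.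
exact: cvg_pair h1 h2.
Qed.

Lemma laplacian_flipx f p L : laplacian f (flipx p) L ->
  laplacian (fun q => f (flipx q)) p L.
Proof.
move=> [c [r [s [fc cr cs rs]]]].
exists (fun q => - conjc (c (flipx q))), (conjc r), (- conjc s); split.
- have fc' : \forall q \near p, is_cgrad f (flipx q) (c (flipx q)).
    exact: (continuous_flipx fc).
  by move: fc'; apply: filterS => q fq; exact: (is_cgrad_flipx fq).
- have := is_cgradN (is_cgrad_flipx cr); rewrite opprK.
  have -> // : (fun q => - complex.Re (c (flipx q))) =
    (fun q => complex.Re (- conjc (c (flipx q)))).
  by apply/funext => q; rewrite ReN; case: (c _).
- have := is_cgrad_flipx cs.
  have -> // : (fun q => complex.Im (c (flipx q))) =
    (fun q => complex.Im (- conjc (c (flipx q)))).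
  by apply/funext => q; rewrite ImN; case: (c _) => a b /=; rewrite opprK.
- by rewrite -rs; case: r {cr rs} => a b; case: s {cs} => a' b' /=; ring.
Qed.

Lemma laplacian_C2 (U : set (R * R)) f p : open U -> C2_on U f -> U p ->
  laplacian f p (dx (dx f) p + dy (dy f) p).
Proof.
move=> oU [fU fxU fyU] Up.
exists (cgrad f), (cgrad (dx f) p), (- cgrad (dy f) p); split.
- have : nbhs p U by exact: open_nbhs_nbhs.
  by apply: filterS => q Uq; exact: (C1_is_cgrad oU fU).
- exact: (C1_is_cgrad oU fxU).
- exact: is_cgradN (C1_is_cgrad oU fyU Up).
- by rewrite /= opprK.
Qed.

End Laplacian.

Section SquaredDistance.
Variable R : realType.
Implicit Types (p q c v : R * R) (r : R).

Definition nsq c p : R := (p.1 - c.1) ^+ 2 + (p.2 - c.2) ^+ 2.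

Lemma nsqE c p : nsq c p = enorm (p - c) ^+ 2.
Proof. by rewrite sqr_sqrtr// addr_ge0// sqr_ge0. Qed.

Lemma nsq_ge0 c p : 0 <= nsq c p.
Proof. by rewrite addr_ge0// sqr_ge0. Qed.

Lemma nsq_disk c r p : 0 < r -> (enorm (p - c) < r) = (nsq c p < r ^+ 2).
Proof. by move=> r0; rewrite nsqE ltr_pXn2r// ?nnegrE ?sqrtr_ge0// ltW. Qed.

Lemma nsq_circle c r p : 0 < r -> enorm (p - c) = r <-> nsq c p = r ^+ 2.
Proof.
move=> r0; rewrite nsqE; split => [->//|/eqP].
by rewrite eqrXn2 ?sqrtr_ge0 ?ltW// => /eqP.
Qed.

Lemma is_cgrad_nsq c p : is_cgrad (nsq c) p (2 * conjc (toC (p - c))).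
Proof.
have h1 : is_cgrad (fun q : R * R => q.1 - c.1) p 1.
  rewrite -[1]subr0; apply: is_cgradB (is_cgrad_cst _ _).
  apply: is_cgrad_near (is_cgrad_linear 1 p); near=> q.
  by rewrite mul1r.
have h2 : is_cgrad (fun q : R * R => q.2 - c.2) p (- 'i).
  rewrite -[- 'i]subr0; apply: is_cgradB (is_cgrad_cst _ _).
  apply: is_cgrad_near (is_cgrad_linear (- 'i) p); near=> q.
  by rewrite ReM /=; ring.
have := is_cgradD (is_cgradM h1 h1) (is_cgradM h2 h2).
under eq_fun do rewrite -!expr2; move/is_cgrad_eq; apply.
by simpc; apply/eqP; rewrite eq_complex /=; apply/andP; split; apply/eqP; ring.
Unshelve. all: by end_near. Qed.

Lemma laplacian_nsq c p : laplacian (nsq c) p 4.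
Proof.
exists (fun q => 2 * conjc (toC (q - c))), 2, (2 * 'i); split.
- by near=> q; exact: is_cgrad_nsq.
- have := is_cgradB (is_cgrad_linear 2 p) (is_cgrad_cst (2 * c.1) p); rewrite subr0.
  apply: is_cgrad_near; near=> q; rewrite !ReM /=; ring.
- have := is_cgradB (is_cgrad_linear (2 * 'i) p) (is_cgrad_cst (- 2 * c.2) p); rewrite subr0.
  apply: is_cgrad_near; near=> q; rewrite !ReM !ImM /=; ring.
- by rewrite /=; ring.
Unshelve. all: by end_near. Qed.

Lemma nsq_cont c : continuous (nsq c).
Proof. by move=> p; exact: is_cgrad_cont (is_cgrad_nsq c p). Qed.

Lemma nsq_line c p v (t : R) :
  nsq c (p + t *: v) = nsq c p + t * (2 * dot (p - c) v) + t ^+ 2 * nsq 0 v.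
Proof. by rewrite /nsq /dot /= /GRing.scale /=; ring. Qed.

End SquaredDistance.

Section MaximumPrinciple.
Variable R : realType.
Implicit Types (p q v : R * R) (w : R * R -> R).

Lemma compact_box (rho : R) : compact [set p : R * R | `|p| <= rho].
Proof.
have -> : [set p : R * R | `|p| <= rho] = `[- rho, rho] `*` `[- rho, rho].
  apply/seteqP; split => -[x y] /=; rewrite prod_normE /= ge_max !ler_norml !in_itv /=.
    by move=> /andP[-> ->].
  by move=> [-> ->].
by apply: compact_setX; exact: segment_compact.
Qed.

Lemma max_on_box (f : R * R -> R) (rho : R) : 0 <= rho -> continuous f ->
  exists2 p, `|p| <= rho & forall q, `|q| <= rho -> f q <= f p.
Proof.
move=> rho0 fc.
have [|c] := compact_EVT_max _ (@compact_box rho) (continuous_subspaceT fc).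
  by exists 0; rewrite /= normr0.
rewrite inE /= => cr H; exists c => // q qr; apply: H; rewrite inE; exact: qr.
Qed.

Definition slope w p v (l : R) :=
  (fun t : R => (w (p + t *: v) - w p) / t) @ (0 : R)^'+ --> l.

Lemma slopeD w w' p v l l' : slope w p v l -> slope w' p v l' ->
  slope (fun q => w q + w' q) p v (l + l').
Proof.
move=> h h'; apply: cvg_trans (cvgD h h'); apply: near_eq_cvg; near=> t; rewrite /=.
by rewrite fctE -mulrDl; congr (_ / _); ring.
Unshelve. all: by end_near.
Qed.

Lemma slopeZ k w p v l : slope w p v l -> slope (fun q => k * w q) p v (k * l).
Proof.
move=> h; apply: cvg_trans (cvgM (cvg_cst k) h); apply: near_eq_cvg; near=> t; rewrite /=.
by rewrite mulrA mulrBr.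
Unshelve. all: by end_near.
Qed.

Lemma slopeB w w' p v l l' : slope w p v l -> slope w' p v l' ->
  slope (fun q => w q - w' q) p v (l - l').
Proof.
move=> h h'; apply: cvg_trans (cvgB h h'); apply: near_eq_cvg; near=> t; rewrite /=.
by rewrite fctE -mulrBl; congr (_ / _); ring.
Unshelve. all: by end_near.
Qed.

Lemma slope_near w w' p v l : w p = w' p ->
  (\forall t \near (0 : R)^'+, w (p + t *: v) = w' (p + t *: v)) ->
  slope w p v l -> slope w' p v l.
Proof.
move=> wp ww; apply: cvg_trans; apply: near_eq_cvg.
by move: ww; apply: filterS => t /= ->; rewrite wp.
Qed.

Lemma slope_cgrad f p v c : is_cgrad f p c -> slope f p v (complex.Re (c * toC v)).
Proof. exact: slope_is_cgrad. Qed.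

Lemma near_ray p v (P : R * R -> Prop) : (\forall q \near p, P q) ->
  \forall t \near (0 : R)^'+, P (p + t *: v).
Proof.
have C : (fun t : R => p + t *: v) t @[t --> (0 : R)^'+] --> p.
  rewrite -[X in _ --> X]addr0 -(scale0r v); apply: cvgD; first exact: cvg_cst.
  by apply: cvgZr_tmp; apply: cvg_at_right_filter; exact: cvg_id.
by move=> H; exact: (C _ H).
Qed.

Lemma max_slope_le0 w p v l : (\forall q \near p, w q <= w p) -> slope w p v l -> l <= 0.
Proof.
move=> wp wl; apply: (@max_slope _ (fun t => w (p + t *: v))); last first.
  by rewrite scale0r addr0.
by rewrite scale0r addr0; exact: (near_ray v wp).
Qed.

Lemma slope_nsq c p v : slope (nsq c) p v (2 * dot (p - c) v).
Proof.
have := slope_cgrad (v:=v) (is_cgrad_nsq c p); congr (slope _ _ _ _).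
by rewrite !ReM !ImM /dot /=; ring.
Qed.

Lemma near_nsq_lt c p (b : R) : nsq c p < b -> \forall q \near p, nsq c q < b.
Proof. by move=> h; exact: (@cvgr_lt _ _ _ _ (nsq c) (nsq c p) (@nsq_cont R c p) b h). Qed.

Lemma near_nsq_gt c p (b : R) : b < nsq c p -> \forall q \near p, b < nsq c q.
Proof. by move=> h; exact: (@cvgr_gt _ _ _ _ (nsq c) (nsq c p) (@nsq_cont R c p) b h). Qed.

Lemma nsq_ray c p (r t : R) : 0 < r -> nsq c p = r ^+ 2 ->
  nsq c (p + t *: (r^-1 *: (p - c))) = (r + t) ^+ 2.
Proof.
move=> r0 pr; rewrite nsq_line pr.
have -> : nsq 0 (r^-1 *: (p - c)) = 1.
  rewrite -(@divff _ (r ^+ 2)) ?expf_neq0 ?gt_eqF// -{1}pr /nsq /= /GRing.scale /=.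
  by field; exact: lt0r_neq0.
have -> : dot (p - c) (r^-1 *: (p - c)) = r.
  rewrite (_ : dot _ _ = nsq c p / r); last by rewrite /dot /nsq /= /GRing.scale /=; ring.
  by rewrite pr; field; exact: lt0r_neq0.
by ring.
Qed.

Lemma dot_normal c p (r : R) : 0 < r -> nsq c p = r ^+ 2 ->
  dot (p - c) (r^-1 *: (p - c)) = r.
Proof.
move=> r0 pr; rewrite (_ : dot _ _ = nsq c p / r).
  by rewrite pr; field; exact: lt0r_neq0.
by rewrite /dot /nsq /= /GRing.scale /=; ring.
Qed.

Lemma normal_unit c p (r : R) : 0 < r -> nsq c p = r ^+ 2 ->
  (r^-1 *: (p - c)).1 ^+ 2 + (r^-1 *: (p - c)).2 ^+ 2 = 1.
Proof.
move=> r0 pr; rewrite -(@divff _ (r ^+ 2)) ?expf_neq0 ?gt_eqF// -{1}pr.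
by rewrite /nsq /= /GRing.scale /=; field; exact: lt0r_neq0.
Qed.

Lemma near_ray_out c p (r : R) : 0 < r -> nsq c p = r ^+ 2 ->
  \forall t \near (0 : R)^'+, r ^+ 2 < nsq c (p + t *: (r^-1 *: (p - c))).
Proof.
move=> r0 pr; near=> t; rewrite nsq_ray// ltr_pXn2r ?nnegrE ?ltW//.
  by rewrite ltrDl; near: t; exact: nbhs_right_gt.
by rewrite addr_gt0//; near: t; exact: nbhs_right_gt.
Unshelve. all: by end_near. Qed.

Lemma near_ray_in c p (r : R) : 0 < r -> nsq c p = r ^+ 2 ->
  \forall t \near (0 : R)^'+, nsq c (p + t *: (- (r^-1 *: (p - c)))) < r ^+ 2.
Proof.
move=> r0 pr; near=> t.
have t0 : 0 < t by near: t; exact: nbhs_right_gt.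
have tr : t < r by near: t; exact: nbhs_right_lt.
by rewrite scalerN -scaleNr nsq_ray// ltr_pXn2r// ?nnegrE; lra.
Unshelve. all: by end_near. Qed.

Lemma dotN p v : dot p (- v) = - dot p v.
Proof. by rewrite /dot /=; ring. Qed.

(* The barrier [phi] is strictly subharmonic with a strict flux jump across both
   circles, so that adding a small multiple of it excludes interior maxima;
   no Hopf lemma is needed. *)
Lemma maximum_principle (ci ce : R * R) (ri re ki ke rho : R) :
  0 < ri -> 0 < re -> 0 < ki -> 0 < ke -> 0 < rho ->
  (forall p, nsq ci p <= ri ^+ 2 -> nsq ce p < re ^+ 2) ->
  exists2 K, 0 <= K & forall w (eta m : R), 0 < eta -> continuous w ->
    (forall p, nsq ci p != ri ^+ 2 -> nsq ce p != re ^+ 2 -> laplacian w p 0) ->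
    (forall p, nsq ce p = re ^+ 2 -> exists lo li : R,
       [/\ slope w p (re^-1 *: (p - ce)) lo,
           slope w p (- (re^-1 *: (p - ce))) (- li) & - eta <= lo - ke * li]) ->
    (forall p, nsq ci p = ri ^+ 2 -> exists lo li : R,
       [/\ slope w p (ri^-1 *: (p - ci)) lo,
           slope w p (- (ri^-1 *: (p - ci))) (- li) & - eta <= ke * lo - ki * li]) ->
    (forall p, `|p| = rho -> w p <= m) ->
    forall p, `|p| <= rho -> w p <= m + eta * K.
Proof.
move=> ri0 re0 ki0 ke0 rho0 BiBe.
(* With this slope the flux of the barrier jumps by ke (1 + K1) 2 ri - ki 2 ri = 2 ri ke + 2 across
   the inner circle; after multiplication by 2 eta this exceeds the allowed defect eta. *)
pose K1 := (ki + ri^-1) / ke.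
have K10 : 0 <= K1 by rewrite divr_ge0 ?addr_ge0 ?invr_ge0 ?ltW.
pose De := `|ce.1 - ci.1| + `|ce.2 - ci.2|.
have De0 : 0 <= De by rewrite addr_ge0.
(* G bounds the flux jump at the outer circle of the part of the barrier that is smooth there, [De]
   bounding the distance of the centres. The slope K2 adds G + 1, so that a jump of at least 1
   remains. *)
pose G := (1 + ke) * ((1 + K1) * (2 * (re + De))).
have G0 : 0 <= G by rewrite !mulr_ge0// ?addr_ge0// ltW.
pose K2 := (G + 1) / (2 * re).
have K20 : 0 <= K2 by rewrite divr_ge0 ?addr_ge0// mulr_ge0// ltW.
pose phi p := nsq ci p + K1 * Num.max (nsq ci p - ri ^+ 2) 0 +
   K2 * Num.max (nsq ce p - re ^+ 2) 0.
pose ph1 p := (1 + K1) * nsq ci p - K1 * ri ^+ 2.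
pose ph2 p := ph1 p + (K2 * nsq ce p - K2 * re ^+ 2).
have phi0 p : nsq ci p <= ri ^+ 2 -> phi p = nsq ci p.
  move=> h; have h' := BiBe p h; rewrite /phi max_r ?subr_le0// max_r ?subr_le0 ?(ltW h')//.
  by rewrite !mulr0 !addr0.
have phi1 p : ri ^+ 2 <= nsq ci p -> nsq ce p <= re ^+ 2 -> phi p = ph1 p.
  move=> h h'; rewrite /phi max_l ?subr_ge0// max_r ?subr_le0// /ph1; ring.
have phi2 p : re ^+ 2 <= nsq ce p -> phi p = ph2 p.
  move=> h'; have h : ri ^+ 2 <= nsq ci p.
    by rewrite leNgt; apply/negP => /ltW/BiBe; rewrite ltNge h'.
  by rewrite /phi !max_l ?subr_ge0// /ph2 /ph1; ring.
have phi_ge0 p : 0 <= phi p.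
  have m0 x : 0 <= Num.max x (0 : R) by rewrite le_max lexx orbT.
  apply: addr_ge0; last exact: mulr_ge0.
  by apply: addr_ge0; [exact: nsq_ge0|exact: mulr_ge0].
have phic : continuous phi.
  have cmax c k : continuous (fun p : R * R => Num.max (nsq c p - k) 0).
    move=> p; apply: (continuous_max (f := fun p => nsq c p - k) (g := fun=> 0)).
      by apply: cvgB; [exact: nsq_cont|exact: cvg_cst].
    exact: cvg_cst.
  move=> p; apply: cvgD.
    by apply: cvgD; [exact: nsq_cont|apply: cvgM; [exact: cvg_cst|exact: cmax]].
  by apply: cvgM; [exact: cvg_cst|exact: cmax].
pose S (c : R * R) := (rho + `|c.1|) ^+ 2 + (rho + `|c.2|) ^+ 2.
have S0 c : 0 <= S c by rewrite addr_ge0// sqr_ge0.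
have nS c p : `|p| <= rho -> nsq c p <= S c.
  rewrite prod_normE ge_max => /andP[p1 p2]; apply: lerD.
    rewrite -[X in X <= _]real_normK ?num_real// lerXn2r ?nnegrE ?addr_ge0 ?(ltW rho0)//.
    by rewrite (le_trans (ler_normB _ _))// lerD2r.
  rewrite -[X in X <= _]real_normK ?num_real// lerXn2r ?nnegrE ?addr_ge0 ?(ltW rho0)//.
  by rewrite (le_trans (ler_normB _ _))// lerD2r.
pose B := S ci + K1 * S ci + K2 * S ce.
have B0 : 0 <= B.
  by apply: addr_ge0; [apply: addr_ge0; [exact: S0|exact: mulr_ge0]|exact: mulr_ge0].
have phiB p : `|p| <= rho -> phi p <= B.
  move=> pr; have hi := nS ci p pr; have he := nS ce p pr.
  rewrite /phi /B; apply: lerD; first apply: lerD => //.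
    rewrite ler_wpM2l// ge_max S0 andbT; apply: le_trans hi.
    by rewrite gerBl sqr_ge0.
  rewrite ler_wpM2l// ge_max S0 andbT; apply: le_trans he.
  by rewrite gerBl sqr_ge0.
exists (2 * B); first by rewrite mulr_ge0.
move=> w eta m eta0 wc wharm we wi wm p pr.
pose W q := w q + 2 * eta * phi q.
have Wc : continuous W.
  move=> q; apply: cvgD; first exact: wc.
  by apply: cvgM; [exact: cvg_cst|exact: phic].
have [p0 p0r p0max] := max_on_box (ltW rho0) Wc.
have eta20 : 0 < 2 * eta by rewrite mulr_gt0.
(* On the boundary of the box w <= m and phi <= B, which gives the claim. A maximum elsewhere is
   excluded: on a circle by the flux jump, off the circles by strict subharmonicity of phi. *)
suff p0b : `|p0| = rho.
  have h1 : W p <= W p0 by exact: p0max.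
  have h2 : w p <= W p by rewrite lerDl mulr_ge0// ltW.
  have h3 : W p0 <= m + 2 * eta * B.
    by apply: lerD; [exact: wm|apply: ler_wpM2l; [exact: ltW|exact: phiB]].
  by rewrite (le_trans h2)// (le_trans h1)// (le_trans h3)// mulrCA mulrA.
apply/eqP; move: p0r; rewrite le_eqVlt => /predU1P[->//|p0lt].
have Wmax : \forall q \near p0, W q <= W p0.
  have : \forall q \near p0, `|q| < rho.
    exact: (@cvgr_lt _ _ _ _ (fun q : R * R => `|q|) `|p0| (@norm_continuous _ _ p0) rho p0lt).
  by apply: filterS => q /ltW; exact: p0max.
have Wslope (v : R * R) l (f : R * R -> R) l' : slope w p0 v l -> slope f p0 v l' ->
    phi p0 = f p0 -> (\forall t \near (0 : R)^'+, f (p0 + t *: v) = phi (p0 + t *: v)) ->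
    l + 2 * eta * l' <= 0.
  move=> h1 h2 h3 h4.
  have h5 := slope_near (esym h3) h4 h2.
  have h6 := slopeD h1 (slopeZ (k := 2 * eta) h5).
  exact: (@max_slope_le0 W p0 v _ Wmax h6).
have Wlap (f : R * R -> R) L : laplacian w p0 0 -> laplacian f p0 L ->
    (\forall q \near p0, f q = phi q) -> L <= 0.
  move=> h1 h2 h3; have := laplacianD h1 (laplacianZ (2 * eta) (laplacian_near h3 h2)).
  by move=> /max_laplacian/(_ Wmax); rewrite add0r pmulr_rle0.
have lap1 : laplacian ph1 p0 ((1 + K1) * 4).
  rewrite -[X in laplacian _ _ X]subr0; apply: laplacianB (laplacian_cst _ _).
  by apply: laplacianZ; exact: laplacian_nsq.
have lap2 : laplacian ph2 p0 ((1 + K1) * 4 + K2 * 4).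
  apply: laplacianD => //.
  rewrite -[X in laplacian _ _ X]subr0; apply: laplacianB (laplacian_cst _ _).
  by apply: laplacianZ; exact: laplacian_nsq.
have slope1 v : slope ph1 p0 v ((1 + K1) * (2 * dot (p0 - ci) v)).
  rewrite -[X in slope _ _ _ X]subr0; apply: slopeB.
    by apply: slopeZ; exact: slope_nsq.
  by have := slope_cgrad (v:=v) (is_cgrad_cst (K1 * ri ^+ 2) p0); rewrite mul0r.
have slope2 v : slope ph2 p0 v ((1 + K1) * (2 * dot (p0 - ci) v) + K2 * (2 * dot (p0 - ce) v)).
  apply: slopeD => //; rewrite -[X in slope _ _ _ X]subr0; apply: slopeB.
    by apply: slopeZ; exact: slope_nsq.
  by have := slope_cgrad (v:=v) (is_cgrad_cst (K2 * re ^+ 2) p0); rewrite mul0r.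
exfalso.
have [pe|pe] := eqVneq (nsq ce p0) (re ^+ 2).
  have pi : ri ^+ 2 < nsq ci p0.
    by rewrite ltNge; apply/negP => /BiBe; rewrite pe ltxx.
  have [lo [li [slo sli]]] := we _ pe.
  set nu := re^-1 *: (p0 - ce).
  have h1 : lo + 2 * eta * ((1 + K1) * (2 * dot (p0 - ci) nu) + K2 * (2 * dot (p0 - ce) nu)) <= 0.
    apply: Wslope slo (slope2 nu) _ _; first by rewrite phi2// pe.
    have := near_ray_out re0 pe; apply: filterS => t h.
    by rewrite phi2// ltW.
  have h2 : - li + 2 * eta * ((1 + K1) * (2 * dot (p0 - ci) (- nu))) <= 0.
    apply: Wslope sli (slope1 _) _ _; first by rewrite phi1 ?pe// ltW.
    have := near_ray_in re0 pe; have := near_ray (- nu) (near_nsq_gt pi).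
    by apply: filterS2 => t h h'; rewrite phi1// ltW.
  rewrite dotN in h2; rewrite dot_normal// in h1.
  set g := dot (p0 - ci) nu in h1 h2.
  have gD : `|g| <= re + De.
    have -> : g = dot (p0 - ce) nu + dot (ce - ci) nu by rewrite /g /dot /=; ring.
    rewrite dot_normal// (le_trans (ler_normD _ _))// gtr0_norm// lerD2l.
    have nu1 : nu.1 ^+ 2 + nu.2 ^+ 2 = 1 := normal_unit re0 pe.
    have n1 : `|nu.1| <= 1.
      by rewrite -(@expr_le1 _ 2)// real_normK ?num_real// -nu1 lerDl sqr_ge0.
    have n2 : `|nu.2| <= 1.
      by rewrite -(@expr_le1 _ 2)// real_normK ?num_real// -nu1 lerDr sqr_ge0.
    have nn (a b : R) : `|b| <= 1 -> `|a * b| <= `|a|.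
      by move=> b1; rewrite normrM ler_piMr.
    by rewrite /dot (le_trans (ler_normD _ _))//; apply: lerD; exact: nn.
  have K1g : `|(1 - ke) * ((1 + K1) * (2 * g))| <= G.
    rewrite /G !normrM; apply: ler_pM => //; last first.
      apply: ler_pM => //; first by rewrite ger0_norm// addr_ge0.
      by rewrite ger0_norm// ler_wpM2l.
    by rewrite (le_trans (ler_normB _ _))// normr1 gtr0_norm.
  have K2E : K2 * (2 * re) = G + 1 by rewrite /K2 divfK// mulf_neq0// gt_eqF.
  move: K1g; rewrite K2E in h1; rewrite ler_norml => /andP[K1g _].
  have h3 : 2 * eta * (- G) <= 2 * eta * ((1 - ke) * ((1 + K1) * (2 * g))).
    by apply: ler_wpM2l => //; exact: ltW.
  have h4 : ke * (- li + 2 * eta * ((1 + K1) * (2 * - g))) <= 0.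
    by rewrite mulr_ge0_le0// ltW.
  lra.
have [pi|pi] := eqVneq (nsq ci p0) (ri ^+ 2).
  have pe' : nsq ce p0 < re ^+ 2 by apply: BiBe; rewrite pi.
  have [lo [li [slo sli]]] := wi _ pi.
  set nu := ri^-1 *: (p0 - ci).
  have h1 : lo + 2 * eta * ((1 + K1) * (2 * dot (p0 - ci) nu)) <= 0.
    apply: Wslope slo (slope1 nu) _ _; first by rewrite phi1 ?pi// ltW.
    have := near_ray_out ri0 pi; have := near_ray nu (near_nsq_lt pe').
    by apply: filterS2 => t h h'; rewrite phi1// ltW.
  have h2 : - li + 2 * eta * (2 * dot (p0 - ci) (- nu)) <= 0.
    apply: Wslope sli (@slope_nsq ci p0 (- nu)) _ _; first by rewrite phi0 ?pi.
    have := near_ray_in ri0 pi.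
    by apply: filterS => t h; rewrite phi0// ltW.
  rewrite dotN in h2; rewrite dot_normal// in h1 h2.
  have h3 : ke * (1 + K1) = ke + ki + ri^-1 by rewrite /K1; field; rewrite !gt_eqF.
  have h4 : ke * (lo + 2 * eta * ((1 + K1) * (2 * ri))) <= 0.
    by rewrite mulr_ge0_le0// ltW.
  have h5 : ki * (- li + 2 * eta * (2 * - ri)) <= 0 by rewrite mulr_ge0_le0// ltW.
  have h6 : ke * (2 * eta * ((1 + K1) * (2 * ri))) = 4 * eta * ri * ke + 4 * eta * ri * ki + 4 * eta.
    transitivity (4 * eta * ri * (ke * (1 + K1))); [ring|rewrite h3].
    by field; rewrite !gt_eqF.
  have h7 : 0 < eta * ri * ke by rewrite !mulr_gt0.
  lra.
have hw := wharm p0 pi pe.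
move: pi pe; rewrite !neq_lt => /orP[pi _|pi /orP[pe|pe]].
- have := Wlap _ _ hw (laplacian_nsq ci p0) _.
  suff h : \forall q \near p0, nsq ci q = phi q by move=> /(_ h); lra.
  by have := near_nsq_lt pi; apply: filterS => q h; rewrite phi0// ltW.
- have := Wlap _ _ hw lap1 _.
  suff h : \forall q \near p0, ph1 q = phi q by move=> /(_ h); lra.
  have := near_nsq_gt pi; have := near_nsq_lt pe.
  by apply: filterS2 => q h h'; rewrite phi1// ltW.
- have := Wlap _ _ hw lap2 _.
  suff h : \forall q \near p0, ph2 q = phi q by move=> /(_ h); lra.
  by have := near_nsq_gt pe; apply: filterS => q h; rewrite phi2// ltW.
Qed.

End MaximumPrinciple.

(** * Kernel sums *)

Section Kernel.
Variable R : realType.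
Implicit Types (w : R[i]) (r s t : R).

Definition kden w r : R := modc (1 + w * r%:C).
(** A substitute for [kden] that is affine and decreasing in r, which [kden] need not be; [kgap_den]
    shows that it is at most 3 times [kden]. *)
Definition kgap w r : R := modc (1 + w) + 1 - r.
Definition kG w r : R[i] := r%:C * (1 + w) ^+ 2 / (1 + w * r%:C) ^+ 2.
(** Increasing in r, with increments that dominate those of [kG] ([kG_diff]); total variations then
    telescope to at most its value 27 at r = 1. The constant is 3^3, from three uses of
    [kgap_den]. *)
Definition kPhi w r : R := 27 * modc (1 + w) ^+ 2 / kgap w r ^+ 2.

Lemma modc_1r r : modc (1 - r%:C) = `|1 - r|.
Proof. by rewrite -(rmorph1 (real_complex R)) -rmorphB modcR. Qed.

Lemma kden_ge w r : modc w <= 1 -> 0 <= r <= 1 -> 1 - r <= kden w r.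
Proof.
move=> w1 /andP[r0 r1]; have := modcB (1 + w * r%:C) (w * r%:C).
rewrite addrK modc1 -/(kden w r) modcM modcR ger0_norm//.
have : modc w * r <= 1 * r by rewrite ler_wpM2r.
lra.
Qed.

Lemma kden_half w r : modc w <= 1 -> 0 <= r <= 1 -> modc (1 + w) <= 2 * kden w r.
Proof.
move=> w1 r01; have h := kden_ge w1 r01; case/andP: r01 => r0 r1.
have -> : 1 + w = (1 + w * r%:C) + w * (1 - r%:C) by ring.
rewrite (le_trans (modcD _ _))// -/(kden w r) modcM modc_1r ger0_norm ?subr_ge0//.
have : modc w * (1 - r) <= 1 * (1 - r) by rewrite ler_wpM2r// subr_ge0.
lra.
Qed.

Lemma kgap_den w r : modc w <= 1 -> 0 <= r <= 1 -> kgap w r <= 3 * kden w r.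
Proof. by move=> w1 r01; have := kden_ge w1 r01; have := kden_half w1 r01; rewrite /kgap; lra. Qed.

Lemma w1_gt0 w : modc w < 1 -> 0 < modc (1 + w).
Proof.
move=> w1; have := modcB (1 + w) w; rewrite addrK modc1; lra.
Qed.

Lemma kgap_ge w r : r <= 1 -> modc (1 + w) <= kgap w r.
Proof. by rewrite /kgap; lra. Qed.

Lemma kgap_gt0 w r : modc w < 1 -> r <= 1 -> 0 < kgap w r.
Proof. by move=> w1 r1; rewrite (lt_le_trans (w1_gt0 w1))// kgap_ge. Qed.

Lemma kden_gt0 w r : modc w < 1 -> 0 <= r <= 1 -> 0 < kden w r.
Proof.
move=> w1 r01; have := kgap_den (ltW w1) r01.
have := kgap_gt0 w1 (proj2 (andP r01)); lra.
Qed.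

Lemma kden_neq0 w r : modc w < 1 -> 0 <= r <= 1 -> 1 + w * r%:C != 0.
Proof. by move=> w1 r01; rewrite -modc_gt0; exact: kden_gt0. Qed.

Lemma modc_kG w r : 0 <= r -> modc (kG w r) = r * modc (1 + w) ^+ 2 / kden w r ^+ 2.
Proof.
by move=> r0; rewrite /kG modcM modcV modcX modcM modcR ger0_norm// modcX.
Qed.

Lemma kG_le w r : modc w < 1 -> 0 <= r <= 1 -> modc (kG w r) <= 4 * r.
Proof.
move=> w1 r01; have d0 := kden_gt0 w1 r01; have h := kden_half (ltW w1) r01.
case/andP: r01 => r0 r1.
rewrite modc_kG// -mulrA mulrC ler_wpM2r// ler_pdivrMr ?exprn_gt0// [X in _ <= X](_ : _ = (2 * kden w r) ^+ 2).
  by rewrite lerXn2r ?nnegrE ?modc_ge0// mulr_ge0// ltW.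
by rewrite exprMn; congr (_ * _); ring.
Qed.

Lemma kPhi_ge0 w r : 0 <= kPhi w r.
Proof. by apply: divr_ge0; [apply: mulr_ge0 => //|]; exact: sqr_ge0. Qed.

Lemma kPhi_le w r : modc w < 1 -> r <= 1 -> kPhi w r <= 27.
Proof.
move=> w1 r1; rewrite ler_pdivrMr ?exprn_gt0 ?kgap_gt0// ler_wpM2l//.
by rewrite lerXn2r ?nnegrE ?modc_ge0 ?kgap_ge// ltW// kgap_gt0.
Qed.

(** The difference equals (r - s) (1 + w)^2 (1 - w^2 r s) / ((1 + w r)^2 (1 + w s)^2). Since 1 - w^2
    r s = (1 + w r) - w r (1 + w s), the numerator is at most the sum of the two denominators'
    moduli, which cancels one of the four factors. *)
Lemma kG_diff_gap w r s : modc w < 1 -> 0 <= s <= r -> r <= 1 ->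
  modc (kG w r - kG w s) <= 27 * modc (1 + w) ^+ 2 * (r - s) *
    ((kgap w r + kgap w s) / (kgap w r ^+ 2 * kgap w s ^+ 2)).
Proof.
move=> w1 /andP[s0 sr] r1.
have r01 : 0 <= r <= 1 by rewrite r1 (le_trans s0).
have s01 : 0 <= s <= 1 by rewrite s0 (le_trans sr).
have nr := kden_neq0 w1 r01; have ns := kden_neq0 w1 s01.
have dr := kden_gt0 w1 r01; have ds := kden_gt0 w1 s01.
have gr := kgap_gt0 w1 r1; have gs := kgap_gt0 w1 (proj2 (andP s01)).
have hr := kgap_den (ltW w1) r01; have hs := kgap_den (ltW w1) s01.
have -> : kG w r - kG w s = (r - s)%:C * (1 + w) ^+ 2 *
   (((1 + w * r%:C) - w * r%:C * (1 + w * s%:C)) /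
   ((1 + w * r%:C) ^+ 2 * (1 + w * s%:C) ^+ 2)).
  by rewrite /kG rmorphB /=; field; rewrite nr ns.
rewrite modcM modcM modcR modcX ger0_norm ?subr_ge0//.
rewrite -mulrA [leRHS](_ : _ = (r - s) * (modc (1 + w) ^+ 2 *
   (27 * ((kgap w r + kgap w s) / (kgap w r ^+ 2 * kgap w s ^+ 2))))); last by ring.
rewrite ler_wpM2l ?subr_ge0// ler_wpM2l ?sqr_ge0//.
rewrite modcM modcV [modc (_ ^+ 2 * _)]modcM !modcX -!/(kden _ _).
have num : modc (1 + w * r%:C - w * r%:C * (1 + w * s%:C)) <= kden w r + kden w s.
  rewrite (le_trans (modcB _ _))// lerD2l modcM ler_piMl ?modc_ge0//.
  rewrite modcM modcR ger0_norm; last by case/andP: r01.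
  by rewrite mulr_ile1 ?modc_ge0 ?(ltW w1)//; case/andP: r01.
apply: (@le_trans _ _ ((kden w r + kden w s) / (kden w r ^+ 2 * kden w s ^+ 2))).
  by rewrite ler_wpM2r// invr_ge0 mulr_ge0// sqr_ge0.
have E (x y : R) : 0 < x -> 0 < y -> (x + y) / (x ^+ 2 * y ^+ 2) = x^-1 * y^-1 ^+ 2 + x^-1 ^+ 2 * y^-1.
  by move=> x0 y0; field; rewrite !gt_eqF.
rewrite !E// mulrDr.
have ir : (kden w r)^-1 <= 3 * (kgap w r)^-1.
  by rewrite -[3]invrK -invfM lef_pV2 ?posrE ?mulr_gt0 ?invr_gt0// mulrC ler_pdivrMr// mulrC.
have is_ : (kden w s)^-1 <= 3 * (kgap w s)^-1.
  by rewrite -[3]invrK -invfM lef_pV2 ?posrE ?mulr_gt0 ?invr_gt0// mulrC ler_pdivrMr// mulrC.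
have u0 : 0 <= (kden w r)^-1 by rewrite invr_ge0 ltW.
have v0 : 0 <= (kden w s)^-1 by rewrite invr_ge0 ltW.
have U0 := le_trans u0 ir; have V0 := le_trans v0 is_.
apply: lerD.
  rewrite [leRHS](_ : _ = (3 * (kgap w r)^-1) * (3 * (kgap w s)^-1) ^+ 2); last by ring.
  by apply: ler_pM => //; [exact: sqr_ge0|rewrite lerXn2r ?nnegrE].
rewrite [leRHS](_ : _ = (3 * (kgap w r)^-1) ^+ 2 * (3 * (kgap w s)^-1)); last by ring.
by apply: ler_pM => //; [exact: sqr_ge0|rewrite lerXn2r ?nnegrE].
Qed.

(** As r - s = kgap s - kgap r, the bound of [kG_diff_gap] is exactly an increment of 27 |1 + w|^2 /
    kgap^2. *)
Lemma kG_diff w r s : modc w < 1 -> 0 <= s <= r -> r <= 1 ->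
  modc (kG w r - kG w s) <= kPhi w r - kPhi w s.
Proof.
move=> w1 sr r1; apply: le_trans (kG_diff_gap w1 sr r1) _.
have gr := kgap_gt0 w1 r1; have gs := kgap_gt0 w1 (le_trans (proj2 (andP sr)) r1).
have -> : r - s = kgap w s - kgap w r by rewrite /kgap; ring.
by rewrite /kPhi le_eqVlt; apply/orP; left; apply/eqP; field; rewrite !gt_eqF.
Qed.

Lemma kPhi_mono w r s : modc w < 1 -> 0 <= s <= r -> r <= 1 -> kPhi w s <= kPhi w r.
Proof. by move=> w1 sr r1; rewrite -subr_ge0 (le_trans (modc_ge0 _) (kG_diff w1 sr r1)). Qed.

(** In the variable -ln r the kernel moves by the relative change (t - s) / s, and the exponential
    factor makes the bound summable over the images. It serves to compare two contraction ratios in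
    [kG_step]. *)
Lemma kG_diff_log w s t : modc w < 1 -> 0 < s -> s <= t ->
  modc (kG w (expR (- s)) - kG w (expR (- t))) <= 108 * ((t - s) / s) * expR (- (s / 2)).
Proof.
move=> w1 s0 st.
set r := expR (- s); set r' := expR (- t).
have r1 : r < 1 by rewrite /r expR_lt1 oppr_lt0.
have rr : 0 <= r' <= r by rewrite expR_ge0 ler_expR lerN2.
apply: le_trans (kG_diff_gap w1 rr (ltW r1)) _.
have a0 := w1_gt0 w1.
have gr := kgap_gt0 w1 (ltW r1); have gs := kgap_gt0 w1 (le_trans (proj2 (andP rr)) (ltW r1)).
have ga := kgap_ge w (ltW r1).
have grs : kgap w r <= kgap w r' by rewrite /kgap; case/andP: rr; lra.
have g1 : 1 - r <= kgap w r by rewrite /kgap; lra.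
have r10 : 0 < 1 - r by rewrite subr_gt0.
have h1 : 27 * modc (1 + w) ^+ 2 * (r - r') * ((kgap w r + kgap w r') /
    (kgap w r ^+ 2 * kgap w r' ^+ 2)) <= 54 * (r - r') / (1 - r).
  have rr0 : 0 <= r - r' by rewrite subr_ge0; case/andP: rr.
  rewrite [leLHS](_ : _ = (r - r') * (27 * ((modc (1 + w) / kgap w r) ^+ 2 *
     ((kgap w r + kgap w r') / kgap w r' / kgap w r')))); last by field; rewrite !gt_eqF.
  rewrite [leRHS](_ : _ = (r - r') * (54 / (1 - r))); last by ring.
  apply: ler_wpM2l => //.
  have -> : 54 / (1 - r) = 27 * (1 * (2 / (1 - r))) by field; rewrite gt_eqF.
  rewrite ler_wpM2l//; apply: ler_pM; rewrite ?sqr_ge0//.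
  - apply: divr_ge0; last exact: ltW.
    by apply: divr_ge0; [apply: addr_ge0; exact: ltW|exact: ltW].
  - by rewrite expr_le1// ?divr_ge0 ?(ltW a0) ?(ltW gr)// ler_pdivrMr// mul1r.
  - apply: ler_pM.
    + by apply: divr_ge0; [apply: addr_ge0; exact: ltW|exact: ltW].
    + by rewrite invr_ge0 ltW.
    + by rewrite ler_pdivrMr//; lra.
    + by rewrite lef_pV2 ?posrE//; lra.
apply: le_trans h1 _.
have h2 : r - r' <= r * (t - s).
  have -> : r' = r * expR (- (t - s)) by rewrite /r /r' -expRD; congr expR; ring.
  rewrite -[X in X - _]mulr1 -mulrBr ler_wpM2l ?expR_ge0//.
  by have := expR_ge1Dx (- (t - s)); lra.
have e0 : 0 < expR (s / 2) by exact: expR_gt0.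
(* With e = e^(s / 2) the left side is 1 / ((e - 1) (e + 1)), where e - 1 >= s / 2 and e + 1 >=
   e. *)
have h3 : r / (1 - r) <= 2 / s * expR (- (s / 2)).
  have rE : r = (expR (s / 2) ^+ 2)^-1.
    by rewrite -expRM_natl -expRN; congr expR; field.
  rewrite expRN; set e := expR (s / 2) in e0 rE *.
  have e1 : 1 + s / 2 <= e by exact: expR_ge1Dx.
  have e1' : 1 < e by lra.
  have -> : r / (1 - r) = ((e - 1) * (e + 1))^-1.
    by rewrite rE; field; rewrite !gt_eqF//; nra.
  have -> : 2 / s * e^-1 = ((s / 2) * e)^-1 by field; rewrite !gt_eqF.
  rewrite lef_pV2 ?posrE; last 2 first.
  - by rewrite mulr_gt0; lra.
  - by rewrite mulr_gt0// divr_gt0.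
  by apply: ler_pM; lra.
apply: (@le_trans _ _ (54 * (t - s) * (r / (1 - r)))).
  rewrite -!mulrA ler_wpM2l// [(t - s) * _]mulrA ler_wpM2r ?invr_ge0 ?(ltW r10)//.
  by rewrite [leRHS]mulrC.
have -> : 108 * ((t - s) / s) * expR (- (s / 2)) = 54 * (t - s) * (2 / s * expR (- (s / 2))).
  by field; rewrite gt_eqF.
by rewrite ler_wpM2l// mulr_ge0// subr_ge0.
Qed.

End Kernel.

Section Sums.
Variable R : realType.
Implicit Types (w : R[i]) (rho tau : R) (N : nat).

Lemma geo_sum_le (x : R) N : 0 <= x < 1 -> \sum_(m < N) x ^+ m <= (1 - x)^-1.
Proof.
move=> /andP[x0 x1]; have x10 : 0 < 1 - x by rewrite subr_gt0.
rewrite -(ler_pM2r x10) mulVf ?gt_eqF//.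
have -> : (\sum_(m < N) x ^+ m) * (1 - x) = 1 - x ^+ N.
  elim: N => [|N IH]; first by rewrite big_ord0 mul0r expr0 subrr.
  by rewrite big_ord_recr /= mulrDl IH exprS; ring.
by rewrite gerBl exprn_ge0.
Qed.

Lemma telescope_ord (f : nat -> R) N : \sum_(m < N) (f m - f m.+1) = f 0%N - f N.
Proof.
elim: N => [|N IH]; first by rewrite big_ord0 subrr.
by rewrite big_ord_recr /= IH; ring.
Qed.

Lemma rhoX01 rho m : 0 <= rho <= 1 -> 0 <= rho ^+ m <= 1.
Proof. by move=> /andP[r0 r1]; rewrite exprn_ge0// exprn_ile1. Qed.

Lemma rhoXS rho m : 0 <= rho <= 1 -> 0 <= rho ^+ m.+1 <= rho ^+ m.
Proof. by move=> /andP[r0 r1]; rewrite exprn_ge0// exprS ler_piMl// exprn_ge0. Qed.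

Lemma kG_tv w rho N : modc w < 1 -> 0 <= rho <= 1 ->
  \sum_(m < N) modc (kG w (rho ^+ m) - kG w (rho ^+ m.+1)) <= 27.
Proof.
move=> w1 r01; apply: (@le_trans _ _ (\sum_(m < N) (kPhi w (rho ^+ m) - kPhi w (rho ^+ m.+1)))).
  apply: ler_sum => m _; apply: kG_diff => //; first exact: rhoXS.
  by have /andP[] := rhoX01 m r01.
rewrite (telescope_ord (fun m => kPhi w (rho ^+ m))) expr0.
have := kPhi_ge0 w (rho ^+ N); have := kPhi_le w1 (lexx 1); lra.
Qed.

(** Each k rho^m lies in [rho^(m + 1), rho^m]; these intervals do not overlap, so a single total
    variation pays for all terms. This treats the reflected images, whose offset k is not a power of
    rho. *)
Lemma kG_tv_shift w rho k N : modc w < 1 -> 0 <= rho <= 1 -> rho <= k <= 1 ->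
  \sum_(m < N) modc (kG w (rho ^+ m) - kG w (k * rho ^+ m)) <= 27.
Proof.
move=> w1 r01 /andP[rk k1]; have k0 : 0 <= k by apply: le_trans rk; case/andP: r01.
apply: (@le_trans _ _ (\sum_(m < N) (kPhi w (rho ^+ m) - kPhi w (rho ^+ m.+1)))).
  apply: ler_sum => m _; have /andP[m0 m1] := rhoX01 m r01.
  have h : 0 <= k * rho ^+ m <= rho ^+ m by rewrite mulr_ge0// ler_piMl.
  apply: le_trans (kG_diff w1 h m1) _; rewrite lerB//; apply: kPhi_mono => //.
    by rewrite exprn_ge0 ?exprS ?ler_wpM2r//; case/andP: r01.
  by rewrite mulr_ile1.
rewrite (telescope_ord (fun m => kPhi w (rho ^+ m))) expr0.
have := kPhi_ge0 w (rho ^+ N); have := kPhi_le w1 (lexx 1); lra.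
Qed.

(* Abel summation; the partial sums of tau^m stay in [0, 1] for tau <= 0. *)
Lemma alternating_sum (g : nat -> R[i]) tau N : -1 < tau <= 0 ->
  modc (\sum_(m < N) (tau ^+ m)%:C * g m) <=
    modc (g N) + \sum_(m < N) modc (g m - g m.+1).
Proof.
move=> /andP[t1 t0]; pose s n : R := \sum_(m < n) tau ^+ m.
have sS n : s n.+1 = s n + tau ^+ n by rewrite /s big_ord_recr.
have s01 n : 0 <= s n <= 1.
  have E : s n * (1 - tau) = 1 - tau ^+ n.
    elim: n => [|n IH]; first by rewrite /s big_ord0 mul0r expr0 subrr.
    by rewrite sS mulrDl IH exprS; ring.
  have t10 : 0 < 1 - tau by lra.
  case: n E => [|n] E; first by rewrite /s big_ord0 lexx ler01.
  have tn : `|tau ^+ n| <= 1 by rewrite normrX exprn_ile1// ler_norml; lra.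
  have h : tau <= tau ^+ n.+1 <= 1.
    rewrite exprS; move: tn; rewrite ler_norml => /andP[h1 h2]; apply/andP; split; last by nra.
    nra.
  apply/andP; split.
    by rewrite -(pmulr_lge0 _ t10) E; lra.
  by rewrite -(ler_pM2r t10) E; lra.
have H : modc (\sum_(m < N) (tau ^+ m)%:C * g m - (s N)%:C * g N) <=
    \sum_(m < N) modc (g m - g m.+1).
  elim: N => [|n IH]; first by rewrite !big_ord0 /s big_ord0 mul0r subrr modc0.
  rewrite !big_ord_recr /=.
  have -> : \sum_(m < n) (tau ^+ m)%:C * g m + (tau ^+ n)%:C * g n - (s n.+1)%:C * g n.+1 =
    (\sum_(m < n) (tau ^+ m)%:C * g m - (s n)%:C * g n) + (s n.+1)%:C * (g n - g n.+1).
    by rewrite sS rmorphD /=; ring.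
  rewrite (le_trans (modcD _ _))// lerD// modcM modcR ler_piMl ?modc_ge0//.
  by have /andP[h1 h2] := s01 n.+1; rewrite ger0_norm.
have -> : \sum_(m < N) (tau ^+ m)%:C * g m = (s N)%:C * g N +
   (\sum_(m < N) (tau ^+ m)%:C * g m - (s N)%:C * g N) by ring.
rewrite (le_trans (modcD _ _))// lerD// modcM modcR ler_piMl ?modc_ge0//.
by have /andP[h1 h2] := s01 N; rewrite ger0_norm.
Qed.

Lemma kG_alternating w rho tau N : modc w < 1 -> 0 <= rho <= 1 -> -1 < tau <= 0 ->
  modc (\sum_(m < N) (tau ^+ m)%:C * kG w (rho ^+ m)) <= 31.
Proof.
move=> w1 r01 t; apply: le_trans (alternating_sum (fun m => kG w (rho ^+ m)) N t) _.
have := kG_tv N w1 r01; have := kG_le w1 (rhoX01 N r01).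
have /andP[] := rhoX01 N r01; lra.
Qed.

Lemma kG_absolute w rho tau N : modc w < 1 -> 0 <= rho <= 1 -> `|tau| < 1 ->
  modc (\sum_(m < N) (tau ^+ m)%:C * kG w (rho ^+ m)) <= 4 / (1 - `|tau|).
Proof.
move=> w1 r01 t; rewrite (le_trans (modc_sum _))//.
apply: (@le_trans _ _ (\sum_(m < N) 4 * `|tau| ^+ m)).
  apply: ler_sum => m _; rewrite modcM modcR normrX mulrC ler_wpM2r ?exprn_ge0//.
  have := kG_le w1 (rhoX01 m r01); have /andP[] := rhoX01 m r01; lra.
by rewrite -mulr_sumr ler_wpM2l// geo_sum_le// normr_ge0.
Qed.

(** This bounds the error of freezing grad H at the origin: the m-th image point has modulus at most
    2 alpha / kden ([modc_Mt]). Multiplied by alpha, both terms on the right become O(1). *)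
Lemma kG_second_order w rho N : modc w < 1 -> 0 < rho < 1 ->
  \sum_(m < N) modc (kG w (rho ^+ m)) / kden w (rho ^+ m) <=
    27 * ((modc (1 + w))^-1 + (1 - rho)^-1).
Proof.
move=> w1 /andP[r0 r1]; have r01 : 0 <= rho <= 1 by rewrite !ltW.
have a0 := w1_gt0 w1; set a := modc (1 + w) in a0 *.
pose A m := kgap w (rho ^+ m).
have A0 m : 0 < A m by apply: kgap_gt0 => //; case/andP: (rhoX01 m r01).
have Aa m : a <= A m by apply: kgap_ge; case/andP: (rhoX01 m r01).
have AS m : A m <= A m.+1 by rewrite /A /kgap; case/andP: (rhoXS m r01); lra.
have T m : modc (kG w (rho ^+ m)) / kden w (rho ^+ m) <= 27 * (a ^+ 2 * rho ^+ m / A m ^+ 3).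
  have rm := rhoX01 m r01.
  have d0 := kden_gt0 w1 rm; have h := kgap_den (ltW w1) rm.
  rewrite modc_kG; last by case/andP: rm.
  rewrite -/a [leLHS](_ : _ = (a ^+ 2 * rho ^+ m) * (kden w (rho ^+ m) ^+ 3)^-1); last first.
    by field; rewrite gt_eqF.
  rewrite [leRHS](_ : _ = (a ^+ 2 * rho ^+ m) * (27 / A m ^+ 3)); last by ring.
  apply: ler_wpM2l; first by apply: mulr_ge0; [exact: sqr_ge0|case/andP: rm].
  rewrite -[27 / _]invrK lef_pV2 ?posrE ?invr_gt0 ?divr_gt0 ?exprn_gt0//.
  rewrite [leLHS](_ : _ = (A m / 3) ^+ 3); last by field; rewrite gt_eqF.
  by rewrite lerXn2r ?nnegrE ?divr_ge0 ?(ltW d0) ?(ltW (A0 m))// ler_pdivrMr// mulrC.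
apply: (@le_trans _ _ (\sum_(m < N) 27 * (a ^+ 2 * rho ^+ m / A m ^+ 3))).
  by apply: ler_sum => m _; exact: T.
rewrite -mulr_sumr ler_wpM2l//.
case: N => [|N]; first by rewrite big_ord0 addr_ge0 ?invr_ge0 ?ltW// subr_gt0.
rewrite big_ord_recl /= expr0 mulr1; apply: lerD.
  by rewrite /A expr0 /kgap addrK -/a; rewrite le_eqVlt; apply/orP; left; apply/eqP; field; rewrite gt_eqF.
have r10 : 0 < 1 - rho by rewrite subr_gt0.
(* Since A (m + 1) - A m = rho^m (1 - rho), each remaining term is dominated by a decrement of 1 /
   A. The term m = 0 was split off because no decrement precedes it. *)
apply: (@le_trans _ _ (\sum_(m < N) (a / (1 - rho)) * ((A m)^-1 - (A m.+1)^-1))).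
  apply: ler_sum => m _; rewrite /bump leq0n add1n.
  set x := A m; set y := A m.+1.
  have x0 : 0 < x by exact: A0.
  have y0 : 0 < y by exact: A0.
  have xy : x <= y by exact: AS.
  have yx : y - x = rho ^+ m * (1 - rho) by rewrite /x /y /A /kgap exprS; ring.
  have -> : a / (1 - rho) * (x^-1 - y^-1) = a * (rho ^+ m / (x * y)).
    have -> : x^-1 - y^-1 = (y - x) / (x * y) by field; rewrite !gt_eqF.
    by rewrite yx; field; rewrite !gt_eqF.
  rewrite expr2 -!mulrA ler_wpM2l ?(ltW a0)//.
  have -> : a * (rho ^+ m.+1 * (y ^+ 3)^-1) = rho ^+ m.+1 * (a / y) * (y ^- 2).
    by rewrite -exprVn; field; rewrite gt_eqF.
  have /andP[q0 q1] := rhoXS m r01.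
  apply: ler_pM; rewrite ?mulr_ge0 ?divr_ge0 ?invr_ge0 ?exprn_ge0 ?(ltW a0) ?(ltW y0) ?(ltW r0)//.
    by rewrite -[leRHS]mulr1 ler_pM ?divr_ge0 ?(ltW a0) ?(ltW y0)// ler_pdivrMr// mul1r; exact: Aa.
  by rewrite lef_pV2 ?posrE ?mulr_gt0 ?exprn_gt0// expr2 ler_wpM2r// ltW.
rewrite -mulr_sumr (telescope_ord (fun m => (A m)^-1)).
rewrite {1}/A expr0 /kgap addrK -/a.
rewrite [leLHS](_ : _ = (1 - rho)^-1 * (1 - a / A N)); last by field; rewrite !gt_eqF.
rewrite -[leRHS]mulr1 ler_wpM2l ?invr_ge0 ?(ltW r10)//.
by rewrite gerBl divr_ge0 ?ltW.
Qed.

End Sums.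

(** * The integrals L and P *)

Section ExponentialIntegrals.
Variable R : realType.
Local Notation mu := (@lebesgue_measure R).
Local Notation D0 := (`[(0 : R), +oo[%classic).
Implicit Types (f g : R -> R).

Lemma cvg_expRN (a : R) : (fun x : R => - expR (- x)) x @[x --> a] --> - expR (- a).
Proof.
apply: cvgN; apply: (@continuous_comp _ _ _ (fun x : R => - x) (@expR R)).
  by apply: cvgN; exact: cvg_id.
exact: continuous_expR.
Qed.

Lemma Rintegral_expRN (a : R) : \int[mu]_(t in `[a, +oo[) expR (- t) = expR (- a).
Proof.
rewrite (@Rintegral_ge0_continuous_FTC2y _ _ (fun x => - expR (- x)) a 0).
- by rewrite sub0r opprK.
- by move=> x _; exact: expR_ge0.
- apply: continuous_subspaceT => x; apply: (@continuous_comp _ _ _ (fun x : R => - x) (@expR R)).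
    by apply: cvgN; exact: cvg_id.
  exact: continuous_expR.
- by rewrite -oppr0; apply: cvgN; exact: cvgr_expR.
- move=> x _; apply: derivableN; apply: (@diff_derivable _ _ _ (expR \o -%R)).
  apply: differentiable_comp; first exact: differentiableN.
  by apply/derivable1_diffP; exact: derivable_expR.
- by apply: cvg_at_right_filter; exact: cvg_expRN.
- move=> x _; rewrite derive1E; apply: derive_val.
  have h : is_derive x 1 (fun x : R => - x) (-1) by exact: is_deriveNid.
  have h1 := @is_derive1_comp R (@expR R) (fun x => - x) x _ _ (is_derive_expR (- x)) h.
  by have := is_deriveN h1; rewrite mulrN1 opprK.
Qed.

Lemma integrable_expRN : mu.-integrable D0 (EFin \o (fun t => expR (- t))).
Proof.
have h := @integrable_exponential_pdf R 1 ltr01.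
have h2 : mu.-integrable D0 (EFin \o exponential_pdf (1 : R)).
  exact: integrableS h.
apply: eq_integrable h2 => //= t; rewrite inE /= in_itv /= andbT => t0.
by rewrite /= exponential_pdfE// mul1r mulN1r.
Qed.

Lemma integrable_scaled (K : R) f (D : set R) : measurable D ->
  mu.-integrable D (EFin \o f) -> mu.-integrable D (EFin \o (fun t => K * f t)).
Proof.
move=> mD fi; have : mu.-integrable D (fun t => K%:E * (EFin \o f) t)%E.
  by apply: integrableZl => //.
exact: eq_integrable.
Qed.

Lemma integrable_sub f (D E : set R) : measurable D -> measurable E ->
  D `<=` E -> mu.-integrable E (EFin \o f) -> mu.-integrable D (EFin \o f).
Proof. by move=> mD mE DE; apply: integrableS. Qed.

Lemma integrable_subr f g (D : set R) : measurable D ->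
  mu.-integrable D (EFin \o f) -> mu.-integrable D (EFin \o g) ->
  mu.-integrable D (EFin \o (fun t => f t - g t)).
Proof.
move=> mD fi gi; have : mu.-integrable D ((EFin \o f) \- (EFin \o g))%E.
  exact: integrableB.
exact: eq_integrable.
Qed.

Lemma integrable_normr f (D : set R) : measurable D ->
  mu.-integrable D (EFin \o f) -> mu.-integrable D (EFin \o (fun t => `|f t|)).
Proof.
move=> mD fi; have : mu.-integrable D (abse \o (EFin \o f)) by exact: integrable_abse.
exact: eq_integrable.
Qed.

Lemma Rintegral_subr f g (D : set R) : measurable D ->
  mu.-integrable D (EFin \o f) -> mu.-integrable D (EFin \o g) ->
  \int[mu]_(t in D) (f t - g t) = \int[mu]_(t in D) f t - \int[mu]_(t in D) g t.
Proof. by move=> mD fi gi; exact: RintegralB. Qed.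

Lemma Rintegral_addr f g (D : set R) : measurable D ->
  mu.-integrable D (EFin \o f) -> mu.-integrable D (EFin \o g) ->
  \int[mu]_(t in D) (f t + g t) = \int[mu]_(t in D) f t + \int[mu]_(t in D) g t.
Proof. by move=> mD fi gi; exact: RintegralD. Qed.

Lemma Rintegral_mull f (k : R) (D : set R) : measurable D ->
  mu.-integrable D (EFin \o f) ->
  \int[mu]_(t in D) (k * f t) = k * \int[mu]_(t in D) f t.
Proof. by move=> mD fi; exact: RintegralZl. Qed.

Lemma Rintegral_norm_le f g (D : set R) : measurable D ->
  mu.-integrable D (EFin \o f) -> mu.-integrable D (EFin \o g) ->
  (forall t, D t -> `|f t| <= g t) -> `|\int[mu]_(t in D) f t| <= \int[mu]_(t in D) g t.
Proof.
move=> mD fi gi fg; apply: (@le_trans _ _ (\int[mu]_(t in D) `|f t|)).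
  exact: le_normr_Rintegral.
by apply: le_Rintegral => //; exact: integrable_normr.
Qed.

Definition dominated (K : R) f :=
  measurable_fun D0 f /\ forall t, 0 <= t -> `|f t| <= K * expR (- t).

Lemma dominated_integrable K f : dominated K f -> mu.-integrable D0 (EFin \o f).
Proof.
move=> [mf fK]; apply: (@le_integrable _ _ _ mu D0 _ _ (EFin \o (fun t => K * expR (- t)))) => //=.
- exact/measurable_EFinP.
- move=> t; rewrite /= in_itv /= andbT => t0; rewrite lee_fin (le_trans (fK t t0))//.
  exact: ler_norm.
- exact: integrable_scaled integrable_expRN.
Qed.

Lemma dominated_tail K f a : dominated K f -> 0 <= a ->
  `|\int[mu]_(t in `[a, +oo[) f t| <= K * expR (- a).
Proof.
move=> fK a0; have aD : `[a, +oo[%classic `<=` D0.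
  by move=> t /=; rewrite !in_itv /= !andbT; exact: le_trans.
have fi : mu.-integrable `[a, +oo[ (EFin \o f).
  exact: integrable_sub (measurable_itv _) (measurable_itv _) aD (dominated_integrable fK).
have ei : mu.-integrable `[a, +oo[ (EFin \o (fun t => expR (- t))).
  exact: integrable_sub (measurable_itv _) (measurable_itv _) aD integrable_expRN.
have Kei : mu.-integrable `[a, +oo[ (EFin \o (fun t => K * expR (- t))).
  exact: integrable_scaled (measurable_itv _) ei.
rewrite -Rintegral_expRN -RintegralZl; [|exact: measurable_itv|exact: ei].
apply: (Rintegral_norm_le (measurable_itv _) fi Kei).
move=> t; rewrite /= in_itv /= andbT => at_.
by apply: (proj2 fK); exact: le_trans at_.
Qed.

(** Only the total of the oscillations v m enters, so an integrand of bounded variation is summed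
    with error O(c), however steep it is on a single cell. *)
Lemma riemann_sum K f (c : R) (a v : nat -> R) N : dominated K f -> 0 < c ->
  (forall (m : nat) t, (m < N)%N -> m%:R * c <= t -> t <= m.+1%:R * c -> `|f t - a m| <= v m) ->
  `|\int[mu]_(t in D0) f t - c * \sum_(m < N) a m| <=
    c * \sum_(m < N) v m + K * expR (- (N%:R * c)).
Proof.
move=> fK c0 H; have fi := dominated_integrable fK.
have N0 (n : nat) : 0 <= n%:R * c by rewrite mulr_ge0// ltW.
have sub (x y : itv_bound R) : (BLeft 0 <= x)%O -> [set` Interval x y] `<=` D0.
  move=> h t /=; rewrite !itv_boundlr /= => /andP[xt _].
  by rewrite (le_trans h xt) .
have fiS (x y : itv_bound R) : (BLeft 0 <= x)%O -> mu.-integrable [set` Interval x y] (EFin \o f).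
  by move=> h; exact: integrable_sub (measurable_itv _) (measurable_itv _) (sub x y h) fi.
have split0 (x y : R) (b : itv_bound R) : 0 <= x -> x <= y -> (BLeft y <= b)%O ->
  \int[mu]_(t in [set` Interval (BLeft x) b]) f t =
  \int[mu]_(t in `[x, y[) f t + \int[mu]_(t in [set` Interval (BLeft y) b]) f t.
  move=> x0 xy yb.
  rewrite (@itv_bndbnd_setU _ _ _ (BLeft y)) ?bnd_simp// Rintegral_setU//.
    by rewrite -itv_bndbnd_setU ?bnd_simp//; apply: fiS; rewrite bnd_simp.
  apply/disj_setPS => t [] /=; rewrite !itv_boundlr /= => /andP[_ ty] /andP[yt _].
  by move: ty yt; rewrite !bnd_simp => ty; rewrite leNgt ty.
have P n : (n <= N)%N -> `|\int[mu]_(t in `[0, n%:R * c[) f t - c * \sum_(m < n) a m| <= c * \sum_(m < n) v m.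
  elim: n => [_|n IH nN].
    by rewrite mul0r !big_ord0 mulr0 set_itvco0 Rintegral_set0 subrr normr0.
  rewrite (split0 0 (n%:R * c)) ?bnd_simp ?ler_wpM2r ?ler_nat ?(ltW c0)//.
  rewrite !big_ord_recr /= !mulrDr opprD addrACA (le_trans (ler_normD _ _))// lerD ?IH ?(ltnW nN)//.
  set D := `[_, _[%classic.
  have mD : mu D = c%:E.
    rewrite /D lebesgue_measure_itv /= lte_fin ltr_pM2r// ltr_nat ltnSn -EFinB.
    by congr EFin; rewrite -natr1; ring.
  have aE (k : R) : \int[mu]_(t in D) k = c * k.
    have mDm : measurable D by exact: measurable_itv.
    have h := @Rintegral_cst _ _ _ mu D mDm k.
    transitivity (k * fine (mu D)); first exact: h.
    by rewrite mD /= mulrC.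
  have ki (k : R) : mu.-integrable D (EFin \o (fun=> k)).
    have mDm : measurable D by exact: measurable_itv.
    apply/integrableP; split; first exact/measurable_EFinP/measurable_cst.
    have h := @integral_cst _ _ _ mu D mDm `|k|%:E.
    have h2 : (\int[mu]_(x in D) `|k|%:E = `|k|%:E * mu D)%E by exact: h.
    by apply: (@le_lt_trans _ _ (`|k|%:E * mu D)%E); [rewrite -h2|rewrite mD -EFinM ltry].
  have fD : mu.-integrable D (EFin \o f) by apply: fiS; rewrite bnd_simp.
  have mDm : measurable D by exact: measurable_itv.
  have fa := integrable_subr (measurable_itv _) fD (ki (a n)).
  rewrite -aE -(Rintegral_subr (measurable_itv _) fD (ki (a n))) -aE.
  apply: (Rintegral_norm_le (measurable_itv _) fa (ki (v n))).
  move=> t; rewrite /D /= in_itv /= => /andP[t1 t2].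
  exact: H nN t1 (ltW t2).
rewrite (split0 0 (N%:R * c))// addrAC (le_trans (ler_normD _ _))// lerD//.
  exact: P.
exact: dominated_tail.
Qed.

End ExponentialIntegrals.

(** * Complex-valued integrals dominated by e^-t *)

Section ComplexIntegrals.
Variable R : realType.
Local Notation mu := (@lebesgue_measure R).
Local Notation D0 := (`[(0 : R), +oo[%classic).
Implicit Types (g : R -> R[i]) (z w h : R[i]).

Definition cdominated (K : R) g := [/\ measurable_fun D0 (fun t => complex.Re (g t)),
  measurable_fun D0 (fun t => complex.Im (g t)) &
  forall t, 0 <= t -> modc (g t) <= K * expR (- t)].

Lemma cdominated_Re K g : cdominated K g -> dominated K (fun t => complex.Re (g t)).
Proof. by move=> [m1 m2 H]; split => // t t0; rewrite (le_trans (Re_le_modc _))// H. Qed.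

Lemma cdominated_Im K g : cdominated K g -> dominated K (fun t => complex.Im (g t)).
Proof. by move=> [m1 m2 H]; split => // t t0; rewrite (le_trans (Im_le_modc _))// H. Qed.

Lemma eq_Cint g g' : (forall t, 0 <= t -> g t = g' t) -> Cint g = Cint g'.
Proof.
move=> gg; rewrite /Cint; congr Complex; apply: eq_Rintegral => t;
  by rewrite inE /= in_itv /= andbT => /gg ->.
Qed.

Lemma Cint_le K g : cdominated K g -> modc (Cint g) <= 2 * K.
Proof.
move=> gK; rewrite (le_trans (modc_le_ReIm _))//= mulrDl mul1r.
by apply: lerD; rewrite -[leRHS]mulr1 -[X in K * X]expR0 -[X in expR X]oppr0;
  [apply: dominated_tail (cdominated_Re gK) _|apply: dominated_tail (cdominated_Im gK) _].
Qed.

Lemma CintD K K' g g' : cdominated K g -> cdominated K' g' ->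
  Cint (fun t => g t + g' t) = Cint g + Cint g'.
Proof.
move=> gK gK'; rewrite /Cint; simpc.
have h1 := dominated_integrable (cdominated_Re gK).
have h2 := dominated_integrable (cdominated_Im gK).
have h3 := dominated_integrable (cdominated_Re gK').
have h4 := dominated_integrable (cdominated_Im gK').
rewrite -(Rintegral_addr (measurable_itv _) h1 h3) -(Rintegral_addr (measurable_itv _) h2 h4).
by congr Complex; apply: eq_Rintegral => t _; rewrite ?ReD ?ImD.
Qed.

Lemma CintZ K g z : cdominated K g -> Cint (fun t => z * g t) = z * Cint g.
Proof.
move=> gK; rewrite /Cint.
have h1 := dominated_integrable (cdominated_Re gK).
have h2 := dominated_integrable (cdominated_Im gK).
have Zi (k : R) (f : R -> R) : mu.-integrable D0 (EFin \o f) -> mu.-integrable D0 (EFin \o (fun t => k * f t)).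
  by move=> fi; exact: integrable_scaled (measurable_itv _) fi.
apply/eqP; rewrite eq_complex ReM ImM /=; apply/andP; split; apply/eqP.
  rewrite -(Rintegral_mull _ (measurable_itv _) h1) -(Rintegral_mull _ (measurable_itv _) h2).
  rewrite -(Rintegral_subr (measurable_itv _) (Zi _ _ h1) (Zi _ _ h2)).
  by apply: eq_Rintegral => t _; rewrite ReM.
rewrite -(Rintegral_mull _ (measurable_itv _) h1) -(Rintegral_mull _ (measurable_itv _) h2).
rewrite -(Rintegral_addr (measurable_itv _) (Zi _ _ h2) (Zi _ _ h1)).
by apply: eq_Rintegral => t _; rewrite ImM.
Qed.

Lemma cdominatedD K K' g g' : cdominated K g -> cdominated K' g' ->
  cdominated (K + K') (fun t => g t + g' t).
Proof.
move=> [m1 m2 H] [m1' m2' H']; split.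
- have -> : (fun t => complex.Re (g t + g' t)) = (fun t => complex.Re (g t) + complex.Re (g' t)).
    by apply/funext => t; rewrite ReD.
  exact: measurable_funD.
- have -> : (fun t => complex.Im (g t + g' t)) = (fun t => complex.Im (g t) + complex.Im (g' t)).
    by apply/funext => t; rewrite ImD.
  exact: measurable_funD.
- move=> t t0; rewrite (le_trans (modcD _ _))// mulrDl; apply: lerD; [exact: H|exact: H'].
Qed.

Lemma cdominatedZ K g z : cdominated K g -> cdominated (modc z * K) (fun t => z * g t).
Proof.
move=> [m1 m2 H]; have mc (k : R) : measurable_fun D0 (fun _ : R => k) by exact: measurable_cst.
split.
- have -> : (fun t => complex.Re (z * g t)) = (fun t => complex.Re z * complex.Re (g t) - complex.Im z * complex.Im (g t)).
    by apply/funext => t; rewrite ReM.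
  by apply: measurable_funB; exact: measurable_funM.
- have -> : (fun t => complex.Im (z * g t)) = (fun t => complex.Re z * complex.Im (g t) + complex.Im z * complex.Re (g t)).
    by apply/funext => t; rewrite ImM.
  by apply: measurable_funD; exact: measurable_funM.
- by move=> t t0; rewrite modcM -mulrA ler_wpM2l ?modc_ge0// H.
Qed.

Lemma cdominated_bound K K' g : cdominated K g ->
  (forall t, 0 <= t -> modc (g t) <= K' * expR (- t)) -> cdominated K' g.
Proof. by move=> [m1 m2 _] H; split. Qed.

(** Measurability comes from continuity in t, and that from complex differentiability of M at the
    real points of [0, 1]; the rules for [cder] thus serve for integrands too. *)
Lemma cdominated_kernel (beta K : R) (M : R[i] -> R[i]) : 0 <= beta -> 0 <= K ->
  (forall r : R, 0 <= r <= 1 -> exists l, cder M r%:C l) ->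
  (forall r : R, 0 <= r <= 1 -> modc (M r%:C) <= K * r) ->
  cdominated K (fun t => (expR (- (beta * t)))%:C * M (expR (- t))%:C).
Proof.
move=> beta0 K0 dM MK.
have e01 (t : R) : 0 <= t -> 0 <= expR (- t) <= 1.
  by move=> t0; rewrite expR_ge0 expR_le1 oppr_le0.
have ec (k t : R) : {for t, continuous (fun t : R => expR (- (k * t)))}.
  apply: (@continuous_comp _ _ _ (fun t : R => - (k * t)) (@expR R)); last exact: continuous_expR.
  by apply: cvgN; apply: cvgM; [exact: cvg_cst|exact: cvg_id].
have ec1 (t : R) : (fun t : R => (expR (- t), 0) : R * R) x @[x --> t] --> (expR (- t), 0 : R).
  have h : (fun t : R => expR (- t)) x @[x --> t] --> expR (- t).
    apply: (@continuous_comp _ _ _ (fun t : R => - t) (@expR R)); last exact: continuous_expR.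
    by apply: cvgN; exact: cvg_id.
  exact: cvg_pair h (cvg_cst _).
have mcont (f : R -> R) : (forall t, 0 <= t -> {for t, continuous f}) -> measurable_fun D0 f.
  move=> fc; apply: subspace_continuous_measurable_fun; first exact: measurable_itv.
  by apply: continuous_in_subspaceT => t; rewrite inE /= in_itv /= andbT => /fc.
split.
- have -> : (fun t => complex.Re ((expR (- (beta * t)))%:C * M (expR (- t))%:C)) =
    (fun t => expR (- (beta * t)) * complex.Re (M (expR (- t))%:C)).
    by apply/funext => t; rewrite ReRM.
  apply: mcont => t t0; apply: cvgM; first exact: ec.
  have [l Ml] := dM _ (e01 t t0).
  have := @is_cgrad_Re _ M (expR (- t), 0) l Ml => -[/differentiable_continuous h _].
  exact: (@continuous_comp _ _ _ (fun t : R => (expR (- t), 0) : R * R)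
     (fun q => complex.Re (M (toC q))) t (ec1 t) h).
- have -> : (fun t => complex.Im ((expR (- (beta * t)))%:C * M (expR (- t))%:C)) =
    (fun t => expR (- (beta * t)) * complex.Im (M (expR (- t))%:C)).
    by apply/funext => t; rewrite ImRM.
  apply: mcont => t t0; apply: cvgM; first exact: ec.
  have [l Ml] := dM _ (e01 t t0).
  have := @is_cgrad_Im _ M (expR (- t), 0) l Ml => -[/differentiable_continuous h _].
  exact: (@continuous_comp _ _ _ (fun t : R => (expR (- t), 0) : R * R)
     (fun q => complex.Im (M (toC q))) t (ec1 t) h).
- move=> t t0; rewrite modcM modcR ger0_norm ?expR_ge0//.
  rewrite -[leRHS]mul1r ler_pM ?modc_ge0 ?expR_ge0 ?MK ?e01//.
  by rewrite expR_le1 oppr_le0 mulr_ge0.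
Qed.

End ComplexIntegrals.

Section LDerivative.
Variable R : realType.
Implicit Types (beta : R) (z w h : R[i]).

(** Minus the z-derivative of [L_fun] ([cder_L]); [P_fun] is z times it ([P_funE]). *)
Definition J_fun z beta : R[i] :=
  Cint (fun t => (expR (- (beta * t)))%:C * ((expR (- t))%:C / (1 + z * (expR (- t))%:C) ^+ 2)).

Lemma modc1D_ge z (r : R) : 0 <= r <= 1 -> 1 - modc z <= modc (1 + z * r%:C).
Proof.
move=> /andP[r0 r1]; have := modcB (1 + z * r%:C) (z * r%:C).
rewrite addrK modc1 modcM modcR ger0_norm//.
have : modc z * r <= modc z * 1 by rewrite ler_wpM2l ?modc_ge0.
lra.
Qed.

Lemma den_neq0 z (r : R) : modc z < 1 -> 0 <= r <= 1 -> 1 + z * r%:C != 0.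
Proof. by move=> z1 r01; rewrite -modc_gt0 (lt_le_trans _ (modc1D_ge z r01))// subr_gt0. Qed.

Lemma cder_den z x : cder (fun r : R[i] => 1 + z * r) x z.
Proof.
have := cderD (cder_cst 1 x) (cderM (cder_cst z x) (cder_id x)).
by move/cder_eq; apply; rewrite mul0r !add0r mulr1.
Qed.

Lemma expR_betaD beta t : (expR (- ((beta + 1) * t)))%:C = (expR (- (beta * t)))%:C * (expR (- t))%:C :> R[i].
Proof. by rewrite -rmorphM -expRD /=; congr ((expR _)%:C); ring. Qed.

Lemma L_dominated z beta : modc z < 1 -> 0 <= beta ->
  cdominated (modc z / (1 - modc z)) (fun t => (expR (- (beta * t)))%:C *
    (z * (expR (- t))%:C / (1 + z * (expR (- t))%:C))).
Proof.
move=> z1 beta0; have z10 : 0 < 1 - modc z by rewrite subr_gt0.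
apply: (@cdominated_kernel R beta _ (fun r => z * r / (1 + z * r))) => //.
- by rewrite divr_ge0 ?modc_ge0// ltW.
- move=> r r01; eexists; apply: cderM; last first.
    by apply: cderV (cder_den _ _); exact: den_neq0.
  by apply: cderM; [exact: cder_cst|exact: cder_id].
- move=> r r01; have := modc1D_ge z r01; case/andP: r01 => r0 r1 H.
  rewrite !modcM modcV modcR ger0_norm// -!mulrA [_ * r]mulrC mulrA mulrA.
  by rewrite ler_wpM2l ?mulr_ge0 ?modc_ge0// lef_pV2 ?posrE// (lt_le_trans z10).
Qed.

Lemma J_dominated z beta : modc z < 1 -> 0 <= beta ->
  cdominated ((1 - modc z) ^- 2) (fun t => (expR (- (beta * t)))%:C *
    ((expR (- t))%:C / (1 + z * (expR (- t))%:C) ^+ 2)).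
Proof.
move=> z1 beta0; have z10 : 0 < 1 - modc z by rewrite subr_gt0.
apply: (@cdominated_kernel R beta _ (fun r => r / (1 + z * r) ^+ 2)) => //.
- by rewrite invr_ge0 sqr_ge0.
- move=> r r01; eexists; apply: cderM; first exact: cder_id.
  apply: cderV; first by rewrite expf_neq0// den_neq0.
  by apply: cderM; exact: cder_den.
- move=> r r01; have := modc1D_ge z r01; case/andP: r01 => r0 r1 H.
  rewrite modcM modcV modcR ger0_norm// mulrC ler_wpM2r// modcX.
  rewrite lef_pV2 ?posrE ?exprn_gt0//; last by rewrite (lt_le_trans z10).
  by rewrite lerXn2r ?nnegrE ?modc_ge0// ltW.
Qed.

Lemma L_funE z beta : L_fun z beta = - Cint (fun t => (expR (- (beta * t)))%:C *
    (z * (expR (- t))%:C / (1 + z * (expR (- t))%:C))).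
Proof.
rewrite /L_fun; congr (- _); apply: eq_Cint => t t0.
by rewrite expR_betaD; ring.
Qed.

Lemma P_funE z beta : modc z < 1 -> 0 <= beta -> P_fun z beta = z * J_fun z beta.
Proof.
move=> z1 beta0; rewrite /J_fun -(CintZ _ (J_dominated z1 beta0)).
by apply: eq_Cint => t t0; rewrite expR_betaD; ring.
Qed.

Lemma L_fun0 beta : L_fun 0 beta = 0.
Proof.
rewrite L_funE; apply/eqP; rewrite oppr_eq0; apply/eqP.
rewrite (@eq_Cint R _ (fun=> 0)); last by move=> t _; rewrite !mul0r mulr0.
by rewrite /Cint /= /Rintegral integral0.
Qed.

(* The second difference of z r / (1 + z r) is
   - h^2 r^2 / ((1 + z r)^2 (1 + (z + h) r)). *)
Lemma cder_L z beta : modc z < 1 -> 0 <= beta ->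
  cder (fun x => L_fun x beta) z (- J_fun z beta).
Proof.
move=> z1 beta0; set m := 1 - modc z; have m0 : 0 < m by rewrite subr_gt0.
apply: (@cderI _ _ _ _ (4 / m ^+ 3) (m / 2)); first by rewrite divr_gt0.
move=> h hm; have zh1 : modc (z + h) < 1.
  by rewrite (le_lt_trans (modcD _ _))//; rewrite /m in hm; lra.
have dL := L_dominated z1 beta0; have dL' := L_dominated zh1 beta0.
have dJ := J_dominated z1 beta0.
rewrite !L_funE.
have -> : - Cint (fun t => (expR (- (beta * t)))%:C * ((z + h) * (expR (- t))%:C /
    (1 + (z + h) * (expR (- t))%:C))) - - Cint (fun t => (expR (- (beta * t)))%:C *
    (z * (expR (- t))%:C / (1 + z * (expR (- t))%:C))) - - J_fun z beta * h =
  - (Cint (fun t => (expR (- (beta * t)))%:C * ((z + h) * (expR (- t))%:C /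
    (1 + (z + h) * (expR (- t))%:C))) + (-1 * Cint (fun t => (expR (- (beta * t)))%:C *
    (z * (expR (- t))%:C / (1 + z * (expR (- t))%:C))) + - h * J_fun z beta)) by ring.
have dL1 := cdominatedZ (-1) dL; have dJ1 := cdominatedZ (- h) dJ.
have dLJ := cdominatedD dL1 dJ1.
rewrite modcN -(CintZ _ dL) -(CintZ _ dJ) -(CintD dL1 dJ1) -(CintD dL' dLJ).
apply: le_trans (Cint_le (cdominated_bound (K' := 2 / m ^+ 3 * modc h ^+ 2) (cdominatedD dL' dLJ) _)) _; last first.
  by have -> : 4 / m ^+ 3 * modc h ^+ 2 = 2 * (2 / m ^+ 3 * modc h ^+ 2) by ring.
move=> t t0; set r := expR (- t).
have r01 : 0 <= r <= 1 by rewrite expR_ge0 expR_le1 oppr_le0.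
have nz := den_neq0 z1 r01; have nzh := den_neq0 zh1 r01.
have -> : (expR (- (beta * t)))%:C * ((z + h) * r%:C / (1 + (z + h) * r%:C)) +
   (-1 * ((expR (- (beta * t)))%:C * (z * r%:C / (1 + z * r%:C))) +
    - h * ((expR (- (beta * t)))%:C * (r%:C / (1 + z * r%:C) ^+ 2))) =
   (expR (- (beta * t)))%:C * (- (h ^+ 2 * r%:C ^+ 2) / ((1 + z * r%:C) ^+ 2 * (1 + (z + h) * r%:C))).
  by field; rewrite nz nzh.
have h1 := modc1D_ge z r01; have h2 := modc1D_ge (z + h) r01.
have h3 : m / 2 <= modc (1 + (z + h) * r%:C).
  by apply: le_trans h2; have := modcD z h; rewrite /m in hm *; lra.
case/andP: r01 => r0 r1.
rewrite modcM modcR ger0_norm ?expR_ge0// modcM modcN modcV [modc (h ^+ 2 * _)]modcM !modcX modcR (ger0_norm r0).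
rewrite [modc (_ ^+ 2 * _)]modcM modcX.
apply: (@le_trans _ _ (1 * (modc h ^+ 2 * r / (m ^+ 2 * (m / 2))))).
  apply: ler_pM; rewrite ?expR_ge0 ?mulr_ge0 ?invr_ge0 ?mulr_ge0 ?modc_ge0 ?sqr_ge0//.
    by rewrite expR_le1 oppr_le0 mulr_ge0.
  apply: ler_pM; rewrite ?mulr_ge0 ?invr_ge0 ?mulr_ge0 ?modc_ge0 ?sqr_ge0//.
    by rewrite ler_wpM2l ?sqr_ge0// expr2 ler_piMr.
  have m20 : 0 < m / 2 by rewrite divr_gt0.
  have a1 : 0 < modc (1 + z * r%:C) by rewrite modc_gt0.
  have a2 : 0 < modc (1 + (z + h) * r%:C) by rewrite modc_gt0.
  rewrite lef_pV2 ?posrE ?mulr_gt0 ?exprn_gt0//.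
  apply: ler_pM; rewrite ?sqr_ge0 ?(ltW m20)//.
  by rewrite lerXn2r ?nnegrE ?modc_ge0// ltW.
by rewrite le_eqVlt; apply/orP; left; apply/eqP; field; rewrite gt_eqF.
Qed.

End LDerivative.

(** * Kernel sums against the integral *)

Section KernelIntegral.
Variable R : realType.
Implicit Types (w : R[i]).

Lemma kG_dominated w (beta : R) : modc w < 1 -> 0 <= beta ->
  cdominated 4 (fun t => (expR (- (beta * t)))%:C * kG w (expR (- t))).
Proof.
move=> w1 beta0.
apply: (@cdominated_kernel R beta _ (fun r => r * (1 + w) ^+ 2 / (1 + w * r) ^+ 2)) => //.
- move=> r r01; eexists; apply: cderM.
    by apply: cderM; [exact: cder_id|exact: cder_cst].
  apply: cderV; first by rewrite expf_neq0// den_neq0.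
  by apply: cderM; exact: cder_den.
- by move=> r r01; exact: kG_le.
Qed.

Lemma kG_J w (beta : R) : modc w < 1 -> 0 <= beta ->
  Cint (fun t => (expR (- (beta * t)))%:C * kG w (expR (- t))) = (1 + w) ^+ 2 * J_fun w beta.
Proof.
move=> w1 beta0; rewrite /J_fun -(CintZ _ (J_dominated w1 beta0)).
by apply: eq_Cint => t t0; rewrite /kG; ring.
Qed.

(* The variation of e^(- beta t) kG w (e^-t) on [m c, (m + 1) c] is bounded by a
   telescoping quantity of total size 31, uniformly in beta and w. *)
Lemma kG_riemann w (beta c : R) N : modc w < 1 -> 0 <= beta -> 0 < c ->
  modc (c%:C * \sum_(m < N) (expR (- (beta * c)) ^+ m)%:C * kG w (expR (- c) ^+ m)
    - (1 + w) ^+ 2 * J_fun w beta) <= 2 * (31 * c + 4 * expR (- (N%:R * c))).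
Proof.
move=> w1 beta0 c0; rewrite -kG_J//.
pose g (t : R) := (expR (- (beta * t)))%:C * kG w (expR (- t)).
rewrite -/g.
pose a m := (expR (- (beta * c)) ^+ m)%:C * kG w (expR (- c) ^+ m).
pose e1 (m : nat) := 4 * expR (- (beta * (m%:R * c))).
pose e2 (m : nat) := kPhi w (expR (- (m%:R * c))).
pose v m := (e1 m - e1 m.+1) + (e2 m - e2 m.+1).
have gdom : cdominated 4 g := kG_dominated w1 beta0.
have e01 (t : R) : 0 <= t -> 0 <= expR (- t) <= 1.
  by move=> t0; rewrite expR_ge0 expR_le1 oppr_le0.
have mc0 (m : nat) : 0 <= m%:R * c by rewrite mulr_ge0// ltW.
have aE m : a m = (expR (- (beta * (m%:R * c))))%:C * kG w (expR (- (m%:R * c))).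
  by rewrite /a -!expRM_natl; congr ((expR _)%:C * kG w (expR _)); ring.
have H (m : nat) t : m%:R * c <= t -> t <= m.+1%:R * c -> modc (g t - a m) <= v m.
  move=> t1 t2; have t0 : 0 <= t := le_trans (mc0 m) t1.
  rewrite aE /g.
  have -> : (expR (- (beta * t)))%:C * kG w (expR (- t)) -
     (expR (- (beta * (m%:R * c))))%:C * kG w (expR (- (m%:R * c))) =
     (expR (- (beta * t)) - expR (- (beta * (m%:R * c))))%:C * kG w (expR (- t)) +
     (expR (- (beta * (m%:R * c))))%:C * (kG w (expR (- t)) - kG w (expR (- (m%:R * c)))).
    by rewrite rmorphB /=; ring.
  rewrite (le_trans (modcD _ _))// lerD// modcM modcR.
    rewrite ler0_norm; last by rewrite subr_le0 ler_expR lerN2 ler_wpM2l.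
    rewrite opprB /e1 -mulrBr [leRHS]mulrC; apply: ler_pM; rewrite ?modc_ge0//.
    - by rewrite subr_ge0 ler_expR lerN2 ler_wpM2l.
    - by rewrite lerB// ler_expR lerN2 ler_wpM2l.
    - by have := kG_le w1 (e01 t t0); have /andP[] := e01 t t0; lra.
  rewrite ger0_norm ?expR_ge0// modcBC.
  apply: le_trans (_ : kPhi w (expR (- (m%:R * c))) - kPhi w (expR (- t)) <= _).
    rewrite -[leRHS]mul1r; apply: ler_pM; rewrite ?expR_ge0 ?modc_ge0//.
      by rewrite expR_le1 oppr_le0 mulr_ge0.
    by apply: kG_diff => //; [rewrite expR_ge0 ler_expR lerN2|case/andP: (e01 _ (mc0 m))].
  rewrite /e2 lerB//; apply: kPhi_mono => //; last by case/andP: (e01 t t0).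
  by rewrite expR_ge0 ler_expR lerN2.
have V : \sum_(m < N) v m <= 31.
  rewrite big_split /= !telescope_ord /e1 /e2 !mul0r mulr0 !oppr0 expR0 mulr1.
  have := kPhi_ge0 w (expR (- (N%:R * c))); have := kPhi_le w1 (lexx 1).
  have := expR_ge0 (- (beta * (N%:R * c))); lra.
have cV : c * \sum_(m < N) v m <= 31 * c by rewrite mulrC ler_wpM2r// ltW.
rewrite modcBC.
have HR : `|complex.Re (Cint g) - c * \sum_(m < N) complex.Re (a m)| <= 31 * c + 4 * expR (- (N%:R * c)).
  have h (m : nat) t : (m < N)%N -> m%:R * c <= t -> t <= m.+1%:R * c ->
      `|complex.Re (g t) - complex.Re (a m)| <= v m.
    by move=> mN t1 t2; rewrite -ReB (le_trans (Re_le_modc _))//; exact: H.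
  have := @riemann_sum R 4 _ c (fun m => complex.Re (a m)) v N (cdominated_Re gdom) c0 h.
  by move=> /le_trans; apply; rewrite lerD2r.
have HI : `|complex.Im (Cint g) - c * \sum_(m < N) complex.Im (a m)| <= 31 * c + 4 * expR (- (N%:R * c)).
  have h (m : nat) t : (m < N)%N -> m%:R * c <= t -> t <= m.+1%:R * c ->
      `|complex.Im (g t) - complex.Im (a m)| <= v m.
    by move=> mN t1 t2; rewrite -ImB (le_trans (Im_le_modc _))//; exact: H.
  have := @riemann_sum R 4 _ c (fun m => complex.Im (a m)) v N (cdominated_Im gdom) c0 h.
  by move=> /le_trans; apply; rewrite lerD2r.
have sumRe : complex.Re (\sum_(m < N) a m) = \sum_(m < N) complex.Re (a m).
  by elim/big_rec2 : _ => // i y1 y2 _ <-; rewrite ReD.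
have sumIm : complex.Im (\sum_(m < N) a m) = \sum_(m < N) complex.Im (a m).
  by elim/big_rec2 : _ => // i y1 y2 _ <-; rewrite ImD.
rewrite (le_trans (modc_le_ReIm _))// ReB ImB ReRM ImRM sumRe sumIm.
by rewrite mulrDl mul1r lerD.
Qed.

(** The m-th terms differ by at most 108 |c - d| / mu times e^(- m mu / 2), and the exponentials sum
    to at most 4 / mu. Steps with |c - d| = O(mu^2) are therefore interchangeable up to O(1),
    uniformly in w and tau. *)
Lemma kG_step w (tau c d mu : R) N : modc w < 1 -> 0 <= tau <= 1 ->
  0 < mu <= 1 -> mu <= c -> mu <= d ->
  modc (\sum_(m < N) (tau ^+ m)%:C * kG w (expR (- c) ^+ m) -
        \sum_(m < N) (tau ^+ m)%:C * kG w (expR (- d) ^+ m)) <= 432 * `|c - d| / mu ^+ 2.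
Proof.
move=> w1 /andP[tau0 tau1] /andP[mu0 mu1] muc mud.
have c0 : 0 < c by exact: lt_le_trans muc.
have d0 : 0 < d by exact: lt_le_trans mud.
have T (m : nat) : modc (kG w (expR (- c) ^+ m) - kG w (expR (- d) ^+ m)) <=
    108 * (`|c - d| / mu) * expR (- (mu / 2)) ^+ m.
  case: m => [|m]; first by rewrite !expr0 subrr modc0 mulr1 mulr_ge0// divr_ge0// ltW.
  rewrite -!expRM_natl; set k : R := m.+1%:R; have k0 : 0 < k by rewrite /k ltr0n.
  have core (x y : R) : mu <= x -> x <= y -> modc (kG w (expR (k * - x)) - kG w (expR (k * - y))) <=
      108 * ((y - x) / mu) * expR (k * - (mu / 2)).
    move=> mux xy; have x0 : 0 < x by exact: lt_le_trans mux.
    rewrite !mulrN; apply: le_trans (kG_diff_log w1 _ _) _; rewrite ?mulr_gt0 ?ler_wpM2l ?(ltW k0)//.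
    have -> : (k * y - k * x) / (k * x) = (y - x) / x by field; rewrite !gt_eqF.
    apply: ler_pM; rewrite ?expR_ge0//.
    - by rewrite mulr_ge0// divr_ge0 ?subr_ge0// ltW.
    - by rewrite ler_wpM2l// ler_wpM2l ?subr_ge0// lef_pV2.
    - by rewrite ler_expR lerN2 -mulrA ler_wpM2l ?(ltW k0)// ler_wpM2r.
  have [cd|dc] := leP c d.
    by rewrite ler0_norm ?subr_le0// opprB core.
  by rewrite modcBC ger0_norm ?subr_ge0 ?core ?(ltW dc).
have -> : \sum_(m < N) (tau ^+ m)%:C * kG w (expR (- c) ^+ m) -
        \sum_(m < N) (tau ^+ m)%:C * kG w (expR (- d) ^+ m) =
  \sum_(m < N) (tau ^+ m)%:C * (kG w (expR (- c) ^+ m) - kG w (expR (- d) ^+ m)).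
  by rewrite -sumrB; apply: eq_bigr => i _; rewrite mulrBr.
rewrite (le_trans (modc_sum _))//.
have Cmu : 0 <= 108 * (`|c - d| / mu) by rewrite mulr_ge0// divr_ge0// ltW.
apply: (@le_trans _ _ (\sum_(m < N) 108 * (`|c - d| / mu) * expR (- (mu / 2)) ^+ m)).
  apply: ler_sum => m _; apply: le_trans (T m).
  rewrite modcM modcR ger0_norm ?exprn_ge0// ler_piMl ?modc_ge0//.
  exact: exprn_ile1.
rewrite -mulr_sumr.
have mu20 : 0 < mu / 2 by rewrite divr_gt0.
have E1 : expR (- (mu / 2)) < 1 by rewrite expR_lt1 oppr_lt0.
have S : \sum_(m < N) expR (- (mu / 2)) ^+ m <= 4 / mu.
  apply: le_trans (geo_sum_le _ _) _; first by rewrite expR_ge0.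
  have h : expR (- (mu / 2)) <= (1 + mu / 2)^-1.
    by rewrite expRN lef_pV2 ?posrE ?expR_gt0 ?expR_ge1Dx//; lra.
  have h2 : mu / 4 <= 1 - expR (- (mu / 2)).
    have : (1 + mu / 2)^-1 <= 1 - mu / 4.
      by rewrite -div1r ler_pdivrMr; nra.
    lra.
  rewrite -[4 / mu]invrK invf_div lef_pV2 ?posrE//; first by rewrite subr_gt0.
  by rewrite divr_gt0.
apply: le_trans (ler_wpM2l Cmu S) _.
by rewrite le_eqVlt; apply/orP; left; apply/eqP; field; rewrite gt_eqF.
Qed.

End KernelIntegral.

(** * Geometry of the disks *)

Definition geo (R : realType) (ri re eps : R) := [/\ 0 < ri, ri < re, 0 < eps & eps < re - ri].

Section Geometry.
Variables (R : realType) (ri re eps : R).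

Local Notation geo := (geo ri re eps).
Local Notation al := (alpha ri re eps).
Local Notation ci := (center_i ri re eps).
Local Notation ce := (center_e ri re eps).

(** e^(-2 xi_i), the squared radius of the inner circle in the coordinate w ([expR_xi_i],
    [wr_disk]), in the rational form that algebra can handle; [besq] is its analogue for the outer
    circle. *)
Definition asq : R := (ci - al) / (ci + al).
Definition besq : R := (ce - al) / (ce + al).

Lemma alpha_prod_gt0 : geo ->
  0 < eps * (2 * ri + eps) * (2 * re - eps) * (2 * re - 2 * ri - eps).
Proof. by case=> *; apply: mulr_gt0; [apply: mulr_gt0; [apply: mulr_gt0|]|]; lra. Qed.

Lemma alpha_gt0 : geo -> 0 < al.
Proof.
move=> g; have p := alpha_prod_gt0 g; case: g => *.
by rewrite divr_gt0 ?sqrtr_gt0// mulr_gt0//; lra.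
Qed.

Lemma alpha_sqr : geo -> al ^+ 2 =
  eps * (2 * ri + eps) * (2 * re - eps) * (2 * re - 2 * ri - eps) / (4 * (re - ri - eps) ^+ 2).
Proof.
move=> g; rewrite /alpha expr_div_n sqr_sqrtr ?(ltW (alpha_prod_gt0 g))//.
by congr (_ / _); ring.
Qed.

Lemma center_i_gt0 : geo -> 0 < ci.
Proof. by case=> *; rewrite divr_gt0// ?mulr_gt0//; nra. Qed.

Lemma center_e_gt0 : geo -> 0 < ce.
Proof. by move=> g; have := center_i_gt0 g; case: g => *; rewrite /center_e; lra. Qed.

(** That is (c - alpha) (c + alpha) = r^2: the poles +-alpha are inverse points for the circle. The
    same pair serves for both circles, which is what makes them concentric in w. *)
Lemma center_i_sqr : geo -> ci ^+ 2 = ri ^+ 2 + al ^+ 2.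
Proof. by move=> g; rewrite alpha_sqr// /center_i; case: g => *; field; lra. Qed.

Lemma center_e_sqr : geo -> ce ^+ 2 = re ^+ 2 + al ^+ 2.
Proof. by move=> g; rewrite alpha_sqr// /center_e /center_i; case: g => *; field; lra. Qed.

Lemma center_e_le : geo -> re <= ce <= re + al.
Proof.
move=> g; have h := center_e_sqr g; have a0 := alpha_gt0 g; have c0 := center_e_gt0 g.
by case: g => *; apply/andP; split; nra.
Qed.

Lemma alpha_lt_i : geo -> al < ci.
Proof.
move=> g; have := center_i_sqr g; have := alpha_gt0 g; have := center_i_gt0 g.
by case: g => *; nra.
Qed.

Lemma alpha_lt_e : geo -> al < ce.
Proof.
move=> g; have := center_e_sqr g; have := alpha_gt0 g; have := center_e_gt0 g.
by case: g => *; nra.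
Qed.

Lemma asq_gt0 : geo -> 0 < asq.
Proof.
by move=> g; rewrite divr_gt0 ?subr_gt0 ?alpha_lt_i// addr_gt0 ?center_i_gt0 ?alpha_gt0.
Qed.

Lemma besq_gt0 : geo -> 0 < besq.
Proof.
by move=> g; rewrite divr_gt0 ?subr_gt0 ?alpha_lt_e// addr_gt0 ?center_e_gt0 ?alpha_gt0.
Qed.

Lemma center_lt : geo -> ci < ce.
Proof. by case=> *; rewrite /center_e; lra. Qed.

Lemma asq_lt : geo -> asq < besq.
Proof.
move=> g; have a0 := alpha_gt0 g; have c0 := center_i_gt0 g; have e0 := center_e_gt0 g.
have h1 : 0 < ci + al by lra.
have h2 : 0 < ce + al by lra.
have h3 := center_lt g.
by rewrite /asq /besq ltr_pdivrMr// mulrAC ltr_pdivlMr//; nra.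
Qed.

Lemma asq_sqr : geo -> asq = (ri / (ci + al)) ^+ 2.
Proof.
move=> g; have a0 := alpha_gt0 g; have e0 := center_i_gt0 g.
rewrite expr_div_n (_ : ri ^+ 2 = (ci - al) * (ci + al)); last first.
  by rewrite -subr_sqr (center_i_sqr g) addrK.
by rewrite /asq; field; lra.
Qed.

Lemma besq_sqr : geo -> besq = (re / (ce + al)) ^+ 2.
Proof.
move=> g; have a0 := alpha_gt0 g; have e0 := center_e_gt0 g.
rewrite expr_div_n (_ : re ^+ 2 = (ce - al) * (ce + al)); last first.
  by rewrite -subr_sqr (center_e_sqr g) addrK.
by rewrite /besq; field; lra.
Qed.

Lemma expR_ln_sub (x y : R) : 0 < x -> 0 < y -> expR (- (2 * (ln `|x| - ln y))) = (y / x) ^+ 2.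
Proof.
move=> x0 y0; rewrite gtr0_norm// -mulrN opprB expRM_natl.
by rewrite expRB !lnK.
Qed.

Lemma expR_xi_i : geo -> expR (- (2 * xi_i ri re eps)) = asq.
Proof.
move=> g; have a0 := alpha_gt0 g; have e0 := center_i_gt0 g.
by rewrite asq_sqr// /xi_i expR_ln_sub//; [lra|case: g].
Qed.

Lemma expR_xi_e : geo -> expR (- (2 * xi_e ri re eps)) = besq.
Proof.
move=> g; have a0 := alpha_gt0 g; have e0 := center_e_gt0 g.
by rewrite besq_sqr// /xi_e expR_ln_sub//; [lra|case: g => *; lra].
Qed.

End Geometry.

(** * Expansion of alpha and of the bipolar radii in sqrt eps *)

Section Asymptotics.
Variables (R : realType) (ri re : R).

Local Notation al eps := (alpha ri re eps).
Local Notation r := (r_star ri re).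
Local Notation xd eps := (2 * (xi_i ri re eps - xi_e ri re eps)).

(** The quantity is arsinh (a / x) - a / x. Both bounds follow from ln (1 + y) <= y, the lower one
    applied to (c - a) / x, the inverse of (c + a) / x. *)
Lemma ln_hypot_bounds (x c a : R) : 0 < x -> 0 < a -> 0 < c -> c ^+ 2 = x ^+ 2 + a ^+ 2 ->
  `|ln `|c + a| - ln x - a / x| <= (a / x) ^+ 2 / 2.
Proof.
move=> x0 a0 c0 h.
have xc : x <= c by nra.
have ac : a < c by nra.
have ca0 : 0 < c + a by rewrite addr_gt0.
have e : c - x <= a ^+ 2 / (2 * x).
  by rewrite ler_pdivlMr ?mulr_gt0//; nra.
have e2 : (c - x) / x <= (a / x) ^+ 2 / 2.
  rewrite [leRHS](_ : _ = a ^+ 2 / (2 * x) / x); last by field; lra.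
  by rewrite ler_pM2r ?invr_gt0.
have ub : ln ((c + a) / x) <= a / x + (a / x) ^+ 2 / 2.
  rewrite (_ : (c + a) / x = 1 + ((c - x) / x + a / x)); last by field; lra.
  apply: (le_trans (le_ln1Dx _)); last by lra.
  have : 0 <= (c - x) / x by rewrite divr_ge0 ?(ltW x0)// subr_ge0.
  have : 0 <= a / x by rewrite divr_ge0 ?(ltW x0) ?(ltW a0).
  lra.
have lb : ln ((c - a) / x) <= - (a / x) + (a / x) ^+ 2 / 2.
  rewrite (_ : (c - a) / x = 1 + ((c - x) / x - a / x)); last by field; lra.
  apply: (le_trans (le_ln1Dx _)); last by lra.
  rewrite -mulrBl ltr_pdivlMr//; lra.
have eq1 : ln ((c + a) / x) = ln (c + a) - ln x.
  by rewrite lnM ?posrE ?invr_gt0// lnV ?posrE.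
have eq2 : ln ((c - a) / x) = - (ln (c + a) - ln x).
  have n0 : (c + a) / x != 0 by rewrite gt_eqF ?divr_gt0.
  rewrite -eq1 -lnV ?posrE ?divr_gt0//; congr ln; apply: (mulIf n0).
  rewrite mulVf// mulrACA -subr_sqr h addrK -invfM -expr2 mulfV//.
  by rewrite gt_eqF ?exprn_gt0.
rewrite (gtr0_norm ca0) ler_norml -eq1; rewrite eq2 -eq1 in lb.
by apply/andP; split; lra.
Qed.

Lemma r_star_sqr : 0 < ri -> ri < re -> r ^+ 2 = 2 * ri * re / (re - ri).
Proof.
move=> i0 ie; rewrite sqr_sqrtr// divr_ge0//; last by lra.
by rewrite !mulr_ge0//; lra.
Qed.

Lemma r_star_gt0 : 0 < ri -> ri < re -> 0 < r.
Proof.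
by move=> i0 ie; rewrite sqrtr_gt0 divr_gt0 ?mulr_gt0//; lra.
Qed.

Lemma alpha_sqr_bounds (eps : R) : geo ri re eps -> eps <= (re - ri) / 2 ->
  0 <= al eps ^+ 2 - r ^+ 2 * eps <=
    (12 * (ri * re) + 4 * (re - ri) ^+ 2) / (re - ri) ^+ 2 * eps ^+ 2.
Proof.
move=> g h; rewrite alpha_sqr// r_star_sqr; [|by case: g|by case: g].
case: g => i0 ie e0 eg.
have [g Eg] : exists g, re = ri + g by exists (re - ri); lra.
subst re; rewrite (_ : ri + g - ri = g) in h eg *; last by ring.
have g0 : 0 < g by lra.
have ge0 : 0 < g - eps by lra.
(* This is 4 (g - eps)^2 / eps^2 times the remainder; as eps <= g / 2, the factor 4 (g - eps)^2 is
   at least g^2. *)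
set b := 12 * (ri * (ri + g)) + 4 * g ^+ 2 - 4 * g * eps + eps ^+ 2
         - 8 * (ri * (ri + g)) * (eps / g).
rewrite (_ : _ - _ = eps ^+ 2 * (b / (4 * (g - eps) ^+ 2))); last first.
  by rewrite /b; field; lra.
have ab0 : 0 < ri * (ri + g) by rewrite mulr_gt0//; lra.
have eg0 : 0 < eps / g by rewrite divr_gt0.
have eg1 : eps / g <= 1 / 2 by rewrite ler_pdivrMr//; lra.
have b0 : 0 <= b by rewrite /b; nra.
have b1 : b <= 12 * (ri * (ri + g)) + 4 * g ^+ 2 by rewrite /b; nra.
have d0 : 0 < 4 * (g - eps) ^+ 2 by rewrite mulr_gt0// exprn_gt0.
rewrite mulr_ge0 ?sqr_ge0 ?divr_ge0 ?(ltW d0)//= mulrC ler_pM2r ?exprn_gt0//.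
rewrite ler_pdivrMr//; apply: (le_trans b1).
rewrite mulrAC ler_pdivlMr ?exprn_gt0// ler_pM2l; first by nra.
by nra.
Qed.

(* The image system contracts by [e^-d], [d = 2 (xi_i - xi_e)], whereas
   [tau = e^(- beta c)] for [c = 4 sqrt eps / r_*]. *)
Lemma geo_asymptotics : 0 < ri -> ri < re -> exists eps0 K : R,
  [/\ 0 < eps0 < re - ri, 1 <= K &
  forall eps, 0 < eps < eps0 ->
    [/\ 0 < Num.sqrt eps <= 1,
        r * Num.sqrt eps <= al eps <= K * Num.sqrt eps /\ al eps <= ri,
        al eps - r * Num.sqrt eps <= K * (Num.sqrt eps) ^+ 2,
        2 * Num.sqrt eps / r <= 1 /\ 2 * Num.sqrt eps / r <= xd eps &
        `|4 * Num.sqrt eps / r - xd eps| <= K * (2 * Num.sqrt eps / r) ^+ 2]].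
Proof.
move=> i0 ie; have r0 := r_star_gt0 i0 ie; have r2 := r_star_sqr i0 ie.
set r := r in r0 r2 *.
set g := re - ri; have g0 : 0 < g by rewrite /g; lra.
have re0 : 0 < re by lra.
have [B EB] : exists B, B = (12 * (ri * re) + 4 * g ^+ 2) / g ^+ 2 by exists ((12 * (ri * re) + 4 * g ^+ 2) / g ^+ 2).
have B0 : 0 < B.
  by rewrite EB divr_gt0 ?exprn_gt0// addr_gt0 ?mulr_gt0// exprn_gt0.
set A := r + B / r; have A0 : 0 < A by rewrite addr_gt0// divr_gt0.
(* The first summand collects the quadratic errors of the two logarithms, the second the error of
   replacing alpha by [r * s]. *)
set K1 := 2 * A ^+ 2 / ri ^+ 2 + 4 * B / r ^+ 3.
have K10 : 0 < K1.
  by apply: addr_gt0; rewrite divr_gt0// ?mulr_gt0// ?exprn_gt0.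
(* The four thresholds for sqrt eps ensure, in this order, s <= 1, then 2 s / r <= 1, then K1 s^2 <=
   2 s / r (a lower bound for the step), and alpha <= ri. *)
set m := Num.min (Num.min 1 (r / 2)) (Num.min (2 / (r * K1)) (ri / A)).
have m0 : 0 < m.
  by rewrite !lt_min; apply/andP; split; apply/andP; split=> //;
    rewrite divr_gt0// ?mulr_gt0.
exists (Num.min (g / 2) (m ^+ 2)), (1 + A + B / r + K1 * r ^+ 2 / 4).
split.
- rewrite lt_min divr_gt0// exprn_gt0//= gt_min; apply/orP; left; lra.
- have : 0 < B / r by rewrite divr_gt0.
  have : 0 < K1 * r ^+ 2 / 4 by rewrite divr_gt0// mulr_gt0// exprn_gt0.
  lra.
move=> eps /andP[e0]; rewrite lt_min => /andP[eg em].
set s := Num.sqrt eps; have s0 : 0 < s by rewrite sqrtr_gt0.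
have s2 : s ^+ 2 = eps by rewrite sqr_sqrtr// ltW.
have sm : s < m.
  by rewrite -(@ltr_pXn2r _ 2) ?s2// ?nnegrE ltW.
have [s1 sr sk si] : [/\ s < 1, s < r / 2, s < 2 / (r * K1) & s < ri / A].
  by move: sm; rewrite !lt_min => /andP[/andP[-> ->] /andP[-> ->]].
have G : geo ri re eps by split=> //; rewrite /g in eg g0; lra.
have /andP[l1 l2] := alpha_sqr_bounds G (ltW eg).
have a0 := alpha_gt0 G.
have hi := ln_hypot_bounds i0 a0 (center_i_gt0 G) (center_i_sqr G).
have he := ln_hypot_bounds re0 a0 (center_e_gt0 G) (center_e_sqr G).
rewrite -/(xi_i ri re eps) in hi; rewrite -/(xi_e ri re eps) in he.
move: (al eps) a0 l1 l2 hi he => a a0 l1 l2 hi he.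
rewrite -/g -EB -s2 in l2; rewrite -/r -s2 in l1 l2.
have ras : r * s <= a.
  rewrite -(@ler_pXn2r _ 2) ?nnegrE ?(ltW a0) ?mulr_ge0 ?(ltW r0) ?(ltW s0)//.
  by rewrite exprMn; lra.
have rs0 : 0 < r * s by rewrite mulr_gt0.
have up : a - r * s <= B / r * s ^+ 3.
  have h : (a - r * s) * (r * s) <= B * s ^+ 4.
    have : 0 <= (a - r * s) * a by rewrite mulr_ge0 ?subr_ge0 ?(ltW a0).
    rewrite (_ : (s ^+ 2) ^+ 2 = s ^+ 4) in l2; last by rewrite -exprM.
    by rewrite !expr2 in l2; lra.
  rewrite -(ler_pM2r rs0); apply: (le_trans h).
  by rewrite le_eqVlt; apply/orP; left; apply/eqP; field; rewrite gt_eqF.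
have Br : 0 < B / r by rewrite divr_gt0.
have s32 : s ^+ 3 <= s ^+ 2 by rewrite exprS ger_pMl ?exprn_gt0// ltW.
have s21 : s ^+ 2 <= s by rewrite expr2 ger_pMl// ltW.
have up2 : a - r * s <= B / r * s ^+ 2.
  by apply: (le_trans up); rewrite ler_pM2l.
have aA : a <= A * s.
  rewrite /A mulrDl; have : B / r * s ^+ 2 <= B / r * s by rewrite ler_pM2l.
  lra.
have aa2 : (a / re) ^+ 2 <= (a / ri) ^+ 2.
  rewrite ler_pXn2r ?nnegrE ?divr_ge0 ?(ltW a0) ?(ltW i0) ?(ltW re0)//.
  by rewrite ler_pM2l// lef_pV2 ?posrE// ltW.
have aA2 : (a / ri) ^+ 2 <= A ^+ 2 / ri ^+ 2 * s ^+ 2.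
  rewrite [leRHS](_ : _ = (A * s / ri) ^+ 2); last by field; lra.
  rewrite ler_pXn2r ?nnegrE ?divr_ge0 ?mulr_ge0 ?(ltW a0) ?(ltW i0) ?(ltW A0) ?(ltW s0)//.
  by rewrite ler_pM2r ?invr_gt0.
(* The origin of [r_star]: 2 (xi_i - xi_e) is 2 alpha (1 / ri - 1 / re) = 4 alpha / r^2 to first
   order, that is 4 s / r. *)
have car : a / ri - a / re = 2 * a / r ^+ 2.
  by rewrite r2; field; rewrite /g in g0; lra.
have dev : 2 * a / r ^+ 2 - 2 * s / r <= 2 * B / r ^+ 3 * s ^+ 2.
  rewrite [leLHS](_ : _ = 2 / r ^+ 2 * (a - r * s)); last by field; rewrite gt_eqF.
  rewrite [leRHS](_ : _ = 2 / r ^+ 2 * (B / r * s ^+ 2)); last by field; rewrite gt_eqF.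
  by rewrite ler_pM2l// divr_gt0// exprn_gt0.
have dev0 : 0 <= 2 * a / r ^+ 2 - 2 * s / r.
  rewrite [leRHS](_ : _ = 2 / r ^+ 2 * (a - r * s)); last by field; rewrite gt_eqF.
  by rewrite mulr_ge0 ?subr_ge0// divr_ge0// exprn_ge0// ltW.
set xi := xi_i _ _ _ in hi *; set xe := xi_e _ _ _ in he *.
have key : `|4 * s / r - 2 * (xi - xe)| <= K1 * s ^+ 2.
  move: hi he; rewrite !ler_norml => /andP[h1 h2] /andP[h3 h4].
  rewrite /K1 mulrDl -!mulrA; rewrite -!mulrA in dev dev0 aA2 car.
  by apply/andP; split; lra.
have K1s : K1 * s ^+ 2 <= 2 * s / r.
  have := sk; rewrite ltr_pdivlMr ?mulr_gt0// => h.
  rewrite ler_pdivlMr//; nra.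
split.
- by rewrite s0 ltW.
- split; last first.
    apply: (le_trans aA); rewrite mulrC -ler_pdivlMr//; exact: ltW.
  rewrite ras (le_trans aA)// ler_pM2r//.
  have : 0 < K1 * r ^+ 2 / 4 by rewrite divr_gt0// mulr_gt0// exprn_gt0.
  lra.
- apply: (le_trans up2); rewrite ler_pM2r ?exprn_gt0//.
  have : 0 < K1 * r ^+ 2 / 4 by rewrite divr_gt0// mulr_gt0// exprn_gt0.
  lra.
- split.
    by rewrite ler_pdivrMr//; lra.
  move: key; rewrite ler_norml => /andP[h1 h2].
  rewrite (_ : 4 * s / r = 2 * s / r + 2 * s / r) in h1 h2; last by field; lra.
  lra.
apply: (le_trans key).
rewrite [leRHS](_ : _ = 4 / r ^+ 2 * (1 + A + B / r) * s ^+ 2 + K1 * s ^+ 2); last first.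
  by field; rewrite gt_eqF.
rewrite lerDr !mulr_ge0 ?invr_ge0 ?exprn_ge0 ?(ltW r0) ?(ltW s0)//; lra.
Qed.

End Asymptotics.

(** * Moebius maps and inversions *)

Section Mobius.
Variable R : realType.
Implicit Types (f H : R * R -> R) (p q : R * R) (z c w : R[i]).

Definition harm f p c := is_cgrad f p c /\ laplacian f p 0.

Lemma harm_cgrad f p c : harm f p c -> is_cgrad f p c. Proof. by case. Qed.

Lemma harm_near f g p c : (\forall q \near p, f q = g q) -> harm f p c -> harm g p c.
Proof.
by move=> fg [h1 h2]; split; [exact: is_cgrad_near fg h1|exact: laplacian_near fg h2].
Qed.

Lemma harm_eq f p c c' : harm f p c -> c = c' -> harm f p c'.
Proof. by move=> h <-. Qed.

Lemma harm_cst (k : R) p : harm (fun _ => k) p 0.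
Proof. by split; [exact: is_cgrad_cst|exact: laplacian_cst]. Qed.

Lemma harmD f g p c c' : harm f p c -> harm g p c' -> harm (fun q => f q + g q) p (c + c').
Proof.
move=> [h1 h2] [h3 h4]; split; first exact: is_cgradD.
by apply: laplacian_eq (laplacianD h2 h4) _; rewrite addr0.
Qed.

Lemma harmZ (k : R) f p c : harm f p c -> harm (fun q => k * f q) p (k%:C * c).
Proof.
move=> [h1 h2]; split; first exact: is_cgradZ.
by apply: laplacian_eq (laplacianZ k h2) _; rewrite mulr0.
Qed.

Lemma harmB f g p c c' : harm f p c -> harm g p c' -> harm (fun q => f q - g q) p (c - c').
Proof.
move=> [h1 h2] [h3 h4]; split; first exact: is_cgradB.
by apply: laplacian_eq (laplacianB h2 h4) _; rewrite subr0.
Qed.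

Lemma harm_sum n (F : 'I_n -> R * R -> R) p (C : 'I_n -> R[i]) :
  (forall i, harm (F i) p (C i)) ->
  harm (fun q => \sum_(i < n) F i q) p (\sum_(i < n) C i).
Proof.
move=> h; split; first by apply: is_cgrad_sum => i; exact: (h i).1.
by apply: laplacian_sum => i; exact: (h i).2.
Qed.

Lemma harm_flipx f p c : harm f (flipx p) c -> harm (fun q => f (flipx q)) p (- conjc c).
Proof.
by move=> [h1 h2]; split; [exact: is_cgrad_flipx|exact: laplacian_flipx].
Qed.

Definition mob (A B C D : R[i]) z : R[i] := (A * z + B) / (C * z + D).

Lemma cder_affine (C D z : R[i]) : cder (fun z => C * z + D) z C.
Proof.
apply: (cder_eq (cderD (cderM (cder_cst C z) (cder_id z)) (cder_cst D z))).
by rewrite mul0r add0r mulr1 addr0.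
Qed.

Lemma cder_mob (A B C D z : R[i]) : C * z + D != 0 ->
  cder (mob A B C D) z ((A * D - B * C) / (C * z + D) ^+ 2).
Proof.
move=> d; have := cderM (cder_affine A B z) (cderV (M := fun z => C * z + D) d (cder_affine C D z)).
by move=> h; apply: cder_eq h _; field.
Qed.

Lemma cder_mob' (n C D z : R[i]) : C * z + D != 0 ->
  cder (fun z => n / (C * z + D) ^+ 2) z (- 2 * n * C / (C * z + D) ^+ 3).
Proof.
move=> d; have a := cder_affine C D z.
have d2 : (C * z + D) * (C * z + D) != 0 by rewrite mulf_neq0.
apply: (cder_eq (cder_ext _ (cderM (cder_cst n z) (cderV (M := fun z => (C * z + D) * (C * z + D)) d2 (cderM a a))))).
  by move=> x /=; rewrite expr2.
by field.
Qed.

Lemma near_affine_neq0 (C D : R[i]) p : C * toC p + D != 0 ->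
  \forall q \near p, C * toC q + D != 0.
Proof.
move=> d; have m0 : 0 < modc (C * toC p + D) by rewrite modc_gt0.
have c0 : 0 < modc C + 1 by rewrite ltr_wpDl ?modc_ge0.
apply: (@near_modc _ p (fun z => C * z + D != 0) _ (divr_gt0 m0 c0)) => h hd.
apply/eqP => e.
have : modc (C * toC p + D) <= modc C * modc h.
  have he : - (C * toC p + D) = C * h - (C * (toC p + h) + D) by ring.
  by rewrite -modcN he e subr0 modcM.
move: hd; rewrite ltr_pdivlMr// => hd; have := modc_ge0 h; have := modc_ge0 C.
nra.
Qed.

Lemma harm_mob f (A B C D : R[i]) p c : C * toC p + D != 0 ->
  harm f (toP (mob A B C D (toC p))) c ->
  harm (fun q => f (toP (mob A B C D (toC q)))) p
    (c * ((A * D - B * C) / (C * toC p + D) ^+ 2)).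
Proof.
move=> d [h1 h2]; split; first exact: (is_cgrad_comp (cder_mob A B d) h1).
apply: (harmonic_comp (l := fun z => (A * D - B * C) / (C * z + D) ^+ 2) _
          (cder_mob' _ d) h2).
have := near_affine_neq0 d; apply: filterS => q; exact: cder_mob.
Qed.

Section Contraction.
Variable al : R.
Hypothesis al0 : 0 < al.

(** The reciprocal of [bipolar_ratio]. It maps the right half-plane, which contains both disks, into
    |w| < 1, where L is defined. *)
Definition wr z : R[i] := (al%:C - z) / (al%:C + z).

(* [Mt s] is multiplication by [s] in the coordinate [wr]. *)
Definition Mt (s : R) z : R[i] :=
  mob (al * (1 + s))%:C (al ^+ 2 * (1 - s))%:C (1 - s)%:C (al * (1 + s))%:C z.

Definition Tm (s : R) p : R * R := toP (Mt s (toC p)).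

Lemma Re_gt0_neq0 z : 0 < complex.Re z -> z != 0.
Proof. by move=> h; apply/eqP => e; move: h; rewrite e ltxx. Qed.

Lemma alz_neq0 z : 0 < complex.Re z -> al%:C + z != 0.
Proof. by move=> h; apply: Re_gt0_neq0; rewrite ReD/= addr_gt0. Qed.

Lemma Mt_den (s : R) z : 0 < complex.Re z -> 0 <= s <= 1 ->
  (1 - s)%:C * z + (al * (1 + s))%:C != 0.
Proof.
move=> h /andP[s0 s1]; apply: Re_gt0_neq0; rewrite ReD ReRM/=.
by rewrite ltr_wpDl ?mulr_ge0 ?subr_ge0 ?mulr_gt0 ?(ltW h)// ltr_wpDr.
Qed.

Lemma wr_lt1 z : 0 < complex.Re z -> modc (wr z) < 1.
Proof.
move=> h; have h0 := alz_neq0 h.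
rewrite /wr modcM modcV ltr_pdivrMr ?modc_gt0// mul1r.
rewrite -(@ltr_pXn2r _ 2) ?nnegrE ?modc_ge0// !sqr_modc.
rewrite ReB ReD ImB ImD/=; move: (complex.Re z) (complex.Im z) h al0 => x y h a0.
by nra.
Qed.

Lemma wr1 z : al%:C + z != 0 -> 1 + wr z = 2 * al%:C / (al%:C + z).
Proof. by move=> h; rewrite /wr; field. Qed.

Lemma Mt_kden (s : R) z : al%:C + z != 0 ->
  1 + wr z * s%:C = ((1 - s)%:C * z + (al * (1 + s))%:C) / (al%:C + z).
Proof.
by move=> h; rewrite /wr rmorphB rmorphM rmorphD/= rmorph1; field.
Qed.

(** The origin of the kernel: the left side is the derivative of [Mt s] at z, and it becomes [kG]
    when written in w = wr z. *)
Lemma kG_Mt (s : R) z : al%:C + z != 0 -> (1 - s)%:C * z + (al * (1 + s))%:C != 0 ->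
  ((al * (1 + s))%:C * (al * (1 + s))%:C - (al ^+ 2 * (1 - s))%:C * (1 - s)%:C) /
  ((1 - s)%:C * z + (al * (1 + s))%:C) ^+ 2 = kG (wr z) s.
Proof.
move=> h d; rewrite /kG Mt_kden// wr1//.
rewrite !(rmorphB, rmorphM, rmorphD, rmorphXn, rmorph1)/= in d *.
by field; rewrite h d.
Qed.

Lemma harm_Tm f s p c : 0 < p.1 -> 0 <= s <= 1 -> harm f (Tm s p) c ->
  harm (fun q => f (Tm s q)) p (c * kG (wr (toC p)) s).
Proof.
move=> p0 s01 h; have d := Mt_den (z := toC p) p0 s01.
by apply: (harm_eq (harm_mob d h)); rewrite kG_Mt// alz_neq0.
Qed.

Lemma Mt_comp (r s : R) z : (1 - s)%:C * z + (al * (1 + s))%:C != 0 ->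
  (1 - r * s)%:C * z + (al * (1 + r * s))%:C != 0 ->
  Mt r (Mt s z) = Mt (r * s) z.
Proof.
move=> d1 d2; have aC : al%:C != 0 :> R[i] by rewrite eq_complex /= negb_and gt_eqF.
rewrite /Mt /mob !(rmorphB, rmorphM, rmorphD, rmorphXn, rmorph1)/= in d1 d2 *.
field; rewrite d1 d2 ?andbT/=.
rewrite (_ : _ + _ = 2 * al%:C * ((1 - r%:C * s%:C) * z + al%:C * (1 + r%:C * s%:C))); last by ring.
by rewrite !mulf_neq0// pnatr_eq0.
Qed.

Lemma Mt1 z : Mt 1 z = z.
Proof.
rewrite /Mt /mob subrr mulr0 mul0r addr0 add0r mulrAC divff ?mul1r//.
by rewrite eq_complex /= negb_and gt_eqF// mulr_gt0.
Qed.

Lemma modc_Mt (s : R) z : 0 < complex.Re z -> 0 <= s <= 1 ->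
  modc (Mt s z) <= 2 * al / kden (wr z) s.
Proof.
move=> h /[dup] s01 /andP[s0 s1]; have d := Mt_den h s01; have a := alz_neq0 h.
have -> : Mt s z = al%:C * (1 - wr z * s%:C) / (1 + wr z * s%:C).
  rewrite Mt_kden// /Mt /mob /wr !(rmorphB, rmorphM, rmorphD, rmorphXn, rmorph1)/= in d *.
  by field; rewrite a d.
rewrite modcM modcV ler_pM2r ?invr_gt0 ?kden_gt0 ?wr_lt1//.
rewrite modcM modcR gtr0_norm// mulrC ler_pM2r//.
apply: (le_trans (modcB _ _)); rewrite modc1 modcM modcR ger0_norm//.
have := wr_lt1 h; have := modc_ge0 (wr z); nra.
Qed.

End Contraction.

Section Inversion.
Variables (c r : R).
Hypothesis r0 : 0 < r.

(* The inversion in the circle of radius [r] about [c]. *)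
Definition inv p : R * R :=
  toP (mob c%:C (c ^+ 2 - r ^+ 2)%:C 1 c%:C (toC (flipx p))).

Local Notation N := (nsq (c, 0)).

Lemma inv_den p : 0 < N p -> 1 * toC (flipx p) + c%:C != 0.
Proof.
rewrite mul1r /nsq/=; apply: contraTneq => /eqP.
rewrite eq_complex /= addr0 => /andP[/eqP h1 /eqP h2].
by rewrite (_ : p.1 = c) 1?h2 ?subrr ?expr0n ?addr0 ?ltxx//; lra.
Qed.

Lemma invE p : 0 < N p -> inv p = (c + r ^+ 2 * (p.1 - c) / N p, r ^+ 2 * p.2 / N p).
Proof.
move=> n0; have d := inv_den n0.
have md : modc (1 * toC (flipx p) + c%:C) ^+ 2 = N p.
  by rewrite sqr_modc mul1r/= /nsq/=; ring.
rewrite /inv /toP /mob; set D := _ * _ + _ in d md *.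
have nz : N p != 0 by rewrite gt_eqF.
rewrite ReM ImM Re_inv Im_inv md /D mul1r; clear D d md.
case: p n0 nz => x y /=; rewrite /nsq /= !subr0 => n0 nz.
by congr (_, _); field.
Qed.

Lemma nsq_inv p : 0 < N p -> N (inv p) = r ^+ 4 / N p.
Proof.
move=> n0; rewrite (invE n0); have := lt0r_neq0 n0; rewrite /nsq/= !subr0 => n1.
by field.
Qed.

Lemma inv_circle p : N p = r ^+ 2 -> inv p = p.
Proof.
move=> h; rewrite invE h ?exprn_gt0//; case: p h => x y /= _.
by congr (_, _); field; rewrite gt_eqF.
Qed.

Lemma inv_in p : r ^+ 2 <= N p -> N (inv p) <= r ^+ 2.
Proof.
move=> h; have n0 : 0 < N p by apply: lt_le_trans h; rewrite exprn_gt0.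
rewrite nsq_inv// ler_pdivrMr// (_ : r ^+ 4 = r ^+ 2 * r ^+ 2); last by rewrite -exprD.
by rewrite ler_pM2l// exprn_gt0.
Qed.

Lemma disk_gt0 p : r < c -> N p <= r ^+ 2 -> 0 < p.1.
Proof.
rewrite /nsq/= ltNge => rc h; apply/negP => p0; have := sqr_ge0 p.2.
by move: r0 rc h p0; rewrite subr0; nra.
Qed.

Lemma harm_inv f p g : 0 < N p -> harm f (inv p) g ->
  harm (fun q => f (inv q)) p (- conjc (g * (r%:C ^+ 2 / conjc (toC p - c%:C) ^+ 2))).
Proof.
move=> n0 h; have d := inv_den n0.
apply: (harm_eq (harm_flipx (harm_mob d h))); congr (- conjc (_ * (_ / _))).
  by rewrite rmorphB /= !rmorphXn/=; ring.
rewrite (_ : conjc (toC p - c%:C) = - (1 * toC (flipx p) + c%:C)) ?sqrrN//.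
by apply/eqP; rewrite eq_complex /=; apply/andP; split; apply/eqP; ring.
Qed.

Lemma modc_inv_der p : r ^+ 2 <= N p -> modc (r%:C ^+ 2 / conjc (toC p - c%:C) ^+ 2) <= 1.
Proof.
move=> h; have n0 : 0 < N p by apply: lt_le_trans h; rewrite exprn_gt0.
rewrite modcM modcV [modc (r%:C ^+ 2)]modcX [modc (conjc _ ^+ 2)]modcX modcR modcJ.
rewrite sqr_modc (gtr0_norm r0) ReB ImB/= subr0.
by move: h n0; rewrite /nsq /= subr0 => h n0; rewrite ler_pdivrMr// mul1r.
Qed.

End Inversion.

End Mobius.

(** * Image sums *)

Section Gluing.
Variable R : realType.
Implicit Types (f g h : R * R -> R) (p q : R * R).

Lemma glue_at h f g (a : R) p : {for p, continuous h} ->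
  (a <= h p -> {for p, continuous f}) -> (h p <= a -> {for p, continuous g}) ->
  (h p = a -> f p = g p) ->
  {for p, continuous (fun q => if a <= h q then f q else g q)}.
Proof.
move=> hc fc gc fg.
have [hlt|hgt|heq] := ltgtP (h p) a.
- have near : \forall q \near p, h q < a by exact: @cvgr_lt _ _ _ _ h (h p) hc a hlt.
  have e : \forall q \near p, g q = (if a <= h q then f q else g q).
    by apply: filterS near => q hq; rewrite leNgt hq.
  have := gc (ltW hlt); rewrite /prop_for/continuous_at => gp.
  apply: cvg_trans; first exact: near_eq_cvg e.
  by rewrite leNgt hlt.
- have near : \forall q \near p, a < h q by exact: @cvgr_gt _ _ _ _ h (h p) hc a hgt.
  have e : \forall q \near p, f q = (if a <= h q then f q else g q).
    by apply: filterS near => q hq; rewrite (ltW hq).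
  have := fc (ltW hgt); rewrite /prop_for/continuous_at => fp.
  apply: cvg_trans; first exact: near_eq_cvg e.
  by rewrite (ltW hgt).
- have ale : a <= h p by rewrite heq.
  have eq_le (e : h p = a) : h p <= a by rewrite e.
  have fp := fc ale; have gp := gc (eq_le heq).
  move: fp gp; rewrite /prop_for/continuous_at ale => fp gp.
  apply/cvgrPdist_lt => e e0.
  move: fp gp => /cvgrPdist_lt/(_ e e0) f1 /cvgrPdist_lt/(_ e e0) g1.
  near=> q; case: ifP => _; first by near: q.
  by rewrite fg//; near: q.
Unshelve. all: by end_near.
Qed.

End Gluing.

Section ImageSystem.
Variables (R : realType) (ri re eps ki ke : R) (H : R * R -> R).

Local Notation geo := (geo ri re eps).
Local Notation al := (alpha ri re eps).
Local Notation ci := (center_i ri re eps).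
Local Notation ce := (center_e ri re eps).
Local Notation a2 := (asq ri re eps).
Local Notation b2 := (besq ri re eps).
Local Notation ti := (tau_i ki ke).
Local Notation te := (tau_e ke).
Local Notation tau := (tau ki ke).
Local Notation pe := (center_e ri re eps, 0).
Local Notation pi_ := (center_i ri re eps, 0).
Local Notation inve := (inv (center_e ri re eps) re).
Local Notation invi := (inv (center_i ri re eps) ri).

Definition rho := a2 / b2.

Lemma rho01 : geo -> 0 < rho < 1.
Proof.
move=> g; rewrite /rho divr_gt0 ?asq_gt0 ?besq_gt0//=.
by rewrite ltr_pdivrMr ?besq_gt0// mul1r asq_lt.
Qed.

Lemma rhoX m : geo -> 0 <= rho ^+ m <= 1.
Proof. by move=> /rho01 /andP[h1 h2]; apply: rhoX01; rewrite !ltW. Qed.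

Lemma mob_scale (k A B C D z : R[i]) : k != 0 ->
  mob (k * A) (k * B) (k * C) (k * D) z = mob A B C D z.
Proof. by move=> k0; rewrite /mob -!mulrA -!mulrDr -mulf_div divff// mul1r. Qed.

(** In w the reflection [flipx] is w -> 1 / conj w, so the inversion in the circle |w|^2 = s is the
    reflection followed by multiplication by s. *)
Lemma inv_Mt (a c r : R) p : 0 < a -> 0 < c -> c ^+ 2 = r ^+ 2 + a ^+ 2 ->
  inv c r p = toP (Mt a ((c - a) / (c + a)) (toC (flipx p))).
Proof.
move=> a0 c0 h; have ca : c + a != 0 by rewrite gt_eqF// addr_gt0.
have k0 : (2 * a / (c + a))%:C != 0 :> R[i].
  by rewrite eq_complex /= negb_and gt_eqF// divr_gt0 ?mulr_gt0 ?addr_gt0.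
rewrite /inv -(mob_scale _ _ _ _ _ k0) /Mt; congr (toP (mob _ _ _ _ _)).
- by rewrite -rmorphM; congr (_%:C); field.
- by rewrite -rmorphM h [_ - _]addrAC subrr add0r; congr (_%:C); field.
- by rewrite mulr1; congr (_%:C); field.
- by rewrite -rmorphM; congr (_%:C); field.
Qed.

Lemma inve_Mt p : geo -> inve p = toP (Mt al b2 (toC (flipx p))).
Proof.
by move=> g; apply: inv_Mt; [exact: alpha_gt0|exact: center_e_gt0|exact: center_e_sqr].
Qed.

Lemma invi_Mt p : geo -> invi p = toP (Mt al a2 (toC (flipx p))).
Proof.
by move=> g; apply: inv_Mt; [exact: alpha_gt0|exact: center_i_gt0|exact: center_i_sqr].
Qed.

Lemma inv_Mt_den (a c : R) p : 0 < a -> 0 < c -> 0 < nsq (c, 0) p ->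
  (1 - (c - a) / (c + a))%:C * toC (flipx p) + (a * (1 + (c - a) / (c + a)))%:C != 0.
Proof.
move=> a0 c0 n0; have ca : c + a != 0 by rewrite gt_eqF// addr_gt0.
rewrite (_ : _ + _ = (2 * a / (c + a))%:C * (1 * toC (flipx p) + c%:C)).
  rewrite mulf_neq0 ?inv_den// eq_complex /= negb_and gt_eqF//.
  by rewrite divr_gt0 ?mulr_gt0 ?addr_gt0.
rewrite mul1r [RHS]mulrDr; congr (_ + _).
  by congr (_%:C * _); field.
by transitivity ((2 * a / (c + a) * c)%:C); [congr (_%:C); field|exact: rmorphM].
Qed.

(** Both inversions are the same reflection followed by a multiplication in w, by [a2] and by [b2],
    and [a2 = rho * b2]. *)
Lemma invi_Tm p : geo -> 0 < nsq pe p -> 0 < nsq pi_ p -> invi p = Tm al rho (inve p).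
Proof.
move=> g n1 n2; rewrite invi_Mt// /Tm inve_Mt// toPK.
have b0 := besq_gt0 g; have a0 := alpha_gt0 g.
have e : rho * b2 = a2 by rewrite /rho divfK// gt_eqF.
rewrite Mt_comp ?e//.
  by apply: (inv_Mt_den a0 (center_e_gt0 g) n1).
by apply: (inv_Mt_den a0 (center_i_gt0 g) n2).
Qed.

Lemma Tm_invi m p : geo -> 0 < nsq pe p -> 0 < nsq pi_ p -> 0 < (inve p).1 ->
  Tm al (rho ^+ m) (invi p) = Tm al (rho ^+ m.+1) (inve p).
Proof.
move=> g n1 n2 i0; rewrite (invi_Tm g n1 n2) /Tm toPK exprSr.
have r1 : 0 <= rho <= 1 by have := rhoX 1 g; rewrite expr1.
rewrite Mt_comp//; first exact: alpha_gt0.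
  by apply: Mt_den; [exact: alpha_gt0|exact: i0|].
by rewrite -exprSr; apply: Mt_den; [exact: alpha_gt0|exact: i0|exact: rhoX].
Qed.

Definition imF N p : R := \sum_(m < N) tau ^+ m * H (Tm al (rho ^+ m) p).
Definition imdF N p : R[i] :=
  \sum_(m < N) (tau ^+ m)%:C * (cgrad H (Tm al (rho ^+ m) p) * kG (wr al (toC p)) (rho ^+ m)).

(** Since T^m R_i = T^(m + 1) R_e, the two sums are shifts of each other and only the end terms
    survive. *)
Lemma imF_reflect N p : geo -> 0 < nsq pe p -> 0 < nsq pi_ p -> 0 < (inve p).1 ->
  imF N (inve p) - tau * imF N (invi p) =
  H (inve p) - tau ^+ N * H (Tm al (rho ^+ N) (inve p)).
Proof.
move=> g n1 n2 i0.
rewrite /imF mulr_sumr -sumrB.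
transitivity (\sum_(m < N) (tau ^+ m * H (Tm al (rho ^+ m) (inve p))
   - tau ^+ m.+1 * H (Tm al (rho ^+ m.+1) (inve p)))).
  by apply: eq_bigr => m _; rewrite Tm_invi// mulrA -exprS.
rewrite (telescope_ord (fun m => tau ^+ m * H (Tm al (rho ^+ m) (inve p)))).
by rewrite !expr0 mul1r /Tm Mt1 ?alpha_gt0// toCK.
Qed.

Lemma harmonic_harm : entire_harmonic H -> forall p, harm H p (cgrad H p).
Proof.
move=> [c2 h0] p; have [c1 _ _] := c2; split.
  by apply: (C1_is_cgrad (U := setT)) => //; exact: openT.
have := laplacian_C2 openT c2 (I : setT p); by rewrite h0.
Qed.

Lemma harm_imF N p : geo -> (forall p, harm H p (cgrad H p)) -> 0 < p.1 ->
  harm (imF N) p (imdF N p).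
Proof.
move=> g hH p0; apply: harm_sum => m; apply: harmZ.
by apply: harm_Tm; [exact: alpha_gt0|exact: p0|exact: rhoX|exact: hH].
Qed.

Lemma nsq_pos c r p : 0 < r -> r ^+ 2 <= nsq c p -> 0 < nsq c p :> R.
Proof. by move=> r0; apply: lt_le_trans; rewrite exprn_gt0. Qed.

Lemma re_lt_ce : geo -> re < ce.
Proof.
move=> g; have := center_e_sqr g; have := alpha_gt0 g; have := center_e_gt0 g.
by case: g => *; nra.
Qed.

Lemma ri_lt_ci : geo -> ri < ci.
Proof.
move=> g; have := center_i_sqr g; have := alpha_gt0 g; have := center_i_gt0 g.
by case: g => *; nra.
Qed.

Lemma in_e_gt0 p : geo -> nsq pe p <= re ^+ 2 -> 0 < p.1.
Proof. by move=> g; apply: disk_gt0; [case: g => *; lra|exact: re_lt_ce]. Qed.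

Lemma in_i_gt0 p : geo -> nsq pi_ p <= ri ^+ 2 -> 0 < p.1.
Proof. by move=> g; apply: disk_gt0; [case: g => *; lra|exact: ri_lt_ci]. Qed.

Lemma disk_nested p : geo -> nsq pi_ p <= ri ^+ 2 -> nsq pe p < re ^+ 2.
Proof.
move=> g; rewrite /nsq /= !subr0.
have [d ed] : exists d, ce = ci + d by exists (ce - ci); ring.
have ed2 : d = re - ri - eps by move: ed; rewrite /center_e; lra.
rewrite ed; case: g => i0 ie e0 eg h.
have x1 : - ri <= p.1 - ci.
  by rewrite leNgt; apply/negP => hh; have := sqr_ge0 p.2; nra.
have : (p.1 - (ci + d)) ^+ 2 + p.2 ^+ 2 <= (ri + d) ^+ 2 by nra.
by nra.
Qed.

Lemma inve_gt0 p : geo -> re ^+ 2 <= nsq pe p -> 0 < (inve p).1.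
Proof.
by move=> g h; apply: in_e_gt0 => //; apply: inv_in => //; case: g => *; lra.
Qed.

Lemma invi_gt0 p : geo -> ri ^+ 2 <= nsq pi_ p -> 0 < (invi p).1.
Proof.
by move=> g h; apply: in_i_gt0 => //; apply: inv_in => //; case: g => *; lra.
Qed.

End ImageSystem.

Section Conjugate.
Variable R : realType.
Implicit Types x y : R[i].

Lemma conjcM x y : conjc (x * y) = conjc x * conjc y. Proof. exact: rmorphM. Qed.
Lemma conjcV x : conjc x^-1 = (conjc x)^-1. Proof. exact: fmorphV. Qed.
Lemma conjcX x n : conjc (x ^+ n) = conjc x ^+ n. Proof. exact: rmorphXn. Qed.
Lemma conjcR (a : R) : conjc a%:C = a%:C. Proof. by apply/eqP; rewrite eq_complex /= oppr0 !eqxx. Qed.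

End Conjugate.

(** * Disks in the coordinate w *)

Section Apollonius.
Variable R : realType.
Implicit Types (p : R * R) (z : R[i]).

(* Disks about [c] are sublevel sets of [|wr|] (circles of Apollonius). *)
Lemma wr_disk (a c r : R) p : 0 < a -> 0 < c -> a < c -> c ^+ 2 = r ^+ 2 + a ^+ 2 -> a%:C + toC p != 0 ->
  (nsq (c, 0) p <= r ^+ 2) = (modc (wr a (toC p)) ^+ 2 <= (c - a) / (c + a)).
Proof.
move=> a0 c0 ac h d.
have m0 : 0 < modc (a%:C + toC p) by rewrite modc_gt0.
have m2 : 0 < modc (a%:C + toC p) ^+ 2 by rewrite exprn_gt0.
have ca : 0 < c + a by rewrite addr_gt0.
rewrite /wr modcM modcV exprMn exprVn ler_pdivrMr// mulrAC ler_pdivlMr//.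
rewrite !sqr_modc ReB ReD ImB ImD/= /nsq/= in m2 *.
move: p.1 p.2 => x y in m2 *.
rewrite -subr_ge0 -[RHS]subr_ge0.
rewrite [X in _ = (0 <= X)](_ : _ = 2 * a * (r ^+ 2 - ((x - c) ^+ 2 + (y - 0) ^+ 2))).
  by rewrite pmulr_rge0// mulr_gt0.
have -> : r ^+ 2 = c ^+ 2 - a ^+ 2 by rewrite h addrK.
ring.
Qed.

Lemma add_Mt (a x : R) z : (1 - x)%:C * z + (a * (1 + x))%:C != 0 ->
  a%:C + Mt a x z = 2 * a%:C * (a%:C + z) / ((1 - x)%:C * z + (a * (1 + x))%:C).
Proof.
move=> d; rewrite /Mt /mob !(rmorphB, rmorphM, rmorphD, rmorphXn, rmorph1)/= in d *.
by field.
Qed.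

Lemma add_Mt_neq0 (a x : R) z : 0 < a -> a%:C + z != 0 ->
  (1 - x)%:C * z + (a * (1 + x))%:C != 0 -> a%:C + Mt a x z != 0.
Proof.
move=> a0 d d'; have aC : a%:C != 0 :> R[i] by rewrite eq_complex /= negb_and gt_eqF.
by rewrite add_Mt// !mulf_neq0 ?invr_eq0 ?pnatr_eq0.
Qed.

Lemma wr_Mt (a x : R) z : 0 < a -> a%:C + z != 0 -> (1 - x)%:C * z + (a * (1 + x))%:C != 0 ->
  wr a (Mt a x z) = x%:C * wr a z.
Proof.
move=> a0 d d'; have aC : a%:C != 0 :> R[i] by rewrite eq_complex /= negb_and gt_eqF.
have e := add_Mt d'.
rewrite /wr e /Mt /mob !(rmorphB, rmorphM, rmorphD, rmorphXn, rmorph1)/= in d' *.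
by field; rewrite ?d ?d' ?aC.
Qed.

(** A disk is a sublevel set of |w|, and multiplication of w by s <= 1 does not increase it. All
    images of a point of B_e thus stay in B_e, where H is under control. *)
Lemma Tm_disk (a c r s : R) p : 0 < a -> 0 < c -> a < c -> 0 < r -> r < c -> c ^+ 2 = r ^+ 2 + a ^+ 2 ->
  0 <= s <= 1 -> nsq (c, 0) p <= r ^+ 2 -> nsq (c, 0) (Tm a s p) <= r ^+ 2.
Proof.
move=> a0 c0 ac r0 rc h /[dup] s01 /andP[s0 s1] hp.
have p0 := disk_gt0 r0 rc hp.
have d := alz_neq0 a0 (z := toC p) p0.
have d' := Mt_den a0 (z := toC p) p0 s01.
have n2 : a%:C + toC (Tm a s p) != 0 by rewrite /Tm toPK; exact: add_Mt_neq0.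
move: hp; rewrite (wr_disk a0 c0 ac h d) (wr_disk a0 c0 ac h n2) /Tm toPK wr_Mt// modcM modcR ger0_norm// exprMn => hp.
by apply: le_trans hp; rewrite ler_piMl ?exprn_ge0 ?modc_ge0 ?expr_le1.
Qed.

End Apollonius.

(** * The truncated image solution and its transmission conditions *)

Section ImageSolution.
Variables (R : realType) (ri re eps ki ke : R) (H : R * R -> R).

Local Notation geo := (geo ri re eps).
Local Notation al := (alpha ri re eps).
Local Notation ci := (center_i ri re eps).
Local Notation ce := (center_e ri re eps).
Local Notation a2 := (asq ri re eps).
Local Notation b2 := (besq ri re eps).
Local Notation ti := (tau_i ki ke).
Local Notation te := (tau_e ke).
Local Notation tau := (tau ki ke).
Local Notation rho := (rho ri re eps).
Local Notation pe := (center_e ri re eps, 0).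
Local Notation pi_ := (center_i ri re eps, 0).
Local Notation inve := (inv (center_e ri re eps) re).
Local Notation invi := (inv (center_i ri re eps) ri).
Local Notation F := (imF ri re eps ki ke H).
Local Notation dF := (imdF ri re eps ki ke H).

Hypothesis hH : forall p, harm H p (cgrad H p).

(* [refl c r p] carries the gradient of [f] at [inv c r p] to the gradient of
   [f \o inv c r] at [p]. *)
Definition refl (c r : R) (p : R * R) (g : R[i]) : R[i] :=
  - conjc (g * (r%:C ^+ 2 / conjc (toC p - c%:C) ^+ 2)).

Local Notation refle := (refl (center_e ri re eps) re).
Local Notation refli := (refl (center_i ri re eps) ri).

Lemma Re_lin3 (k l : R) (a b c n : R[i]) :
  complex.Re ((a + k%:C * b - l%:C * c) * n) =
  complex.Re (a * n) + k * complex.Re (b * n) - l * complex.Re (c * n).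
Proof. by rewrite mulrBl mulrDl ReB ReD -!mulrA !ReRM. Qed.

Lemma Re_lin2 (k l : R) (a b c n : R[i]) :
  complex.Re ((k%:C * (a - l%:C * b) + c) * n) =
  k * (complex.Re (a * n) - l * complex.Re (b * n)) + complex.Re (c * n).
Proof. by rewrite mulrDl ReD -mulrA ReRM mulrBl ReB -mulrA ReRM. Qed.

Lemma modc_refl c r p g : 0 < r -> r ^+ 2 <= nsq (c, 0) p -> modc (refl c r p g) <= modc g.
Proof.
move=> r0 h; rewrite /refl modcN modcJ modcM -[leRHS]mulr1.
by rewrite ler_wpM2l ?modc_ge0// modc_inv_der.
Qed.

(** On its circle the inversion fixes points and reverses the normal; pairing F with F o R therefore
    matches values and flips fluxes, which is what the transmission conditions require. *)
Lemma refl_normal c r p g : 0 < r -> nsq (c, 0) p = r ^+ 2 ->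
  complex.Re (refl c r p g * toC (r^-1 *: (p - (c, 0)))) =
  - complex.Re (g * toC (r^-1 *: (p - (c, 0)))).
Proof.
move=> r0 h; have rC : r%:C != 0 :> R[i] by rewrite eq_complex /= negb_and gt_eqF.
set d := toC p - c%:C.
have dd : d * conjc d = r%:C ^+ 2.
  rewrite -modc2J -rmorphXn /= -h; congr (_%:C).
  by rewrite sqr_modc /d /nsq /= !subr0.
have d0 : d != 0.
  by apply/eqP => e; move/eqP: dd; rewrite e mul0r eq_sym expf_eq0 (negbTE rC).
have -> : toC (r^-1 *: (p - (c, 0))) = r%:C^-1 * d.
  rewrite -rmorphV ?unitfE ?gt_eqF//= /d; case: p {h d dd d0} => x y.
  apply/eqP; rewrite eq_complex /= /GRing.scale/=.
  by apply/andP; split; apply/eqP; ring.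
have -> : refl c r p g * (r%:C^-1 * d) = - conjc (g * (r%:C^-1 * d)).
  rewrite /refl -/d -dd mulNr !(conjcM, conjcV, conjcX, conjcK, conjcR).
  by move: (conjc d) (conjc g) => d' g'; field; rewrite d0 rC.
by rewrite ReN; case: (_ * _).
Qed.

Lemma harm_refl c r f p g : 0 < nsq (c, 0) p -> harm f (inv c r p) g ->
  harm (fun q => f (inv c r q)) p (refl c r p g).
Proof. exact: harm_inv. Qed.

(** The end term of [imF_reflect]. Added inside the outer disk, it makes the truncated solution
    continuous across the outer circle and becomes the only source of flux defect ([flux_err]). *)
Definition imR N p : R := tau ^+ N * H (Tm al (rho ^+ N) p).
Definition imdR N p : R[i] :=
  (tau ^+ N)%:C * (cgrad H (Tm al (rho ^+ N) p) * kG (wr al (toC p)) (rho ^+ N)).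

Lemma harm_imR N p : geo -> 0 < p.1 -> harm (imR N) p (imdR N p).
Proof.
move=> g p0; apply: harmZ.
by apply: harm_Tm; [exact: alpha_gt0|exact: p0|exact: rhoX|exact: hH].
Qed.

Definition imc N : R := te * F N pe - ti * F N pi_.
(** The coefficients here and in [ush], [uin] are fixed by continuity and by the relations ke (1 +
    te) = 1 - te and ke (1 + ti) = ki (1 - ti): 1 + te and 1 - ti act as transmission factors. *)
Definition uext N p : R := H p + te * F N (inve p) - ti * F N (invi p) - imc N.
Definition ush N p : R := (1 + te) * (F N p - ti * F N (invi p)) + imR N p - imc N.
Definition uin N p : R := (1 - ti) * (1 + te) * F N p + imR N p - imc N.

(* The partial sum u_N; [imc N] makes it agree with [H] at infinity. *)
Definition uim N p : R :=
  if re ^+ 2 <= nsq pe p then uext N p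
  else if ri ^+ 2 <= nsq pi_ p then ush N p else uin N p.

Definition duext N p : R[i] :=
  cgrad H p + te%:C * refle p (dF N (inve p)) - ti%:C * refli p (dF N (invi p)).
Definition dush N p : R[i] :=
  (1 + te)%:C * (dF N p - ti%:C * refli p (dF N (invi p))) + imdR N p.
Definition duin N p : R[i] := ((1 - ti) * (1 + te))%:C * dF N p + imdR N p.

Lemma outside_i p : geo -> re ^+ 2 <= nsq pe p -> ri ^+ 2 < nsq pi_ p.
Proof.
move=> g h; rewrite ltNge; apply/negP => h'.
by have := disk_nested g h'; rewrite ltNge h.
Qed.

Lemma geo_ri : geo -> 0 < ri. Proof. by case. Qed.
Lemma geo_re : geo -> 0 < re. Proof. by case=> *; lra. Qed.

Lemma pe_gt0 p : geo -> re ^+ 2 <= nsq pe p -> 0 < nsq pe p.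
Proof. by move=> g; apply: nsq_pos; exact: geo_re. Qed.

Lemma pi_gt0 p : geo -> ri ^+ 2 <= nsq pi_ p -> 0 < nsq pi_ p.
Proof. by move=> g; apply: nsq_pos; exact: geo_ri. Qed.

Lemma harm_Fe N p : geo -> re ^+ 2 <= nsq pe p ->
  harm (fun q => F N (inve q)) p (refle p (dF N (inve p))).
Proof.
move=> g h; apply: harm_refl; first exact: pe_gt0.
by apply: harm_imF => //; exact: inve_gt0.
Qed.

Lemma harm_Fi N p : geo -> ri ^+ 2 <= nsq pi_ p ->
  harm (fun q => F N (invi q)) p (refli p (dF N (invi p))).
Proof.
move=> g h; apply: harm_refl; first exact: pi_gt0.
by apply: harm_imF => //; exact: invi_gt0.
Qed.

Lemma harm_uext N p : geo -> re ^+ 2 <= nsq pe p -> harm (uext N) p (duext N p).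
Proof.
move=> g h; have h' := ltW (outside_i g h).
apply: (harm_eq (harmB (harmB (harmD (hH p) (harmZ te (harm_Fe N g h)))
  (harmZ ti (harm_Fi N g h'))) (harm_cst (imc N) p))).
by rewrite subr0.
Qed.

Lemma harm_ush N p : geo -> nsq pe p <= re ^+ 2 -> ri ^+ 2 <= nsq pi_ p ->
  harm (ush N) p (dush N p).
Proof.
move=> g h h'; have p0 := in_e_gt0 g h.
apply: (harm_eq (harmB (harmD (harmZ (1 + te) (harmB (harm_imF ki ke N g hH p0)
  (harmZ ti (harm_Fi N g h')))) (harm_imR N g p0)) (harm_cst (imc N) p))).
by rewrite subr0.
Qed.

Lemma harm_uin N p : geo -> nsq pi_ p <= ri ^+ 2 -> harm (uin N) p (duin N p).
Proof.
move=> g h; have p0 := in_i_gt0 g h.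
apply: (harm_eq (harmB (harmD (harmZ ((1 - ti) * (1 + te)) (harm_imF ki ke N g hH p0))
  (harm_imR N g p0)) (harm_cst (imc N) p))).
by rewrite subr0.
Qed.

Lemma near_inve_gt0 p : geo -> re ^+ 2 <= nsq pe p -> \forall q \near p, 0 < (inve q).1.
Proof.
move=> g h; have re0 := geo_re g; have lt := re_lt_ce g.
have ce0 : 0 < ce by exact: center_e_gt0.
have h1 : re ^+ 3 / ce < nsq pe p.
  apply: lt_le_trans h; rewrite ltr_pdivrMr// exprSr ltr_pM2l ?exprn_gt0//.
have := near_nsq_gt h1; apply: filterS => q hq.
have n0 : 0 < nsq pe q by apply: lt_trans hq; rewrite divr_gt0 ?exprn_gt0.
have : nsq pe (inve q) < ce * re.
  rewrite nsq_inv// ltr_pdivrMr// (_ : re ^+ 4 = re ^+ 3 / ce * (ce * re)); last first.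
    by field; rewrite gt_eqF.
  by rewrite mulrC ltr_pM2l ?mulr_gt0.
rewrite /nsq/= subr0; move: (inve q).1 (inve q).2 => x y hx.
rewrite ltNge; apply/negP => x0; have := sqr_ge0 y; nra.
Qed.

(** Both sides are gradients of the two sides of [imF_reflect], which agree near p, so uniqueness of
    the gradient suffices. *)
Lemma imdF_reflect N p : geo -> re ^+ 2 <= nsq pe p ->
  refle p (dF N (inve p)) - tau%:C * refli p (dF N (invi p)) =
  refle p (cgrad H (inve p)) - refle p (imdR N (inve p)).
Proof.
move=> g h; have h' := ltW (outside_i g h).
have l1 := harmB (harm_Fe N g h) (harmZ tau (harm_Fi N g h')).
have e0 := pe_gt0 g h.
have l2 := harmB (harm_refl e0 (hH (inve p))) (harm_refl e0 (harm_imR N g (inve_gt0 g h))).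
apply: (is_cgrad_uniq _ (harm_cgrad l2)).
apply: is_cgrad_near (harm_cgrad l1).
near=> q; apply: imF_reflect => //; near: q.
- exact: near_nsq_gt.
- exact: near_nsq_gt (pi_gt0 g h').
- exact: near_inve_gt0.
Unshelve. all: by end_near. Qed.

Lemma uext_ush N p : geo -> nsq pe p = re ^+ 2 -> uext N p = ush N p.
Proof.
move=> g h; have re0 := geo_re g.
have h1 : re ^+ 2 <= nsq pe p by rewrite h.
have := imF_reflect ki ke H N g (pe_gt0 g h1) (pi_gt0 g (ltW (outside_i g h1))) (inve_gt0 g h1).
rewrite /uext /ush (inv_circle re0 h) /imR.
rewrite (_ : tau = ti * te)//; move: (F N p) (F N (invi p)) (H p) (tau ^+ N * _) => a b c d.
move: te ti => x y; lra.
Qed.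

Lemma ush_uin N p : geo -> nsq pi_ p = ri ^+ 2 -> ush N p = uin N p.
Proof.
by move=> g h; rewrite /ush /uin (inv_circle (geo_ri g) h); ring.
Qed.

Lemma uim_cont N : geo -> continuous (uim N).
Proof.
move=> g p; apply: glue_at; first exact: nsq_cont.
- by move=> h; apply: is_cgrad_cont (harm_cgrad (harm_uext N g h)).
- move=> h; apply: glue_at; first exact: nsq_cont.
  + by move=> h'; apply: is_cgrad_cont (harm_cgrad (harm_ush N g h h')).
  + by move=> h'; apply: is_cgrad_cont (harm_cgrad (harm_uin N g h')).
  + exact: ush_uin.
- move=> h; rewrite (uext_ush N g h) ltW ?outside_i// ?h//.
Qed.

Lemma uim_ext N p : geo -> re ^+ 2 < nsq pe p -> \forall q \near p, uext N q = uim N q.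
Proof.
move=> g h; have := near_nsq_gt h; apply: filterS => q hq.
by rewrite /uim (ltW hq).
Qed.

Lemma uim_sh N p : geo -> nsq pe p < re ^+ 2 -> ri ^+ 2 < nsq pi_ p ->
  \forall q \near p, ush N q = uim N q.
Proof.
move=> g h h'; near=> q.
have h1 : nsq pe q < re ^+ 2 by near: q; exact: near_nsq_lt.
have h2 : ri ^+ 2 < nsq pi_ q by near: q; exact: near_nsq_gt.
by rewrite /uim leNgt h1/= (ltW h2).
Unshelve. all: by end_near. Qed.

Lemma uim_in N p : geo -> nsq pi_ p < ri ^+ 2 -> \forall q \near p, uin N q = uim N q.
Proof.
move=> g h; have := near_nsq_lt h; apply: filterS => q hq.
by rewrite /uim leNgt disk_nested ?(ltW hq)//= leNgt hq.
Qed.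

Lemma harm_uim N p : geo -> nsq pi_ p != ri ^+ 2 -> nsq pe p != re ^+ 2 ->
  harm (uim N) p (if re ^+ 2 < nsq pe p then duext N p
                  else if ri ^+ 2 < nsq pi_ p then dush N p else duin N p).
Proof.
move=> g hi he; case: (ltgtP (nsq pe p) (re ^+ 2)) he => // he _; last first.
  by apply: harm_near (uim_ext N g he) _; apply: harm_uext => //; exact: ltW.
case: (ltgtP (nsq pi_ p) (ri ^+ 2)) hi => // hi _; last first.
  by apply: harm_near (uim_sh N g he hi) _; apply: harm_ush => //; exact: ltW.
by apply: harm_near (uim_in N g hi) _; apply: harm_uin => //; exact: ltW.
Qed.

Definition flux_err N (n p : R * R) : R := complex.Re (imdR N p * toC n).

Lemma tau_e_flux : 0 < ke -> ke * (1 + te) = 1 - te.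
Proof. by move=> k0; rewrite /tau_e; field; lra. Qed.

Lemma tau_i_flux : 0 < ki -> 0 < ke -> ke * (1 + ti) = ki * (1 - ti).
Proof. by move=> i0 k0; rewrite /tau_i; field; lra. Qed.

Lemma uim_flux_e N p : geo -> 0 < ke -> nsq pe p = re ^+ 2 -> exists lo li : R,
  [/\ slope (uim N) p (re^-1 *: (p - pe)) lo,
      slope (uim N) p (- (re^-1 *: (p - pe))) (- li) &
      lo - ke * li = (1 - ke) * flux_err N (re^-1 *: (p - pe)) p].
Proof.
move=> g k0 h; have re0 := geo_re g; set n := re^-1 *: (p - pe).
have h1 : re ^+ 2 <= nsq pe p by rewrite h.
have h2 : nsq pe p <= re ^+ 2 by rewrite h.
have h3 := outside_i g h1.
have eu : uim N p = uext N p by rewrite /uim h1.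
exists (complex.Re (duext N p * toC n)), (complex.Re (dush N p * toC n)); split.
- apply: (slope_near _ _ (slope_cgrad (harm_cgrad (harm_uext N g h1)))).
    by rewrite eu.
  have := near_ray_out re0 h; apply: filterS => t ht.
  by rewrite /uim (ltW ht).
- have -> : - complex.Re (dush N p * toC n) = complex.Re (dush N p * toC (- n)).
    by rewrite -ReN; congr complex.Re; rewrite -mulrN; congr (_ * _).
  apply: (slope_near _ _ (slope_cgrad (harm_cgrad (harm_ush N g h2 (ltW h3))))).
    by rewrite eu uext_ush.
  near=> t.
  have ht1 : nsq pe (p + t *: (- n)) < re ^+ 2 by near: t; exact: near_ray_in.
  have ht2 : ri ^+ 2 < nsq pi_ (p + t *: (- n)).
    by near: t; exact: near_ray (near_nsq_gt h3).
  by rewrite /uim leNgt ht1/= (ltW ht2).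
have e := imdF_reflect N g h1.
have {e} : complex.Re (refle p (dF N (inve p)) * toC n) -
    tau * complex.Re (refli p (dF N (invi p)) * toC n) =
    complex.Re (refle p (cgrad H (inve p)) * toC n) - complex.Re (refle p (imdR N (inve p)) * toC n).
  by rewrite -ReRM -!ReB mulrA -!mulrBl e.
rewrite (inv_circle re0 h) !refl_normal// -/n /flux_err /duext /dush (inv_circle re0 h).
rewrite Re_lin3 Re_lin2 refl_normal// -/n.
have := tau_e_flux k0.
have -> : tau = ti * te by [].
move: (complex.Re _) (complex.Re _) (complex.Re _) (complex.Re _) => a b c d.
move: te ti => x y h4 h5.
(* The normal component of grad H, read off from [imdF_reflect]. With ke (1 + te) = 1 - te
   everything except the contribution of [imdR] cancels. *)
have -> : b = a + d + y * x * c by lra.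
by rewrite [ke * (_ + a)]mulrDr [ke * (_ * _)]mulrA h4; ring.
Unshelve. all: by end_near. Qed.

Lemma uim_flux_i N p : geo -> 0 < ki -> 0 < ke -> nsq pi_ p = ri ^+ 2 -> exists lo li : R,
  [/\ slope (uim N) p (ri^-1 *: (p - pi_)) lo,
      slope (uim N) p (- (ri^-1 *: (p - pi_))) (- li) &
      ke * lo - ki * li = (ke - ki) * flux_err N (ri^-1 *: (p - pi_)) p].
Proof.
move=> g i0 k0 h; have ri0 := geo_ri g; set n := ri^-1 *: (p - pi_).
have h1 : ri ^+ 2 <= nsq pi_ p by rewrite h.
have h2 : nsq pi_ p <= ri ^+ 2 by rewrite h.
have h3 := disk_nested g h2.
have eu : uim N p = ush N p by rewrite /uim leNgt h3/= h1.
exists (complex.Re (dush N p * toC n)), (complex.Re (duin N p * toC n)); split.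
- apply: (slope_near _ _ (slope_cgrad (harm_cgrad (harm_ush N g (ltW h3) h1)))).
    by rewrite eu.
  near=> t.
  have ht1 : ri ^+ 2 < nsq pi_ (p + t *: n) by near: t; exact: near_ray_out.
  have ht2 : nsq pe (p + t *: n) < re ^+ 2.
    by near: t; exact: near_ray (near_nsq_lt h3).
  by rewrite /uim leNgt ht2/= (ltW ht1).
- have -> : - complex.Re (duin N p * toC n) = complex.Re (duin N p * toC (- n)).
    by rewrite -ReN; congr complex.Re; rewrite -mulrN; congr (_ * _).
  apply: (slope_near _ _ (slope_cgrad (harm_cgrad (harm_uin N g h2)))).
    by rewrite eu ush_uin.
  near=> t.
  have ht1 : nsq pi_ (p + t *: (- n)) < ri ^+ 2 by near: t; exact: near_ray_in.
  by rewrite /uim leNgt disk_nested ?(ltW ht1)//= leNgt ht1.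
rewrite /flux_err /dush Re_lin2 (inv_circle ri0 h) refl_normal// -/n.
rewrite /duin [X in _ - ki * complex.Re X]mulrDl [X in _ - ki * X]ReD -[X in _ - ki * (complex.Re X + _)]mulrA [X in _ - ki * (X + _)]ReRM.
have := tau_i_flux i0 k0.
move: (complex.Re _) (complex.Re _) => a b.
move: te ti => x y h4.
rewrite [ke * (_ + _)]mulrDr (_ : ke * (_ * _) = ke * (1 + y) * (1 + x) * b); last by ring.
by rewrite h4; ring.
Unshelve. all: by end_near. Qed.

End ImageSolution.

(** * Convergence of the image sums *)

Section SolutionFacts.
Variables (R : realType) (ri re eps ki ke : R) (H u : R * R -> R).
Implicit Types p q : R * R.

Local Notation geo := (geo ri re eps).
Local Notation al := (alpha ri re eps).
Local Notation ci := (center_i ri re eps).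
Local Notation ce := (center_e ri re eps).
Local Notation a2 := (asq ri re eps).
Local Notation b2 := (besq ri re eps).
Local Notation ti := (tau_i ki ke).
Local Notation te := (tau_e ke).
Local Notation tau := (tau ki ke).
Local Notation rho := (rho ri re eps).
Local Notation pe := (center_e ri re eps, 0).
Local Notation pi_ := (center_i ri re eps, 0).
Local Notation inve := (inv (center_e ri re eps) re).
Local Notation invi := (inv (center_i ri re eps) ri).
Local Notation sol := (is_solution ri re eps ki ke H u).

Lemma off_interfacesE p : geo ->
  off_interfaces ri re eps p <-> nsq pi_ p != ri ^+ 2 /\ nsq pe p != re ^+ 2.
Proof.
move=> g; rewrite /off_interfaces /bd_i /bd_e /circle /=; split.
- by move=> h; split; apply/eqP => e; apply: h; [left|right];
    apply/nsq_circle => //; [exact: geo_ri g|exact: geo_re g].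
- move=> [/eqP h1 /eqP h2] [] h; [apply: h1|apply: h2].
    by apply/nsq_circle => //; exact: geo_ri g.
  by apply/nsq_circle => //; exact: geo_re g.
Qed.

Lemma nsq_neq_near (c : R * R) (b : R) p : nsq c p != b -> \forall q \near p, nsq c q != b.
Proof.
case: ltgtP => // h _; [have := near_nsq_lt h|have := near_nsq_gt h]; apply: filterS => q hq.
  by rewrite lt_eqF.
by rewrite gt_eqF.
Qed.

Lemma off_interfaces_open : geo -> open (off_interfaces ri re eps).
Proof.
move=> g; rewrite openE => p /(off_interfacesE _ g)[h1 h2].
rewrite /interior; near=> q; apply/(off_interfacesE _ g); split; near: q; exact: nsq_neq_near.
Unshelve. all: by end_near. Qed.

Lemma sigma_cst p : geo -> off_interfaces ri re eps p -> 0 < ki -> 0 < ke ->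
  exists2 k, 0 < k & \forall q \near p, k = sigma ri re eps ki ke q.
Proof.
move=> g /(off_interfacesE _ g)[h1 h2] i0 k0.
have dE q : (B_e ri re eps q) = (nsq pe q < re ^+ 2) :> Prop.
  by rewrite /B_e /disk /= nsq_disk//; exact: geo_re g.
have dI q : (B_i ri re eps q) = (nsq pi_ q < ri ^+ 2) :> Prop.
  by rewrite /B_i /disk /= nsq_disk//; exact: geo_ri g.
have mE q : (q \in B_e ri re eps) = (nsq pe q < re ^+ 2).
  by apply/idP/idP; rewrite inE dE.
have mI q : (q \in B_i ri re eps) = (nsq pi_ q < ri ^+ 2).
  by apply/idP/idP; rewrite inE dI.
have sE q : sigma ri re eps ki ke q =
    ki * ((nsq pi_ q < ri ^+ 2)%R)%:R + ke * ((nsq pe q < re ^+ 2)%R && ~~ (nsq pi_ q < ri ^+ 2)%R)%:R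
    + (~~ (nsq pe q < re ^+ 2)%R)%:R.
  by rewrite /sigma !indicE in_setD in_setC mE mI andbC.
case: (ltgtP (nsq pe p) (re ^+ 2)) h2 => // h2 _; last first.
  exists 1 => //; near=> q; rewrite sE.
  have h : re ^+ 2 < nsq pe q by near: q; exact: near_nsq_gt.
  have -> : (nsq pe q < re ^+ 2) = false by apply/negbTE; rewrite -leNgt ltW.
  have -> : (nsq pi_ q < ri ^+ 2) = false.
    by apply/negbTE; rewrite -leNgt (ltW (outside_i g (ltW h))).
  by rewrite !mulr0 !add0r.
case: (ltgtP (nsq pi_ p) (ri ^+ 2)) h1 => // h1 _; last first.
  exists ke => //; near=> q; rewrite sE.
  have -> : nsq pe q < re ^+ 2 by near: q; exact: near_nsq_lt.
  have h : ri ^+ 2 < nsq pi_ q by near: q; exact: near_nsq_gt.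
  have -> : (nsq pi_ q < ri ^+ 2) = false by apply/negbTE; rewrite -leNgt ltW.
  by rewrite mulr0 mulr1 add0r addr0.
exists ki => //; near=> q; rewrite sE.
have h : nsq pi_ q < ri ^+ 2 by near: q; exact: near_nsq_lt.
by rewrite h (disk_nested g (ltW h))/= mulr1 mulr0 !addr0.
Unshelve. all: by end_near. Qed.

Lemma sol_harm p : geo -> 0 < ki -> 0 < ke -> sol -> off_interfaces ri re eps p ->
  harm u p (cgrad u p).
Proof.
move=> g i0 k0 [uc [u2 ueq] _ _ _] op; have oo := off_interfaces_open g.
have [u1 u1x u1y] := u2.
split; first exact: C1_is_cgrad oo u1 op.
have [k kpos ks] := sigma_cst g op i0 k0.
have gx := C1_is_cgrad oo u1x op; have gy := C1_is_cgrad oo u1y op.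
have hx : is_cgrad (fun q => sigma ri re eps ki ke q * dx u q) p (k%:C * cgrad (dx u) p).
  by apply: is_cgrad_near (is_cgradZ k gx); move: ks; apply: filterS => q ->.
have hy : is_cgrad (fun q => sigma ri re eps ki ke q * dy u q) p (k%:C * cgrad (dy u) p).
  by apply: is_cgrad_near (is_cgradZ k gy); move: ks; apply: filterS => q ->.
apply: laplacian_eq (laplacian_C2 oo u2 op) _.
have := ueq p op.
have -> : dx (fun p' => sigma ri re eps ki ke p' * dx u p') p = k * dx (dx u) p.
  by have := congr1 (@complex.Re R) hx.2; rewrite ReRM.
have -> : dy (fun p' => sigma ri re eps ki ke p' * dy u p') p = k * dy (dy u) p.
  by have := congr1 (@complex.Im R) hy.2; rewrite ImRM /= mulrN => /oppr_inj.
by rewrite -mulrDr => /eqP; rewrite mulf_eq0 gt_eqF//= => /eqP.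
Qed.

Lemma slope_normal (s : R) (c : R * R) (r : R) p l : 
  (s = 1 \/ s = -1) -> {for p, continuous u} ->
  (\forall t \near (0 : R)^'+, is_cgrad u (p + t *: (s *: (r^-1 *: (p - c))))
     (cgrad u (p + t *: (s *: (r^-1 *: (p - c)))))) ->
  normal_deriv_cvg s u c r p l -> slope u p (s *: (r^-1 *: (p - c))) (s * l).
Proof.
move=> s1 uc ug ul; apply: (slope_of_gradient uc ug).
have e : (fun t : R => complex.Re (cgrad u (p + t *: (s *: (r^-1 *: (p - c)))) * toC (s *: (r^-1 *: (p - c))))) =
   (fun t : R => s * dot (grad u (p.1 + s * t * ((p.1 - c.1) / r), p.2 + s * t * ((p.2 - c.2) / r)))
       ((p.1 - c.1) / r, (p.2 - c.2) / r)).
  apply/funext => t.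
  have -> : p + t *: (s *: (r^-1 *: (p - c))) = (p.1 + s * t * ((p.1 - c.1) / r), p.2 + s * t * ((p.2 - c.2) / r)).
    by apply: injective_projections; rewrite /= /GRing.scale/=; ring.
  rewrite ReM /dot /grad /=; rewrite /GRing.scale/=.
  by rewrite /GRing.scale/=; ring.
rewrite e; exact: cvgM (cvg_cst s) ul.
Qed.

Lemma sol_flux_e p : geo -> 0 < ki -> 0 < ke -> sol -> nsq pe p = re ^+ 2 -> exists lo li : R,
  [/\ slope u p (re^-1 *: (p - pe)) lo,
      slope u p (- (re^-1 *: (p - pe))) (- li) & lo - ke * li = 0].
Proof.
move=> g i0 k0 S h; have re0 := geo_re g; have [uc _ ue _ _] := S.
have be : bd_e ri re eps p by apply/nsq_circle.
have [gp [gm [h1 h2 h3]]] := ue p be; exists gp, gm; split; last by rewrite h3 subrr.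
- have := @slope_normal 1 pe re p gp (or_introl erefl) (uc p) _ h1; rewrite scale1r mul1r; apply.
  near=> t; apply: harm_cgrad; apply: sol_harm => //; apply/off_interfacesE => //; split.
    have : ri ^+ 2 < nsq pi_ (p + t *: (re^-1 *: (p - pe))).
      near: t; have h0 : ri ^+ 2 < nsq pi_ p by apply: outside_i => //; rewrite h.
      exact: near_ray (near_nsq_gt h0).
    by move=> hh; rewrite gt_eqF.
  have : re ^+ 2 < nsq pe (p + t *: (re^-1 *: (p - pe))) by near: t; exact: near_ray_out.
  by move=> hh; rewrite gt_eqF.
have := @slope_normal (-1) pe re p gm (or_intror erefl) (uc p) _ h2; rewrite scaleN1r mulN1r; apply.
near=> t; apply: harm_cgrad; apply: sol_harm => //; apply/off_interfacesE => //; split.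
  have : ri ^+ 2 < nsq pi_ (p + t *: (- (re^-1 *: (p - pe)))).
    near: t; have h0 : ri ^+ 2 < nsq pi_ p by apply: outside_i => //; rewrite h.
      exact: near_ray (near_nsq_gt h0).
  by move=> hh; rewrite gt_eqF.
have : nsq pe (p + t *: (- (re^-1 *: (p - pe)))) < re ^+ 2 by near: t; exact: near_ray_in.
by move=> hh; rewrite lt_eqF.
Unshelve. all: by end_near. Qed.

Lemma sol_flux_i p : geo -> 0 < ki -> 0 < ke -> sol -> nsq pi_ p = ri ^+ 2 -> exists lo li : R,
  [/\ slope u p (ri^-1 *: (p - pi_)) lo,
      slope u p (- (ri^-1 *: (p - pi_))) (- li) & ke * lo - ki * li = 0].
Proof.
move=> g i0 k0 S h; have ri0 := geo_ri g; have [uc _ _ ui _] := S.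
have be : bd_i ri re eps p by apply/nsq_circle.
have h' : nsq pe p < re ^+ 2 by apply: disk_nested => //; rewrite h.
have [gp [gm [h1 h2 h3]]] := ui p be; exists gp, gm; split; last by rewrite h3 subrr.
- have := @slope_normal 1 pi_ ri p gp (or_introl erefl) (uc p) _ h1; rewrite scale1r mul1r; apply.
  near=> t; apply: harm_cgrad; apply: sol_harm => //; apply/off_interfacesE => //; split.
    have : ri ^+ 2 < nsq pi_ (p + t *: (ri^-1 *: (p - pi_))) by near: t; exact: near_ray_out.
    by move=> hh; rewrite gt_eqF.
  have : nsq pe (p + t *: (ri^-1 *: (p - pi_))) < re ^+ 2.
    near: t; exact: near_ray (near_nsq_lt h').
  by move=> hh; rewrite lt_eqF.
have := @slope_normal (-1) pi_ ri p gm (or_intror erefl) (uc p) _ h2; rewrite scaleN1r mulN1r; apply.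
near=> t; apply: harm_cgrad; apply: sol_harm => //; apply/off_interfacesE => //; split.
  have : nsq pi_ (p + t *: (- (ri^-1 *: (p - pi_)))) < ri ^+ 2 by near: t; exact: near_ray_in.
  by move=> hh; rewrite lt_eqF.
have : nsq pe (p + t *: (- (ri^-1 *: (p - pi_)))) < re ^+ 2.
  near: t; exact: near_ray (near_nsq_lt h').
by move=> hh; rewrite lt_eqF.
Unshelve. all: by end_near. Qed.

End SolutionFacts.

(** * Bounds for fixed tau, uniform in the truncation *)

Section UniformBounds.
Variables (R : realType) (ri re eps ki ke : R) (H : R * R -> R).
Implicit Types p q : R * R.

Local Notation geo := (geo ri re eps).
Local Notation al := (alpha ri re eps).
Local Notation ci := (center_i ri re eps).
Local Notation ce := (center_e ri re eps).
Local Notation a2 := (asq ri re eps).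
Local Notation b2 := (besq ri re eps).
Local Notation ti := (tau_i ki ke).
Local Notation te := (tau_e ke).
Local Notation tau := (tau ki ke).
Local Notation rho := (rho ri re eps).
Local Notation pe := (center_e ri re eps, 0).
Local Notation pi_ := (center_i ri re eps, 0).
Local Notation inve := (inv (center_e ri re eps) re).
Local Notation invi := (inv (center_i ri re eps) ri).
Local Notation F := (imF ri re eps ki ke H).
Local Notation dF := (imdF ri re eps ki ke H).

Lemma cgrad_bound (f : R * R -> R) (r : R) : 0 <= r -> C1_on setT f ->
  exists2 B, 0 <= B & forall p, `|p| <= r -> modc (cgrad f p) <= B.
Proof.
move=> r0 h.
have cx : continuous (dx f) by move=> p; have [_ _ h1 _] := h p I.
have cy : continuous (dy f) by move=> p; have [_ _ _ h1] := h p I.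
have c : continuous (fun p => `|dx f p| + `|dy f p|).
  move=> p; apply: cvgD; [exact: cvg_norm (cx p)|exact: cvg_norm (cy p)].
have [p0 _ hp0] := max_on_box r0 c.
exists (`|dx f p0| + `|dy f p0|); first by rewrite addr_ge0.
move=> p hp; apply: (le_trans (modc_le_ReIm _)); rewrite /= normrN; exact: hp0.
Qed.

Lemma gradient_lipschitz (f : R * R -> R) (p v : R * R) (B : R) :
  (forall t : R, `|t| <= 1 -> exists2 c, is_cgrad f (p + t *: v) c & modc c <= B) ->
  `|f (p + v) - f p| <= B * modc (toC v).
Proof.
move=> h.
have hd (t : R) : `|t| <= `|1 : R| -> is_derive t 1 (fun x => f (p + x *: v)) (complex.Re (cgrad f (p + t *: v) * toC v)).
  rewrite normr1 => /h[c hc _]; have := hc.2 => e; rewrite -e in hc.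
  exact: is_derive_cgrad.
have [t] := MVT0 hd; rewrite normr1 => /h[c hc cB].
rewrite scale1r scale0r addr0 mulr1 => ->.
apply: (le_trans (Re_le_modc _)); rewrite modcM hc.2.
by rewrite ler_wpM2r ?modc_ge0.
Qed.

(** |p| <= re + ce <= 2 re + alpha. The point is that the box of size 3 re, on which H is bounded,
    can be fixed before eps. *)
Lemma in_e_modc p : geo -> al <= ri -> nsq pe p <= re ^+ 2 -> modc (toC p) <= 3 * re.
Proof.
move=> g ai h; have re0 := geo_re g; have := center_e_le g => /andP[_ c1].
have lt : ri < re by case: g.
have c0 := center_e_gt0 g.
have h1 : modc (toC (p - pe)) <= re.
  rewrite -(@ler_pXn2r _ 2) ?nnegrE ?modc_ge0 ?(ltW re0)//.
  by rewrite -enormE -nsqE.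
have -> : toC p = toC (p - pe) + toC pe by rewrite -toCD subrK.
apply: (le_trans (modcD _ _)).
have -> : modc (toC pe) = ce by rewrite -[toC _]/(ce%:C) modcR gtr0_norm.
lra.
Qed.

Lemma in_e_norm p : geo -> al <= ri -> nsq pe p <= re ^+ 2 -> `|p| <= 3 * re.
Proof. by move=> g ai h; apply: le_trans (norm_modc _) (in_e_modc g ai h). Qed.

Lemma Tm_in_e s p : geo -> 0 <= s <= 1 -> nsq pe p <= re ^+ 2 -> nsq pe (Tm al s p) <= re ^+ 2.
Proof.
move=> g; apply: Tm_disk; [exact: alpha_gt0|exact: center_e_gt0|exact: alpha_lt_e| |exact: re_lt_ce|exact: center_e_sqr].
exact: geo_re g.
Qed.

Lemma tau_lt1 : admissible ki ke -> [/\ `|ti| < 1, `|te| < 1 & `|tau| < 1].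
Proof.
case=> i0 k0 _ _.
have h1 : `|ti| < 1.
  rewrite /tau_i normrM normfV (gtr0_norm (addr_gt0 i0 k0)) ltr_pdivrMr ?addr_gt0// mul1r.
  by rewrite ltr_norml; apply/andP; split; lra.
have h2 : `|te| < 1.
  rewrite /tau_e normrM normfV (gtr0_norm (addr_gt0 ltr01 k0)) ltr_pdivrMr ?addr_gt0// mul1r.
  by rewrite ltr_norml; apply/andP; split; lra.
split=> //; rewrite normrM.
by rewrite (le_lt_trans _ h1)// ler_piMr// ltW.
Qed.

(** Uniform in N but not in tau. It suffices for the convergence of u_N, and in the form [imdF_tau]
    it bounds every contribution that carries a factor 1 - |tau|. *)
Lemma imdF_bound B N p : geo -> al <= ri -> `|tau| < 1 -> 0 <= B ->
  (forall q, `|q| <= 3 * re -> modc (cgrad H q) <= B) ->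
  nsq pe p <= re ^+ 2 -> modc (dF N p) <= B * 4 / (1 - `|tau|).
Proof.
move=> g ai t1 B0 hB hp; apply: (le_trans (modc_sum _)).
have w1 : modc (wr al (toC p)) < 1 by apply: wr_lt1; [exact: alpha_gt0|exact: in_e_gt0 g hp].
apply: (@le_trans _ _ (\sum_(m < N) `|tau| ^+ m * (B * 4))).
  apply: ler_sum => m _; rewrite modcM modcR normrX ler_wpM2l ?exprn_ge0// modcM.
  apply: ler_pM; rewrite ?modc_ge0//.
    by apply: hB; apply: in_e_norm => //; apply: Tm_in_e => //; exact: rhoX.
  have r01 := rhoX m g; apply: (le_trans (kG_le w1 r01)).
  by rewrite ler_piMr//; case/andP: r01.
rewrite -mulr_suml mulrC ler_wpM2l ?mulr_ge0//.
by apply: geo_sum_le; rewrite normr_ge0.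
Qed.

Lemma imdR_bound B N p : geo -> al <= ri -> 0 <= B ->
  (forall q, `|q| <= 3 * re -> modc (cgrad H q) <= B) ->
  nsq pe p <= re ^+ 2 -> modc (imdR ri re eps ki ke H N p) <= `|tau| ^+ N * (B * 4).
Proof.
move=> g ai B0 hB hp.
have w1 : modc (wr al (toC p)) < 1 by apply: wr_lt1; [exact: alpha_gt0|exact: in_e_gt0 g hp].
rewrite /imdR modcM modcR normrX ler_wpM2l ?exprn_ge0// modcM.
apply: ler_pM; rewrite ?modc_ge0//.
  by apply: hB; apply: in_e_norm => //; apply: Tm_in_e => //; exact: rhoX.
have r01 := rhoX N g; apply: (le_trans (kG_le w1 r01)).
by rewrite ler_piMr//; case/andP: r01.
Qed.

(** The disk is star-shaped about its centre, so the gradient bound may be used along the radius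
    through p. *)
Lemma imF_lipschitz B (c r : R) N p : geo -> (forall q, harm H q (cgrad H q)) ->
  (forall q, nsq (c, 0) q <= r ^+ 2 -> nsq pe q <= re ^+ 2) ->
  (forall q, nsq pe q <= re ^+ 2 -> modc (dF N q) <= B) -> nsq (c, 0) p <= r ^+ 2 ->
  `|F N p - F N (c, 0)| <= B * modc (toC (p - (c, 0))).
Proof.
move=> g hH hc hB hp.
rewrite -{1}(subrK (c, 0) p) addrC [_ + _]addrC -[(_ - _) + (c, 0)]addrC.
apply: gradient_lipschitz => t t1.
have hq : nsq pe ((c, 0) + t *: (p - (c, 0))) <= re ^+ 2.
  apply: hc; apply: le_trans hp.
  have -> : nsq (c, 0) ((c, 0) + t *: (p - (c, 0))) = t ^+ 2 * nsq (c, 0) p.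
    by rewrite /nsq/= /GRing.scale/=; ring.
  by rewrite ler_piMl ?nsq_ge0// -real_normK ?num_real// expr_le1.
exists (dF N ((c, 0) + t *: (p - (c, 0)))); last exact: hB.
by apply: harm_cgrad; apply: harm_imF => //; exact: in_e_gt0 hq.
Qed.

End UniformBounds.

(** * Convergence by the maximum principle *)

Section Limit.
Variables (R : realType) (ri re eps ki ke : R) (H u : R * R -> R).
Implicit Types p q : R * R.

Local Notation geo := (geo ri re eps).
Local Notation al := (alpha ri re eps).
Local Notation ci := (center_i ri re eps).
Local Notation ce := (center_e ri re eps).
Local Notation a2 := (asq ri re eps).
Local Notation b2 := (besq ri re eps).
Local Notation ti := (tau_i ki ke).
Local Notation te := (tau_e ke).
Local Notation tau := (tau ki ke).
Local Notation rho := (rho ri re eps).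
Local Notation pe := (center_e ri re eps, 0).
Local Notation pi_ := (center_i ri re eps, 0).
Local Notation inve := (inv (center_e ri re eps) re).
Local Notation invi := (inv (center_i ri re eps) ri).
Local Notation F := (imF ri re eps ki ke H).
Local Notation dF := (imdF ri re eps ki ke H).
Local Notation uim := (uim ri re eps ki ke H).

Lemma dist_inv (c r : R) p : 0 < r -> r ^+ 2 <= nsq (c, 0) p ->
  modc (toC (inv c r p - (c, 0))) = r ^+ 2 / modc (toC (p - (c, 0))).
Proof.
move=> r0 h; have n0 : 0 < nsq (c, 0) p := nsq_pos r0 h.
have m0 : 0 < modc (toC (p - (c, 0))).
  by rewrite lt_def modc_ge0 andbT; apply: contraTneq n0 => e; rewrite nsqE enormE e expr0n ltxx.
apply/eqP; rewrite -(@eqrXn2 _ 2) ?modc_ge0 ?divr_ge0 ?exprn_ge0 ?(ltW r0) ?modc_ge0//; apply/eqP.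
rewrite -[in LHS]enormE -nsqE nsq_inv// expr_div_n -exprM; congr (_ / _).
by rewrite nsqE enormE.
Qed.

(** The inversions send p to within O(1 / |p|) of the centres, F is Lipschitz in the disk, and [imc]
    subtracts exactly its values at the centres. The bound does not depend on N, so the box in
    [uim_limit] can be chosen before N. *)
Lemma uim_far B1 N p : geo -> (forall q, harm H q (cgrad H q)) -> admissible ki ke -> 0 <= B1 ->
  (forall q, nsq pe q <= re ^+ 2 -> modc (dF N q) <= B1) ->
  2 * ce <= `|p| -> re ^+ 2 <= nsq pe p ->
  `|uim N p - H p| <= 4 * B1 * re ^+ 2 / `|p|.
Proof.
move=> g hH adm B0 hB hp hn.
have [t1 t2 _] := tau_lt1 adm.
have re0 := geo_re g; have ri0 := geo_ri g; have ce0 := center_e_gt0 g.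
have hi := ltW (outside_i g hn).
have he1 : nsq pe (inve p) <= re ^+ 2 by exact: inv_in.
have hi1 : nsq pi_ (invi p) <= ri ^+ 2 by exact: inv_in.
have p0 : 0 < `|p| by apply: lt_le_trans hp; rewrite mulr_gt0.
have near (c : R) : 0 < c -> c <= ce -> `|p| / 2 <= modc (toC (p - (c, 0))).
  move=> c0 cc; apply: le_trans (norm_modc _).
  have : `|p| <= `|p - (c, 0)| + `|(c, 0) : R * R| by rewrite -{1}(subrK (c, 0) p) ler_normD.
  have -> : `|(c, 0) : R * R| = c.
    by rewrite prod_normE /= normr0 gtr0_norm// max_l// ltW.
  lra.
have bnd (c r : R) : 0 < r -> r <= re -> r ^+ 2 <= nsq (c, 0) p -> 0 < c -> c <= ce ->
    modc (toC (inv c r p - (c, 0))) <= 2 * re ^+ 2 / `|p|.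
  move=> r0 rre hr c0 cc; rewrite dist_inv//.
  have n := near c c0 cc.
  have n0 : 0 < modc (toC (p - (c, 0))) by apply: lt_le_trans n; rewrite divr_gt0.
  rewrite [leRHS](_ : _ = re ^+ 2 / (`|p| / 2)); last by field; rewrite gt_eqF.
  apply: ler_pM; rewrite ?exprn_ge0 ?invr_ge0 ?modc_ge0 ?(ltW r0)//.
    by rewrite ler_pXn2r ?nnegrE ?(ltW r0) ?(ltW re0).
  by rewrite lef_pV2 ?posrE// divr_gt0.
have rre : ri <= re by case: g => *; exact: ltW.
have b1 := bnd ce re re0 (lexx _) hn ce0 (lexx _).
have b2 := bnd ci ri ri0 rre hi (center_i_gt0 g) (ltW (center_lt g)).
have l1 := imF_lipschitz (B := B1) (N := N) g hH (fun q h => h) hB he1.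
have l2 := imF_lipschitz (B := B1) (N := N) g hH (fun q h => ltW (disk_nested g h)) hB hi1.
have -> : uim N p - H p = te * (F N (inve p) - F N pe) - ti * (F N (invi p) - F N pi_).
  by rewrite /uim hn /uext /imc; ring.
apply: (le_trans (ler_normB _ _)); rewrite (normrM te) (normrM ti).
have := modc_ge0 (toC (inve p - pe)); have := modc_ge0 (toC (invi p - pi_)) => m1 m2.
have {}l1 : `|te| * `|F N (inve p) - F N pe| <= B1 * (2 * re ^+ 2 / `|p|).
  apply: (@le_trans _ _ (1 * (B1 * modc (toC (inve p - pe))))).
    by apply: ler_pM => //; exact: ltW.
  by rewrite mul1r ler_wpM2l.
have {}l2 : `|ti| * `|F N (invi p) - F N pi_| <= B1 * (2 * re ^+ 2 / `|p|).
  apply: (@le_trans _ _ (1 * (B1 * modc (toC (invi p - pi_))))).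
    by apply: ler_pM => //; exact: ltW.
  by rewrite mul1r ler_wpM2l.
apply: (le_trans (lerD l1 l2)).
by rewrite le_eqVlt; apply/orP; left; apply/eqP; field; rewrite gt_eqF.
Qed.

Lemma normal_toC (c : R * R) (r : R) p : 0 < r -> nsq c p = r ^+ 2 ->
  modc (toC (r^-1 *: (p - c))) = 1.
Proof.
move=> r0 h; have := normal_unit r0 h => e.
apply/eqP; rewrite -(@eqrXn2 _ 2) ?modc_ge0//; apply/eqP.
by rewrite sqr_modc expr1n -e.
Qed.

(** The order of choices matters: the box first, from the decay of u - H and of u_N - H; then the
    barrier constant K, which depends on the box but not on the function; then the admissible defect
    eta = d / (K + 1); and N last, so that the flux defect is below eta. *)
Lemma uim_limit : geo -> al <= ri -> admissible ki ke -> entire_harmonic H ->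
  is_solution ri re eps ki ke H u -> forall p, (fun N => uim N p) @ \oo --> u p.
Proof.
move=> g ai adm eH S p; have hH := harmonic_harm eH.
have [i0 k0 _ _] := adm; have [t1 t2 t3] := tau_lt1 adm.
have re0 := geo_re g; have ri0 := geo_ri g; have ce0 := center_e_gt0 g.
have [B B0 hB] : exists2 B, 0 <= B & forall q, `|q| <= 3 * re -> modc (cgrad H q) <= B.
  by apply: cgrad_bound; [rewrite mulr_ge0// ltW|have [[]] := eH].
have [B1 B10 hB1] : exists2 B1, 0 <= B1 & forall N q, nsq pe q <= re ^+ 2 -> modc (dF N q) <= B1.
  exists (B * 4 / (1 - `|tau|)); last by move=> N q; exact: imdF_bound.
  by rewrite divr_ge0 ?mulr_ge0// subr_ge0 ltW.
have [uc _ _ _ [M [rho0 [rho00 hM]]]] := S.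
apply/cvgrPdist_le => e e0; pose d := e / 2; have d0 : 0 < d by rewrite divr_gt0.
pose A := `|M| + 4 * B1 * re ^+ 2.
have A0 : 0 <= A by rewrite addr_ge0 ?mulr_ge0 ?exprn_ge0 ?(ltW re0).
(* [rho0] and [2 * ce] put the boundary of the box where the two decay estimates hold, and [A / d]
   makes their sum at most d there. *)
pose r := `|p| + rho0 + 2 * ce + A / d.
have Ad0 : 0 <= A / d by rewrite divr_ge0 ?(ltW d0).
have pn0 := normr_ge0 p.
have r0 : 0 < r by rewrite /r; lra.
have [K K0 hK] := @maximum_principle R pi_ pe ri re ki ke r ri0 re0 i0 k0 r0
  (fun q => @disk_nested R ri re eps q g).
pose eta := d / (K + 1).
have K10 : 0 < K + 1 by rewrite ltr_wpDl.
have eta0 : 0 < eta by rewrite divr_gt0.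
pose A2 := B * 4 * (`|1 - ke| + `|ke - ki|).
have A20 : 0 <= A2 by rewrite mulr_ge0 ?mulr_ge0 ?addr_ge0.
have hN : \forall N \near \oo, `|tau| ^+ N * A2 <= eta.
  have c : (fun N => `|tau| ^+ N * A2) @ \oo --> 0 * A2.
    apply: cvgM; last exact: cvg_cst.
    by apply: cvg_expr; rewrite normr_id.
  rewrite mul0r in c; move/cvgrPdist_le: c => /(_ _ eta0); apply: filterS => N.
  by rewrite sub0r normrN ger0_norm// mulr_ge0// exprn_ge0.
have rA : A / r <= d.
  rewrite ler_pdivrMr// mulrC -ler_pdivrMr// /r; lra.
have far N q : `|q| = r -> `|u q - uim N q| <= d.
  move=> qr; have q0 : 0 < `|q| by rewrite qr.
  have mq : `|q| <= modc (toC q) := norm_modc q.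
  have u1 : `|u q - H q| <= `|M| / r.
    have := hM q; rewrite enormE => /(_ _) h; apply: (le_trans (h _)).
      by apply: le_trans mq; rewrite qr /r; lra.
    apply: (@le_trans _ _ (`|M| * (modc (toC q))^-1)).
      by rewrite ler_wpM2r ?invr_ge0 ?modc_ge0// ler_norm.
    by rewrite ler_wpM2l// -qr lef_pV2 ?posrE//; exact: lt_le_trans mq.
  have hn : re ^+ 2 <= nsq pe q.
    have h : ce <= modc (toC (q - pe)).
      apply: le_trans (norm_modc _).
      have : `|q| <= `|q - pe| + `|pe : R * R| by rewrite -{1}(subrK pe q) ler_normD.
      have -> : `|pe : R * R| = ce.
        by rewrite prod_normE /= normr0 gtr0_norm// max_l// ltW.
      rewrite qr /r; lra.
    rewrite nsqE enormE ler_pXn2r ?nnegrE ?modc_ge0 ?(ltW re0)//.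
    exact: le_trans (ltW (re_lt_ce g)) h.
  have q2 : 2 * ce <= `|q| by rewrite qr /r; lra.
  have u2 := uim_far g hH adm B10 (hB1 N) q2 hn.
  have -> : u q - uim N q = (u q - H q) - (uim N q - H q) by ring.
  apply: (le_trans (ler_normB _ _)); apply: le_trans rA.
  by rewrite /A mulrDl; apply: lerD u1 _; rewrite -qr.
have pr : `|p| <= r by rewrite /r; lra.
have off_lap N q : nsq pi_ q != ri ^+ 2 -> nsq pe q != re ^+ 2 ->
    laplacian u q 0 /\ laplacian (uim N) q 0.
  move=> h1 h2; split.
    by apply: (sol_harm g i0 k0 S _).2; apply/off_interfacesE.
  by have := (harm_uim ki ke hH N g h1 h2).2.
move: hN; apply: filterS => N hN.
have small (x : R) (n q : R * R) : modc (toC n) = 1 -> nsq pe q <= re ^+ 2 ->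
    `|x| <= `|1 - ke| + `|ke - ki| -> `|x * flux_err ri re eps ki ke H N n q| <= eta.
  move=> n1 hq hx; apply: le_trans hN; rewrite normrM.
  have f1 : `|flux_err ri re eps ki ke H N n q| <= `|tau| ^+ N * (B * 4).
    apply: (le_trans (Re_le_modc _)); rewrite modcM n1 mulr1.
    exact: imdR_bound.
  rewrite /A2 mulrA mulrC; apply: ler_pM => //.
(* The sign s applies the one-sided principle to u - u_N and to its negative. *)
have W (s : R) : (s = 1 \/ s = -1) -> s * (u p - uim N p) <= d + eta * K.
  move=> s1.
  apply: (hK (fun q => s * (u q - uim N q)) eta d eta0 _ _ _ _ _ p pr).
  - move=> q; apply: cvgM; first exact: cvg_cst.
    by apply: cvgB; [exact: uc|exact: uim_cont].
  - move=> q h1 h2; have [l1 l2] := off_lap N q h1 h2.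
    by apply: laplacian_eq (laplacianZ s (laplacianB l1 l2)) _; rewrite subrr mulr0.
  - move=> q hq; have [lo [li [a1 a2 a3]]] := sol_flux_e g i0 k0 S hq.
    have [lo' [li' [b1 b2 b3]]] := uim_flux_e ki hH N g k0 hq.
    exists (s * (lo - lo')), (s * (li - li')); split.
    + exact: (slopeZ (k := s) (slopeB a1 b1)).
    + rewrite (_ : - (s * (li - li')) = s * (- li - - li')); last by ring.
      exact: (slopeZ (k := s) (slopeB a2 b2)).
    + have e1 : s * (lo - lo') - ke * (s * (li - li')) =
        s * ((lo - ke * li) - (lo' - ke * li')) by ring.
      rewrite e1 a3 b3 sub0r.
      have := small (1 - ke) (re^-1 *: (q - pe)) q (normal_toC re0 hq).
      rewrite hq => /(_ (lexx _)); rewrite lerDl normr_ge0 => /(_ isT).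
      rewrite ler_norml => /andP[h1 h2].
      by case: s1 => ->; rewrite ?mul1r ?mulN1r ?opprK// lerN2.
  - move=> q hq; have [lo [li [a1 a2 a3]]] := sol_flux_i g i0 k0 S hq.
    have [lo' [li' [b1 b2 b3]]] := uim_flux_i hH N g i0 k0 hq.
    exists (s * (lo - lo')), (s * (li - li')); split.
    + exact: (slopeZ (k := s) (slopeB a1 b1)).
    + rewrite (_ : - (s * (li - li')) = s * (- li - - li')); last by ring.
      exact: (slopeZ (k := s) (slopeB a2 b2)).
    + have e1 : ke * (s * (lo - lo')) - ki * (s * (li - li')) =
        s * ((ke * lo - ki * li) - (ke * lo' - ki * li')) by ring.
      rewrite e1 a3 b3 sub0r.
      have hq' : nsq pe q <= re ^+ 2 by apply: ltW; apply: disk_nested => //; rewrite hq.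
      have := small (ke - ki) (ri^-1 *: (q - pi_)) q (normal_toC ri0 hq) hq'.
      rewrite lerDr normr_ge0 => /(_ isT).
      rewrite ler_norml => /andP[h1 h2].
      by case: s1 => ->; rewrite ?mul1r ?mulN1r ?opprK// lerN2.
  - move=> q hq; have := far N q hq; rewrite ler_norml => /andP[h1 h2].
    by case: s1 => ->; rewrite ?mul1r ?mulN1r//; lra.
have etaK : eta * K <= d.
  by rewrite /eta -mulrA ler_piMr ?(ltW d0)// mulrC ler_pdivrMr// mul1r; lra.
have w1 := W 1 (or_introl erefl); have w2 := W (-1) (or_intror erefl).
rewrite mul1r in w1; rewrite mulN1r in w2.
have e2 : e = d + d by rewrite /d; field.
by rewrite ler_norml e2; apply/andP; split; lra.
Qed.

End Limit.

(** * Gradient estimates *)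

Section Profile.
Variable R : realType.
Implicit Types (w z : R[i]) (beta c d : R).

Lemma RCM (a b : R) : (a * b)%:C = a%:C * b%:C :> R[i].
Proof. exact: rmorphM. Qed.

(* The continuum limit of [c * \sum_m tau ^ m * kG w (e^(- c m))], [tau = e^(- beta c)]. *)
Definition V_fun w beta : R[i] := (1 + w) ^+ 2 * J_fun w beta.

Lemma V_fun_le w beta : modc w < 1 -> 0 <= beta -> modc (V_fun w beta) <= 8.
Proof.
move=> w1 b0; rewrite /V_fun -kG_J//.
apply: (le_trans (Cint_le (kG_dominated w1 b0))).
by rewrite -natrM.
Qed.

Lemma expR_tail c (e : R) : 0 < c -> 0 < e ->
  \forall N \near \oo, expR (- (N%:R * c)) <= e.
Proof.
move=> c0 e0.
have h : (fun N => expR (- c) ^+ N) @ \oo --> (0 : R).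
  by apply: cvg_expr; rewrite ger0_norm ?expR_ge0// expR_lt1 oppr_lt0.
move/cvgrPdist_le: h => /(_ _ e0); apply: filterS => N.
rewrite sub0r normrN ger0_norm ?exprn_ge0 ?expR_ge0//.
by rewrite -mulrN expRM_natl.
Qed.

Lemma limit_le (x y k c : R) : 0 < c -> 0 <= k ->
  (forall N : nat, x <= y + k * expR (- (N%:R * c))) -> x <= y.
Proof.
move=> c0 k0 h; apply/ler_addgt0Pr => e e0.
have [N _ hN] := expR_tail c0 (divr_gt0 e0 (ltr_wpDl k0 ltr01)).
apply: (le_trans (h N)); rewrite lerD2l.
apply: (@le_trans _ _ (k * (e / (k + 1)))); first by rewrite ler_wpM2l// hN/=.
by rewrite mulrCA ler_piMr ?(ltW e0)// ler_pdivrMr ?mul1r; lra.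
Qed.

(** Read off from the discrete sum S: (1 - tau) |S| <= 4 by the geometric series, and c S differs
    from V by 62 c; hence 66. This pays for coefficients of size (1 - tau) / c in front of V. *)
Lemma V_fun_absorb w beta c : modc w < 1 -> 0 < beta -> 0 < c ->
  (1 - expR (- (beta * c))) * modc (V_fun w beta) <= 66 * c.
Proof.
move=> w1 b0 c0; set tau := expR _.
have tau0 : 0 <= tau by exact: expR_ge0.
have tau1 : tau < 1 by rewrite expR_lt1 oppr_lt0 mulr_gt0.
apply: (@limit_le _ _ 8 c c0) => // N.
have h := kG_riemann N w1 (ltW b0) c0.
have r01 : 0 <= expR (- c) <= 1 by rewrite expR_ge0 expR_le1 oppr_le0 ltW.
have := kG_absolute N w1 r01 (_ : `|tau| < 1); rewrite ger0_norm// => /(_ tau1) h2.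
rewrite -/tau in h; move: h h2; set S := \sum_(m < N) _ => h h2.
have h3 : modc (V_fun w beta) <= c * modc S + 2 * (31 * c + 4 * expR (- (N%:R * c))).
  rewrite -[V_fun w beta](subrK (c%:C * S)); apply: (le_trans (modcD _ _)).
  by rewrite addrC modcM modcR gtr0_norm// lerD2l modcBC.
have t1 : 0 < 1 - tau by rewrite subr_gt0.
have h4 : (1 - tau) * modc S <= 4.
  by rewrite mulrC -ler_pdivlMr.
have h5 : (1 - tau) * modc (V_fun w beta) <= (1 - tau) * (c * modc S) + (1 - tau) * (2 * (31 * c + 4 * expR (- (N%:R * c)))).
  by rewrite -mulrDr ler_pM2l.
have h6 : (1 - tau) * (c * modc S) <= c * 4 by rewrite mulrCA ler_pM2l.
have h7 : (1 - tau) * (2 * (31 * c + 4 * expR (- (N%:R * c)))) <= 2 * (31 * c + 4 * expR (- (N%:R * c))).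
  rewrite ler_piMl//; last by rewrite lerBlDr lerDl.
  by rewrite mulr_ge0// addr_ge0 ?mulr_ge0 ?expR_ge0// ltW.
lra.
Qed.

(** The chain rule for multiplication by k and then by r in w. If 1 + w k r = 0, both sides are 0 by
    the convention for inverses. *)
Lemma kG_scale w (k r : R) : 1 + w * k%:C != 0 ->
  kG w k * kG (w * k%:C) r = kG w (k * r).
Proof.
move=> h; rewrite /kG [(k * r)%:C]rmorphM/= mulrA [w * (_ * _)]mulrA.
have [->|h2] := eqVneq (1 + w * k%:C * r%:C) 0.
  by rewrite expr0n/= invr0 !mulr0.
by field; rewrite h h2.
Qed.

(** The second term is the limit of the image system offset by k, a fraction of one step. With step
    d both are Riemann sums of one kernel, at rho^m and k rho^m, and [kG_tv_shift] compares them.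
    The errors are 27 d, 62 d and 4 times 62 d, within 340 d. *)
Lemma V_fun_shift w beta (k d : R) : modc w < 1 -> 0 <= beta -> 0 < d -> expR (- d) <= k <= 1 ->
  modc (V_fun w beta - k%:C * ((1 + w) ^+ 2 * J_fun (w * k%:C) beta)) <= 340 * d.
Proof.
move=> w1 b0 d0 /andP[k0 k1]; have kp : 0 < k by apply: lt_le_trans k0; exact: expR_gt0.
have k01 : 0 <= k <= 1 by rewrite ltW.
have n0 := kden_neq0 w1 k01.
have wk1 : modc (w * k%:C) < 1.
  rewrite modcM modcR gtr0_norm//; apply: le_lt_trans w1.
  by rewrite ler_piMr ?modc_ge0.
have e1 : k%:C * ((1 + w) ^+ 2 * J_fun (w * k%:C) beta) = kG w k * V_fun (w * k%:C) beta.
  by rewrite /kG /V_fun; field.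
rewrite e1; apply: (@limit_le _ _ 40 d d0) => // N.
have h1 := kG_riemann N w1 b0 d0; have h2 := kG_riemann N wk1 b0 d0.
set S1 := \sum_(m < N) _ in h1; set S2 := \sum_(m < N) _ in h2.
have r01 : 0 <= expR (- d) <= 1 by rewrite expR_ge0 expR_le1 oppr_le0 ltW.
have h3 : modc (S1 - kG w k * S2) <= 27.
  have h := kG_tv_shift N w1 r01 (_ : expR (- d) <= k <= 1).
  apply: le_trans (h _); last by rewrite k0 k1.
  rewrite /S1 /S2 mulr_sumr -sumrB; apply: (le_trans (modc_sum _)).
  apply: ler_sum => m _; rewrite [kG w k * _]mulrCA kG_scale// -mulrBr modcM modcR ger0_norm ?exprn_ge0 ?expR_ge0//.
  have t01 : 0 <= expR (- (beta * d)) <= 1.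
    by rewrite expR_ge0 expR_le1 oppr_le0 mulr_ge0// ltW.
  by rewrite ler_piMl ?modc_ge0//; case/andP: (rhoX01 m t01).
have g4 : modc (kG w k) <= 4.
  by apply: (le_trans (kG_le w1 k01)); rewrite ler_piMr.
have -> : V_fun w beta - kG w k * V_fun (w * k%:C) beta =
   (d%:C * (S1 - kG w k * S2) - (d%:C * S1 - V_fun w beta))
   + kG w k * (d%:C * S2 - V_fun (w * k%:C) beta) by ring.
apply: (le_trans (modcD _ _)); rewrite modcM.
have := modcB (d%:C * (S1 - kG w k * S2)) (d%:C * S1 - V_fun w beta).
rewrite modcM modcR gtr0_norm// => h4.
have h5 : d * modc (S1 - kG w k * S2) <= d * 27 by rewrite ler_pM2l.
have h6 : modc (kG w k) * modc (d%:C * S2 - V_fun (w * k%:C) beta) <= 4 * (2 * (31 * d + 4 * expR (- (N%:R * d)))).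
  by apply: ler_pM; rewrite ?modc_ge0.
have := expR_ge0 (- (N%:R * d)).
rewrite -/(V_fun w beta) in h1.
lra.
Qed.

Lemma J_fun_conj z beta : modc z < 1 -> 0 <= beta -> conjc (J_fun z beta) = J_fun (conjc z) beta.
Proof.
move=> z1 b0; have [m1 m2 _] := J_dominated z1 b0.
have h := dominated_integrable (cdominated_Im (J_dominated z1 b0)).
pose g (t : R) : R[i] :=
  (expR (- (beta * t)))%:C * ((expR (- t))%:C / (1 + z * (expR (- t))%:C) ^+ 2).
rewrite -/g in h; rewrite [J_fun z beta](_ : _ = Cint g)// /J_fun.
have -> : Cint (fun t : R => (expR (- (beta * t)))%:C * ((expR (- t))%:C / (1 + conjc z * (expR (- t))%:C) ^+ 2)) = Cint (fun t => conjc (g t)).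
  apply: eq_Cint => t t0; rewrite /g !(conjcM, conjcV, conjcX, conjcR).
  by congr (_ * (_ / _ ^+ 2)); rewrite -[X in X + _]conjcR rmorphD /= conjcM conjcR.
rewrite /Cint; apply/eqP; rewrite eq_complex /=; apply/andP; split; apply/eqP.
  by apply: eq_Rintegral => t _; case: (g t).
rewrite -mulN1r -(Rintegral_mull _ (measurable_itv _) h).
by apply: eq_Rintegral => t _; rewrite mulN1r -[X in - complex.Im X]/(g t); case: (g t).
Qed.

(** The weights are powers of e^(- beta c), but the kernel contracts with the geometric step d.
    Moving the kernel to step c costs 432 K, and the Riemann sum with step c costs 62 after division
    by c. *)
Lemma kG_profile w beta c d (mu K : R) N : modc w < 1 -> 0 < beta ->
  0 < mu <= 1 -> mu <= c -> mu <= d -> `|c - d| <= K * mu ^+ 2 ->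
  modc (\sum_(m < N) (expR (- (beta * c)) ^+ m)%:C * kG w (expR (- d) ^+ m) - (c^-1)%:C * V_fun w beta)
  <= 62 + 432 * K + 8 / c * expR (- (N%:R * c)).
Proof.
move=> w1 b0 /[dup] mu01 /andP[mu0 mu1] mc md hK; have c0 : 0 < c by exact: lt_le_trans mc.
set tau := expR (- (beta * c)).
have tau01 : 0 <= tau <= 1 by rewrite expR_ge0 expR_le1 oppr_le0 mulr_ge0// ltW.
have h := kG_step N w1 tau01 mu01 mc md.
have h2 := kG_riemann N w1 (ltW b0) c0.
move: h h2; rewrite -/tau -/(V_fun w beta).
set S := \sum_(m < N) _; set S' := \sum_(m < N) _ => h h2.
have hK' : 432 * `|c - d| / mu ^+ 2 <= 432 * K.
  rewrite ler_pdivrMr ?exprn_gt0// -mulrA; apply: ler_wpM2l hK; exact: ler0n.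
have e : S - c^-1%:C * V_fun w beta = c^-1%:C * (c%:C * S - V_fun w beta).
  have e0 : (c^-1)%:C * c%:C = 1 :> R[i] by rewrite -RCM mulVf ?gt_eqF.
  by rewrite -[S in LHS]mul1r -e0; ring.
have h3 : modc (S - c^-1%:C * V_fun w beta) <= 62 + 8 / c * expR (- (N%:R * c)).
  rewrite e modcM modcR gtr0_norm ?invr_gt0// mulrC ler_pdivrMr//.
  apply: (le_trans h2); rewrite mulrDl le_eqVlt; apply/orP; left; apply/eqP.
  by field; rewrite gt_eqF.
have -> : S' - c^-1%:C * V_fun w beta = (S - c^-1%:C * V_fun w beta) - (S - S') by ring.
by apply: (le_trans (modcB _ _)); lra.
Qed.

End Profile.

Section HarmonicBounds.
Variables (R : realType) (H : R * R -> R).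
Implicit Types p q : R * R.

Lemma harmonic_bounds (r : R) : 0 <= r -> entire_harmonic H -> exists B : R, [/\ 0 <= B,
  forall q, `|q| <= r -> modc (cgrad H q) <= B &
  forall q, `|q| <= r -> modc (cgrad H q - cgrad H (0, 0)) <= B * modc (toC q)].
Proof.
move=> r0 [[c1 c1x c1y] _].
have [B B0 hB] := cgrad_bound r0 c1.
have [Bx Bx0 hBx] := cgrad_bound r0 c1x.
have [By By0 hBy] := cgrad_bound r0 c1y.
have lip f Bf : C1_on setT f -> (forall p, `|p| <= r -> modc (cgrad f p) <= Bf) ->
    forall q, `|q| <= r -> `|f q - f (0, 0)| <= Bf * modc (toC q).
  move=> h hb q hq.
  have -> : f q = f ((0, 0) + q) by congr f; rewrite -[LHS]add0r.
  apply: gradient_lipschitz => t t1.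
  exists (cgrad f ((0, 0) + t *: q)); first exact: C1_is_cgrad openT h I.
  apply: hb; rewrite -[(0, 0) + _]/(0 + t *: q) add0r normrZ.
  by apply: le_trans hq; rewrite ler_piMl.
exists (B + Bx + By); split; first by rewrite !addr_ge0.
  by move=> q /hB h; apply: (le_trans h); rewrite -addrA lerDl addr_ge0.
move=> q hq; apply: (le_trans (modc_le_ReIm _)).
have h1 := lip _ _ c1x hBx q hq; have h2 := lip _ _ c1y hBy q hq.
rewrite ReB ImB /= opprK addrC [- dy H q + _]addrC -[dy H _ - dy H q]opprB normrN.
rewrite !mulrDl -addrA; apply: (le_trans (lerD h2 h1)).
by rewrite [By * _ + _]addrC lerDr mulr_ge0 ?modc_ge0.
Qed.

End HarmonicBounds.

(** * The image gradient and its continuum limit *)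

Section ImageGradient.
Variables (R : realType) (ri re eps ki ke : R) (H : R * R -> R).
Implicit Types p q : R * R.

Local Notation geo := (geo ri re eps).
Local Notation al := (alpha ri re eps).
Local Notation ci := (center_i ri re eps).
Local Notation ce := (center_e ri re eps).
Local Notation a2 := (asq ri re eps).
Local Notation b2 := (besq ri re eps).
Local Notation ti := (tau_i ki ke).
Local Notation te := (tau_e ke).
Local Notation tau := (tau ki ke).
Local Notation rho := (rho ri re eps).
Local Notation pe := (center_e ri re eps, 0).
Local Notation pi_ := (center_i ri re eps, 0).
Local Notation inve := (inv (center_e ri re eps) re).
Local Notation invi := (inv (center_i ri re eps) ri).
Local Notation F := (imF ri re eps ki ke H).
Local Notation dF := (imdF ri re eps ki ke H).
Local Notation G0 := (cgrad H (0, 0)).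
Local Notation rs := (r_star ri re).
Local Notation s := (Num.sqrt eps).
Local Notation xd := (2 * (xi_i ri re eps - xi_e ri re eps)).
Local Notation beta := (beta ri re eps ki ke).
Local Notation stp := (4 * Num.sqrt eps / r_star ri re).

(** What [geo_asymptotics] says about one eps. The bounds below depend on eps only through it, with
    a K that depends on the radii alone. *)
Definition regime (K : R) := [/\ geo,
  0 < s <= 1,
  rs * s <= al <= K * s /\ al <= ri,
  al - rs * s <= K * s ^+ 2 &
  [/\ 2 * s / rs <= 1, 2 * s / rs <= xd, 1 <= K &
  `|4 * s / rs - xd| <= K * (2 * s / rs) ^+ 2]].

(** The exact factor that appears when [Lam] is differentiated. It differs from 1 / stp by O(1),
    because alpha exceeds [rs * s] by O(eps). *)
Definition kap : R := rs ^+ 2 / (4 * al).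

Lemma regime_rs K : regime K -> 0 < rs.
Proof. by case=> -[i0 ie _ _] *; apply: r_star_gt0. Qed.

Lemma rho_exp : geo -> rho = expR (- xd).
Proof.
by move=> g; rewrite /rho -expR_xi_i// -expR_xi_e// -expRB; congr expR; ring.
Qed.

Lemma image_sum_gap K : regime K -> al / (1 - rho) <= K * rs.
Proof.
move=> rg; have r0 := regime_rs rg; case: rg => g /andP[s0 s1] [/andP[_ aK] _] _ [m1 md K1 _].
set mu := 2 * s / rs in m1 md; have mu0 : 0 < mu by rewrite divr_gt0 ?mulr_gt0.
(* rho <= e^-mu <= 1 / (1 + mu), with mu <= 1. *)
have h : mu / 2 <= 1 - rho.
  have rl : rho <= expR (- mu) by rewrite rho_exp// ler_expR lerN2.
  have e1 : expR (- mu) * (1 + mu) <= 1.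
    rewrite -[leRHS](@mulVf _ (expR mu)) ?gt_eqF ?expR_gt0// -expRN.
    by rewrite ler_wpM2l ?expR_ge0// expR_ge1Dx.
  have := expR_ge0 (- mu); nra.
have r1 : 0 < 1 - rho by apply: lt_le_trans h; rewrite divr_gt0.
rewrite ler_pdivrMr//; apply: (le_trans aK).
rewrite [leLHS](_ : _ = K * rs * (mu / 2)); last by rewrite /mu; field; rewrite gt_eqF.
by rewrite ler_wpM2l// mulr_ge0 ?(ltW r0)//; lra.
Qed.

Lemma kap_bounds K : regime K -> [/\ 0 < kap, kap <= stp^-1 & stp^-1 - kap <= K / 4].
Proof.
move=> rg; have r0 := regime_rs rg; case: rg => g /andP[s0 s1] [/andP[aK1 aK] _] aK2 [m1 md K1 _].
have a0 := alpha_gt0 g; rewrite /kap.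
move: (al) a0 aK1 aK aK2 => a a0 aK1 aK aK2.
have -> : stp^-1 = rs / (4 * s) by rewrite invf_div.
split.
- by rewrite divr_gt0 ?exprn_gt0// mulr_gt0.
- rewrite ler_pdivrMr ?mulr_gt0// mulrAC ler_pdivlMr ?mulr_gt0//.
  by have : 0 <= 4 * rs * (a - rs * s); [rewrite mulr_ge0 ?subr_ge0// mulr_ge0// ltW|nra].
have -> : rs / (4 * s) - rs ^+ 2 / (4 * a) = rs * (a - rs * s) / (4 * s * a).
  by field; rewrite !gt_eqF.
rewrite ler_pdivrMr ?mulr_gt0//.
have h1 : rs * (a - rs * s) <= rs * (K * s ^+ 2) by rewrite ler_pM2l.
have h2 : 0 <= K * s * (a - rs * s) by rewrite !mulr_ge0 ?subr_ge0 ?(ltW s0)//; lra.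
by apply: (le_trans h1); nra.
Qed.

(** 1 + w = 2 alpha / (alpha + z), so the quotient is |alpha + z| / 2: the smallness of 1 + w is
    compensated by that of alpha. *)
Lemma modc_alz p : geo -> al <= ri -> nsq pe p <= re ^+ 2 ->
  al / modc (1 + wr al (toC p)) <= 2 * re.
Proof.
move=> g ai h; have a0 := alpha_gt0 g; have p0 := in_e_gt0 g h.
have n0 := alz_neq0 a0 (z := toC p) p0.
have m0 : 0 < modc (al%:C + toC p) by rewrite modc_gt0.
rewrite wr1// modcM modcV modcM modcR (gtr0_norm a0).
have -> : modc (2 : R[i]) = 2.
  by rewrite (_ : (2 : R[i]) = (2 : R)%:C) ?modcR ?ger0_norm// rmorph_nat.
have h1 := in_e_modc g ai h; have rr : ri < re by case: g.
have := modcD al%:C (toC p); rewrite modcR (gtr0_norm a0) => h2.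
have -> : forall x : R, 0 < x -> al / (2 * al / x) = x / 2.
  by move=> x x0; move: (al) a0 => a a0; field; rewrite !gt_eqF.
  lra.
exact: m0.
Qed.

(** Freezes grad H at the origin. The error at each image is linear in its modulus, at most 2 alpha
    / kden; the weights tau^m are bounded by 1 and the rest is [kG_second_order]. *)
Lemma imdF_split B N p : geo -> al <= ri -> 0 <= B -> `|tau| <= 1 ->
  (forall q, `|q| <= 3 * re -> modc (cgrad H q - G0) <= B * modc (toC q)) ->
  nsq pe p <= re ^+ 2 ->
  modc (dF N p - G0 * \sum_(m < N) (tau ^+ m)%:C * kG (wr al (toC p)) (rho ^+ m))
    <= 54 * B * (2 * re + al / (1 - rho)).
Proof.
move=> g ai B0 t1 hB h; have a0 := alpha_gt0 g; have p0 := in_e_gt0 g h.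
set w := wr al (toC p); have w1 : modc w < 1 by exact: wr_lt1.
rewrite /imdF mulr_sumr -sumrB.
apply: (@le_trans _ _ (\sum_(m < N) 2 * B * al * (modc (kG w (rho ^+ m)) / kden w (rho ^+ m)))).
  apply: (le_trans (modc_sum _)); apply: ler_sum => m _.
  set z := Tm _ _ _.
  have -> : (tau ^+ m)%:C * (cgrad H z * kG w (rho ^+ m)) - G0 * ((tau ^+ m)%:C * kG w (rho ^+ m)) =
     (tau ^+ m)%:C * ((cgrad H z - G0) * kG w (rho ^+ m)) by ring.
  rewrite modcM modcR normrX.
  apply: (@le_trans _ _ (modc ((cgrad H z - G0) * kG w (rho ^+ m)))).
    by rewrite ler_piMl ?modc_ge0// exprn_ile1.
  rewrite modcM mulrCA mulrC.
  have r01 := rhoX m g.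
  have hz : modc (toC z) <= 2 * al / kden w (rho ^+ m).
    by rewrite /z /Tm toPK; apply: modc_Mt.
  have hz' : modc (cgrad H z - G0) <= B * (2 * al / kden w (rho ^+ m)).
    apply: (le_trans (hB z _)); last by rewrite ler_wpM2l.
    by apply: (in_e_norm g ai); exact: Tm_in_e g r01 h.
  apply: (@le_trans _ _ (B * (2 * al / kden w (rho ^+ m)) * modc (kG w (rho ^+ m)))).
    by rewrite mulrC ler_wpM2r ?modc_ge0.
  by rewrite le_eqVlt; apply/orP; left; apply/eqP; ring.
rewrite -mulr_sumr.
have h2 := kG_second_order N w1 (rho01 g).
apply: (@le_trans _ _ (2 * B * al * (27 * ((modc (1 + w))^-1 + (1 - rho)^-1)))).
  by apply: ler_wpM2l h2; apply: mulr_ge0 (ltW a0); exact: mulr_ge0.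
have h3 := modc_alz g ai h.
have -> : 2 * B * al * (27 * ((modc (1 + w))^-1 + (1 - rho)^-1)) =
  54 * B * (al / modc (1 + w) + al / (1 - rho)) by ring.
by rewrite ler_wpM2l ?mulr_ge0// lerD2r.
Qed.

(** The cut at 1/2 is a matter of convenience: below it alternation or the geometric series bounds
    the sum by 31, above it ti and te have the same sign and |te| > 1/2, which the region bounds
    exploit. *)
Lemma imdF_small K B N p : regime K -> -1 < tau <= 2^-1 -> 0 <= B ->
  (forall q, `|q| <= 3 * re -> modc (cgrad H q) <= B) ->
  (forall q, `|q| <= 3 * re -> modc (cgrad H q - G0) <= B * modc (toC q)) ->
  nsq pe p <= re ^+ 2 -> modc (dF N p) <= B * (31 + 54 * (2 * re + K * rs)).
Proof.
move=> rg /andP[t1 t2] B0 hB1 hB h.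
have gap := image_sum_gap rg; have [g _ [_ ai] _ _] := rg.
have tl : `|tau| <= 1 by rewrite ler_norml; apply/andP; split; lra.
have h1 := imdF_split N g ai B0 tl hB h.
have w1 : modc (wr al (toC p)) < 1 by apply: wr_lt1; [exact: alpha_gt0|exact: in_e_gt0 g h].
have rho1 := rho01 g.
have r01 : 0 <= rho <= 1 by case/andP: rho1 => *; rewrite !ltW.
move: h1; set S := \sum_(m < N) _ => h1.
have h2 : modc S <= 31.
  have [t0|t0] := leP tau 0; first by apply: kG_alternating => //; rewrite t1 t0.
  have ta : `|tau| < 1 by rewrite gtr0_norm//; lra.
  apply: (le_trans (kG_absolute N w1 r01 ta)).
  by rewrite gtr0_norm// ler_pdivrMr; lra.
have h3 : modc G0 <= B.
  apply: hB1; rewrite prod_normE /= normr0 maxxx.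
  by rewrite mulr_ge0//; have := geo_re g; lra.
have h4 : modc (G0 * S) <= B * 31 by rewrite modcM ler_pM ?modc_ge0.
rewrite -[dF N p](subrK (G0 * S)); apply: (le_trans (modcD _ _)).
have h5 : 54 * B * (2 * re + al / (1 - rho)) <= 54 * B * (2 * re + K * rs).
  by rewrite ler_wpM2l ?mulr_ge0// lerD2l.
lra.
Qed.

Lemma beta_exp K : regime K -> 0 < tau < 1 -> 0 < beta /\ expR (- (beta * stp)) = tau.
Proof.
move=> rg /andP[t0 t1]; have r0 := regime_rs rg; have [g /andP[s0 _] _ _ _] := rg.
have l0 : 0 < - ln tau by rewrite oppr_gt0 ln_lt0// t0 t1.
split; first by rewrite /Defs.beta divr_gt0 ?mulr_gt0.
have -> : - (beta * stp) = ln tau.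
  by rewrite /Defs.beta; field; rewrite !gt_eqF.
by rewrite lnK.
Qed.

Definition dLam p : R[i] := kap%:C * (G0 * V_fun (wr al (toC p)) beta).

(** Three errors add up: freezing grad H, replacing the sum by V / stp, and replacing 1 / stp by
    [kap], which costs K / 4 times |V| <= 8. *)
Lemma imdE_bound K B N p : regime K -> 0 < tau < 1 -> 0 <= B ->
  (forall q, `|q| <= 3 * re -> modc (cgrad H q) <= B) ->
  (forall q, `|q| <= 3 * re -> modc (cgrad H q - G0) <= B * modc (toC q)) ->
  nsq pe p <= re ^+ 2 ->
  modc (dF N p - dLam p) <=
    B * (54 * (2 * re + K * rs) + 62 + 434 * K + 8 / stp * expR (- (N%:R * stp))).
Proof.
move=> rg /[dup] t01 /andP[t0 t1] B0 hB1 hB h.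
have gap := image_sum_gap rg; have [b0 te] := beta_exp rg t01.
have [k0 k1 k2] := kap_bounds rg.
have r0 := regime_rs rg; have [g /andP[s0 s1] [_ ai] _ [m1 md K1 hcd]] := rg.
have tl : `|tau| <= 1 by rewrite gtr0_norm// ltW.
have h1 := imdF_split N g ai B0 tl hB h.
have w1 : modc (wr al (toC p)) < 1 by apply: wr_lt1; [exact: alpha_gt0|exact: in_e_gt0 g h].
have c0 : 0 < stp by rewrite divr_gt0 ?mulr_gt0.
have mu0 : 0 < 2 * s / rs by rewrite divr_gt0 ?mulr_gt0.
have mu01 : 0 < 2 * s / rs <= 1 by rewrite mu0.
have mc : 2 * s / rs <= stp by rewrite ler_pM2r ?invr_gt0// ler_pM2r//; lra.
have h2 := kG_profile N w1 b0 mu01 mc md hcd.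
rewrite te -rho_exp// in h2.
move: h1 h2; rewrite /dLam; set S := \sum_(m < N) _; set V := V_fun _ _ => h1 h2.
have hV : modc V <= 8 by exact: V_fun_le w1 (ltW b0).
have h3 : modc G0 <= B.
  apply: hB1; rewrite prod_normE /= normr0 maxxx.
  by rewrite mulr_ge0//; have := geo_re g; lra.
have -> : dF N p - kap%:C * (G0 * V) = (dF N p - G0 * S) + G0 * (S - (stp^-1)%:C * V)
   + G0 * ((stp^-1 - kap)%:C * V) by rewrite rmorphB; ring.
apply: (le_trans (modcD _ _)).
have h4 : modc (G0 * ((stp^-1 - kap)%:C * V)) <= B * (K / 4 * 8).
  rewrite modcM modcM modcR; apply: ler_pM; rewrite ?mulr_ge0 ?modc_ge0//.
  by apply: ler_pM; rewrite ?modc_ge0// ger0_norm ?subr_ge0.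
have h5 : modc (G0 * (S - (stp^-1)%:C * V)) <= B * (62 + 432 * K + 8 / stp * expR (- (N%:R * stp))).
  by rewrite modcM; apply: ler_pM; rewrite ?modc_ge0.
have h6 := modcD (dF N p - G0 * S) (G0 * (S - (stp^-1)%:C * V)).
have h7 : 54 * B * (2 * re + al / (1 - rho)) <= 54 * B * (2 * re + K * rs).
  by rewrite ler_wpM2l ?mulr_ge0// lerD2l.
lra.
Qed.

End ImageGradient.

(** * Bounds in the exterior, the shell and the core *)

Section RegionBounds.
Variables (R : realType) (ri re eps ki ke : R) (H : R * R -> R).
Implicit Types p q : R * R.

Local Notation geo := (geo ri re eps).
Local Notation al := (alpha ri re eps).
Local Notation ci := (center_i ri re eps).
Local Notation ce := (center_e ri re eps).
Local Notation a2 := (asq ri re eps).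
Local Notation b2 := (besq ri re eps).
Local Notation ti := (tau_i ki ke).
Local Notation te := (tau_e ke).
Local Notation tau := (tau ki ke).
Local Notation rho := (rho ri re eps).
Local Notation pe := (center_e ri re eps, 0).
Local Notation pi_ := (center_i ri re eps, 0).
Local Notation inve := (inv (center_e ri re eps) re).
Local Notation invi := (inv (center_i ri re eps) ri).
Local Notation F := (imF ri re eps ki ke H).
Local Notation dF := (imdF ri re eps ki ke H).
Local Notation G0 := (cgrad H (0, 0)).
Local Notation rs := (r_star ri re).
Local Notation s := (Num.sqrt eps).
Local Notation beta := (beta ri re eps ki ke).
Local Notation stp := (4 * Num.sqrt eps / r_star ri re).
Local Notation regime := (regime ri re eps).
Local Notation kap := (kap ri re eps).
Local Notation dLam := (dLam ri re eps ki ke H).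
Local Notation refle := (refl (center_e ri re eps) re).
Local Notation refli := (refl (center_i ri re eps) ri).
Local Notation imdR := (imdR ri re eps ki ke H).
Local Notation duext := (duext ri re eps ki ke H).
Local Notation dush := (dush ri re eps ki ke H).
Local Notation duin := (duin ri re eps ki ke H).

Definition hbound (B : R) := [/\ 0 <= B,
  forall q, `|q| <= 3 * re -> modc (cgrad H q) <= B &
  forall q, `|q| <= 3 * re -> modc (cgrad H q - G0) <= B * modc (toC q)].

Lemma reflB c r p g g' : refl c r p (g - g') = refl c r p g - refl c r p g'.
Proof.
rewrite /refl mulrBl; move: (_ * _) (_ * _) => x y.
by apply/eqP; rewrite eq_complex /=; apply/andP; split; apply/eqP;
  rewrite !(ReB, ImB, ReN, ImN) /=; case: x => a b; case: y => c' d /=; ring.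
Qed.

Lemma modc_refle p g : geo -> re ^+ 2 <= nsq pe p -> modc (refle p g) <= modc g.
Proof. by move=> G; apply: modc_refl; exact: geo_re G. Qed.

Lemma modc_refli p g : geo -> ri ^+ 2 <= nsq pi_ p -> modc (refli p g) <= modc g.
Proof. by move=> G; apply: modc_refl; exact: geo_ri G. Qed.

Lemma inve_in p : geo -> re ^+ 2 <= nsq pe p -> nsq pe (inve p) <= re ^+ 2.
Proof. by move=> g; apply: inv_in; exact: geo_re g. Qed.

Lemma invi_in p : geo -> ri ^+ 2 <= nsq pi_ p -> nsq pe (invi p) <= re ^+ 2.
Proof.
move=> g h; apply: ltW; apply: (disk_nested g); apply: inv_in => //; exact: geo_ri g.
Qed.

Lemma modc_scale (a b : R) (x : R[i]) : `|a| <= b -> modc (a%:C * x) <= b * modc x.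
Proof. by move=> h; rewrite modcM modcR ler_wpM2r ?modc_ge0. Qed.

Lemma imdF_tau K B N p : regime K -> hbound B -> `|tau| < 1 -> nsq pe p <= re ^+ 2 ->
  (1 - `|tau|) * modc (dF N p) <= 4 * B.
Proof.
move=> [g _ [_ ai] _ _] [B0 hB _] t1 h.
by rewrite mulrC -ler_pdivlMr ?subr_gt0// [4 * B]mulrC; exact: imdF_bound.
Qed.

Lemma imdR_le K B N p : regime K -> hbound B -> `|tau| < 1 -> nsq pe p <= re ^+ 2 ->
  modc (imdR N p) <= 4 * B.
Proof.
move=> [g _ [_ ai] _ _] [B0 hB _] t1 h.
apply: (le_trans (imdR_bound ki ke N g ai B0 hB h)).
by rewrite [4 * B]mulrC ler_piMl ?mulr_ge0// exprn_ile1// ltW.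
Qed.

Lemma cgradH_le K B p : regime K -> hbound B -> nsq pe p <= re ^+ 2 -> modc (cgrad H p) <= B.
Proof. by move=> [g _ [_ ai] _ _] [_ hB _] h; apply: hB; exact: in_e_norm h. Qed.

Lemma tau_le_e : admissible ki ke -> `|tau| <= `|te|.
Proof.
by move=> /tau_lt1[h _ _]; rewrite /Defs.tau normrM ler_piMl// ltW.
Qed.

Lemma tau_le_i : admissible ki ke -> `|tau| <= `|ti|.
Proof.
by move=> /tau_lt1[_ h _]; rewrite /Defs.tau normrM ler_piMr// ltW.
Qed.

(** The constant of [imdE_bound] with its N-dependent tail bounded by 1, whence 63 in place of
    62. *)
Definition CE (K B : R) : R := B * (54 * (2 * re + K * rs) + 63 + 434 * K).
Definition CF (K B : R) : R := B * (31 + 54 * (2 * re + K * rs)).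

Lemma imdE_le K B N p : regime K -> hbound B -> 0 < tau < 1 ->
  8 / stp * expR (- (N%:R * stp)) <= 1 -> nsq pe p <= re ^+ 2 ->
  modc (dF N p - dLam p) <= CE K B.
Proof.
move=> rg [B0 h1 h2] t01 tl h; apply: (le_trans (imdE_bound N rg t01 B0 h1 h2 h)).
by rewrite /CE ler_wpM2l//; lra.
Qed.

Lemma imdF_le K B N p : regime K -> hbound B -> `|tau| < 1 -> tau <= 2^-1 ->
  nsq pe p <= re ^+ 2 -> modc (dF N p) <= CF K B.
Proof.
move=> rg [B0 h1 h2] t1 t2 h; apply: imdF_small rg _ B0 h1 h2 h.
by move: t1; rewrite ltr_norml => /andP[-> _].
Qed.

Section WithHarmonic.
Hypothesis hH : forall p, harm H p (cgrad H p).

(* In each region the gradient of [uim N - H - Q] is a combination of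
   [dF - dLam], [(1 - tau) dF] and gradients of [H], all of them bounded. *)
Lemma ext_split N p : geo -> re ^+ 2 <= nsq pe p ->
  duext N p - cgrad H p - ((tau + te)%:C * refle p (dLam (inve p)) - (tau + ti)%:C * refli p (dLam (invi p))) =
  (te + tau)%:C * refle p (dF N (inve p) - dLam (inve p))
  - (ti + tau)%:C * refli p (dF N (invi p) - dLam (invi p))
  + ((1 - tau)%:C * refle p (dF N (inve p)) - refle p (cgrad H (inve p)) + refle p (imdR N (inve p))).
Proof.
move=> g h; have := imdF_reflect ki ke hH N g h.
rewrite /duext !reflB !(rmorphD, rmorphN, rmorph1) /=.
move: (refle p _) (refli p _) (refle p _) (refle p _) (refle p _) (refli p _) => a b c d e f E.
have -> : e = d - c + tau%:C * f by rewrite -E; ring.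
ring.
Qed.

Lemma modc3 (x y z : R[i]) (a b c : R) : modc x <= a -> modc y <= b -> modc z <= c ->
  modc (x - y + z) <= a + b + c.
Proof.
move=> h1 h2 h3; apply: (le_trans (modcD _ _)); apply: lerD h3.
by apply: (le_trans (modcB _ _)); exact: lerD.
Qed.

Lemma tau_coef : admissible ki ke ->
  [/\ `|te + tau| <= 2, `|ti + tau| <= 2 & `|te - ti| <= 2].
Proof.
move=> /tau_lt1[h1 h2 h3]; split.
- by apply: (le_trans (ler_normD _ _)); lra.
- by apply: (le_trans (ler_normD _ _)); lra.
- by apply: (le_trans (ler_normB _ _)); lra.
Qed.

Lemma ext_res_le K B N p : regime K -> hbound B -> admissible ki ke -> 0 < tau ->
  8 / stp * expR (- (N%:R * stp)) <= 1 -> re ^+ 2 <= nsq pe p ->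
  modc (duext N p - cgrad H p - ((tau + te)%:C * refle p (dLam (inve p)) - (tau + ti)%:C * refli p (dLam (invi p))))
    <= 4 * CE K B + 9 * B.
Proof.
move=> rg hb adm t0 tl h; have [g _ _ _ _] := rg.
have [_ _ t1] := tau_lt1 adm; have [c1 c2 _] := tau_coef adm.
have t01 : 0 < tau < 1 by rewrite t0 (le_lt_trans (ler_norm _) t1).
have h' := ltW (outside_i g h).
have he := inve_in g h; have hi := invi_in g h'.
rewrite ext_split//.
have e1 := le_trans (modc_refle _ g h) (imdE_le rg hb t01 tl he).
have e2 := le_trans (modc_refli _ g h') (imdE_le rg hb t01 tl hi).
have b1 := le_trans (modc_scale _ c1) (ler_wpM2l (ler0n R 2) e1).
have b2 := le_trans (modc_scale _ c2) (ler_wpM2l (ler0n R 2) e2).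
have b3 : modc ((1 - tau)%:C * refle p (dF N (inve p))) <= 4 * B.
  rewrite modcM modcR ger0_norm; last by rewrite subr_ge0 ltW//; case/andP: t01.
  apply: le_trans (imdF_tau N rg hb t1 he); rewrite (ger0_norm (ltW t0)).
  by rewrite ler_wpM2l ?modc_refle//; rewrite subr_ge0 ltW//; case/andP: t01.
have b4 := le_trans (modc_refle _ g h) (cgradH_le rg hb he).
have b5 := le_trans (modc_refle _ g h) (imdR_le N rg hb t1 he).
apply: (le_trans (modc3 b1 b2 (modc3 b3 b4 b5))).
by rewrite le_eqVlt; apply/orP; left; apply/eqP; ring.
Qed.

Lemma sh_res_le K B N p : regime K -> hbound B -> admissible ki ke -> 0 < tau ->
  8 / stp * expR (- (N%:R * stp)) <= 1 -> nsq pe p <= re ^+ 2 -> ri ^+ 2 <= nsq pi_ p ->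
  modc (dush N p - cgrad H p - ((tau + te)%:C * dLam p - (tau + ti)%:C * refli p (dLam (invi p))))
    <= 4 * CE K B + 9 * B.
Proof.
move=> rg hb adm t0 tl h h'; have [g _ _ _ _] := rg.
have [_ _ t1] := tau_lt1 adm; have [c1 c2 _] := tau_coef adm.
have t01 : 0 < tau < 1 by rewrite t0 (le_lt_trans (ler_norm _) t1).
have hi := invi_in g h'.
(* Here 1 + te = (te + tau) + (1 - tau) and (1 + te) ti = ti + tau. *)
have -> : dush N p - cgrad H p - ((tau + te)%:C * dLam p - (tau + ti)%:C * refli p (dLam (invi p))) =
  (te + tau)%:C * (dF N p - dLam p) - (ti + tau)%:C * refli p (dF N (invi p) - dLam (invi p))
  + ((1 - tau)%:C * dF N p - cgrad H p + imdR N p).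
  rewrite /dush !reflB; have tE : tau = ti * te by [].
  move: (refli p _) (refli p _) (dLam p) te ti tau tE => a b c x y t ->.
  by rewrite !(rmorphD, rmorphN, rmorphM, rmorph1) /=; ring.
have e1 := imdE_le rg hb t01 tl h.
have e2 := le_trans (modc_refli _ g h') (imdE_le rg hb t01 tl hi).
have b1 := le_trans (modc_scale _ c1) (ler_wpM2l (ler0n R 2) e1).
have b2 := le_trans (modc_scale _ c2) (ler_wpM2l (ler0n R 2) e2).
have b3 : modc ((1 - tau)%:C * dF N p) <= 4 * B.
  rewrite modcM modcR ger0_norm; last by case/andP: t01 => *; lra.
  by apply: le_trans (imdF_tau N rg hb t1 h); rewrite (ger0_norm (ltW t0)).
have b4 := cgradH_le rg hb h.
have b5 := imdR_le N rg hb t1 h.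
apply: (le_trans (modc3 b1 b2 (modc3 b3 b4 b5))).
lra.
Qed.

Lemma in_res_le K B N p : regime K -> hbound B -> admissible ki ke -> 0 < tau ->
  8 / stp * expR (- (N%:R * stp)) <= 1 -> nsq pi_ p <= ri ^+ 2 ->
  modc (duin N p - cgrad H p - (te - ti)%:C * dLam p) <= 4 * CE K B + 9 * B.
Proof.
move=> rg hb adm t0 tl h'; have [g _ _ _ _] := rg.
have [_ _ t1] := tau_lt1 adm; have [_ _ c1] := tau_coef adm.
have t01 : 0 < tau < 1 by rewrite t0 (le_lt_trans (ler_norm _) t1).
have h := ltW (disk_nested g h').
(* Here (1 - ti) (1 + te) = (te - ti) + (1 - tau). *)
have -> : duin N p - cgrad H p - (te - ti)%:C * dLam p =
  (te - ti)%:C * (dF N p - dLam p) - 0 + ((1 - tau)%:C * dF N p - cgrad H p + imdR N p).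
  rewrite /duin; have tE : tau = ti * te by [].
  move: (dLam p) te ti tau tE => c x y t ->.
  by rewrite !(rmorphD, rmorphN, rmorphM, rmorph1) /=; ring.
have e1 := imdE_le rg hb t01 tl h.
have CE0 : 0 <= CE K B by apply: le_trans e1; exact: modc_ge0.
have b1 := le_trans (modc_scale _ c1) (ler_wpM2l (ler0n R 2) e1).
have b2 : modc (0 : R[i]) <= 2 * CE K B by rewrite modc0 mulr_ge0.
have b3 : modc ((1 - tau)%:C * dF N p) <= 4 * B.
  rewrite modcM modcR ger0_norm; last by case/andP: t01 => *; lra.
  by apply: le_trans (imdF_tau N rg hb t1 h); rewrite (ger0_norm (ltW t0)).
have b4 := cgradH_le rg hb h.
have b5 := imdR_le N rg hb t1 h.
apply: (le_trans (modc3 b1 b2 (modc3 b3 b4 b5))).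
lra.
Qed.

(** For tau > 1/2 neither image term is bounded by itself. Multiplying their combination by te
    produces tau C, which the reflection identity trades for A; what remains is (te^2 - 1) A, and 1
    - |te| <= 1 - tau tames it. Dividing back costs a factor 2, since |te| >= tau > 1/2. *)
Lemma ext_le K B N p : regime K -> hbound B -> admissible ki ke -> re ^+ 2 <= nsq pe p ->
  modc (duext N p - cgrad H p) <= 2 * CF K B + 26 * B.
Proof.
move=> rg hb adm h; have [g _ _ _ _] := rg; have [B0 _ _] := hb.
have [t1 t2 t3] := tau_lt1 adm.
have h' := ltW (outside_i g h).
have he := inve_in g h; have hi := invi_in g h'.
set A := refle p (dF N (inve p)); set C := refli p (dF N (invi p)).
have -> : duext N p - cgrad H p = te%:C * A - ti%:C * C by rewrite /duext -/A -/C; ring.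
have [th|th] := leP tau (2^-1).
  have e1 := le_trans (modc_refle _ g h) (imdF_le N rg hb t3 th he).
  have e2 := le_trans (modc_refli _ g h') (imdF_le N rg hb t3 th hi).
  have b1 := le_trans (modc_scale A (ltW t2)) (ler_wpM2l (ler0n R 1) e1).
  have b2 := le_trans (modc_scale C (ltW t1)) (ler_wpM2l (ler0n R 1) e2).
  by apply: (le_trans (modcB _ _)); lra.
have t0 : 0 < tau by apply: lt_trans th; rewrite invr_gt0.
have tE : `|tau| = tau by rewrite gtr0_norm.
have hte := tau_le_e adm; rewrite tE in hte t3.
have te0 : te%:C != 0 :> R[i].
  by rewrite eq_complex /= negb_and -normr_gt0; apply/orP; left; exact: lt_le_trans hte.
set X := _ - _.
have hX : te%:C * X = (te ^+ 2 - 1)%:C * A + (refle p (cgrad H (inve p)) - refle p (imdR N (inve p))).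
  rewrite -(imdF_reflect ki ke hH N g h) -/A -/C /X [tau]/(ti * te).
  move: te ti => x y.
  by rewrite !(rmorphD, rmorphN, rmorphM, rmorphXn, rmorph1) /=; ring.
have bA : modc ((te ^+ 2 - 1)%:C * A) <= 8 * B.
  have hF : (1 - tau) * modc (dF N (inve p)) <= 4 * B.
    by have := imdF_tau N rg hb _ he; rewrite tE => /(_ t3).
  have hA : modc A <= modc (dF N (inve p)) by exact: modc_refle.
  rewrite modcM modcR.
  have -> : `|te ^+ 2 - 1| = (1 - `|te|) * (1 + `|te|).
    rewrite -subr_sqr expr1n real_normK ?num_real// distrC ger0_norm// subr_ge0.
    by rewrite -real_normK ?num_real// expr_le1// ltW.
  have hc : (1 - `|te|) * (1 + `|te|) <= (1 - tau) * 2.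
    by apply: ler_pM; lra.
  apply: (@le_trans _ _ ((1 - tau) * 2 * modc (dF N (inve p)))).
    by apply: ler_pM; rewrite ?modc_ge0// mulr_ge0//; lra.
  by lra.
have bB : modc (refle p (cgrad H (inve p)) - refle p (imdR N (inve p))) <= 5 * B.
  apply: (le_trans (modcB _ _)).
  have := le_trans (modc_refle _ g h) (cgradH_le rg hb he).
  have := le_trans (modc_refle _ g h) (imdR_le N rg hb _ he); rewrite tE => /(_ t3).
  lra.
have bX : `|te| * modc X <= 13 * B.
  rewrite -modcR -modcM hX; apply: (le_trans (modcD _ _)); lra.
have CF0 : 0 <= CF K B.
  rewrite /CF mulr_ge0// addr_ge0// mulr_ge0// addr_ge0 ?mulr_ge0 ?(ltW (regime_rs rg))//.
    by have := geo_re g; lra.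
  by case: rg => _ _ _ _ [_ _ K1 _]; lra.
have : 2^-1 * modc X <= `|te| * modc X by rewrite ler_wpM2r ?modc_ge0//; lra.
lra.
Qed.

(** For tau > 1/2 the numbers ti and te have the same sign and modulus at least tau. If both are
    positive, 1 - ti <= 1 - tau; if both are negative, 1 + te <= 1 - tau. Either way the coefficient
    is at most 2 (1 - tau). *)
Lemma in_le K B N p : regime K -> hbound B -> admissible ki ke -> nsq pi_ p <= ri ^+ 2 ->
  modc (duin N p - cgrad H p) <= 4 * CF K B + 13 * B.
Proof.
move=> rg hb adm h'; have [g _ _ _ _] := rg; have [B0 _ _] := hb.
have [t1 t2 t3] := tau_lt1 adm; have h := ltW (disk_nested g h').
have b4 := cgradH_le rg hb h; have b5 := imdR_le N rg hb t3 h.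
have hbd : modc (duin N p - cgrad H p) <= modc (((1 - ti) * (1 + te))%:C * dF N p) + 5 * B.
  rewrite /duin -addrA; apply: (le_trans (modcD _ _)); rewrite lerD2l.
  by apply: (le_trans (modcB _ _)); lra.
have CF0 : 0 <= CF K B.
  rewrite /CF mulr_ge0// addr_ge0// mulr_ge0// addr_ge0 ?mulr_ge0 ?(ltW (regime_rs rg))//.
    by have := geo_re g; lra.
  by case: rg => _ _ _ _ [_ _ K1 _]; lra.
apply: (le_trans hbd).
move: (t1) (t2); rewrite !ltr_norml => /andP[t11 t12] /andP[t21 t22].
have [th|th] := leP tau (2^-1).
  have e1 := imdF_le N rg hb t3 th h.
  have c : `|(1 - ti) * (1 + te)| <= 4.
    rewrite normrM (_ : 4 = 2 * 2); last by rewrite -natrM.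
    by apply: ler_pM => //; rewrite ger0_norm; lra.
  have := le_trans (modc_scale _ c) (ler_wpM2l (ler0n R 4) e1); lra.
have t0 : 0 < tau by apply: lt_trans th; rewrite invr_gt0.
have tE : `|tau| = tau by rewrite gtr0_norm.
have hF := imdF_tau N rg hb t3 h; rewrite tE in hF.
have hte := tau_le_e adm; have hti := tau_le_i adm; rewrite tE in hte hti.
have c : `|(1 - ti) * (1 + te)| <= 2 * (1 - tau).
  rewrite normrM (ger0_norm (_ : 0 <= 1 - ti)); last by lra.
  rewrite (ger0_norm (_ : 0 <= 1 + te)); last by lra.
  have [i0|i0] := leP 0 ti.
    by rewrite ger0_norm// in hti; rewrite mulrC; apply: ler_pM; lra.
  have e0 : te < 0.
    rewrite ltNge; apply/negP => e0.
    by have := mulr_le0_ge0 (ltW i0) e0; rewrite -[ti * te]/tau; lra.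
  by rewrite ltr0_norm// in hte; apply: ler_pM; lra.
have := modc_scale (dF N p) c; lra.
Qed.

(** Here the coefficient is 1 + te, small only for te < 0. If tau > 1/2 and te >= 0, then ti and te
    are both at least tau, so 1 - tau < delta would make them near one; hence 1 - tau >= delta, and
    the geometric series suffices. *)
Lemma sh_le K B N (delta : R) p : regime K -> hbound B -> admissible ki ke ->
  0 < delta < 1 -> ~ tau_near_one ki ke delta ->
  nsq pe p <= re ^+ 2 -> ri ^+ 2 <= nsq pi_ p ->
  modc (dush N p - cgrad H p) <= 4 * CF K B + (13 + 16 / delta) * B.
Proof.
move=> rg hb adm /andP[d0 d1] nn h h'; have [g _ _ _ _] := rg; have [B0 _ _] := hb.
have [t1 t2 t3] := tau_lt1 adm; have hi := invi_in g h'.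
have b4 := cgradH_le rg hb h; have b5 := imdR_le N rg hb t3 h.
have Bd : 0 <= 16 / delta * B by rewrite mulr_ge0 ?divr_ge0// ltW.
have hbd : modc (dush N p - cgrad H p) <= `|1 + te| * (modc (dF N p) + modc (dF N (invi p))) + 5 * B.
  rewrite /dush -addrA; apply: (le_trans (modcD _ _)); apply: lerD; last first.
    by apply: (le_trans (modcB _ _)); lra.
  rewrite modcM modcR ler_wpM2l//; apply: (le_trans (modcB _ _)); rewrite lerD2l.
  apply: (le_trans (modc_scale _ (ltW t1))); rewrite mul1r; exact: modc_refli.
have CF0 : 0 <= CF K B.
  rewrite /CF mulr_ge0// addr_ge0// mulr_ge0// addr_ge0 ?mulr_ge0 ?(ltW (regime_rs rg))//.
    by have := geo_re g; lra.
  by case: rg => _ _ _ _ [_ _ K1 _]; lra.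
apply: (le_trans hbd).
move: (t1) (t2); rewrite !ltr_norml => /andP[t11 t12] /andP[t21 t22].
rewrite (ger0_norm (_ : 0 <= 1 + te)); last by lra.
have m0 := modc_ge0 (dF N p); have m1 := modc_ge0 (dF N (invi p)).
have [th|th] := leP tau (2^-1).
  have e1 := imdF_le N rg hb t3 th h; have e2 := imdF_le N rg hb t3 th hi.
  have : (1 + te) * (modc (dF N p) + modc (dF N (invi p))) <= 2 * (CF K B + CF K B).
    by apply: ler_pM; lra.
  lra.
have t0 : 0 < tau by apply: lt_trans th; rewrite invr_gt0.
have tE : `|tau| = tau by rewrite gtr0_norm.
have hF := imdF_tau N rg hb t3 h; have hFi := imdF_tau N rg hb t3 hi.
have hte := tau_le_e adm; have hti := tau_le_i adm; rewrite tE in hF hFi hte hti t3.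
have [e0|e0] := leP 0 te; last first.
  have : (1 + te) * (modc (dF N p) + modc (dF N (invi p))) <= (1 - tau) * (modc (dF N p) + modc (dF N (invi p))).
    by rewrite ltr0_norm// in hte; rewrite ler_wpM2r; lra.
  lra.
have i0 : 0 <= ti.
  rewrite leNgt; apply/negP => i0.
  by have := mulr_le0_ge0 (ltW i0) e0; rewrite -[ti * te]/tau; lra.
have td : delta <= 1 - tau.
  rewrite leNgt; apply/negP => hd; apply: nn.
  rewrite ger0_norm// in hte; rewrite ger0_norm// in hti.
  by split; rewrite ltr_norml; apply/andP; split; lra.
have q1 : delta * modc (dF N p) <= 4 * B.
  by apply: le_trans hF; rewrite ler_wpM2r.
have q2 : delta * modc (dF N (invi p)) <= 4 * B.
  by apply: le_trans hFi; rewrite ler_wpM2r.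
have : (1 + te) * (modc (dF N p) + modc (dF N (invi p))) <= 16 / delta * B.
  apply: (@le_trans _ _ (2 * (modc (dF N p) + modc (dF N (invi p))))).
    by rewrite ler_wpM2r; lra.
  rewrite mulrAC ler_pdivlMr//; lra.
lra.
Qed.

End WithHarmonic.

End RegionBounds.

(** * The singular part *)

Section SingularPart.
Variables (R : realType) (ri re eps ki ke : R) (H u : R * R -> R).
Implicit Types p q : R * R.

Local Notation geo := (geo ri re eps).
Local Notation al := (alpha ri re eps).
Local Notation ci := (center_i ri re eps).
Local Notation ce := (center_e ri re eps).
Local Notation a2 := (asq ri re eps).
Local Notation b2 := (besq ri re eps).
Local Notation ti := (tau_i ki ke).
Local Notation te := (tau_e ke).
Local Notation tau := (tau ki ke).
Local Notation rho := (rho ri re eps).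
Local Notation pe := (center_e ri re eps, 0).
Local Notation pi_ := (center_i ri re eps, 0).
Local Notation inve := (inv (center_e ri re eps) re).
Local Notation invi := (inv (center_i ri re eps) ri).
Local Notation F := (imF ri re eps ki ke H).
Local Notation dF := (imdF ri re eps ki ke H).
Local Notation G0 := (cgrad H (0, 0)).
Local Notation rs := (r_star ri re).
Local Notation s := (Num.sqrt eps).
Local Notation beta := (beta ri re eps ki ke).
Local Notation stp := (4 * Num.sqrt eps / r_star ri re).
Local Notation regime := (regime ri re eps).
Local Notation kap := (kap ri re eps).
Local Notation dLam := (dLam ri re eps ki ke H).
Local Notation refle := (refl (center_e ri re eps) re).
Local Notation refli := (refl (center_i ri re eps) ri).
Local Notation imdR := (imdR ri re eps ki ke H).
Local Notation duext := (duext ri re eps ki ke H).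
Local Notation dush := (dush ri re eps ki ke H).
Local Notation duin := (duin ri re eps ki ke H).
Local Notation uim := (uim ri re eps ki ke H).
Local Notation off := (off_interfaces ri re eps).
Local Notation hbound := (hbound re H).
Local Notation CE := (CE ri re).
Local Notation CF := (CF ri re).

(** The function with gradient [dLam]. The singular function is assembled from its values at p and
    at the two inverted points; the factor is [rs ^+ 2] times the 1/2 in q. *)
Definition Lam p : R := rs ^+ 2 / 2 * complex.Re (G0 * L_fun (wr al (toC p)) beta).

Lemma cder_wr (a : R) z : a%:C + z != 0 -> cder (wr a) z (- (2 * a%:C / (a%:C + z) ^+ 2)).
Proof.
move=> d; have d' : 1 * z + a%:C != 0 by rewrite mul1r addrC.
apply: (cder_eq (cder_ext _ (cder_mob (-1) a%:C d'))).
  by move=> x; rewrite /mob /wr mulN1r mul1r addrC [x + _]addrC.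
by rewrite [1 * z]mul1r [z + _]addrC -[in RHS]mulNr; congr (_ * _); ring.
Qed.

Lemma is_cgrad_Lam p : geo -> 0 <= beta -> 0 < p.1 -> is_cgrad Lam p (dLam p).
Proof.
move=> g b0 p0; have a0 := alpha_gt0 g.
have n0 := alz_neq0 a0 (z := toC p) p0.
have w1 : modc (wr al (toC p)) < 1 by exact: wr_lt1.
have cL := cder_comp (cder_wr n0) (cder_L w1 b0).
have cG := cderM (cder_cst G0 (toC p)) cL.
apply: (is_cgrad_eq (is_cgradZ (rs ^+ 2 / 2) (is_cgrad_Re cG))).
rewrite mul0r add0r /dLam /V_fun wr1// /kap.
move: (al) n0 a0 (J_fun _ _) G0 => a n0 a0 J G.
have aC : a%:C != 0 :> R[i] by rewrite eq_complex /= negb_and gt_eqF.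
rewrite !(RCM, rmorphV) ?unitfE ?gt_eqF ?mulr_gt0//=.
rewrite (_ : 2%:R%:C = 2 :> R[i]) 1?(_ : 4%:R%:C = 4 :> R[i]) ?rmorph_nat//.
by field; rewrite n0 aC.
Qed.

(** The gradient part of [harm_inv], for functions such as [Lam] that enter through their
    gradient. *)
Lemma is_cgrad_inv (c r : R) f p g : 0 < nsq (c, 0) p -> is_cgrad f (inv c r p) g ->
  is_cgrad (fun q => f (inv c r q)) p (refl c r p g).
Proof.
move=> n0 h; have d := inv_den n0.
apply: (is_cgrad_eq (is_cgrad_flipx (is_cgrad_comp (cder_mob _ _ d) h))).
congr (- conjc (_ * (_ / _))).
  by rewrite rmorphB /= !rmorphXn/=; ring.
rewrite (_ : conjc (toC p - c%:C) = - (1 * toC (flipx p) + c%:C)) ?sqrrN//.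
by apply/eqP; rewrite eq_complex /=; apply/andP; split; apply/eqP; ring.
Qed.

Definition Qext p : R := (tau + te) * Lam (inve p) - (tau + ti) * Lam (invi p).
Definition Qsh p : R := (tau + te) * Lam p - (tau + ti) * Lam (invi p).
Definition Qin p : R := (te - ti) * Lam p.
Definition Qim p : R :=
  if re ^+ 2 <= nsq pe p then Qext p
  else if ri ^+ 2 <= nsq pi_ p then Qsh p else Qin p.

Definition dQext p : R[i] :=
  (tau + te)%:C * refle p (dLam (inve p)) - (tau + ti)%:C * refli p (dLam (invi p)).
Definition dQsh p : R[i] :=
  (tau + te)%:C * dLam p - (tau + ti)%:C * refli p (dLam (invi p)).
Definition dQin p : R[i] := (te - ti)%:C * dLam p.
Definition dQim p : R[i] :=
  if re ^+ 2 < nsq pe p then dQext p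
  else if ri ^+ 2 < nsq pi_ p then dQsh p else dQin p.

Lemma is_cgrad_Qext p : geo -> 0 <= beta -> re ^+ 2 <= nsq pe p -> is_cgrad Qext p (dQext p).
Proof.
move=> g b0 h; have h' := ltW (outside_i g h).
apply: is_cgradB; apply: is_cgradZ; apply: is_cgrad_inv.
- exact: pe_gt0.
- by apply: is_cgrad_Lam => //; exact: inve_gt0.
- exact: pi_gt0.
- by apply: is_cgrad_Lam => //; exact: invi_gt0.
Qed.

Lemma is_cgrad_Qsh p : geo -> 0 <= beta -> nsq pe p <= re ^+ 2 -> ri ^+ 2 <= nsq pi_ p ->
  is_cgrad Qsh p (dQsh p).
Proof.
move=> g b0 h h'; apply: is_cgradB; apply: is_cgradZ.
  by apply: is_cgrad_Lam => //; exact: in_e_gt0 h.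
apply: is_cgrad_inv; first exact: pi_gt0.
by apply: is_cgrad_Lam => //; exact: invi_gt0.
Qed.

Lemma is_cgrad_Qin p : geo -> 0 <= beta -> nsq pi_ p <= ri ^+ 2 -> is_cgrad Qin p (dQin p).
Proof.
by move=> g b0 h; apply: is_cgradZ; apply: is_cgrad_Lam => //; exact: in_i_gt0 h.
Qed.

Lemma Qim_cont : geo -> 0 <= beta -> continuous Qim.
Proof.
move=> g b0 p; apply: glue_at; first exact: nsq_cont.
- by move=> h; apply: is_cgrad_cont (is_cgrad_Qext g b0 h).
- move=> h; apply: glue_at; first exact: nsq_cont.
  + by move=> h'; apply: is_cgrad_cont (is_cgrad_Qsh g b0 h h').
  + by move=> h'; apply: is_cgrad_cont (is_cgrad_Qin g b0 h').
  + by move=> h'; rewrite /Qsh /Qin (inv_circle (geo_ri g) h'); ring.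
- move=> h; rewrite (ltW (outside_i g _)) ?h//.
  by rewrite /Qext /Qsh (inv_circle (geo_re g) h).
Qed.

Lemma is_cgrad_Qim p : geo -> 0 <= beta -> off p -> is_cgrad Qim p (dQim p).
Proof.
move=> g b0 /(off_interfacesE _ g)[hi he]; rewrite /dQim.
case: (ltgtP (nsq pe p) (re ^+ 2)) he => // he _; last first.
  apply: is_cgrad_near (is_cgrad_Qext g b0 (ltW he)).
  by have := near_nsq_gt he; apply: filterS => q hq; rewrite /Qim (ltW hq).
case: (ltgtP (nsq pi_ p) (ri ^+ 2)) hi => // hi _; last first.
  apply: is_cgrad_near (is_cgrad_Qsh g b0 (ltW he) (ltW hi)).
  near=> q.
  have h1 : nsq pe q < re ^+ 2 by near: q; exact: near_nsq_lt.
  have h2 : ri ^+ 2 < nsq pi_ q by near: q; exact: near_nsq_gt.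
  by rewrite /Qim leNgt h1/= (ltW h2).
apply: is_cgrad_near (is_cgrad_Qin g b0 (ltW hi)).
have := near_nsq_lt hi; apply: filterS => q hq.
by rewrite /Qim leNgt disk_nested ?(ltW hq)//= leNgt hq.
Unshelve. all: by end_near. Qed.

Definition duim N p : R[i] :=
  if re ^+ 2 < nsq pe p then duext N p
  else if ri ^+ 2 < nsq pi_ p then dush N p else duin N p.

(** The comparison function f0 will be H or H + Qim. Since U is open, a ball about p stays in it;
    there the u_N - f0 are equi-Lipschitz for large N and converge pointwise, so [limit_cgrad_bound]
    applies. *)
Lemma sol_limit_bound f0 (c0 : R * R -> R[i]) (U : set (R * R)) (M : R) p :
  geo -> al <= ri -> admissible ki ke -> entire_harmonic H ->
  is_solution ri re eps ki ke H u -> open U -> U `<=` off ->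
  (forall q, U q -> is_cgrad f0 q (c0 q)) -> 0 <= M ->
  (\forall N \near \oo, forall q, U q -> modc (duim N q - c0 q) <= M) ->
  U p -> is_cgrad (fun q => u q - f0 q) p (cgrad u p - c0 p) /\ modc (cgrad u p - c0 p) <= M.
Proof.
move=> g ai adm eH S oU Uoff hc M0 hM Up; have [i0 k0 _ _] := adm.
have hH := harmonic_harm eH.
have uc : is_cgrad (fun q => u q - f0 q) p (cgrad u p - c0 p).
  by apply: is_cgradB (hc p Up); apply: harm_cgrad; apply: (sol_harm g i0 k0 S); exact: Uoff.
split=> //.
have /nbhs_ballP[d /= d0 hd] : nbhs p U by exact: open_nbhs_nbhs.
have lim := uim_limit g ai adm eH S.
apply: (@limit_cgrad_bound R (fun N q => uim N q - f0 q) _ p _ M d d0 M0 uc).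
  by move=> q _; apply: cvgB; [exact: lim|exact: cvg_cst].
move: hM; apply: filterS => N hN q /hd Uq.
exists (duim N q - c0 q); last exact: hN.
have [h1 h2] := (off_interfacesE q g).1 (Uoff q Uq).
by apply: is_cgradB (hc q Uq); apply: harm_cgrad; exact: harm_uim.
Qed.

Lemma hbound_CF K B : regime K -> hbound B -> 0 <= CF K B.
Proof.
move=> rg [B0 _ _]; have [g _ _ _ [_ _ K1 _]] := rg.
rewrite /CF mulr_ge0// addr_ge0// mulr_ge0// addr_ge0 ?mulr_ge0 ?(ltW (regime_rs rg))//.
  by have := geo_re g; lra.
by lra.
Qed.

Lemma hbound_CE K B : regime K -> hbound B -> 0 <= CE K B.
Proof.
move=> rg [B0 _ _]; have [g _ _ _ [_ _ K1 _]] := rg.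
have rs0 := regime_rs rg; have re0 := geo_re g.
rewrite /CE; apply: mulr_ge0 B0 _.
have : 0 <= K * rs by rewrite mulr_ge0 ?(ltW rs0)//; lra.
lra.
Qed.

Lemma residual_bound K B p : regime K -> hbound B -> admissible ki ke -> entire_harmonic H ->
  is_solution ri re eps ki ke H u -> 0 < tau -> off p ->
  is_cgrad (fun q => u q - (H q + Qim q)) p (cgrad u p - (cgrad H p + dQim p)) /\
  modc (cgrad u p - (cgrad H p + dQim p)) <= 4 * CE K B + 9 * B.
Proof.
move=> rg hb adm eH S t0 offp; have [g /andP[s0 _] [_ ai] _ _] := rg.
have [B0 _ _] := hb.
have hH := harmonic_harm eH; have [_ _ t1] := tau_lt1 adm.
have t01 : 0 < tau < 1 by rewrite t0 (le_lt_trans (ler_norm _) t1).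
have [b0 _] := beta_exp rg t01.
have CE0 := hbound_CE rg hb.
apply: (sol_limit_bound (U := off) (f0 := fun q => H q + Qim q)
  (c0 := fun q => cgrad H q + dQim q) g ai adm eH S) => //.
- exact: off_interfaces_open.
- by move=> q hq; apply: is_cgradD (harm_cgrad (hH q)) (is_cgrad_Qim g (ltW b0) hq).
- by lra.
have c0 : 0 < stp by rewrite divr_gt0 ?mulr_gt0 ?(regime_rs rg).
(* N is taken so large that the tail of the Riemann sum, divided by the step, is at most 1. *)
have := expR_tail c0 (divr_gt0 c0 (ltr0n R 8)); apply: filterS => N hN q hq.
have tl : 8 / stp * expR (- (N%:R * stp)) <= 1.
  by rewrite mulrAC ler_pdivrMr// mul1r mulrC -ler_pdivlMr.
rewrite opprD addrA /duim /dQim.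
case: ifP => he; first by exact: ext_res_le rg hb adm t0 tl (ltW he).
have he' : nsq pe q <= re ^+ 2 by rewrite leNgt he.
case: ifP => hi; first by exact: sh_res_le rg hb adm t0 tl he' (ltW hi).
by apply: (in_res_le rg hb adm t0 tl); rewrite leNgt hi.
Qed.

Lemma outer_bound K B p : regime K -> hbound B -> admissible ki ke -> entire_harmonic H ->
  is_solution ri re eps ki ke H u -> re ^+ 2 < nsq pe p \/ nsq pi_ p < ri ^+ 2 ->
  is_cgrad (fun q => u q - H q) p (cgrad u p - cgrad H p) /\
  modc (cgrad u p - cgrad H p) <= 4 * CF K B + 26 * B.
Proof.
move=> rg hb adm eH S hp; have [g /andP[s0 _] [_ ai] _ _] := rg.
have [B0 _ _] := hb; have hH := harmonic_harm eH; have CF0 := hbound_CF rg hb.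
pose U := [set q | re ^+ 2 < nsq pe q \/ nsq pi_ q < ri ^+ 2].
apply: (sol_limit_bound (U := U) g ai adm eH S) => //.
- rewrite openE => q [h|h]; rewrite /interior.
    by have := near_nsq_gt h; apply: filterS => q' h'; left.
  by have := near_nsq_lt h; apply: filterS => q' h'; right.
- move=> q [h|h]; apply/off_interfacesE => //; split.
  + by rewrite gt_eqF ?outside_i// ltW.
  + by rewrite gt_eqF.
  + by rewrite lt_eqF.
  + by rewrite lt_eqF// disk_nested// ltW.
- by move=> q _; exact: harm_cgrad.
- by lra.
near=> N => q hq; rewrite /duim.
case: ifP => he.
  by apply: (le_trans (ext_le hH N rg hb adm (ltW he))); lra.
have hi : nsq pi_ q < ri ^+ 2 by case: hq => //; rewrite he.
rewrite ltNge (ltW hi)/=.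
by apply: (le_trans (in_le N rg hb adm (ltW hi))); lra.
Unshelve. all: by end_near. Qed.

Lemma shell_bound K B (delta : R) p : regime K -> hbound B -> admissible ki ke -> entire_harmonic H ->
  is_solution ri re eps ki ke H u -> 0 < delta < 1 -> ~ tau_near_one ki ke delta ->
  nsq pe p < re ^+ 2 -> ri ^+ 2 < nsq pi_ p ->
  is_cgrad (fun q => u q - H q) p (cgrad u p - cgrad H p) /\
  modc (cgrad u p - cgrad H p) <= 4 * CF K B + (13 + 16 / delta) * B.
Proof.
move=> rg hb adm eH S /[dup] d01 /andP[d0 d1] nn he hi; have [g /andP[s0 _] [_ ai] _ _] := rg.
have [B0 _ _] := hb; have hH := harmonic_harm eH; have CF0 := hbound_CF rg hb.
pose U := [set q | nsq pe q < re ^+ 2 /\ ri ^+ 2 < nsq pi_ q].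
apply: (sol_limit_bound (U := U) g ai adm eH S) => //.
- rewrite openE => q [h h']; rewrite /interior; near=> q'; split; near: q'.
    exact: near_nsq_lt.
  exact: near_nsq_gt.
- by move=> q [h h']; apply/off_interfacesE => //; split; [rewrite gt_eqF|rewrite lt_eqF].
- by move=> q _; exact: harm_cgrad.
- have : 0 <= (13 + 16 / delta) * B by rewrite mulr_ge0// addr_ge0// divr_ge0// ltW.
  by lra.
near=> N => q [h h']; rewrite /duim ltNge (ltW h)/= h'.
exact: sh_le rg hb adm d01 nn (ltW h) (ltW h').
Unshelve. all: by end_near. Qed.

End SingularPart.

(** * Bipolar coordinates *)

Section BipolarCoordinates.
Variable R : realType.
Implicit Types (a x t c r : R) (p : R * R) (z : R[i]).

Lemma expc_conj x t : expc x (- t) = conjc (expc x t).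
Proof. by rewrite /expc /conjc cosN sinN mulrN. Qed.

Lemma expcDR x y t : expc (x + y) t = (expR y)%:C * expc x t.
Proof.
by apply/eqP; rewrite eq_complex /= !mul0r subr0 addr0 expRD; apply/andP; split;
  apply/eqP; ring.
Qed.

Lemma expcV x t : expc (- x) (- t) = (expc x t)^-1.
Proof.
have e : expc (- x) (- t) * expc x t = 1.
  apply/eqP; rewrite eq_complex /= cosN sinN expRN.
  have h := cos2Dsin2 t; have n0 : expR x != 0 by rewrite gt_eqF ?expR_gt0.
  apply/andP; split; apply/eqP; last by ring.
  rewrite -[RHS]h; move: (expR x) n0 => e n0; by field.
have n0 : expc x t != 0 by apply/eqP => h; move/eqP: e; rewrite h mulr0 eq_sym oner_eq0.
by rewrite -[LHS](mulfK n0) e mul1r.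
Qed.

Lemma bipolar_ratioV a p : (bipolar_ratio a p)^-1 = wr a (toC p).
Proof. by rewrite /bipolar_ratio invf_div. Qed.

Lemma not_pole_neq0 a p : ~~ is_pole a p -> a%:C - toC p != 0 /\ a%:C + toC p != 0.
Proof.
rewrite negb_or => /andP[h1 h2]; split.
  apply: contraNneq h1 => /eqP; rewrite eq_complex /= => /andP[/eqP e1 /eqP e2].
  by case: p e1 e2 {h2} => x y /= e1 e2; rewrite xpair_eqE; apply/andP; split; apply/eqP; lra.
apply: contraNneq h2 => /eqP; rewrite eq_complex /= => /andP[/eqP e1 /eqP e2].
by case: p e1 e2 {h1} => x y /= e1 e2; rewrite xpair_eqE; apply/andP; split; apply/eqP; lra.
Qed.

Lemma wr_inv a c r p : 0 < a -> 0 < c -> c ^+ 2 = r ^+ 2 + a ^+ 2 -> 0 < nsq (c, 0) p ->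
  a%:C - toC p != 0 ->
  wr a (toC (inv c r p)) = ((c - a) / (c + a))%:C * conjc ((a%:C + toC p) / (a%:C - toC p)).
Proof.
move=> a0 c0 h n0 d; rewrite (inv_Mt _ a0 c0 h) toPK.
have e : a%:C + toC (flipx p) = conjc (a%:C - toC p).
  by rewrite toC_flipx; apply/eqP; rewrite eq_complex /= ; apply/andP; split; apply/eqP; ring.
have e2 : a%:C - toC (flipx p) = conjc (a%:C + toC p).
  by rewrite toC_flipx; apply/eqP; rewrite eq_complex /= ; apply/andP; split; apply/eqP; ring.
rewrite wr_Mt//.
- by rewrite /wr e e2 conjcM conjcV.
- by rewrite e -modc_gt0 modcJ modc_gt0.
- exact: inv_Mt_den a0 c0 n0.
Qed.

(* At the pole [p = (- a, 0)] the inversions land on the other pole, where [wr = 0]. *)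
Lemma wr_inv_pole a c r : 0 < a -> 0 < c -> c ^+ 2 = r ^+ 2 + a ^+ 2 ->
  wr a (toC (inv c r (- a, 0))) = 0.
Proof.
move=> a0 c0 h; rewrite (inv_Mt _ a0 c0 h) toPK.
have e : toC (flipx (- a, 0)) = a%:C by rewrite /toC /flipx /= opprK.
have n0 : 0 < nsq (c, 0) (- a, 0).
  by rewrite /nsq /= -opprD sqrrN subrr expr0n addr0 exprn_gt0// addr_gt0.
rewrite wr_Mt//; first by rewrite e /wr subrr mul0r mulr0.
  by rewrite e -rmorphD /= eq_complex /= negb_and gt_eqF// addr_gt0.
exact: inv_Mt_den a0 c0 n0.
Qed.

End BipolarCoordinates.

(** * Identification with the singular function q *)

Section SingularFunction.
Variables (R : realType) (ri re eps ki ke : R) (H : R * R -> R).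
Implicit Types p q : R * R.

Local Notation geo := (geo ri re eps).
Local Notation al := (alpha ri re eps).
Local Notation ci := (center_i ri re eps).
Local Notation ce := (center_e ri re eps).
Local Notation a2 := (asq ri re eps).
Local Notation b2 := (besq ri re eps).
Local Notation ti := (tau_i ki ke).
Local Notation te := (tau_e ke).
Local Notation tau := (tau ki ke).
Local Notation rho := (rho ri re eps).
Local Notation pe := (center_e ri re eps, 0).
Local Notation pi_ := (center_i ri re eps, 0).
Local Notation inve := (inv (center_e ri re eps) re).
Local Notation invi := (inv (center_i ri re eps) ri).
Local Notation F := (imF ri re eps ki ke H).
Local Notation dF := (imdF ri re eps ki ke H).
Local Notation G0 := (cgrad H (0, 0)).
Local Notation rs := (r_star ri re).
Local Notation s := (Num.sqrt eps).
Local Notation beta := (beta ri re eps ki ke).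
Local Notation stp := (4 * Num.sqrt eps / r_star ri re).
Local Notation regime := (regime ri re eps).
Local Notation kap := (kap ri re eps).
Local Notation dLam := (dLam ri re eps ki ke H).
Local Notation refle := (refl (center_e ri re eps) re).
Local Notation refli := (refl (center_i ri re eps) ri).
Local Notation imdR := (imdR ri re eps ki ke H).
Local Notation duext := (duext ri re eps ki ke H).
Local Notation dush := (dush ri re eps ki ke H).
Local Notation duin := (duin ri re eps ki ke H).
Local Notation Lam := (Lam ri re eps ki ke H).
Local Notation Qim := (Qim ri re eps ki ke H).
Local Notation C_x := (dot (grad H (0, 0)) (1, 0)).
Local Notation C_y := (dot (grad H (0, 0)) (0, 1)).

Lemma Re_G0 z : complex.Re (G0 * z) = C_x * complex.Re z + C_y * complex.Im z.
Proof. by rewrite ReM /dot /grad /=; ring. Qed.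

(** The arguments of L in q are values of w: e^(- xi - i theta) at p itself, and e^(xi - i theta - 2
    xi_i), e^(xi - i theta - 2 xi_e) at the two inverses of p. The poles are treated apart: there
    the relevant values of w are 0 and L(0) = 0. *)
Lemma Qim_q p : geo ->
  Qim p = C_x * rs ^+ 2 * complex.Re (q_fun ri re eps ki ke p)
    + C_y * rs ^+ 2 * complex.Im (q_fun ri re eps ki ke p).
Proof.
move=> g; have a0 := alpha_gt0 g; have re0 := geo_re g; have ri0 := geo_ri g.
have e0 := center_e_gt0 g; have i0 := center_i_gt0 g.
have ale := alpha_lt_e g; have ali := alpha_lt_i g.
have e2 := center_e_sqr g; have i2 := center_i_sqr g.
set q := q_fun _ _ _ _ _ _.
suff -> : Qim p = rs ^+ 2 * complex.Re (G0 * q) by rewrite Re_G0; ring.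
have mE : (p \notin B_e ri re eps) = (re ^+ 2 <= nsq pe p).
  rewrite leNgt; congr (~~ _).
  by apply/idP/idP; rewrite inE /B_e /disk /= nsq_disk.
have mI : (p \notin B_i ri re eps) = (ri ^+ 2 <= nsq pi_ p).
  rewrite leNgt; congr (~~ _).
  by apply/idP/idP; rewrite inE /B_i /disk /= nsq_disk.
have comb (x y : R) (z w : R[i]) : rs ^+ 2 * complex.Re (G0 * (2^-1 * (- x%:C * z + y%:C * w))) =
    y * (rs ^+ 2 / 2 * complex.Re (G0 * w)) - x * (rs ^+ 2 / 2 * complex.Re (G0 * z)).
  have h2 : (2 : R[i])^-1 = (2^-1 : R)%:C by rewrite fmorphV rmorph_nat.
  rewrite h2 (_ : G0 * _ = (2^-1)%:C * (y%:C * (G0 * w) - x%:C * (G0 * z))); last by ring.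
  by rewrite ReRM ReB !ReRM; ring.
have [pp|np] := boolP (is_pole al p).
  rewrite {}/q /q_fun pp mulr0 /= mulr0 /Qim.
  case/orP: pp => /eqP->.
    have h : nsq pi_ (al, 0) < ri ^+ 2.
      by rewrite /nsq /= subrr expr0n addr0; nra.
    rewrite leNgt disk_nested ?(ltW h)//= leNgt h /=.
    have w0 : wr al (toC (al, 0)) = 0 by rewrite /wr -[toC _]/(al%:C) subrr mul0r.
    by rewrite /Qin /Lam w0 L_fun0 mulr0 [complex.Re 0]/= !mulr0.
  have h : re ^+ 2 <= nsq pe (- al, 0).
    by rewrite /nsq /= subrr expr0n addr0; nra.
  by rewrite h /Qext /Lam !wr_inv_pole// L_fun0 mulr0 [complex.Re 0]/= !mulr0 subrr.
have [nm np'] := not_pole_neq0 np.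
have an0 : al != 0 by rewrite gt_eqF.
have eE := expc_bip an0 np.
have xi1 : expc (- bip_xi al p) (- bip_theta al p) = wr al (toC p).
  by rewrite expcV eE bipolar_ratioV.
have xiI : 0 < nsq pi_ p ->
    expc (bip_xi al p - 2 * xi_i ri re eps) (- bip_theta al p) = wr al (toC (invi p)).
  by move=> n0; rewrite (wr_inv a0 i0 i2 n0 nm) expcDR expR_xi_i// expc_conj eE.
have xiE : 0 < nsq pe p ->
    expc (bip_xi al p - 2 * xi_e ri re eps) (- bip_theta al p) = wr al (toC (inve p)).
  by move=> n0; rewrite (wr_inv a0 e0 e2 n0 nm) expcDR expR_xi_e// expc_conj eE.
rewrite {}/q /q_fun (negbTE np) mE mI xi1 /Qim.
case: ifP => he.
  have h' := ltW (outside_i g he).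
  by rewrite xiI ?pi_gt0// xiE ?pe_gt0// comb.
case: ifP => hi; first by rewrite xiI ?pi_gt0// comb.
by rewrite comb /Qin /Lam; ring.
Qed.

End SingularFunction.

(** * The leading term in the shell *)

Section RadialDirection.
Variable R : realType.
Implicit Types (a x t : R) (p : R * R) (z : R[i]).

Lemma conjc1D z : conjc (1 + z) = 1 + conjc z.
Proof.
by case: z => x y; apply/eqP; rewrite eq_complex /=; apply/andP; split; apply/eqP; ring.
Qed.

Lemma conjc_zJ (G z : R[i]) (beta : R) : modc z < 1 -> 0 <= beta ->
  conjc (G * (z * J_fun z beta)) = conjc G * (conjc z * J_fun (conjc z) beta).
Proof. by move=> z1 b0; rewrite conjcM conjcM J_fun_conj. Qed.

(** The xi-derivative of z = a (E - 1) / (E + 1) with E = e^(xi + i theta). Its modulus is the scale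
    factor a / (cosh xi + cos theta) of bipolar coordinates. *)
Definition dxi a x t : R[i] := 2 * a%:C * expc x t / (expc x t + 1) ^+ 2.

(* For fixed theta, [bip_point] is a Moebius map along the ray [expR x * (cos t, sin t)]. *)
Lemma is_derive_bip a x t : expc x t + 1 != 0 ->
  is_derive x 1 (fun y => (bip_point a y t).1) (complex.Re (dxi a x t)) /\
  is_derive x 1 (fun y => (bip_point a y t).2) (complex.Im (dxi a x t)).
Proof.
move=> d; pose v : R * R := (cos t, sin t).
have eE y : toC (0 + expR y *: v) = expc y t by rewrite add0r.
have d' : 1 * toC (0 + expR x *: v) + 1 != 0 by rewrite mul1r eE.
have cM := cder_mob a%:C (- a%:C) d'.
have E1 y : bip_point a y t = toP (mob a%:C (- a%:C) 1 1 (toC (0 + expR y *: v))).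
  by rewrite /bip_point eE /mob /toP mul1r mulrBr mulr1.
have vE : toC v * (expR x)%:C = expc x t.
  by apply/eqP; rewrite eq_complex /= !mulr0 subr0 add0r; apply/andP; split; apply/eqP; ring.
set l := (X in cder _ _ X) in cM.
have lE : l * expc x t = dxi a x t.
  rewrite /l /dxi mul1r eE; move: (expc x t) d => E d.
  by field.
split.
- have h := is_derive1_comp (is_derive_cgrad (is_cgrad_Re cM)) (is_derive_expR x).
  have -> : (fun y => (bip_point a y t).1) =
      (fun z : R => complex.Re (mob a%:C (- a%:C) 1 1 (toC (0 + z *: v)))) \o expR.
    by apply/funext => y; rewrite E1.
  apply: (is_derive_eq h).
  by rewrite mulrC -ReRM -lE -vE; congr complex.Re; ring.
- have h := is_derive1_comp (is_derive_cgrad (is_cgrad_Im cM)) (is_derive_expR x).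
  have -> : (fun y => (bip_point a y t).2) =
      (fun z : R => complex.Im (mob a%:C (- a%:C) 1 1 (toC (0 + z *: v)))) \o expR.
    by apply/funext => y; rewrite E1.
  apply: (is_derive_eq h).
  rewrite mulrC -ReRM -lE -vE.
  have ReI (z : R[i]) : complex.Re (- 'i * z) = complex.Im z by case: z => b c /=; ring.
  by rewrite -ReI; congr complex.Re; ring.
Qed.

Lemma toC_e_xi a x t : expc x t + 1 != 0 ->
  toC (e_xi a x t) = ((modc (dxi a x t))^-1)%:C * dxi a x t.
Proof.
move=> d; have [h1 h2] := is_derive_bip a d.
rewrite /e_xi !derive1E !derive_val.
set X := dxi a x t; rewrite -[enorm _]/(modc X); move: (modc X) => k.
clearbody X; case: X => b c.
by apply/eqP; rewrite eq_complex /=; apply/andP; split; apply/eqP; ring.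
Qed.

Lemma modc_expc x t : modc (expc x t) = expR x.
Proof.
apply/eqP; rewrite -(@eqrXn2 _ 2) ?modc_ge0 ?expR_ge0//; apply/eqP.
rewrite sqr_modc /= !exprMn -mulrDr cos2Dsin2 mulr1//.
Qed.

Lemma coshR_cos a x t : 0 < a -> expc x t + 1 != 0 -> coshR x + cos t = a / modc (dxi a x t).
Proof.
move=> a0 d; have e0 := expR_gt0 x.
have D0 : 0 < modc (expc x t + 1) by rewrite modc_gt0.
have m2 : modc (2 : R[i]) = 2.
  by rewrite (_ : (2 : R[i]) = (2 : R)%:C) ?modcR ?ger0_norm// rmorph_nat.
have D2 : modc (expc x t + 1) ^+ 2 = expR x ^+ 2 + 2 * expR x * cos t + 1.
  transitivity (expR x ^+ 2 * (cos t ^+ 2 + sin t ^+ 2) + 2 * expR x * cos t + 1).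
    by rewrite sqr_modc /=; ring.
  by rewrite cos2Dsin2 mulr1.
rewrite /dxi modcM modcV [modc (_ ^+ 2)]modcX !modcM modcR m2 modc_expc (gtr0_norm a0).
have D20 : modc (expc x t + 1) ^+ 2 != 0 by rewrite gt_eqF ?exprn_gt0.
rewrite /coshR expRN; transitivity (modc (expc x t + 1) ^+ 2 / (2 * expR x)).
  by rewrite D2; move: (expR x) e0 => e e0; field; rewrite gt_eqF.
by move: (expR x) (modc _) e0 D0 {D2 D20} => e D e0 D0; field; rewrite !gt_eqF.
Qed.

End RadialDirection.

Section Coefficients.
Variable R : realType.
Implicit Types x y t i k K : R.

Lemma product_coef x y : 0 < x < 1 -> 0 < y < 1 ->
  [/\ 0 <= x * y + y <= 2, 0 <= x * y + x <= 2 & `|y - x| <= 1 - x * y].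
Proof.
move=> /andP[? ?] /andP[? ?]; split.
- by apply/andP; split; nra.
- by apply/andP; split; nra.
- by rewrite ler_norml; apply/andP; split; nra.
Qed.

(** Used with x and y equal to tau + te and tau + ti, i = 1 / stp and k = kap. The leading term has
    one coefficient, their mean; the price is the error of kap and half of their difference, at most
    t = 1 - tau. *)
Lemma mix_coef x y t i k K : 0 <= x <= 2 -> 0 <= i - k <= K / 4 -> 0 < i -> `|x - y| <= t ->
  `|x * k - i * (x + y) / 2| <= K / 2 + i * t / 2.
Proof.
move=> /andP[x0 x2] /andP[h1 h2] i0; rewrite !ler_norml => /andP[t1 t2].
have p1 : x * (i - k) <= 2 * (K / 4) by exact: ler_pM.
have p2 : 0 <= x * (i - k) by exact: mulr_ge0.
have p3 : i * (x - y) <= i * t by rewrite ler_pM2l.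
have p4 : i * (- t) <= i * (x - y) by rewrite ler_pM2l.
by apply/andP; split; lra.
Qed.

(** The error (1 - tau) / stp left by [mix_coef] is not bounded, but it multiplies V, and
    [V_fun_absorb] bounds the product. *)
Lemma absorb_coef t i m K : 1 <= K -> 0 < i -> 0 <= m <= 8 -> t * m <= 66 * i ->
  (K / 2 + i^-1 * t / 2) * m <= 4 * K + 33.
Proof.
move=> K1 i0 /andP[m0 m8] h.
have h1 : i^-1 * (t * m) <= 66 by rewrite mulrC ler_pdivrMr.
by nra.
Qed.

Lemma step_coef mu c d K : 0 <= K -> 0 < mu -> mu <= 1 -> mu <= c ->
  `|c - d| <= K * mu ^+ 2 -> d <= c * (1 + K).
Proof.
move=> K0 mu0 mu1 mc; rewrite ler_norml => /andP[h1 h2].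
have mm : mu ^+ 2 <= mu by rewrite expr2 ger_pMl.
by nra.
Qed.

End Coefficients.

(** * The gradient of the singular part in the shell *)

Section ShellGradient.
Variables (R : realType) (ri re eps ki ke : R) (H : R * R -> R).
Implicit Types p q : R * R.

Local Notation geo := (geo ri re eps).
Local Notation al := (alpha ri re eps).
Local Notation ci := (center_i ri re eps).
Local Notation ce := (center_e ri re eps).
Local Notation a2 := (asq ri re eps).
Local Notation b2 := (besq ri re eps).
Local Notation ti := (tau_i ki ke).
Local Notation te := (tau_e ke).
Local Notation tau := (tau ki ke).
Local Notation rho := (rho ri re eps).
Local Notation pe := (center_e ri re eps, 0).
Local Notation pi_ := (center_i ri re eps, 0).
Local Notation inve := (inv (center_e ri re eps) re).
Local Notation invi := (inv (center_i ri re eps) ri).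
Local Notation F := (imF ri re eps ki ke H).
Local Notation dF := (imdF ri re eps ki ke H).
Local Notation G0 := (cgrad H (0, 0)).
Local Notation rs := (r_star ri re).
Local Notation s := (Num.sqrt eps).
Local Notation beta := (beta ri re eps ki ke).
Local Notation stp := (4 * Num.sqrt eps / r_star ri re).
Local Notation regime := (regime ri re eps).
Local Notation kap := (kap ri re eps).
Local Notation dLam := (dLam ri re eps ki ke H).
Local Notation refle := (refl (center_e ri re eps) re).
Local Notation refli := (refl (center_i ri re eps) ri).
Local Notation imdR := (imdR ri re eps ki ke H).
Local Notation duext := (duext ri re eps ki ke H).
Local Notation dush := (dush ri re eps ki ke H).
Local Notation duin := (duin ri re eps ki ke H).
Local Notation hbound := (hbound re H).

(** The factor cosh xi + cos theta is alpha / |dz/dxi|, so together with the conjugate of e_xi it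
    gives alpha / (dz/dxi), and 1 / (dz/dxi) = (1 + w)^2 / (2 alpha w). The conjugate appears
    because [cgrad] is dx - i dy. *)
Lemma shell_gradient_conj p : geo -> ~~ is_pole al p ->
  conjc (toC (shell_gradient ri re eps ki ke H p)) =
  (rs / (4 * s) * (ti + te + 2 * tau))%:C * (complex.Re (G0 * P_fun (wr al (toC p)) beta))%:C *
  ((1 + wr al (toC p)) ^+ 2 / wr al (toC p)).
Proof.
move=> g np; have a0 := alpha_gt0 g; have an0 : al != 0 by rewrite gt_eqF.
have s0 : 0 < s by rewrite sqrtr_gt0; case: g.
have [nm nq] := not_pole_neq0 np.
have eE := expc_bip an0 np.
have xi1 : expc (- bip_xi al p) (- bip_theta al p) = wr al (toC p).
  by rewrite expcV eE bipolar_ratioV.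
have aC : al%:C != 0 :> R[i] by rewrite eq_complex /= negb_and gt_eqF.
have d : expc (bip_xi al p) (bip_theta al p) + 1 != 0.
  rewrite eE /bipolar_ratio -/(toC p) (_ : _ + 1 = 2 * al%:C / (al%:C - toC p)); last by field.
  by rewrite !mulf_neq0 ?invr_eq0 ?pnatr_eq0.
set E := expc (bip_xi al p) (bip_theta al p) in d eE.
have E0 : E != 0 by rewrite eE /bipolar_ratio -/(toC p) mulf_neq0 ?invr_eq0.
have wE : wr al (toC p) = E^-1 by rewrite -bipolar_ratioV eE.
rewrite /shell_gradient xi1.
have -> : forall (m : R) (v : R * R), toC (m * v.1, m * v.2) = m%:C * toC v.
  by move=> m v; apply/eqP; rewrite eq_complex /= !mul0r subr0 addr0 !eqxx.
rewrite toC_e_xi// conjcM conjcR conjcM conjcR.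
rewrite (coshR_cos a0 d); set X := dxi _ _ _.
have X0 : X != 0 by rewrite /X /dxi -/E !mulf_neq0 ?invr_eq0 ?expf_eq0 ?pnatr_eq0.
have mX : 0 < modc X by rewrite modc_gt0.
have cX : conjc X = (modc X ^+ 2)%:C / X by rewrite modc2J mulrAC divff ?mul1r.
rewrite cX (Re_G0 H); set P := P_fun _ _.
set Cx := dot _ (1, 0); set Cy := dot _ (0, 1).
have -> : Cx * (rs * (ti + te + 2 * tau) / (2 * s)) * (al / modc X) * complex.Re P +
  Cy * (rs * (ti + te + 2 * tau) / (2 * s)) * (al / modc X) * complex.Im P =
  (rs / (4 * s) * (ti + te + 2 * tau)) * (Cx * complex.Re P + Cy * complex.Im P) * (2 * al) / modc X.
  by move: (al) (ti) (te) (tau) => a' x y z; field; rewrite !gt_eqF.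
move: (_ * (ti + te + _)) (_ + Cy * _) => k m.
have -> : (k * m * (2 * al) / modc X)%:C * ((modc X)^-1%:C * ((modc X ^+ 2)%:C / X)) =
    (k * m * (2 * al))%:C / X.
  rewrite [(modc X)^-1%:C * _]mulrA [LHS]mulrA -!RCM; congr (_%:C / X).
  by move: (al) => a'; field; rewrite gt_eqF.
have h2 : (2 : R)%:C = 2 :> R[i] by rewrite rmorph_nat.
rewrite RCM RCM [(2 * al)%:C]RCM h2 wE -[LHS]mulrA; congr (_ * _).
rewrite /X /dxi -/E; by field; rewrite aC E0 d.
Qed.

Lemma shell_not_pole p : geo -> nsq pe p <= re ^+ 2 -> ri ^+ 2 <= nsq pi_ p -> ~~ is_pole al p.
Proof.
move=> g he hi; have a0 := alpha_gt0 g; apply/negP => /orP[] /eqP E.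
  move: hi; rewrite E leNgt => /negP; apply.
  rewrite /nsq /= subrr expr0n addr0; have := center_i_sqr g; have := alpha_lt_i g.
  have := center_i_gt0 g; have := geo_ri g; nra.
by have := in_e_gt0 g he; rewrite E /= oppr_gt0; lra.
Qed.

(* [wr (invi p)] is the conjugate of [a2 / w = k v]. *)
Lemma refli_dLam p (w := wr al (toC p)) (v := conjc w) (k := a2 / modc w ^+ 2) :
  geo -> 0 <= beta -> nsq pe p <= re ^+ 2 -> ri ^+ 2 <= nsq pi_ p ->
  refli p (dLam (invi p)) =
  - (kap%:C * (conjc G0 * (v / w * ((1 + w) / (1 + v)) ^+ 2 *
      (k%:C * ((1 + v) ^+ 2 * J_fun (v * k%:C) beta))))).
Proof.
move=> g b0 he hi; have a0 := alpha_gt0 g; have ci0 := center_i_gt0 g.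
have p0 := in_e_gt0 g he.
have [nm nq] := not_pole_neq0 (shell_not_pole g he hi).
have w0 : w != 0 by rewrite /w /wr mulf_neq0 ?invr_eq0.
have w1 : modc w < 1 by exact: wr_lt1.
have n0 := pi_gt0 g hi.
have wi := wr_inv a0 ci0 (center_i_sqr g) n0 nm.
have wi1 : modc (wr al (toC (invi p))) < 1 by apply: wr_lt1 => //; exact: invi_gt0.
have mw : modc w != 0 by rewrite gt_eqF// modc_gt0.
have v0 : v != 0 by rewrite -modc_gt0 modcJ modc_gt0.
have v1 : 1 + v != 0.
  have := kden_neq0 (w := v) (r := 1); rewrite /v modcJ mulr1; apply => //.
  by rewrite ler01 lexx.
have kv : v * k%:C = a2%:C / w.
  rewrite /k RCM rmorphV ?unitfE ?expf_eq0//= modc2J.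
  by move: v0; rewrite -/v => v0; field; rewrite v0 w0.
have cwi : conjc (wr al (toC (invi p))) = v * k%:C.
  by rewrite kv wi [LHS]conjcM conjcR conjcK /w /wr invf_div.
rewrite /refl /dLam /V_fun !(conjcM, conjcV, conjcX, conjcK, conjcR).
rewrite J_fun_conj// conjc1D cwi; congr (- _); move: (J_fun _ _) => J.
have zc : toC p - ci%:C != 0.
  apply/eqP => /eqP; rewrite eq_complex /= => /andP[/eqP e1 /eqP e2].
  by move: n0; rewrite /nsq /= e1 (_ : p.2 - 0 = 0) ?expr0n ?addr0 ?ltxx//; lra.
have zcE : (toC p - ci%:C) * (1 + w) = - ((ci + al)%:C * (a2%:C + w)).
  have ca : ci%:C + al%:C != 0 :> R[i].
    by rewrite -rmorphD /= eq_complex /= negb_and gt_eqF// addr_gt0.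
  rewrite /asq /w /wr; move: (ci) (al) ca nq (addr_gt0 ci0 a0) => C A ca nq CA0.
  rewrite !(RCM, rmorphV, rmorphB, rmorphD) ?unitfE ?gt_eqF//=.
  by field; rewrite ca nq.
have r2 : ri%:C ^+ 2 = a2%:C * (ci + al)%:C ^+ 2 :> R[i].
  rewrite -!rmorphXn -RCM asq_sqr// expr_div_n divfK// expf_eq0 /= gt_eqF// addr_gt0//.
have w1n : 1 + w != 0.
  have := kden_neq0 (w := w) (r := 1); rewrite mulr1; apply => //.
  by rewrite ler01 lexx.
(* The factor (1 + a2 / w)^2 of V at the inverted point cancels the pole of the derivative of the
   inversion. *)
have key : (1 + a2%:C / w) ^+ 2 * (ri%:C ^+ 2 / (toC p - ci%:C) ^+ 2) = a2%:C * (1 + w) ^+ 2 / w ^+ 2.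
  rewrite r2 (_ : (toC p - ci%:C) = - ((ci + al)%:C * (a2%:C + w)) / (1 + w)); last first.
    by rewrite -zcE mulfK.
  have aw : (ci + al)%:C * (a2%:C + w) != 0 by rewrite -oppr_eq0 -zcE mulf_neq0.
  move: aw; rewrite mulf_eq0 negb_or => /andP[aw1 aw2].
  move: (a2%:C) ((ci + al)%:C) aw1 aw2 => A C aw1 aw2.
  by field; rewrite w0 w1n aw1 aw2.
rewrite -kv in key.
have a2E : a2%:C = v * k%:C * w by rewrite kv divfK.
rewrite [LHS](_ : _ = kap%:C * conjc G0 * J *
  ((1 + v * k%:C) ^+ 2 * (ri%:C ^+ 2 / (toC p - ci%:C) ^+ 2))); last by ring.
rewrite key a2E; move: (k%:C) (kap%:C) (conjc G0) (w) (v) w0 v1 => k' kp G' w' v' w0' v1'.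
by field; rewrite w0' v1'.
Qed.

(** Up to the unimodular factor U, the reflected term is V at conj w offset by k, and [V_fun_shift]
    removes the offset. Direct and reflected terms then have the coefficients tau + te and tau + ti,
    which are replaced by their mean; with equal coefficients they combine to 2 Re (G0 P), and only
    the direction e_xi is left. *)
Lemma shell_leading K B p : regime K -> hbound B -> admissible ki ke -> 0 < ti -> 0 < te ->
  nsq pe p < re ^+ 2 -> ri ^+ 2 < nsq pi_ p ->
  modc (dQsh ri re eps ki ke H p - conjc (toC (shell_gradient ri re eps ki ke H p)))
    <= B * (8 * K + 66 + 680 * (1 + K)).
Proof.
move=> rg hb adm ti0 te0 he hi; have [g /andP[s0 s1] _ _ [m1 md K1 hcd]] := rg.
have rs0 := regime_rs rg; have [B0 hB _] := hb.
have [t1 t2 t3] := tau_lt1 adm.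
rewrite gtr0_norm// in t1; rewrite gtr0_norm// in t2.
have t0 : 0 < tau by rewrite /Defs.tau mulr_gt0.
have t01 : 0 < tau < 1 by rewrite t0 (le_lt_trans (ler_norm _) t3).
have [b0 bE] := beta_exp rg t01; have [k0 k1 k2] := kap_bounds rg.
have a0 := alpha_gt0 g.
have np := shell_not_pole g (ltW he) (ltW hi).
have [nm nq] := not_pole_neq0 np.
have p0 := in_e_gt0 g (ltW he).
rewrite /dQsh shell_gradient_conj// (refli_dLam g (ltW b0) (ltW he) (ltW hi)) /dLam.
set w := wr al (toC p); set v := conjc w; set k := a2 / modc w ^+ 2.
have w0 : w != 0 by rewrite /w /wr mulf_neq0 ?invr_eq0.
have w1 : modc w < 1 by exact: wr_lt1.
have v1 : modc v < 1 by rewrite modcJ.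
have v0 : v != 0 by rewrite -modc_gt0 modcJ modc_gt0.
have n1v : 1 + v != 0.
  have := kden_neq0 (w := v) (r := 1); rewrite mulr1; apply => //.
  by rewrite ler01 lexx.
have mw0 : 0 < modc w ^+ 2 by rewrite exprn_gt0// modc_gt0.
(* In the shell |w|^2 lies between [a2] and [b2], and rho = a2 / b2. *)
have hk : rho <= k <= 1.
  have ei := wr_disk a0 (center_e_gt0 g) (alpha_lt_e g) (center_e_sqr g) nq.
  have ii := wr_disk a0 (center_i_gt0 g) (alpha_lt_i g) (center_i_sqr g) nq.
  have h1 : modc w ^+ 2 <= b2 by rewrite -ei ltW.
  have h2 : a2 < modc w ^+ 2 by rewrite ltNge -ii -ltNge.
  apply/andP; split; last by rewrite /k ler_pdivrMr// mul1r ltW.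
  by rewrite /k /rho ler_pM2l ?asq_gt0// lef_pV2 ?posrE ?besq_gt0.
have c0 : 0 < stp by rewrite divr_gt0 ?mulr_gt0.
have d0 : 0 < 2 * (xi_i ri re eps - xi_e ri re eps).
  by apply: lt_le_trans md; rewrite divr_gt0 ?mulr_gt0.
rewrite rho_exp// in hk.
have sh := V_fun_shift v1 (ltW b0) d0 hk.
set Z := k%:C * _ in sh *; set Vv := V_fun v beta in sh.
set Vw := V_fun w beta; set U := v / w * _.
have mU : modc U = 1.
  rewrite /U modcM modcM modcV [modc (_ ^+ 2)]modcX modcM modcV modcJ.
  have -> : modc (1 + v) = modc (1 + w).
    by rewrite -[RHS]modcJ conjc1D.
  rewrite !divff ?expr1n ?mulr1// ?gt_eqF ?modc_gt0//.
  have := kden_neq0 (w := w) (r := 1); rewrite mulr1; apply => //.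
  by rewrite ler01 lexx.
have G1 : modc G0 <= B.
  apply: hB; rewrite prod_normE /= normr0 maxxx.
  by rewrite mulr_ge0//; have := geo_re g; lra.
have ReC (z : R[i]) : (complex.Re z)%:C = 2^-1 * (z + conjc z).
  have h2 : (2 : R[i])^-1 = (2^-1 : R)%:C by rewrite fmorphV rmorph_nat.
  by case: z => x y; rewrite h2; apply/eqP; rewrite eq_complex /=; apply/andP; split; apply/eqP; field.
(* 2 Re (G0 P) = G0 w J(w) + conj G0 v J(v) with v = conj w; the factor (1 + w)^2 / w turns the two
   summands into G0 V(w) and conj G0 U V(v). *)
have shE : (rs / (4 * s) * (ti + te + 2 * tau))%:C * (complex.Re (G0 * P_fun w beta))%:C * ((1 + w) ^+ 2 / w)
   = (stp^-1 * ((tau + te) + (tau + ti)) / 2)%:C * (G0 * Vw + conjc G0 * U * Vv).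
  rewrite ReC P_funE ?(ltW b0)// conjc_zJ ?(ltW b0)// -/v /Vw /Vv /V_fun /U.
  have -> : stp^-1 * (tau + te + (tau + ti)) / 2 = rs / (4 * s) * (ti + te + 2 * tau) * 2^-1.
    by move: (ti) (te) (tau) => x y z; field; rewrite !gt_eqF.
  have h2 : (2^-1 : R)%:C = (2 : R[i])^-1 by rewrite fmorphV rmorph_nat.
  rewrite [(rs / (4 * s) * (ti + te + 2 * tau) * 2^-1)%:C]RCM h2.
  move: ((rs / (4 * s) * (ti + te + 2 * tau))%:C) (J_fun w beta) (J_fun v beta) (conjc G0) G0 => k' J J' G' G.
  move: (w) (v) w0 n1v => w' v' w0' n1v'.
  by field; rewrite w0' n1v'.
rewrite shE.
set a := tau + te; set b := tau + ti.
have -> : a%:C * (kap%:C * (G0 * Vw)) - b%:C * (- (kap%:C * (conjc G0 * (U * Z)))) -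
   (stp^-1 * (a + b) / 2)%:C * (G0 * Vw + conjc G0 * U * Vv) =
   G0 * ((a * kap - stp^-1 * (a + b) / 2)%:C * Vw)
   + conjc G0 * (U * ((b * kap - stp^-1 * (a + b) / 2)%:C * Vv - (b * kap)%:C * (Vv - Z))).
  rewrite !rmorphB /= [(a * kap)%:C]RCM [(b * kap)%:C]RCM; ring.
have tie : tau = ti * te by [].
have ti01 : 0 < ti < 1 by rewrite ti0.
have te01 : 0 < te < 1 by rewrite te0.
have [a02 b02 dte] := product_coef ti01 te01; rewrite -tie -/a -/b in a02 b02 dte.
have k3 : 0 <= stp^-1 - kap <= K / 4 by rewrite subr_ge0 k1.
have i0 : 0 < stp^-1 by rewrite invr_gt0.
have ca : `|a * kap - stp^-1 * (a + b) / 2| <= K / 2 + stp^-1 * (1 - tau) / 2.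
  apply: mix_coef => //; rewrite (_ : a - b = te - ti)//.
  by rewrite /a /b; ring.
have cb : `|b * kap - stp^-1 * (a + b) / 2| <= K / 2 + stp^-1 * (1 - tau) / 2.
  rewrite [a + b]addrC; apply: mix_coef => //; rewrite distrC (_ : a - b = te - ti)//.
  by rewrite /a /b; ring.
have Vb (x : R[i]) : modc x < 1 -> (K / 2 + stp^-1 * (1 - tau) / 2) * modc (V_fun x beta) <= 4 * K + 33.
  move=> x1; have h2 := V_fun_absorb x1 b0 c0; rewrite bE in h2.
  by apply: absorb_coef h2 => //; rewrite modc_ge0 V_fun_le// ltW.
have q1 : modc (G0 * ((a * kap - stp^-1 * (a + b) / 2)%:C * Vw)) <= B * (4 * K + 33).
  rewrite modcM; apply: ler_pM; rewrite ?modc_ge0//.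
  by apply: le_trans (modc_scale _ ca) _; exact: Vb.
have q2 : modc ((b * kap - stp^-1 * (a + b) / 2)%:C * Vv) <= 4 * K + 33.
  by apply: le_trans (modc_scale _ cb) _; exact: Vb.
have q3 : modc ((b * kap)%:C * (Vv - Z)) <= 680 * (1 + K).
  have hbk : `|b * kap| <= 2 * stp^-1.
    rewrite ger0_norm; last by case/andP: b02 => *; rewrite mulr_ge0// ltW.
    by case/andP: b02 => b1 b2'; apply: ler_pM => //; exact: ltW.
  apply: (le_trans (modc_scale _ hbk)).
  have hd : 2 * (xi_i ri re eps - xi_e ri re eps) <= stp * (1 + K).
    have mu0 : 0 < 2 * s / rs by rewrite divr_gt0 ?mulr_gt0.
    by apply: step_coef hcd; rewrite ?mu0 ?(le_trans ler01 K1)// ler_pM2r ?invr_gt0// ler_pM2r// ler_nat.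
  rewrite mulrAC ler_pdivrMr//; have : 2 * modc (Vv - Z) <= 2 * (340 * (stp * (1 + K))).
    by rewrite ler_wpM2l//; apply: (le_trans sh); apply: ler_wpM2l hd; exact: ler0n.
  by move=> /le_trans; apply; rewrite le_eqVlt; apply/orP; left; apply/eqP; ring.
apply: (le_trans (modcD _ _)).
have q4 : modc (conjc G0 * (U * ((b * kap - stp^-1 * (a + b) / 2)%:C * Vv - (b * kap)%:C * (Vv - Z))))
    <= B * (4 * K + 33 + 680 * (1 + K)).
  rewrite modcM modcJ modcM mU mul1r; apply: ler_pM; rewrite ?modc_ge0//.
  by apply: (le_trans (modcB _ _)); exact: lerD.
apply: (le_trans (lerD q1 q4)).
by rewrite le_eqVlt; apply/orP; left; apply/eqP; ring.
Qed.

End ShellGradient.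

(** * Essential bounds and contrast parameters *)

Section EssentialBound.
Variable R : realType.
Implicit Types (c p q : R * R) (r C : R).

Local Notation mu2 := (@lebesgue_measure R \x @lebesgue_measure R)%E.

Lemma measurable_circle c r : measurable [set p : measurableTypeR R * measurableTypeR R | nsq c p = r].
Proof.
have m : measurable_fun setT (fun p : measurableTypeR R * measurableTypeR R => nsq c p).
  apply: measurable_funD; apply: measurable_funX; apply: measurable_funB;
    [exact: measurable_fst|exact: measurable_cst|exact: measurable_snd|exact: measurable_cst].
have := m measurableT [set r] (measurable_set1 r).
by rewrite setTI.
Qed.

(** By sections: each line of constant first coordinate meets the circle in at most two points. *)
Lemma circle_null c r : mu2 [set p : R * R | nsq c p = r] = 0%E.
Proof.
rewrite /= /product_measure1 /=.
apply: integral0_eq => x _ /=.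
rewrite /xsection /=.
set A := (X in lebesgue_measure X).
apply: countable_lebesgue_measure0.
apply: finite_set_countable.
apply: (@sub_finite_set _ _ [set c.2 - Num.sqrt (r - (x - c.1) ^+ 2); c.2 + Num.sqrt (r - (x - c.1) ^+ 2)]).
  move=> y; rewrite /A /= inE /nsq /= => h.
  have e : r - (x - c.1) ^+ 2 = (y - c.2) ^+ 2 by rewrite -h; ring.
  rewrite e sqrtr_sqr; have [h'|h'] := leP 0 (y - c.2); [right|left].
    by rewrite ger0_norm// addrC subrK.
  by rewrite ltr0_norm// opprK addrC subrK.
by rewrite finite_setU; split; exact: finite_set1.
Qed.

Lemma gradLoo_le (U : set (R * R)) f ri re eps C : geo ri re eps -> 0 <= C ->
  (forall p, off_interfaces ri re eps p -> U p -> modc (cgrad f p) <= C) ->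
  (gradLoo U f <= C%:E)%E.
Proof.
move=> g C0 h; rewrite /gradLoo unlock; case: ifP => [_|_]; last by rewrite lee_fin.
apply/ess_supP.
exists ([set p | nsq (center_i ri re eps, 0) p = ri ^+ 2] `|` [set p | nsq (center_e ri re eps, 0) p = re ^+ 2]).
split.
- by apply: measurableU; exact: measurable_circle.
- apply/eqP; rewrite eq_le measure_ge0 andbT.
  have -> := measureU0 (measurable_circle (center_i ri re eps, 0) (ri ^+ 2))
    (measurable_circle (center_e ri re eps, 0) (re ^+ 2)) (circle_null _ _).
  by rewrite le_eqVlt; apply/orP; left; apply/eqP; exact: circle_null.
- move=> p /= hp; have [//|no] := pselect (([set p | nsq (center_i ri re eps, 0) p = ri ^+ 2]
    `|` [set p | nsq (center_e ri re eps, 0) p = re ^+ 2]) p).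
  exfalso; apply: hp; rewrite lee_fin.
  have op : off_interfaces ri re eps p.
    by apply/off_interfacesE => //; split; apply/eqP => e; apply: no; [left|right].
  rewrite patchE; case: ifPn => [|_]; last by rewrite normr0.
  rewrite inE => Up; rewrite ger0_norm ?sqrtr_ge0// enorm_grad; exact: h.
Qed.

Lemma enorm_grad_sub f p (v : R * R) : enorm (grad f p - v) = modc (cgrad f p - conjc (toC v)).
Proof.
rewrite enormE toCB -modcJ; congr modc.
by case: v => x y; apply/eqP; rewrite eq_complex /=; apply/andP; split; apply/eqP; ring.
Qed.

End EssentialBound.

(** * Contrast parameters *)

Section Contrast.
Variable R : realType.
Implicit Types ki ke delta eta : R.

Lemma tau_i_sub1 ki ke : 0 < ki -> 0 < ke -> `|tau_i ki ke - 1| = 2 * ke / (ki + ke).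
Proof.
move=> i0 e0; rewrite distrC /tau_i (_ : 1 - _ = 2 * ke / (ki + ke)); last by field; lra.
by rewrite gtr0_norm// divr_gt0 ?mulr_gt0 ?addr_gt0.
Qed.

Lemma tau_e_sub1 ke : 0 < ke -> `|tau_e ke - 1| = 2 * ke / (1 + ke).
Proof.
move=> e0; rewrite distrC /tau_e (_ : 1 - _ = 2 * ke / (1 + ke)); last by field; lra.
by rewrite gtr0_norm// divr_gt0 ?mulr_gt0 ?addr_gt0.
Qed.

Lemma ke_small_tau_near delta : 0 < delta -> exists2 eta, 0 < eta &
  forall ki ke, admissible ki ke -> ke_small ki ke eta -> tau_near_one ki ke delta.
Proof.
move=> d0; exists (delta / 2); first by rewrite divr_gt0.
move=> ki ke [i0 e0 _ _] [h1 h2]; split.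
  rewrite tau_i_sub1// ltr_pdivrMr ?addr_gt0//; nra.
by rewrite tau_e_sub1// ltr_pdivrMr ?addr_gt0//; nra.
Qed.

Lemma tau_near_ke_small eta : 0 < eta -> exists2 delta, 0 < delta &
  forall ki ke, admissible ki ke -> tau_near_one ki ke delta -> ke_small ki ke eta.
Proof.
(* With delta <= 1, 2 ke < delta (ki + ke) implies ke < delta ki; likewise with 1 in place of ki. *)
move=> e0; exists (Num.min eta 1); first by rewrite lt_min e0 ltr01.
have d1 : Num.min eta 1 <= 1 by rewrite ge_min lexx orbT.
have d2 : Num.min eta 1 <= eta by rewrite ge_min lexx.
move: (Num.min eta 1) d1 d2 => d d1 d2 ki ke [i0 k0 _ _] [].
rewrite tau_i_sub1// tau_e_sub1// !ltr_pdivrMr ?addr_gt0// => h1 h2.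
by split; nra.
Qed.

End Contrast.

Theorem theorem4p3 (R : realType) (ri re : R) (hri : 0 < ri) (hre : ri < re) :
  exists2 eps0 : R, 0 < eps0 < re - ri &
  forall H : R * R -> R, entire_harmonic H ->
  [/\ exists C : R, forall (eps ki ke : R) (u : R * R -> R),
        0 < eps < eps0 -> admissible ki ke ->
        is_solution ri re eps ki ke H u ->
        0 < tau ki ke ->
        exists r : R * R -> R,
          [/\ forall p : R * R,
                u p = H p
                  + dot (grad H (0, 0)) (1, 0) * r_star ri re ^+ 2
                    * complex.Re (q_fun ri re eps ki ke p)
                  + dot (grad H (0, 0)) (0, 1) * r_star ri re ^+ 2
                    * complex.Im (q_fun ri re eps ki ke p)
                  + r p,
              continuous r,
              forall p : R * R, off_interfaces ri re eps p -> differentiable r p &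
              (gradLoo setT r < C%:E)%E],
      exists C : R, forall (eps ki ke : R) (u : R * R -> R),
        0 < eps < eps0 -> admissible ki ke ->
        is_solution ri re eps ki ke H u ->
        (gradLoo (~` closure (B_e ri re eps `\` B_i ri re eps))
                 (fun p => (u p - H p)%R) <= C%:E)%E,
      forall delta : R, 0 < delta ->
        exists M : R, forall (eps ki ke : R) (u : R * R -> R),
        0 < eps < eps0 -> admissible ki ke ->
        is_solution ri re eps ki ke H u ->
        (M%:E < gradLoo setT (fun p => (u p - H p)%R))%E ->
        tau_near_one ki ke delta,
      (forall delta : R, 0 < delta -> exists2 eta : R, 0 < eta &
         forall ki ke : R, admissible ki ke ->
         ke_small ki ke eta -> tau_near_one ki ke delta) /\
      (forall eta : R, 0 < eta -> exists2 delta : R, 0 < delta &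
         forall ki ke : R, admissible ki ke ->
         tau_near_one ki ke delta -> ke_small ki ke eta) &
      forall delta : R, 0 < delta < 1 ->
        exists C : R, forall (eps ki ke : R) (u : R * R -> R),
        0 < eps < eps0 -> admissible ki ke ->
        is_solution ri re eps ki ke H u ->
        tau_near_one ki ke delta ->
        forall p : R * R,
          (B_e ri re eps `\` (B_i ri re eps `|` bd_i ri re eps)) p ->
          enorm (grad (fun p' => u p' - H p') p
                 - shell_gradient ri re eps ki ke H p) <= C].
Proof.
have [eps0 [K [e01 K1 asym]]] := geo_asymptotics hri hre.
exists eps0 => // H eH; have hH := harmonic_harm eH.
have re0 : 0 < re by exact: lt_trans hre.
have [B hb] : exists B, hbound re H B.
  by apply: harmonic_bounds eH; rewrite mulr_ge0// ltW.
have [B0 _ _] := hb.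
have rg eps : 0 < eps < eps0 -> regime ri re eps K.
  move=> he; have [a1 a2 a3 [a4 a5] a6] := asym eps he; split=> //.
  by move: he e01 => /andP[? ?] /andP[? ?]; split=> //; lra.
(* The constants [CE] and [CF] do not involve eps; their signs are read off at one admissible
   value. *)
have [eps1 he1] : exists eps, 0 < eps < eps0.
  by case/andP: e01 => h _; exists (eps0 / 2); apply/andP; split; lra.
have CE0 := hbound_CE (rg _ he1) hb; have CF0 := hbound_CF (rg _ he1) hb.
split.
(* The summand 1 makes the inequality strict. *)
- exists (4 * CE ri re K B + 9 * B + 1) => eps ki ke u he adm S t0.
  have G := rg _ he; have [g _ _ _ _] := G; have [uc _ _ _ _] := S.
  have [_ _ t1] := tau_lt1 adm.
  have t01 : 0 < tau ki ke < 1 by rewrite t0 (le_lt_trans (ler_norm _) t1).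
  have [b0 _] := beta_exp G t01.
  have res p (hp : off_interfaces ri re eps p) := residual_bound G hb adm eH S t0 hp.
  exists (fun p => u p - (H p + Qim ri re eps ki ke H p)); split.
  + by move=> p; rewrite Qim_q//; ring.
  + move=> p; apply: cvgB; first exact: uc.
    apply: cvgD; first exact: is_cgrad_cont (harm_cgrad (hH p)).
    exact: Qim_cont g (ltW b0) p.
  + by move=> p /res[[]].
  + apply: (@le_lt_trans _ _ (4 * CE ri re K B + 9 * B)%:E); last by rewrite lte_fin ltrDl.
    apply: (gradLoo_le g); first by lra.
    by move=> p /res[[_ ->] h] _.
- exists (4 * CF ri re K B + 26 * B) => eps ki ke u he adm S.
  have G := rg _ he; have [g _ _ _ _] := G.
  apply: (gradLoo_le g); first by lra.
  move=> p /(off_interfacesE _ g)[hi ho] Up.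
  suff hp : re ^+ 2 < nsq (center_e ri re eps, 0) p \/ nsq (center_i ri re eps, 0) p < ri ^+ 2.
    by have [[_ ->] h] := outer_bound G hb adm eH S hp.
  case: (ltgtP (nsq (center_e ri re eps, 0) p) (re ^+ 2)) ho => // ho _; last by left.
  case: (ltgtP (nsq (center_i ri re eps, 0) p) (ri ^+ 2)) hi => // hi _; first by right.
  exfalso; apply: Up; apply: subset_closure; split; rewrite /B_e /B_i /disk /= nsq_disk//.
  by apply/negP; rewrite -leNgt ltW.
(* [shell_bound] wants a threshold below 1, and shrinking the threshold preserves the failure of
   [tau_near_one]. *)
- move=> delta d0; pose d := Num.min delta (2^-1).
  have d01 : 0 < d < 1.
    by rewrite /d lt_min d0 invr_gt0 ltr0n /= gt_min; apply/orP; right; lra.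
  have Bd : 0 <= 16 / d * B by case/andP: d01 => d1 _; rewrite mulr_ge0 ?divr_ge0// ltW.
  exists (4 * CF ri re K B + 26 * B + (13 + 16 / d) * B) => eps ki ke u he adm S hM.
  have G := rg _ he; have [g _ _ _ _] := G.
  have [//|nn] := pselect (tau_near_one ki ke delta).
  have nn' : ~ tau_near_one ki ke d.
    move=> [h1 h2]; apply: nn; have dd : d <= delta by rewrite /d ge_min lexx.
    by split; [exact: lt_le_trans h1 dd|exact: lt_le_trans h2 dd].
  move: hM; rewrite ltNge => /negP; case.
  apply: (gradLoo_le g); first by lra.
  move=> p /(off_interfacesE _ g)[hi ho] _.
  case: (ltgtP (nsq (center_e ri re eps, 0) p) (re ^+ 2)) ho => // ho _; last first.
    by have [[_ ->] h] := outer_bound G hb adm eH S (or_introl ho); lra.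
  case: (ltgtP (nsq (center_i ri re eps, 0) p) (ri ^+ 2)) hi => // hi _.
    by have [[_ ->] h] := outer_bound G hb adm eH S (or_intror hi); lra.
  by have [[_ ->] h] := shell_bound G hb adm eH S d01 nn' ho hi; lra.
- by split; [exact: ke_small_tau_near|exact: tau_near_ke_small].
move=> delta /andP[d0 d1].
exists (4 * CE ri re K B + 9 * B + B * (8 * K + 66 + 680 * (1 + K))) => eps ki ke u he adm S [n1 n2] p [pe pin].
have G := rg _ he; have [g _ _ _ _] := G; have [i0 k0 _ _] := adm.
(* As delta < 1, nearness to 1 makes ti and te positive, hence tau > 0, and the bound on the
   residual is available. *)
have ti0 : 0 < tau_i ki ke by move: n1; rewrite ltr_norml => /andP[? ?]; lra.
have te0 : 0 < tau_e ke by move: n2; rewrite ltr_norml => /andP[? ?]; lra.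
have t0 : 0 < tau ki ke by rewrite /tau mulr_gt0.
have ho : nsq (center_e ri re eps, 0) p < re ^+ 2.
  by move: pe; rewrite /B_e /disk /= nsq_disk.
have hi : ri ^+ 2 < nsq (center_i ri re eps, 0) p.
  rewrite lt_neqAle; apply/andP; split.
    by apply/eqP => e; apply: pin; right; apply/nsq_circle.
  by rewrite leNgt; apply/negP => h; apply: pin; left; rewrite /B_i /disk /= nsq_disk.
have op : off_interfaces ri re eps p.
  by apply/off_interfacesE => //; split; [rewrite gt_eqF|rewrite lt_eqF].
have [_ h1] := residual_bound G hb adm eH S t0 op.
have h2 := shell_leading G hb adm ti0 te0 ho hi.
rewrite /dQim ltNge (ltW ho)/= hi in h1.
rewrite enorm_grad_sub.
have [_ ->] := is_cgradB (harm_cgrad (sol_harm g i0 k0 S op)) (harm_cgrad (hH p)).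
set X := conjc _ in h2 *.
have -> : cgrad u p - cgrad H p - X = (cgrad u p - (cgrad H p + dQsh ri re eps ki ke H p))
   + (dQsh ri re eps ki ke H p - X) by ring.
by apply: (le_trans (modcD _ _)); exact: lerD.
Qed.
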